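(* Assume $\mathsf{AD}$. Let $X$ be an uncountable zero-dimensional Polish space (so that $\Theta_X=\Theta$). Then the following are equivalent: (i) the perfect kernel of $X$ is not compact; (ii) every limit ordinal $\alpha<\omega_1$ belongs to $\mathrm{SD}_X$; (iii) every limit ordinal $\alpha<\Theta_X$ of countable cofinality belongs to $\mathrm{SD}_X$.
   Context: Base theory $\mathsf{ZF}+\mathsf{DC}(\mathbb R)$. For $A,B\subseteq X$, $A\le_{\mathsf W}^X B$ means there is a continuous $f\colon X\to X$ with $f^{-1}(B)=A$; $<_{\mathsf W}^X$ is the strict part. $A$ is selfdual if $A\le_{\mathsf W}^X X\setminus A$. The Wadge rank is $\mathrm{rk}(A)=\sup(\{1\}\cup\{\mathrm{rk}(B)+1:B<_{\mathsf W}^XA\})$, $\Theta_X=\sup\{\mathrm{rk}(A)+1:A\subseteq X\}$, and for $1\le\alpha<\Theta_X$, $\alpha\in\mathrm{SD}_X$ if the subsets of $X$ of Wadge rank $\alpha$ are selfdual. $\Theta=\sup\{\alpha:\mathbb R\text{ surjects onto }\alpha\}$. The perfect kernel of $X$ is its largest perfect (closed, without isolated points) subset. *)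

(* Defs.v *)
(* AD contradicts the axiom of choice, which is available in the ambient logic,
   so a theorem of ZF + DC(R) + AD is rendered as a statement about all models
   of that first-order theory.  Every notion below is internal to a model M:
   all quantifiers range over M, so that each definition is the satisfaction
   in M of the usual formula of the language of set theory. *)

Record set_structure : Type := SetStructure {
  carrier :> Type;
  mem : carrier -> carrier -> Prop
}.
Arguments mem {_} _ _.

Notation "x ∈ y" := (mem x y) (at level 70, no associativity).
Notation "x ∉ y" := (~ mem x y) (at level 70, no associativity).

(* First-order formulas with de Bruijn indices; needed only for the schemas. *)
Inductive formula : Type :=
| Fmem (i j : nat)
| Feq (i j : nat)
| Fbot
| Fimp (p q : formula)
| Fand (p q : formula)
| For (p q : formula)
| Fall (p : formula)
| Fex (p : formula).

Definition scons {A : Type} (x : A) (e : nat -> A) (n : nat) : A :=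
  match n with O => x | S k => e k end.

Fixpoint sat {M : set_structure} (e : nat -> M) (p : formula) : Prop :=
  match p with
  | Fmem i j => e i ∈ e j
  | Feq i j => e i = e j
  | Fbot => False
  | Fimp p q => sat e p -> sat e q
  | Fand p q => sat e p /\ sat e q
  | For p q => sat e p \/ sat e q
  | Fall p => forall x : M, sat (scons x e) p
  | Fex p => exists x : M, sat (scons x e) p
  end.

(* Basic set-theoretic vocabulary *)

Section Basic.
Context {M : set_structure}.
Implicit Types a b c f g p r s w x y z : M.

Definition subset a b : Prop := forall z, z ∈ a -> z ∈ b.
Definition is_empty a : Prop := forall z, z ∉ a.
Definition is_upair p x y : Prop := forall z, z ∈ p <-> z = x \/ z = y.
Definition is_succ s x : Prop := forall z, z ∈ s <-> z ∈ x \/ z = x.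
Definition is_union u a : Prop := forall z, z ∈ u <-> exists y, y ∈ a /\ z ∈ y.
Definition is_power p a : Prop := forall z, z ∈ p <-> subset z a.
Definition is_compl c x a : Prop := forall z, z ∈ c <-> z ∈ x /\ z ∉ a.

Definition is_opair p x y : Prop :=
  exists a b, is_upair a x x /\ is_upair b x y /\ is_upair p a b.

(* (x, y) belongs to f, i.e., f(x) = y when f is a function. *)
Definition app f x y : Prop := exists p, is_opair p x y /\ p ∈ f.

(* ((x, y), z) belongs to f *)
Definition app2 f x y z : Prop := exists p, is_opair p x y /\ app f p z.

Definition is_prod p a b : Prop :=
  forall z, z ∈ p <-> exists x y, x ∈ a /\ y ∈ b /\ is_opair z x y.

Definition is_fun_on f a : Prop :=
  (forall p, p ∈ f -> exists x y, x ∈ a /\ is_opair p x y) /\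
  (forall x, x ∈ a -> exists! y, app f x y).

Definition is_fun f a b : Prop :=
  is_fun_on f a /\ (forall x y, app f x y -> y ∈ b).

Definition is_fun2 f a b c : Prop := exists p, is_prod p a b /\ is_fun f p c.

Definition is_injection f a b : Prop :=
  is_fun f a b /\ (forall x y z, app f x z -> app f y z -> x = y).

Definition is_surjection f a b : Prop :=
  is_fun f a b /\ (forall y, y ∈ b -> exists x, app f x y).

(* In the presence of Foundation a transitive set of transitive sets is
   well-ordered by membership. *)
Definition transitive a : Prop := forall y, y ∈ a -> subset y a.
Definition is_ord a : Prop := transitive a /\ (forall y, y ∈ a -> transitive y).
Definition ord_le a b : Prop := a ∈ b \/ a = b.

(* nonzero limit ordinals *)
Definition is_limit a : Prop :=
  is_ord a /\ ~ is_empty a /\ (forall y, y ∈ a -> exists z, z ∈ a /\ y ∈ z).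

Definition is_one o : Prop := exists z, is_empty z /\ is_succ o z.
Definition is_omega w : Prop := is_limit w /\ (forall y, y ∈ w -> ~ is_limit y).

Definition countable a : Prop := exists w f, is_omega w /\ is_injection f a w.
Definition finite a : Prop :=
  exists w n f, is_omega w /\ n ∈ w /\ is_surjection f n a.

Definition is_omega1 k : Prop :=
  is_ord k /\ ~ countable k /\ (forall y, y ∈ k -> countable y).

(* s = sup P, for a class P of ordinals *)
Definition is_sup (P : M -> Prop) s : Prop :=
  is_ord s /\ (forall y, P y -> ord_le y s) /\
  (forall c, is_ord c -> (forall y, P y -> ord_le y c) -> ord_le s c).

Definition countable_cofinality a : Prop :=
  exists w f, is_omega w /\ is_fun f w a /\
    (forall b, b ∈ a -> exists n c, app f n c /\ ord_le b c).

End Basic.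

Definition extensionality (M : set_structure) : Prop :=
  forall a b : M, (forall z, z ∈ a <-> z ∈ b) -> a = b.

Definition foundation (M : set_structure) : Prop :=
  forall a : M, ~ is_empty a -> exists x, x ∈ a /\ (forall y, y ∈ a -> y ∉ x).

Definition pairing (M : set_structure) : Prop :=
  forall x y : M, exists p, is_upair p x y.

Definition union_axiom (M : set_structure) : Prop :=
  forall a : M, exists u, is_union u a.

Definition power_set (M : set_structure) : Prop :=
  forall a : M, exists p, is_power p a.

Definition infinity (M : set_structure) : Prop :=
  exists a : M, (exists z, is_empty z /\ z ∈ a) /\
    (forall x, x ∈ a -> exists s, is_succ s x /\ s ∈ a).

Definition separation (M : set_structure) : Prop :=
  forall (phi : formula) (e : nat -> M) (a : M), exists b : M,
    forall x, x ∈ b <-> x ∈ a /\ sat (scons x e) phi.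

Definition replacement (M : set_structure) : Prop :=
  forall (phi : formula) (e : nat -> M),
    (forall x y z : M, sat (scons x (scons y e)) phi ->
                       sat (scons x (scons z e)) phi -> y = z) ->
    forall a : M, exists b : M,
      forall y, y ∈ b <-> exists x, x ∈ a /\ sat (scons x (scons y e)) phi.

Definition ZF (M : set_structure) : Prop :=
  extensionality M /\ foundation M /\ pairing M /\ union_axiom M /\
  power_set M /\ infinity M /\ separation M /\ replacement M.

(* The real line of M, given up to isomorphism as a complete ordered field. *)
Record ordered_field_data (M : set_structure) : Type := OrderedFieldData {
  Rset : M;
  Rzero : M;
  Rone : M;
  Radd : M;
  Rmul : M;
  Rless : M
}.
Arguments Rset {_} _.
Arguments Rzero {_} _.
Arguments Rone {_} _.
Arguments Radd {_} _.
Arguments Rmul {_} _.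
Arguments Rless {_} _.

Section Reals.
Context {M : set_structure} (R : ordered_field_data M).
Implicit Types s t u v x y z : M.

Definition Rlt x y : Prop := app (Rless R) x y.
Definition Rle x y : Prop := Rlt x y \/ x = y.

(* The operations are sets of M, so an equation such as (x + y) + z = x + (y + z)
   is expressed by naming all its subterms. *)
Definition is_field : Prop :=
  is_fun2 (Radd R) (Rset R) (Rset R) (Rset R) /\
  is_fun2 (Rmul R) (Rset R) (Rset R) (Rset R) /\
  Rzero R ∈ Rset R /\ Rone R ∈ Rset R /\ Rzero R <> Rone R /\
  (forall x y z s t u v, app2 (Radd R) x y s -> app2 (Radd R) y z t ->
     app2 (Radd R) s z u -> app2 (Radd R) x t v -> u = v) /\
  (forall x y s, app2 (Radd R) x y s -> app2 (Radd R) y x s) /\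
  (forall x, x ∈ Rset R -> app2 (Radd R) x (Rzero R) x) /\
  (forall x, x ∈ Rset R -> exists y, app2 (Radd R) x y (Rzero R)) /\
  (forall x y z s t u v, app2 (Rmul R) x y s -> app2 (Rmul R) y z t ->
     app2 (Rmul R) s z u -> app2 (Rmul R) x t v -> u = v) /\
  (forall x y s, app2 (Rmul R) x y s -> app2 (Rmul R) y x s) /\
  (forall x, x ∈ Rset R -> app2 (Rmul R) x (Rone R) x) /\
  (forall x, x ∈ Rset R -> x <> Rzero R ->
     exists y, app2 (Rmul R) x y (Rone R)) /\
  (forall x y z s t u v, app2 (Radd R) y z s -> app2 (Rmul R) x s t ->
     app2 (Rmul R) x y u -> app2 (Rmul R) x z v -> app2 (Radd R) u v t).

Definition is_field_order : Prop :=
  (forall x, ~ Rlt x x) /\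
  (forall x y z, Rlt x y -> Rlt y z -> Rlt x z) /\
  (forall x y, x ∈ Rset R -> y ∈ Rset R -> Rlt x y \/ x = y \/ Rlt y x) /\
  (forall x y z u v, Rlt x y -> app2 (Radd R) x z u -> app2 (Radd R) y z v ->
     Rlt u v) /\
  (forall x y z, Rlt (Rzero R) x -> Rlt (Rzero R) y -> app2 (Rmul R) x y z ->
     Rlt (Rzero R) z).

Definition order_complete : Prop :=
  forall a : M, subset a (Rset R) -> ~ is_empty a ->
    (exists u, u ∈ Rset R /\ (forall x, x ∈ a -> Rle x u)) ->
    exists u, u ∈ Rset R /\ (forall x, x ∈ a -> Rle x u) /\
      (forall v, v ∈ Rset R -> (forall x, x ∈ a -> Rle x v) -> Rle u v).

Definition is_real_line : Prop :=
  is_field /\ is_field_order /\ order_complete.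

Definition DC_reals : Prop :=
  forall P : M,
    (forall x, x ∈ Rset R -> exists y, y ∈ Rset R /\ app P x y) ->
    exists w f : M, is_omega w /\ is_fun f w (Rset R) /\
      (forall n m x y, n ∈ w -> is_succ m n -> app f n x -> app f m y ->
         app P x y).

Definition is_Theta (theta : M) : Prop :=
  is_sup (fun a => is_ord a /\ exists f, is_surjection f (Rset R) a) theta.

End Reals.

(* Games of length omega with natural number moves; player I makes the moves of
   even index.  A strategy is a function on all finite sequences. *)
Section Determinacy.
Context {M : set_structure}.
Implicit Types A x s t n m v w ev sq sigma : M.

Definition is_evens w ev : Prop :=
  subset ev w /\ (forall z, is_empty z -> z ∈ ev) /\
  (forall n m, n ∈ w -> is_succ m n -> (m ∈ ev <-> n ∉ ev)).

Definition is_finite_sequences w sq : Prop :=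
  forall s, s ∈ sq <-> exists n, n ∈ w /\ is_fun s n w.

Definition is_restriction t x n : Prop :=
  forall p, p ∈ t <-> p ∈ x /\ exists k v, k ∈ n /\ is_opair p k v.

(* The move x(n) is the answer of sigma to the position x|n. *)
Definition follows_at sigma x n : Prop :=
  exists t v, is_restriction t x n /\ app sigma t v /\ app x n v.

Definition determined w A : Prop :=
  exists ev sq sigma, is_evens w ev /\ is_finite_sequences w sq /\
    is_fun sigma sq w /\
    ((forall x, is_fun x w w ->
        (forall n, n ∈ w -> n ∈ ev -> follows_at sigma x n) -> x ∈ A) \/
     (forall x, is_fun x w w ->
        (forall n, n ∈ w -> n ∉ ev -> follows_at sigma x n) -> x ∉ A)).

End Determinacy.

Definition AD (M : set_structure) : Prop :=
  forall w A : M, is_omega w -> (forall x, x ∈ A -> is_fun x w w) ->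
    determined w A.

(* Topology: X is a set of M and T is the set of its open subsets. *)
Section Topology.
Context {M : set_structure}.
Implicit Types A B C K U X T d f : M.

Definition is_metric (R : ordered_field_data M) X d : Prop :=
  is_fun2 d X X (Rset R) /\
  (forall x y r, app2 d x y r -> Rle R (Rzero R) r) /\
  (forall x y r, app2 d x y r -> (r = Rzero R <-> x = y)) /\
  (forall x y r, app2 d x y r -> app2 d y x r) /\
  (forall x y z r s t u, app2 d x y r -> app2 d y z s -> app2 d x z t ->
     app2 (Radd R) r s u -> Rle R t u).

Definition dist_lt (R : ordered_field_data M) d (x y e : M) : Prop :=
  exists r, app2 d x y r /\ Rlt R r e.

Definition induces_topology (R : ordered_field_data M) X d T : Prop :=
  forall U, U ∈ T <-> subset U X /\
    (forall x, x ∈ U -> exists e, e ∈ Rset R /\ Rlt R (Rzero R) e /\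
       (forall y, y ∈ X -> dist_lt R d x y e -> y ∈ U)).

Definition is_cauchy (R : ordered_field_data M) d (w s : M) : Prop :=
  forall e, e ∈ Rset R -> Rlt R (Rzero R) e ->
    exists N, N ∈ w /\ (forall m n x y, N ∈ m -> N ∈ n ->
      app s m x -> app s n y -> dist_lt R d x y e).

Definition converges (R : ordered_field_data M) d (w s l : M) : Prop :=
  forall e, e ∈ Rset R -> Rlt R (Rzero R) e ->
    exists N, N ∈ w /\
      (forall n x, N ∈ n -> app s n x -> dist_lt R d x l e).

Definition complete_metric (R : ordered_field_data M) X d : Prop :=
  forall w s, is_omega w -> is_fun s w X -> is_cauchy R d w s ->
    exists l, l ∈ X /\ converges R d w s l.

Definition separable X T : Prop :=
  exists D, subset D X /\ countable D /\
    (forall U, U ∈ T -> ~ is_empty U -> exists x, x ∈ D /\ x ∈ U).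

Definition is_polish (R : ordered_field_data M) X T : Prop :=
  separable X T /\
  (exists d, is_metric R X d /\ complete_metric R X d /\
             induces_topology R X d T).

Definition is_closed X T C : Prop :=
  subset C X /\ (exists U, is_compl U X C /\ U ∈ T).

(* The clopen sets form a base. *)
Definition zero_dimensional X T : Prop :=
  forall U x, U ∈ T -> x ∈ U ->
    exists C, C ∈ T /\ is_closed X T C /\ x ∈ C /\ subset C U.

Definition is_perfect X T K : Prop :=
  is_closed X T K /\
  (forall x U, x ∈ K -> U ∈ T -> x ∈ U -> exists y, y ∈ K /\ y ∈ U /\ y <> x).

Definition is_perfect_kernel X T K : Prop :=
  is_perfect X T K /\ (forall C, is_perfect X T C -> subset C K).

Definition compact T K : Prop :=
  forall C, subset C T ->
    (forall x, x ∈ K -> exists U, U ∈ C /\ x ∈ U) ->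
    exists F, subset F C /\ finite F /\
      (forall x, x ∈ K -> exists U, U ∈ F /\ x ∈ U).

Definition is_preimage V f X U : Prop :=
  forall x, x ∈ V <-> x ∈ X /\ exists y, app f x y /\ y ∈ U.

Definition continuous X T f : Prop :=
  is_fun f X X /\
  (forall U, U ∈ T -> exists V, is_preimage V f X U /\ V ∈ T).

End Topology.

Section Wadge.
Context {M : set_structure} (X T : M).
Implicit Types A B C r alpha beta theta : M.

Definition wadge_le A B : Prop :=
  exists f, continuous X T f /\ is_preimage A f X B.

Definition wadge_lt A B : Prop := wadge_le A B /\ ~ wadge_le B A.

Definition selfdual A : Prop := exists C, is_compl C X A /\ wadge_le A C.

(* The function rk on the power set of X, characterized by its recursion; it is
   unique, since such a function is strictly increasing along wadge_lt. *)
Definition is_rank_function r : Prop :=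
  (exists p, is_power p X /\ is_fun_on r p) /\
  (forall A alpha, app r A alpha ->
     is_sup (fun beta => is_one beta \/
               exists B gamma, subset B X /\ wadge_lt B A /\
                 app r B gamma /\ is_succ beta gamma) alpha).

Definition has_rank A alpha : Prop :=
  exists r, is_rank_function r /\ app r A alpha.

Definition is_Theta_X theta : Prop :=
  is_sup (fun beta => exists A alpha, subset A X /\ has_rank A alpha /\
                        is_succ beta alpha) theta.

Definition SD alpha : Prop :=
  (exists o, is_one o /\ ord_le o alpha) /\
  (exists theta, is_Theta_X theta /\ alpha ∈ theta) /\
  (forall A, subset A X -> has_rank A alpha -> selfdual A).

End Wadge.

(* Main.v *)
(* The complement of A is denoted A^c.  Determinacy of two-board games gives Wadge's
   lemma (A <= B or B <= A^c), the well-foundedness of the Wadge order (Martin-Monk), and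
   two local facts: a selfdual set is of lower rank near every point, whereas a
   non-selfdual set E has a point p near which it is as complicated as E itself.  Hence a
   set A which near every point y has rank less than rk E, except for points y with
   y in A <-> p in E, reduces to E.
   (i) => (iii): every non-selfdual set reduces to its copy inside any open set meeting
   the perfect kernel.  If the kernel is not compact, copies of sets with ranks cofinal in
   alpha can be spread over infinitely many clopen pieces, and the result would lie
   strictly below a non-selfdual A of rank alpha.
   (ii) => (i): if the kernel is compact, a selfdual set of rank a large countable limit
   ordinal has a uniform bound on its local ranks, below its own rank, and so it reduces
   to a non-selfdual set of smaller rank.
   (iii) => (ii): countable limit ordinals have cofinality omega.
   Since separation and replacement are schemas, all sets of M are built by operations
   that are definable in the sense of D and T. *)

(* The base theory offers choice only for reals, so nothing can be chosen among the subsets of X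
   directly. A set to be chosen is therefore named by a continuous reduction to a fixed set, and
   reductions are coded by elements of Baire space. Determinacy, too, speaks only of sequences of
   natural numbers: a point of X is played as an arbitrary sequence b and read as [pi b], which is
   why X is coded as a retract. The usual Martin-Monk argument appeals to the Baire property of all
   sets of reals. Here its role is taken by a single strategy-stealing statement about sets of
   natural numbers, applied to two kinds of infinite composition: an inverse system of contractions
   for well-foundedness, and maps shrinking to a point for the local fact about selfdual sets. In
   (ii) => (i) compactness controls the kernel only. The rest of X is open and may be far from
   compact, so its local ranks need a bound of their own; this is what the limit ordinal has to
   exceed. In (i) => (iii) the sets that are copied must be non-selfdual. Their ranks are cofinal in
   every limit rank, because two consecutive ranks are never both selfdual. *)
From Stdlib Require Import Classical ClassicalEpsilon Arith Lia.
Require Import Defs.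

(** * Definable predicates and operations *)

Section Definability.
Context {M : set_structure}.

Notation env := (nat -> M).

Fixpoint ren (r : nat -> nat) (p : formula) : formula :=
  match p with
  | Fmem i j => Fmem (r i) (r j)
  | Feq i j => Feq (r i) (r j)
  | Fbot => Fbot
  | Fimp p q => Fimp (ren r p) (ren r q)
  | Fand p q => Fand (ren r p) (ren r q)
  | For p q => For (ren r p) (ren r q)
  | Fall p => Fall (ren (fun n => match n with O => O | S k => S (r k) end) p)
  | Fex p => Fex (ren (fun n => match n with O => O | S k => S (r k) end) p)
  end.

Lemma sat_ren (p : formula) : forall (r : nat -> nat) (e e' : env),
  (forall n, e' n = e (r n)) -> (sat e (ren r p) <-> sat e' p).
Proof.
  induction p as [i j|i j| |p IHp q IHq|p IHp q IHq|p IHp q IHq|p IHp|p IHp];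
    cbn; intros r e e' H.
  - rewrite !H; tauto.
  - rewrite !H; tauto.
  - tauto.
  - rewrite (IHp r e e'), (IHq r e e') by assumption; tauto.
  - rewrite (IHp r e e'), (IHq r e e') by assumption; tauto.
  - rewrite (IHp r e e'), (IHq r e e') by assumption; tauto.
  - split; intros A x; specialize (A x); revert A; eapply IHp;
      intros [|n]; cbn; auto.
  - split; intros [x A]; exists x; revert A; eapply IHp; intros [|n]; cbn; auto.
Qed.

Lemma ren_id_ext (p : formula) (e e' : env) :
  (forall n, e' n = e n) -> (sat e p <-> sat e' p).
Proof.
  intros H. rewrite <- (sat_ren p (fun n => n) e e' H).
  symmetry. apply sat_ren. reflexivity.
Qed.

(* The first N variables come from the environment e, the others are parameters
   taken from p.  The dummy hypothesis env in D makes D trivial on an empty M. *)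
Definition mix (N : nat) (e p : env) : env :=
  fun k => if k <? N then e k else p (k - N).

Definition D (P : env -> Prop) : Prop :=
  env -> exists N phi p, forall e, sat (mix N e p) phi <-> P e.

(** A term is definable when its graph is; the value occupies variable 0 and the arguments are
    shifted by one. *)
Definition T (t : env -> M) : Prop :=
  D (fun e => e 0 = t (fun k => e (S k))).

Lemma D_ext P Q : D P -> (forall e, P e <-> Q e) -> D Q.
Proof.
  intros A E e0. destruct (A e0) as (N & phi & p & H). exists N, phi, p. intros e. rewrite H. apply E.
Qed.

(** Raising N only renumbers the parameters, so two witnesses can be brought to a common N. *)
Lemma D_widen N phi p N' : N <= N' ->
  exists phi', forall e, sat (mix N' e p) phi' <-> sat (mix N e p) phi.
Proof.
  intros L. exists (ren (fun k => if k <? N then k else k + (N' - N)) phi).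
  intros e. apply sat_ren. intros n. unfold mix.
  destruct (n <? N) eqn:E; [apply Nat.ltb_lt in E|apply Nat.ltb_ge in E].
  - replace (n <? N') with true; [reflexivity|symmetry; apply Nat.ltb_lt; lia].
  - replace (n + (N' - N) <? N') with false;
      [f_equal; lia|symmetry; apply Nat.ltb_ge; lia].
Qed.

(** The two parameter sequences are merged into one, with [p] at the even and [q] at the odd places,
    so that both formulas can be combined by a connective. *)
Lemma D_join P Q : D P -> D Q -> env -> exists N phi psi p,
  (forall e, sat (mix N e p) phi <-> P e) /\
  (forall e, sat (mix N e p) psi <-> Q e).
Proof.
  intros A B e0. destruct (A e0) as (N1 & phi & p & H1), (B e0) as (N2 & psi & q & H2).
  destruct (D_widen N1 phi p (max N1 N2)) as [phi' E1]; [lia|].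
  destruct (D_widen N2 psi q (max N1 N2)) as [psi' E2]; [lia|].
  set (N := max N1 N2) in *.
  exists N, (ren (fun k => if k <? N then k else N + 2 * (k - N)) phi'),
    (ren (fun k => if k <? N then k else N + (2 * (k - N) + 1)) psi'),
    (fun k => if Nat.even k then p (Nat.div2 k) else q (Nat.div2 k)).
  split; intros e.
  - rewrite <- H1, <- E1. apply sat_ren. intros n. unfold mix.
    destruct (n <? N) eqn:E; [rewrite E; reflexivity|].
    replace (N + 2 * (n - N) <? N) with false by (symmetry; apply Nat.ltb_ge; lia).
    replace (N + 2 * (n - N) - N) with (2 * (n - N)) by lia.
    rewrite Nat.even_mul, Nat.div2_double. reflexivity.
  - rewrite <- H2, <- E2. apply sat_ren. intros n. unfold mix.
    destruct (n <? N) eqn:E; [rewrite E; reflexivity|].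
    replace (N + (2 * (n - N) + 1) <? N) with false by (symmetry; apply Nat.ltb_ge; lia).
    replace (N + (2 * (n - N) + 1) - N) with (S (2 * (n - N))) by lia.
    rewrite Nat.even_succ, Nat.odd_mul, Nat.div2_succ_double. reflexivity.
Qed.

Lemma D_and P Q : D P -> D Q -> D (fun e => P e /\ Q e).
Proof.
  intros A B e0. destruct (D_join P Q A B e0) as (N & phi & psi & p & H1 & H2).
  exists N, (Fand phi psi), p. intros e. cbn. rewrite H1, H2. tauto.
Qed.

Lemma D_or P Q : D P -> D Q -> D (fun e => P e \/ Q e).
Proof.
  intros A B e0. destruct (D_join P Q A B e0) as (N & phi & psi & p & H1 & H2).
  exists N, (For phi psi), p. intros e. cbn. rewrite H1, H2. tauto.
Qed.

Lemma D_imp P Q : D P -> D Q -> D (fun e => P e -> Q e).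
Proof.
  intros A B e0. destruct (D_join P Q A B e0) as (N & phi & psi & p & H1 & H2).
  exists N, (Fimp phi psi), p. intros e. cbn. rewrite H1, H2. tauto.
Qed.

Lemma mix_scons N x e p n : mix (S N) (scons x e) p n = scons x (mix N e p) n.
Proof.
  destruct n as [|n]; [reflexivity|]. unfold mix. cbn [scons].
  replace (S n <? S N) with (n <? N) by (destruct (n <? N) eqn:E; symmetry;
    [apply Nat.ltb_lt; apply Nat.ltb_lt in E; lia|apply Nat.ltb_ge; apply Nat.ltb_ge in E; lia]).
  destruct (n <? N); reflexivity.
Qed.

Lemma D_succ_form P : D P -> env -> exists N phi p, forall e, sat (mix (S N) e p) phi <-> P e.
Proof.
  intros A e0. destruct (A e0) as (N & phi & p & H). destruct (D_widen N phi p (S N)) as [phi' E]; [lia|].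
  exists N, phi', p. intros e. rewrite E. apply H.
Qed.

Lemma D_all (Q : env -> M -> Prop) :
  D (fun e => Q (fun k => e (S k)) (e 0)) -> D (fun e => forall x, Q e x).
Proof.
  intros A e0. destruct (D_succ_form _ A e0) as (N & phi & p & H).
  exists N, (Fall phi), p. intros e. cbn.
  split; intros B x; specialize (B x).
  - apply (H (scons x e)). revert B. apply ren_id_ext. intros n. rewrite mix_scons. reflexivity.
  - apply (H (scons x e)) in B. revert B. apply ren_id_ext.
    intros n. rewrite mix_scons. reflexivity.
Qed.

Lemma D_ex (Q : env -> M -> Prop) :
  D (fun e => Q (fun k => e (S k)) (e 0)) -> D (fun e => exists x, Q e x).
Proof.
  intros A e0. destruct (D_succ_form _ A e0) as (N & phi & p & H).
  exists N, (Fex phi), p. intros e. cbn.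
  split; intros [x B]; exists x.
  - apply (H (scons x e)). revert B. apply ren_id_ext. intros n. rewrite mix_scons. reflexivity.
  - apply (H (scons x e)) in B. revert B. apply ren_id_ext.
    intros n. rewrite mix_scons. reflexivity.
Qed.

Lemma D_const (P : Prop) : D (fun _ => P).
Proof.
  intros e0. destruct (classic P) as [H|H].
  - exists 0, (Fimp Fbot Fbot), e0. intros e. cbn. tauto.
  - exists 0, Fbot, e0. intros e. cbn. tauto.
Qed.

Lemma D_not P : D P -> D (fun e => ~ P e).
Proof. intros A. apply D_imp; [exact A|apply D_const]. Qed.

Lemma D_iff P Q : D P -> D Q -> D (fun e => P e <-> Q e).
Proof. intros A B. apply D_and; apply D_imp; assumption. Qed.

(** Only the first N variables matter, and on them an arbitrary [r] is bounded by some K; the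
    parameters are placed beyond K. *)
Lemma D_ren (P : env -> Prop) (r : nat -> nat) :
  D P -> D (fun e => P (fun k => e (r k))).
Proof.
  intros A e0. destruct (A e0) as (N & phi & p & H).
  assert (B : exists K, forall k, k < N -> r k < K).
  { clear. induction N as [|N [K IH]]; [exists 0; lia|].
    exists (S (max K (r N))). intros k L.
    destruct (Nat.eq_dec k N) as [->|E]; [lia|]. specialize (IH k). lia. }
  destruct B as [K B].
  exists K, (ren (fun k => if k <? N then r k else K + (k - N)) phi), p.
  intros e. rewrite <- H. apply sat_ren. intros n. unfold mix.
  destruct (n <? N) eqn:E.
  - apply Nat.ltb_lt in E. apply B in E. apply Nat.ltb_lt in E. rewrite E. reflexivity.
  - replace (K + (n - N) <? K) with false by (symmetry; apply Nat.ltb_ge; lia).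
    f_equal. lia.
Qed.

Lemma D_eq_var i j : D (fun e => e i = e j).
Proof.
  intros e0. exists (S (max i j)), (Feq i j), e0. intros e. cbn. unfold mix.
  replace (i <? S (max i j)) with true by (symmetry; apply Nat.ltb_lt; lia).
  replace (j <? S (max i j)) with true by (symmetry; apply Nat.ltb_lt; lia).
  tauto.
Qed.

Lemma D_mem_var i j : D (fun e => e i ∈ e j).
Proof.
  intros e0. exists (S (max i j)), (Fmem i j), e0. intros e. cbn. unfold mix.
  replace (i <? S (max i j)) with true by (symmetry; apply Nat.ltb_lt; lia).
  replace (j <? S (max i j)) with true by (symmetry; apply Nat.ltb_lt; lia).
  tauto.
Qed.

Lemma T_var k : T (fun e => e k).
Proof. apply (D_eq_var 0 (S k)). Qed.

Lemma T_const (c : M) : T (fun _ => c).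
Proof.
  intros e0. exists 1, (Feq 0 1), (fun _ => c). intros e. cbn. tauto.
Qed.

Lemma T_ren (t : env -> M) (r : nat -> nat) :
  T t -> T (fun e => t (fun k => e (r k))).
Proof.
  intros A.
  exact (D_ren _ (fun n => match n with O => O | S k => S (r k) end) A).
Qed.

(** Substitution of a term. The formulas have no function symbols, so Q(t) is rendered as the
    existence of some y equal to t with Q(y). *)
Lemma D_bind (t : env -> M) (Q : env -> M -> Prop) :
  T t -> D (fun e => Q (fun k => e (S k)) (e 0)) -> D (fun e => Q e (t e)).
Proof.
  intros A B. eapply D_ext.
  - apply (D_ex (fun e y => y = t e /\ Q e y)). apply D_and; [exact A|exact B].
  - intros e. split; [intros (y & -> & H); exact H|eauto].
Qed.

Lemma D_eq s t : T s -> T t -> D (fun e => s e = t e).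
Proof.
  intros A B. apply (D_bind s (fun e y => y = t e) A). exact B.
Qed.

Lemma D_mem s t : T s -> T t -> D (fun e => s e ∈ t e).
Proof.
  intros A B. apply (D_bind s (fun e y => y ∈ t e) A).
  apply (D_bind (fun e => t (fun k => e (S k))) (fun e z => e 0 ∈ z)).
  - apply (T_ren t S B).
  - apply (D_mem_var 1 0).
Qed.

Lemma D_ex1 (Q : env -> M -> Prop) :
  D (fun e => Q (fun k => e (S k)) (e 0)) -> D (fun e => exists! x, Q e x).
Proof.
  intros A. apply D_ex. apply D_and; [exact A|].
  apply D_all. apply D_imp.
  - exact (D_ren _ (fun n => match n with O => O | S k => S (S k) end) A).
  - apply D_eq_var.
Qed.

Definition D1 (P : M -> Prop) : Prop := D (fun e => P (e 0)).
Definition D2 (P : M -> M -> Prop) : Prop := D (fun e => P (e 0) (e 1)).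
Definition T1 (F : M -> M) : Prop := T (fun e => F (e 0)).
Definition T2 (F : M -> M -> M) : Prop := T (fun e => F (e 0) (e 1)).

Lemma D1_app P t : D1 P -> T t -> D (fun e => P (t e)).
Proof.
  intros A B. apply (D_bind t (fun _ y => P y) B). exact A.
Qed.

Lemma D2_app P s t : D2 P -> T s -> T t -> D (fun e => P (s e) (t e)).
Proof.
  intros A B C. apply (D_bind t (fun e y => P (s e) y) C).
  apply (D_bind (fun e => s (fun k => e (S k))) (fun e y => P y (e 0))).
  - apply (T_ren s S B).
  - exact (D_ren _ (fun n => n) A).
Qed.

Lemma T1_app F t : T1 F -> T t -> T (fun e => F (t e)).
Proof.
  intros A B. unfold T.
  apply (D_bind (fun e => t (fun k => e (S k))) (fun e y => e 0 = F y)).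
  - apply (T_ren t S B).
  - exact (D_ren _ (fun n => match n with O => 1 | S k => 0 end) A).
Qed.

Lemma T2_app F s t : T2 F -> T s -> T t -> T (fun e => F (s e) (t e)).
Proof.
  intros A B C. unfold T.
  apply (D_bind (fun e => t (fun k => e (S k)))
    (fun e y => e 0 = F (s (fun k => e (S k))) y)).
  { apply (T_ren t S C). }
  apply (D_bind (fun e => s (fun k => e (S (S k)))) (fun e y => e 1 = F y (e 0))).
  - apply (T_ren s (fun k => S (S k)) B).
  - exact (D_ren _ (fun n => match n with O => 2 | S O => 0 | _ => 1 end) A).
Qed.

End Definability.

Class ZF_model (M : set_structure) : Prop := zf_axioms : ZF M.

Section Description.
Context {M : set_structure} {hZF : ZF_model M}.

Lemma ext (a b : M) : (forall z, z ∈ a <-> z ∈ b) -> a = b.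
Proof. apply zf_axioms. Qed.

Lemma M_inhabited : inhabited M.
Proof. destruct zf_axioms as (_ & _ & _ & _ & _ & (a & _) & _). exact (inhabits a). Qed.

Lemma D1_form (P : M -> Prop) : D1 P ->
  exists phi e, forall x : M, sat (scons x e) phi <-> P x.
Proof.
  intros A. destruct M_inhabited as [m]. destruct (D_succ_form _ A (fun _ => m)) as (N & phi & p & H).
  exists phi, (mix N (fun _ => m) p). intros x.
  rewrite <- (H (scons x (fun _ => m))). apply ren_id_ext.
  intros n. rewrite mix_scons. reflexivity.
Qed.

Lemma D2_form (P : M -> M -> Prop) : D2 P ->
  exists phi e, forall x y : M, sat (scons x (scons y e)) phi <-> P x y.
Proof.
  intros A. destruct M_inhabited as [m]. destruct (A (fun _ => m)) as (N & phi & p & H).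
  destruct (D_widen N phi p (S (S N))) as [phi' E]; [lia|].
  exists phi', (mix N (fun _ => m) p). intros x y.
  rewrite <- (H (scons x (scons y (fun _ => m)))), <- E. apply ren_id_ext.
  intros n. rewrite mix_scons. destruct n as [|n]; [reflexivity|]. cbn [scons].
  rewrite mix_scons. reflexivity.
Qed.

Lemma separation_D (P : M -> Prop) (a : M) : D1 P ->
  exists b : M, forall x, x ∈ b <-> x ∈ a /\ P x.
Proof.
  intros A. destruct (D1_form P A) as (phi & e & H).
  destruct zf_axioms as (_ & _ & _ & _ & _ & _ & hsep & _).
  destruct (hsep phi e a) as [b Hb]. exists b. intros x. rewrite Hb, H. tauto.
Qed.

Lemma replacement_D (P : M -> M -> Prop) (a : M) : D2 P ->
  (forall x y z, P x y -> P x z -> y = z) ->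
  exists b : M, forall y, y ∈ b <-> exists x, x ∈ a /\ P x y.
Proof.
  intros A U. destruct (D2_form P A) as (phi & e & H).
  destruct zf_axioms as (_ & _ & _ & _ & _ & _ & _ & hrep).
  destruct (hrep phi e) with (a := a) as [b Hb].
  - intros x y z B C. apply H in B. apply H in C. eapply U; eassumption.
  - exists b. intros y. rewrite Hb. split; intros (x & X & Y); exists x;
      (split; [exact X|apply H; exact Y]).
Qed.

Lemma empty_exists : exists a : M, is_empty a.
Proof.
  destruct M_inhabited as [m]. destruct (separation_D (fun _ => False) m) as [b Hb].
  - exact (D_const False).
  - exists b. intros z A. apply Hb in A. tauto.
Qed.

(* Definite description; its junk value is the empty set. *)
Definition the (P : M -> Prop) : M :=
  epsilon M_inhabited (fun y => (exists! z, P z) /\ P y \/ ~ (exists! z, P z) /\ is_empty y).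

Lemma the_spec (P : M -> Prop) :
  (exists! z, P z) /\ P (the P) \/ ~ (exists! z, P z) /\ is_empty (the P).
Proof.
  apply (epsilon_spec M_inhabited
    (fun y => (exists! z, P z) /\ P y \/ ~ (exists! z, P z) /\ is_empty y)).
  destruct (classic (exists! z, P z)) as [H|H].
  - destruct H as [z Hz]. exists z. left. split; [exists z; exact Hz|apply Hz].
  - destruct empty_exists as [a Ha]. exists a. right. auto.
Qed.

Lemma the_eq (P : M -> Prop) y : P y -> (forall z, P z -> z = y) -> the P = y.
Proof.
  intros A B. destruct (the_spec P) as [[_ C]|[C _]]; [auto|].
  destruct C. exists y. split; [exact A|]. intros z Hz. symmetry. auto.
Qed.

Lemma the_prop (P : M -> Prop) : (exists! z, P z) -> P (the P).
Proof. intros A. destruct (the_spec P) as [[_ C]|[C _]]; tauto. Qed.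

Lemma the_ext (P : M -> Prop) : (exists y, P y) ->
  (forall y z, P y -> P z -> y = z) -> P (the P).
Proof.
  intros [y A] U. apply the_prop. exists y. split; [exact A|]. intros z Hz. eauto.
Qed.

(** Thanks to the junk value, description is a total operation whose graph is a case distinction on
    unique existence; definable operations are closed under it without side conditions. *)
Lemma T_the (P : (nat -> M) -> M -> Prop) :
  D (fun e => P (fun k => e (S k)) (e 0)) -> T (fun e => the (P e)).
Proof.
  intros A.
  assert (B : D (fun e : nat -> M => exists! z, P (fun k => e (S k)) z)).
  { exact (D_ren _ S (D_ex1 P A)). }
  unfold T. eapply D_ext.
  - apply D_or; apply D_and; [exact B|exact A|apply D_not; exact B|].
    apply D_all with (Q := fun e z => z ∉ e 0). apply D_not, (D_mem_var 0 1).
  - intros e. cbn beta. destruct (the_spec (P (fun k => e (S k)))) as [[C E]|[C E]].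
    + split.
      * intros [[_ H]|[H _]]; [|tauto]. destruct C as [z [_ U]].
        rewrite <- (U _ E). symmetry. auto.
      * intros ->. tauto.
    + split.
      * intros [[H _]|[_ H]]; [tauto|]. apply ext. intros z.
        split; intros Z; [destruct (H z Z)|destruct (E z Z)].
      * intros ->. tauto.
Qed.
End Description.

Create HintDb dfn discriminated.

(** Definability follows the syntax: connectives, quantifiers and descriptions are peeled off, and
    every fixed set of M counts as a parameter. Defined notions are added as hints in [dfn]. *)
Ltac dcore :=
  cbv beta;
  first
  [ assumption
  | apply T_const
  | apply D_const
  | lazymatch goal with
    | |- T (fun e => e _) => apply T_var
    | |- T (fun e => the _) => apply T_the
    | |- D (fun e => _ /\ _) => apply D_and
    | |- D (fun e => _ \/ _) => apply D_or
    | |- D (fun e => ~ _) => apply D_not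
    | |- D (fun e => _ <-> _) => apply D_iff
    | |- D (fun e => exists! x, _) => apply D_ex1
    | |- D (fun e => exists x, _) => apply D_ex
    | |- D (fun e => _ = _) => apply D_eq
    | |- D (fun e => _ ∈ _) => apply D_mem
    | H : T ?t |- T (fun e => ?t _) => apply (T_ren t _ H)
    | H : D ?t |- D (fun e => ?t _) => apply (D_ren t _ H)
    | H : D1 ?P |- D (fun e => ?P _) => apply (D1_app P _ H)
    | H : T1 ?P |- T (fun e => ?P _) => apply (T1_app P _ H)
    | H : D2 ?P |- D (fun e => ?P _ _) => apply (D2_app P _ _ H)
    | H : T2 ?P |- T (fun e => ?P _ _) => apply (T2_app P _ _ H)
    | |- D (fun e => forall x : _, _) => first [apply D_all | apply D_imp]
    end ].
Hint Extern 5 (D _) => dcore : dfn.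
Hint Extern 5 (T _) => dcore : dfn.
Ltac dsolve :=
  try unfold D1; try unfold D2; try unfold T1; try unfold T2;
  solve [auto 200 with dfn nocore].

(** * Basic set theory *)

Section Basic.
Context {M : set_structure} {hZF : ZF_model M}.
Implicit Types a b c f g h x y z u v p : M.
Notation env := (nat -> M).

Lemma mem_sep_ex (P : M -> Prop) a : D1 P -> exists b, forall x, x ∈ b <-> x ∈ a /\ P x.
Proof. intros A. exact (separation_D P a A). Qed.

Definition emp : M := the is_empty.
Definition sep a (P : M -> Prop) : M := the (fun b => forall x, x ∈ b <-> x ∈ a /\ P x).
Definition rep a (F : M -> M) : M :=
  the (fun b => forall y, y ∈ b <-> exists x, x ∈ a /\ y = F x).
Definition up x y : M := the (fun p => is_upair p x y).
Definition op x y : M := the (fun p => is_opair p x y).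
Definition un a : M := the (fun u => is_union u a).
Definition pow a : M := the (fun u => is_power u a).
Definition cup a b : M := un (up a b).
Definition suc x : M := the (fun s => is_succ s x).
Definition lam a (F : M -> M) : M := rep a (fun x => op x (F x)).
(** Application is total, with value [emp] off the domain; finite sequences are later padded by
    exactly this default. *)
Definition ap f x : M := the (fun y => app f x y).
Definition prod a b : M := un (rep a (fun x => rep b (fun y => op x y))).
Definition ite (P : Prop) x y : M := the (fun v => P /\ v = x \/ ~ P /\ v = y).
Definition res f a : M := lam a (fun x => ap f x).

Lemma T_sep (a : env -> M) (P : env -> M -> Prop) :
  T a -> D (fun e => P (fun k => e (S k)) (e 0)) -> T (fun e => sep (a e) (P e)).
Proof.
  intros A B. unfold sep. apply T_the. apply D_all. apply D_iff; [dsolve|].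
  apply D_and; [dsolve|].
  exact (D_ren _ (fun n => match n with O => O | S k => S (S k) end) B).
Qed.
Lemma T_rep (a : env -> M) (F : env -> M -> M) :
  T a -> T (fun e => F (fun k => e (S k)) (e 0)) -> T (fun e => rep (a e) (F e)).
Proof.
  intros A B. unfold rep. apply T_the. apply D_all. apply D_iff; [dsolve|].
  apply D_ex. apply D_and; [dsolve|].
  apply D_eq; [dsolve|].
  exact (T_ren _ (fun n => match n with O => O | S k => S (S (S k)) end) B).
Qed.
Lemma D_is_upair (p x y : env -> M) : T p -> T x -> T y -> D (fun e => is_upair (p e) (x e) (y e)).
Proof. intros. unfold is_upair. dsolve. Qed.
Hint Resolve D_is_upair : dfn.
Lemma D_is_opair (p x y : env -> M) : T p -> T x -> T y -> D (fun e => is_opair (p e) (x e) (y e)).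
Proof. intros. unfold is_opair. dsolve. Qed.
Hint Resolve D_is_opair : dfn.
Lemma T_up (x y : env -> M) : T x -> T y -> T (fun e => up (x e) (y e)).
Proof. intros. unfold up. dsolve. Qed.
Lemma T_op (x y : env -> M) : T x -> T y -> T (fun e => op (x e) (y e)).
Proof. intros. unfold op. dsolve. Qed.
Lemma T_un (x : env -> M) : T x -> T (fun e => un (x e)).
Proof. intros. unfold un, is_union. dsolve. Qed.
Lemma D_subset (x y : env -> M) : T x -> T y -> D (fun e => subset (x e) (y e)).
Proof. intros. unfold subset. dsolve. Qed.
Hint Resolve T_up T_op T_un D_subset : dfn.
Lemma T_pow (x : env -> M) : T x -> T (fun e => pow (x e)).
Proof. intros. unfold pow, is_power. dsolve. Qed.
Lemma D_is_succ (x y : env -> M) : T x -> T y -> D (fun e => is_succ (x e) (y e)).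
Proof. intros. unfold is_succ. dsolve. Qed.
Hint Resolve D_is_succ : dfn.
Lemma T_suc (x : env -> M) : T x -> T (fun e => suc (x e)).
Proof. intros. unfold suc. dsolve. Qed.
Lemma T_cup (x y : env -> M) : T x -> T y -> T (fun e => cup (x e) (y e)).
Proof. intros. unfold cup. dsolve. Qed.
Lemma D_app (x y z : env -> M) : T x -> T y -> T z -> D (fun e => app (x e) (y e) (z e)).
Proof. intros. unfold app. dsolve. Qed.
Hint Resolve T_pow T_suc T_cup D_app T_rep T_sep : dfn.
Lemma T_ap (x y : env -> M) : T x -> T y -> T (fun e => ap (x e) (y e)).
Proof. intros. unfold ap. dsolve. Qed.
Lemma T_lam (a : env -> M) (F : env -> M -> M) :
  T a -> T (fun e => F (fun k => e (S k)) (e 0)) -> T (fun e => lam (a e) (F e)).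
Proof.
  intros A B. unfold lam. apply T_rep; [exact A|]. apply T_op; [apply T_var|exact B].
Qed.
Lemma T_ite (P : env -> Prop) (x y : env -> M) :
  D P -> T x -> T y -> T (fun e => ite (P e) (x e) (y e)).
Proof. intros. unfold ite. dsolve. Qed.
Hint Resolve T_ap T_lam T_ite : dfn.
Lemma T_res (x y : env -> M) : T x -> T y -> T (fun e => res (x e) (y e)).
Proof. intros. unfold res. dsolve. Qed.
Hint Resolve T_res : dfn.
Lemma D_is_fun_on (x y : env -> M) : T x -> T y -> D (fun e => is_fun_on (x e) (y e)).
Proof. intros. unfold is_fun_on. dsolve. Qed.
Hint Resolve D_is_fun_on : dfn.
Lemma D_is_fun (x y z : env -> M) : T x -> T y -> T z -> D (fun e => is_fun (x e) (y e) (z e)).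
Proof. intros. unfold is_fun. dsolve. Qed.
Hint Resolve D_is_fun : dfn.
Lemma D_is_injection (x y z : env -> M) : T x -> T y -> T z -> D (fun e => is_injection (x e) (y e) (z e)).
Proof. intros. unfold is_injection. dsolve. Qed.
Lemma D_transitive (x : env -> M) : T x -> D (fun e => transitive (x e)).
Proof. intros. unfold transitive. dsolve. Qed.
Hint Resolve D_is_injection D_transitive : dfn.
Lemma D_is_ord (x : env -> M) : T x -> D (fun e => is_ord (x e)).
Proof. intros. unfold is_ord. dsolve. Qed.
Lemma D_ord_le (x y : env -> M) : T x -> T y -> D (fun e => ord_le (x e) (y e)).
Proof. intros. unfold ord_le. dsolve. Qed.
Lemma D_is_empty (x : env -> M) : T x -> D (fun e => is_empty (x e)).
Proof. intros. unfold is_empty. dsolve. Qed.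
Hint Resolve D_is_ord D_ord_le D_is_empty : dfn.
Lemma D_is_limit (x : env -> M) : T x -> D (fun e => is_limit (x e)).
Proof. intros. unfold is_limit. dsolve. Qed.
Hint Resolve D_is_limit : dfn.
Lemma D_is_omega (x : env -> M) : T x -> D (fun e => is_omega (x e)).
Proof. intros. unfold is_omega. dsolve. Qed.
Hint Resolve D_is_omega : dfn.
Lemma D_countable (x : env -> M) : T x -> D (fun e => countable (x e)).
Proof. intros. unfold countable. dsolve. Qed.
Hint Resolve D_countable : dfn.

Lemma mem_emp z : z ∉ emp.
Proof.
  unfold emp. assert (H : is_empty (the (is_empty (M := M)))).
  { apply (the_ext is_empty); [apply empty_exists|]. intros y w A B. apply ext.
    intros u. split; intros U; [destruct (A _ U)|destruct (B _ U)]. }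
  apply H.
Qed.

Lemma is_empty_emp z : is_empty z <-> z = emp.
Proof.
  split; [|intros ->; exact mem_emp].
  intros A. apply ext. intros u. split; intros U; [destruct (A _ U)|destruct (mem_emp _ U)].
Qed.

Lemma not_empty a : a <> emp -> exists x, x ∈ a.
Proof.
  intros H. apply NNPP. intros C. apply H, is_empty_emp. intros z Z. apply C. eauto.
Qed.

Lemma ext_unique (P : M -> Prop) b c :
  (forall z, z ∈ b <-> P z) -> (forall z, z ∈ c <-> P z) -> b = c.
Proof. intros A B. apply ext. intros z. rewrite A, B. tauto. Qed.

Lemma mem_sep (P : M -> Prop) a x : D1 P -> x ∈ sep a P <-> x ∈ a /\ P x.
Proof.
  intros A. unfold sep. revert x.
  apply (the_ext (fun b => forall x, x ∈ b <-> x ∈ a /\ P x)).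
  - apply mem_sep_ex, A.
  - intros b c. apply ext_unique.
Qed.

Lemma mem_rep (F : M -> M) a y : T1 F -> y ∈ rep a F <-> exists x, x ∈ a /\ y = F x.
Proof.
  intros A. unfold rep. revert y.
  apply (the_ext (fun b => forall y, y ∈ b <-> exists x, x ∈ a /\ y = F x)).
  - destruct (replacement_D (fun x y => y = F x) a) as [b Hb].
    + dsolve.
    + intros x y z -> ->. reflexivity.
    + exists b. exact Hb.
  - intros b c. apply ext_unique.
Qed.

Lemma mem_up x y z : z ∈ up x y <-> z = x \/ z = y.
Proof.
  unfold up. revert z. apply (the_ext (fun p => is_upair p x y)).
  - apply zf_axioms.
  - intros b c. apply ext_unique.
Qed.

Lemma mem_un a z : z ∈ un a <-> exists y, y ∈ a /\ z ∈ y.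
Proof.
  unfold un. revert z. apply (the_ext (fun p => is_union p a)).
  - apply zf_axioms.
  - intros b c. apply ext_unique.
Qed.

Lemma mem_pow a z : z ∈ pow a <-> subset z a.
Proof.
  unfold pow. revert z. apply (the_ext (fun p => is_power p a)).
  - apply zf_axioms.
  - intros b c. apply ext_unique.
Qed.

Lemma mem_cup a b z : z ∈ cup a b <-> z ∈ a \/ z ∈ b.
Proof.
  unfold cup. rewrite mem_un. split.
  - intros (y & Y & Z). apply mem_up in Y. destruct Y as [->| ->]; auto.
  - intros [H|H]; eexists; (split; [apply mem_up|exact H]); auto.
Qed.

Lemma mem_suc x z : z ∈ suc x <-> z ∈ x \/ z = x.
Proof.
  unfold suc. revert z. apply (the_ext (fun p => is_succ p x)).
  - exists (cup x (up x x)). intros z. rewrite mem_cup, mem_up. tauto.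
  - intros b c. apply ext_unique.
Qed.

Lemma is_succ_suc s x : is_succ s x <-> s = suc x.
Proof.
  split; [|intros ->; intros z; apply mem_suc].
  intros A. apply ext. intros z. rewrite mem_suc. apply A.
Qed.

Lemma is_upair_up p x y : is_upair p x y <-> p = up x y.
Proof.
  split; [|intros ->; intros z; apply mem_up].
  intros A. apply ext. intros z. rewrite mem_up. apply A.
Qed.

Lemma is_power_pow p x : is_power p x <-> p = pow x.
Proof.
  split; [|intros ->; intros z; apply mem_pow].
  intros A. apply ext. intros z. rewrite mem_pow. apply A.
Qed.

Lemma is_opair_up p x y : is_opair p x y <-> p = up (up x x) (up x y).
Proof.
  unfold is_opair. split.
  - intros (a & b & A & B & C). rewrite is_upair_up in A, B, C. subst. reflexivity.
  - intros ->. exists (up x x), (up x y). rewrite !is_upair_up. auto.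
Qed.

Lemma op_up x y : op x y = up (up x x) (up x y).
Proof.
  unfold op. apply the_eq; [apply is_opair_up; reflexivity|].
  intros z. apply is_opair_up.
Qed.

Lemma is_opair_op p x y : is_opair p x y <-> p = op x y.
Proof. rewrite op_up. apply is_opair_up. Qed.

Lemma up_inj_l x y z : up x x = up y z -> x = y /\ x = z.
Proof.
  intros E. split; symmetry.
  - assert (H : y ∈ up x x) by (rewrite E; apply mem_up; auto). apply mem_up in H. tauto.
  - assert (H : z ∈ up x x) by (rewrite E; apply mem_up; auto). apply mem_up in H. tauto.
Qed.

Lemma op_inj x y z w : op x y = op z w -> x = z /\ y = w.
Proof.
  rewrite !op_up. intros E.
  assert (A : x = z).
  { assert (H : up x x ∈ up (up z z) (up z w)) by (rewrite <- E; apply mem_up; auto).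
    apply mem_up in H. destruct H as [H|H]; apply up_inj_l in H; tauto. }
  subst z. split; [reflexivity|].
  assert (H1 : up x y ∈ up (up x x) (up x w)) by (rewrite <- E; apply mem_up; auto).
  assert (H2 : up x w ∈ up (up x x) (up x y)) by (rewrite E; apply mem_up; auto).
  apply mem_up in H1. apply mem_up in H2.
  destruct H1 as [H1|H1].
  - symmetry in H1. apply up_inj_l in H1. destruct H1 as [_ <-].
    destruct H2 as [H2|H2]; symmetry in H2; apply up_inj_l in H2; tauto.
  - assert (H : y ∈ up x w) by (rewrite <- H1; apply mem_up; auto).
    apply mem_up in H. destruct H as [->|H]; [|exact H].
    symmetry in H1. destruct H2 as [H2|H2].
    + symmetry in H2. apply up_inj_l in H2. tauto.
    + assert (H : w ∈ up x x) by (rewrite <- H2; apply mem_up; auto).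
      apply mem_up in H. destruct H; auto.
Qed.

Lemma mem_prod a b z : z ∈ prod a b <-> exists x y, x ∈ a /\ y ∈ b /\ z = op x y.
Proof.
  unfold prod. rewrite mem_un. split.
  - intros (u & U & Z). rewrite mem_rep in U by dsolve. destruct U as (x & X & ->).
    rewrite mem_rep in Z by dsolve. destruct Z as (y & Y & ->). eauto.
  - intros (x & y & X & Y & ->). exists (rep b (fun y => op x y)). split.
    + rewrite mem_rep by dsolve. eauto.
    + rewrite mem_rep by dsolve. eauto.
Qed.

Lemma op_in_prod a b x y : op x y ∈ prod a b <-> x ∈ a /\ y ∈ b.
Proof.
  rewrite mem_prod. split.
  - intros (x' & y' & X & Y & E). apply op_inj in E. destruct E; subst; auto.
  - intros [X Y]. eauto.
Qed.

Lemma is_prod_prod p a b : is_prod p a b <-> p = prod a b.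
Proof.
  assert (H : forall z, z ∈ prod a b <-> exists x y, x ∈ a /\ y ∈ b /\ is_opair z x y).
  { intros z. rewrite mem_prod. split; intros (x & y & X & Y & Z); exists x, y;
      rewrite is_opair_op in *; auto. }
  split; [|intros ->; exact H].
  intros A. apply ext. intros z. rewrite H. apply A.
Qed.

Lemma app_iff f x y : app f x y <-> op x y ∈ f.
Proof.
  unfold app. split.
  - intros (p & A & B). apply is_opair_op in A. subst. exact B.
  - intros A. exists (op x y). rewrite is_opair_op. auto.
Qed.

Lemma ite_true (P : Prop) x y : P -> ite P x y = x.
Proof. intros H. unfold ite. apply the_eq; [auto|]. intros z [[_ Z]|[Z _]]; tauto. Qed.
Lemma ite_false (P : Prop) x y : ~ P -> ite P x y = y.
Proof. intros H. unfold ite. apply the_eq; [auto|]. intros z [[Z _]|[_ Z]]; tauto. Qed.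

Lemma app_unique_ap f x y : app f x y -> (forall z, app f x z -> z = y) -> ap f x = y.
Proof. intros A B. unfold ap. apply the_eq; assumption. Qed.

Lemma app_ap_on f a x : is_fun_on f a -> x ∈ a -> app f x (ap f x).
Proof. intros [_ A] X. unfold ap. apply the_prop, A, X. Qed.

Lemma app_eq_on f a x y : is_fun_on f a -> app f x y -> x ∈ a /\ y = ap f x.
Proof.
  intros [A B] C. assert (X : x ∈ a).
  { destruct C as (p & P & C). destruct (A p C) as (x' & y' & X & E).
    rewrite is_opair_op in *. subst p. apply op_inj in E. destruct E; subst. exact X. }
  split; [exact X|]. destruct (B x X) as (z & Z & U).
  rewrite <- (U _ C). apply U. apply (app_ap_on f a); [split; assumption|exact X].
Qed.

Lemma ap_out f a x : is_fun_on f a -> x ∉ a -> ap f x = emp.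
Proof.
  intros A X. unfold ap. destruct (the_spec (fun y => app f x y)) as [[_ B]|[_ B]].
  - apply (app_eq_on f a) in B; tauto.
  - apply is_empty_emp, B.
Qed.

Lemma app_ap f a b x : is_fun f a b -> x ∈ a -> app f x (ap f x).
Proof. intros [A _]. apply app_ap_on, A. Qed.

Lemma app_eq f a b x y : is_fun f a b -> app f x y -> x ∈ a /\ y = ap f x.
Proof. intros [A _]. apply app_eq_on, A. Qed.

Lemma ap_mem f a b x : is_fun f a b -> x ∈ a -> ap f x ∈ b.
Proof. intros A X. apply A with x. apply (app_ap f a b); assumption. Qed.

Lemma fun_on_ext f g a : is_fun_on f a -> is_fun_on g a ->
  (forall x, x ∈ a -> ap f x = ap g x) -> f = g.
Proof.
  assert (H : forall f g, is_fun_on f a -> is_fun_on g a ->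
    (forall x, x ∈ a -> ap f x = ap g x) -> forall p, p ∈ f -> p ∈ g).
  { clear. intros f g F G E p P. destruct F as [F1 F2].
    destruct (F1 p P) as (x & y & X & O). apply is_opair_op in O. subst p.
    apply app_iff. apply app_iff in P.
    apply (app_eq_on f a) in P; [|split; assumption]. destruct P as [_ ->].
    rewrite E by exact X. apply (app_ap_on g a); assumption. }
  intros F G E. apply ext. intros p. split; apply H; auto.
  intros x X. symmetry. auto.
Qed.

Lemma fun_ext f g a b c : is_fun f a b -> is_fun g a c ->
  (forall x, x ∈ a -> ap f x = ap g x) -> f = g.
Proof. intros [A _] [B _]. apply fun_on_ext; assumption. Qed.

Lemma app_lam (F : M -> M) a x y : T1 F -> app (lam a F) x y <-> x ∈ a /\ y = F x.
Proof.
  intros A. rewrite app_iff. unfold lam. rewrite mem_rep by dsolve. split.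
  - intros (x' & X & E). apply op_inj in E. destruct E; subst. auto.
  - intros [X ->]. eauto.
Qed.

Lemma ap_lam (F : M -> M) a x : T1 F -> x ∈ a -> ap (lam a F) x = F x.
Proof.
  intros A X. apply app_unique_ap; [apply app_lam; auto|].
  intros z Z. apply app_lam in Z; tauto.
Qed.

Lemma lam_fun_on (F : M -> M) a : T1 F -> is_fun_on (lam a F) a.
Proof.
  intros A. split.
  - intros p P. unfold lam in P. rewrite mem_rep in P by dsolve.
    destruct P as (x & X & ->). exists x, (F x). rewrite is_opair_op. auto.
  - intros x X. exists (F x). split; [apply app_lam; auto|].
    intros y Y. apply app_lam in Y; [symmetry; tauto|exact A].
Qed.

Lemma lam_fun (F : M -> M) a b : T1 F -> (forall x, x ∈ a -> F x ∈ b) -> is_fun (lam a F) a b.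
Proof.
  intros A B. split; [apply lam_fun_on, A|].
  intros x y H. apply app_lam in H; [|exact A]. destruct H as [X ->]. auto.
Qed.

Lemma lam_ext (F G : M -> M) a : T1 F -> T1 G -> (forall x, x ∈ a -> F x = G x) -> lam a F = lam a G.
Proof.
  intros A B E. apply (fun_on_ext _ _ a); [apply lam_fun_on, A|apply lam_fun_on, B|].
  intros x X. rewrite !ap_lam by assumption. auto.
Qed.

Lemma ap_res f a x : x ∈ a -> ap (res f a) x = ap f x.
Proof. intros X. unfold res. rewrite ap_lam; [reflexivity|dsolve|exact X]. Qed.

Lemma res_fun_on f a : is_fun_on (res f a) a.
Proof. apply lam_fun_on. dsolve. Qed.

Lemma res_fun f a b c : is_fun f a b -> subset c a -> is_fun (res f c) c b.
Proof.
  intros A B. apply lam_fun; [dsolve|]. intros x X. apply (ap_mem f a b); auto.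
Qed.

Lemma res_ext f g a : (forall x, x ∈ a -> ap f x = ap g x) -> res f a = res g a.
Proof. intros E. apply lam_ext; [dsolve|dsolve|exact E]. Qed.

Definition fn a b : M := sep (pow (prod a b)) (fun f => is_fun f a b).

Lemma mem_fn a b f : f ∈ fn a b <-> is_fun f a b.
Proof.
  unfold fn. rewrite mem_sep by dsolve. split; [tauto|]. intros A. split; [|exact A].
  apply mem_pow. intros p P. destruct A as [[A1 A2] B].
  destruct (A1 p P) as (x & y & X & E). apply is_opair_op in E. subst p.
  apply op_in_prod. split; [exact X|]. apply (B x). apply app_iff, P.
Qed.

Lemma foundation_min a : a <> emp -> exists x, x ∈ a /\ forall y, y ∈ a -> y ∉ x.
Proof.
  intros H. apply zf_axioms. intros E. apply H, is_empty_emp, E.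
Qed.

Lemma mem_irrefl x : x ∉ x.
Proof.
  intros X. destruct (foundation_min (up x x)) as (y & Y & H).
  - intros E. apply (mem_emp x). rewrite <- E. apply mem_up. auto.
  - apply mem_up in Y. assert (y = x) as -> by tauto. apply (H x); [apply mem_up; auto|exact X].
Qed.

Lemma mem_asym x y : x ∈ y -> y ∉ x.
Proof.
  intros X Y. destruct (foundation_min (up x y)) as (z & Z & H).
  - intros E. apply (mem_emp x). rewrite <- E. apply mem_up. auto.
  - apply mem_up in Z. destruct Z as [-> | ->]; [apply (H y)|apply (H x)]; auto; apply mem_up; auto.
Qed.

(** * Ordinals *)

Lemma ord_in a b : is_ord a -> b ∈ a -> is_ord b.
Proof.
  intros [A B] H. split; [apply B, H|]. intros y Y. apply B, (A b H), Y.
Qed.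

Lemma ord_trans a b c : is_ord c -> a ∈ b -> b ∈ c -> a ∈ c.
Proof. intros [A _] X Y. exact (A b Y a X). Qed.

Lemma suc_ord a : is_ord a -> is_ord (suc a).
Proof.
  intros [A B]. split.
  - intros y Y z Z. rewrite mem_suc in *. destruct Y as [Y| ->]; [left; exact (A y Y z Z)|auto].
  - intros y Y. apply mem_suc in Y. destruct Y as [Y| ->]; auto.
Qed.

Lemma emp_ord : is_ord emp.
Proof. split; intros y Y; destruct (mem_emp y Y). Qed.

Lemma un_ord a : (forall x, x ∈ a -> is_ord x) -> is_ord (un a).
Proof.
  intros H. split.
  - intros y Y z Z. apply mem_un in Y. destruct Y as (x & X & Y). apply mem_un.
    exists x. split; [exact X|]. exact (ord_trans z y x (H x X) Z Y).
  - intros y Y. apply mem_un in Y. destruct Y as (x & X & Y). apply (H x X), Y.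
Qed.

Lemma ord_least_in (P : M -> Prop) a : D1 P -> is_ord a -> P a ->
  exists b, is_ord b /\ P b /\ ord_le b a /\ forall c, c ∈ b -> ~ P c.
Proof.
  intros DP A Pa. destruct (foundation_min (sep (suc a) P)) as (b & B & H).
  - intros E. apply (mem_emp a). rewrite <- E. apply mem_sep; [exact DP|].
    split; [apply mem_suc; auto|exact Pa].
  - apply mem_sep in B; [|exact DP]. destruct B as [B Pb]. exists b.
    assert (OB : is_ord b) by (apply (ord_in (suc a)); [apply suc_ord, A|exact B]).
    split; [exact OB|]. split; [exact Pb|]. split.
    + apply mem_suc in B. exact B.
    + intros c C Pc. apply (H c); [|exact C]. apply mem_sep; [exact DP|].
      split; [|exact Pc]. apply (ord_trans c b); [apply suc_ord, A|exact C|exact B].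
Qed.

Lemma ord_ind (P : M -> Prop) : D1 P ->
  (forall a, is_ord a -> (forall b, b ∈ a -> P b) -> P a) -> forall a, is_ord a -> P a.
Proof.
  intros DP IH a A. apply NNPP. intros N.
  destruct (ord_least_in (fun x => ~ P x) a) as (b & B & NP & _ & H); [dsolve|exact A|exact N|].
  apply NP, IH; [exact B|]. intros c C. apply NNPP. exact (H c C).
Qed.

Lemma ord_tricho a b : is_ord a -> is_ord b -> a ∈ b \/ a = b \/ b ∈ a.
Proof.
  intros A. revert b. pattern a. revert a A. apply ord_ind; [dsolve|].
  intros a A IHa b B. pattern b. revert b B. apply ord_ind; [dsolve|].
  intros b B IHb. destruct (classic (a ∈ b)) as [H|H]; [auto|].
  destruct (classic (b ∈ a)) as [H'|H']; [auto|]. right; left.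
  apply ext. intros z. split; intros Z.
  - destruct (IHa z Z b B) as [E|[E|E]]; [exact E|subst; tauto|].
    destruct H'. exact (ord_trans b z a A E Z).
  - destruct (IHb z Z) as [E|[E|E]]; [|subst; tauto|exact E].
    destruct H. exact (ord_trans a z b B E Z).
Qed.

Lemma ord_subset_le a c : is_ord a -> is_ord c -> subset c a -> ord_le c a.
Proof.
  intros A C S. destruct (ord_tricho c a C A) as [H|[H|H]]; [left|right|]; auto.
  destruct (mem_irrefl a). apply S, H.
Qed.

Lemma ord_le_subset a c : is_ord a -> ord_le c a -> subset c a.
Proof.
  intros A [H| ->]; [|intros z Z; exact Z]. intros z Z. exact (ord_trans z c a A Z H).
Qed.

Lemma ord_le_or_lt a b : is_ord a -> is_ord b -> ord_le a b \/ b ∈ a.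
Proof. intros A B. destruct (ord_tricho a b A B) as [H|[H|H]]; unfold ord_le; auto. Qed.

Lemma ord_le_lt a b c : is_ord c -> ord_le a b -> b ∈ c -> a ∈ c.
Proof. intros C [H| ->] B; [exact (ord_trans a b c C H B)|exact B]. Qed.

Lemma ord_lt_le a b c : is_ord c -> a ∈ b -> ord_le b c -> a ∈ c.
Proof. intros C A [H| <-]; [exact (ord_trans a b c C A H)|exact A]. Qed.

Lemma ord_le_trans a b c : is_ord c -> ord_le a b -> ord_le b c -> ord_le a c.
Proof.
  intros C A [H| <-]; [left; exact (ord_le_lt a b c C A H)|exact A].
Qed.

Lemma ord_le_not_lt a b : is_ord b -> ord_le a b -> b ∉ a.
Proof.
  intros B A H. apply (mem_irrefl b). apply (ord_lt_le b a b B H A).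
Qed.

Lemma ord_le_antisym a b : is_ord b -> ord_le a b -> ord_le b a -> a = b.
Proof.
  intros B A [H|H]; [|auto]. destruct (ord_le_not_lt a b B A H).
Qed.

Lemma suc_le a b : is_ord b -> a ∈ b -> ord_le (suc a) b.
Proof.
  intros B A. apply ord_subset_le; [exact B|apply suc_ord, (ord_in b); assumption|].
  intros z Z. apply mem_suc in Z. destruct Z as [Z| ->]; [|exact A].
  exact (ord_trans z a b B Z A).
Qed.

Lemma mem_suc_le a b : ord_le a b <-> a ∈ suc b.
Proof. rewrite mem_suc. reflexivity. Qed.

Lemma suc_self a : a ∈ suc a.
Proof. apply mem_suc. auto. Qed.

Lemma suc_mono a b : is_ord b -> a ∈ b -> suc a ∈ suc b.
Proof. intros B A. apply mem_suc_le, suc_le; assumption. Qed.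

Lemma suc_inj a b : suc a = suc b -> a = b.
Proof.
  intros E. assert (A : a ∈ suc b) by (rewrite <- E; apply suc_self).
  assert (B : b ∈ suc a) by (rewrite E; apply suc_self).
  apply mem_suc in A. apply mem_suc in B. destruct A as [A|A]; [|exact A].
  destruct B as [B|B]; [|auto]. destruct (mem_asym a b A B).
Qed.

Lemma emp_le a : is_ord a -> ord_le emp a.
Proof.
  intros A. apply ord_subset_le; [exact A|apply emp_ord|]. intros z Z. destruct (mem_emp z Z).
Qed.

Lemma suc_not_emp a : suc a <> emp.
Proof. intros E. apply (mem_emp a). rewrite <- E. apply suc_self. Qed.

Lemma ord_cases a : is_ord a -> a = emp \/ (exists b, b ∈ a /\ a = suc b) \/ is_limit a.
Proof.
  intros A. destruct (classic (a = emp)) as [E|E]; [auto|right].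
  destruct (classic (exists b, b ∈ a /\ a = suc b)) as [H|H]; [auto|right].
  split; [exact A|]. split; [intros C; apply E, is_empty_emp, C|].
  intros y Y. exists (suc y). split; [|apply suc_self].
  destruct (suc_le y a A Y) as [H'|H']; [exact H'|]. destruct H. exists y. auto.
Qed.

Lemma limit_suc a y : is_limit a -> y ∈ a -> suc y ∈ a.
Proof.
  intros (A & _ & L) Y. destruct (L y Y) as (z & Z & YZ).
  apply (ord_le_lt _ z); [exact A| |exact Z]. apply suc_le; [|exact YZ].
  exact (ord_in a z A Z).
Qed.

Lemma suc_not_limit a : ~ is_limit (suc a).
Proof.
  intros L. apply (mem_irrefl (suc a)). apply limit_suc; [exact L|apply suc_self].
Qed.

Lemma un_suc a : is_ord a -> un (suc a) = a.
Proof.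
  intros A. apply ext. intros z. rewrite mem_un. split.
  - intros (y & Y & Z). apply mem_suc in Y. destruct Y as [Y| ->]; [|exact Z].
    exact (ord_trans z y a A Z Y).
  - intros Z. exists a. split; [apply suc_self|exact Z].
Qed.

(** * The set of natural numbers *)

Lemma omega_exists : exists w : M, is_omega w.
Proof.
  destruct zf_axioms as (_ & _ & _ & _ & _ & (I & (z0 & Z0 & I0) & IS) & _).
  apply is_empty_emp in Z0. subst z0.
  (* Natural numbers are the ordinals n such that every k up to n is zero or a successor. The least
     one missing from the inductive set I would be neither. *)
  set (N := fun n : M => is_ord n /\ forall k, k ∈ suc n -> k = emp \/ exists j, k = suc j).
  assert (DN : D1 N) by (unfold N; dsolve).
  assert (NI : forall n, N n -> n ∈ I).
  { intros n [ON H]. apply NNPP. intros C.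
    destruct (ord_least_in (fun k => k ∉ I) n) as (m & OM & MI & LE & MIN); [dsolve|exact ON|exact C|].
    destruct (H m) as [->|[j ->]].
    - apply mem_suc_le, LE.
    - exact (MI I0).
    - destruct (IS j) as (s & S & SI).
      + apply NNPP. apply MIN, suc_self.
      + apply is_succ_suc in S. subst. exact (MI SI). }
  assert (NM : forall n m, N n -> m ∈ n -> N m).
  { intros n m [ON H] Hm. split; [exact (ord_in n m ON Hm)|]. intros k K. apply H.
    apply mem_suc. left. apply (ord_le_lt k m); [exact ON|apply mem_suc_le, K|exact Hm]. }
  assert (NS : forall n, N n -> N (suc n)).
  { intros n [ON H]. split; [apply suc_ord, ON|]. intros k K. apply mem_suc in K.
    destruct K as [K| ->]; [apply H, K|right; eauto]. }
  assert (OW : is_ord (sep I N)).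
  { split.
    - intros y Y z Z. apply mem_sep in Y; [|exact DN]. apply mem_sep; [exact DN|].
      assert (N z) by (apply (NM y); tauto). auto.
    - intros y Y. apply mem_sep in Y; [|exact DN]. destruct Y as [_ [[TY _] _]]. exact TY. }
  exists (sep I N). split; [split; [exact OW|split]|].
  - intros H. apply (H emp). apply mem_sep; [exact DN|]. split; [exact I0|].
    split; [apply emp_ord|]. intros k K. apply mem_suc in K.
    destruct K as [K| ->]; [destruct (mem_emp k K)|auto].
  - intros y Y. exists (suc y). split; [|apply suc_self].
    apply mem_sep in Y; [|exact DN]. apply mem_sep; [exact DN|].
    assert (N (suc y)) by (apply NS; tauto). auto.
  - intros y Y L. apply mem_sep in Y; [|exact DN]. destruct Y as [_ [OY H]].
    destruct (H y (suc_self y)) as [->|[j ->]].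
    + destruct L as (_ & L & _). apply L. exact mem_emp.
    + exact (suc_not_limit j L).
Qed.

Definition om : M := the is_omega.

Lemma is_omega_om w : is_omega w <-> w = om.
Proof.
  assert (U : forall y z, is_omega y -> is_omega z -> y = z).
  { intros y z [Y1 Y2] [Z1 Z2].
    destruct (ord_tricho y z) as [H|[H|H]]; [apply Y1|apply Z1| |exact H|].
    - destruct (Z2 y H Y1).
    - destruct (Y2 z H Z1). }
  assert (H : is_omega om) by (apply (the_ext is_omega); [apply omega_exists|exact U]).
  split; [intros W; exact (U w om W H)|intros ->; exact H].
Qed.

Lemma om_limit : is_limit om.
Proof. apply (proj2 (is_omega_om om) eq_refl). Qed.
Lemma om_ord : is_ord om.
Proof. apply om_limit. Qed.
Lemma om_emp : emp ∈ om.
Proof.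
  destruct (emp_le om om_ord) as [H|H]; [exact H|].
  destruct om_limit as (_ & L & _). rewrite <- H in L. destruct (L mem_emp).
Qed.
Lemma om_suc n : n ∈ om -> suc n ∈ om.
Proof. apply limit_suc, om_limit. Qed.
Lemma nat_ord n : n ∈ om -> is_ord n.
Proof. apply ord_in, om_ord. Qed.
Lemma nat_trans m n : n ∈ om -> m ∈ n -> m ∈ om.
Proof. intros N H. exact (ord_trans m n om om_ord H N). Qed.
Lemma nat_cases n : n ∈ om -> n = emp \/ exists m, m ∈ om /\ n = suc m.
Proof.
  intros N. destruct (ord_cases n (nat_ord n N)) as [H|[(b & B & E)|L]]; [auto| |].
  - right. exists b. split; [exact (nat_trans b n N B)|exact E].
  - destruct (proj2 (proj2 (is_omega_om om) eq_refl) n N L).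
Qed.

Lemma nat_ind_D (P : M -> Prop) : D1 P -> P emp ->
  (forall n, n ∈ om -> P n -> P (suc n)) -> forall n, n ∈ om -> P n.
Proof.
  intros DP P0 PS.
  assert (H : forall n, is_ord n -> n ∈ om -> P n).
  { apply (ord_ind (fun n => n ∈ om -> P n)); [dsolve|].
    intros n ON IH N. destruct (nat_cases n N) as [->|(m & Hm & ->)]; [exact P0|].
    apply PS; [exact Hm|]. apply IH; [apply suc_self|exact Hm]. }
  intros n N. apply H; [apply nat_ord, N|exact N].
Qed.

Lemma nat_least (P : M -> Prop) : D1 P -> (exists n, n ∈ om /\ P n) ->
  exists n, n ∈ om /\ P n /\ forall m, m ∈ n -> ~ P m.
Proof.
  intros DP (n & N & Pn). destruct (ord_least_in P n DP (nat_ord n N) Pn) as (m & OM & Pm & LE & H).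
  exists m. split; [|auto]. destruct LE as [LE| ->]; [exact (nat_trans m n N LE)|exact N].
Qed.

Lemma suc_in_nat m n : n ∈ om -> m ∈ n -> suc m ∈ suc n.
Proof. intros N. apply suc_mono, nat_ord, N. Qed.

(* Well-founded recursion: Q need not be transitive. *)

Section Recursion.
Context (Z : M) (Q : M -> M -> Prop) (F : M -> M -> M) (DQ : D2 Q) (TF : T2 F).
Context (wf : forall S, subset S Z -> S <> emp ->
  exists z, z ∈ S /\ forall y, y ∈ S -> ~ Q y z).

Let preds z := sep Z (fun y => Q y z).
(** The attempts of the classical recursion proof: solutions of the recursion on part of Z. Their
    domains must be closed under Q-predecessors for the recursion to make sense there. *)
Let att (A h : M) := subset A Z /\ (forall z y, z ∈ A -> y ∈ Z -> Q y z -> y ∈ A) /\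
  forall z, z ∈ A -> ap h z = F z (res h (preds z)).

Let T_preds (z : env -> M) : T z -> T (fun e => preds (z e)).
Proof. intros H. unfold preds. dsolve. Qed.
Let D_att (a h : env -> M) : T a -> T h -> D (fun e => att (a e) (h e)).
Proof.
  intros A H. unfold att. dsolve.
Qed.

Lemma att_agree A h B g z : att A h -> att B g -> z ∈ A -> z ∈ B -> ap h z = ap g z.
Proof.
  intros (A1 & A2 & A3) (B1 & B2 & B3) ZA ZB. apply NNPP. intros C.
  destruct (wf (sep A (fun z => z ∈ B /\ ap h z <> ap g z))) as (m & Hm & MIN).
  - intros y Y. apply mem_sep in Y; [|dsolve]. apply A1, Y.
  - intros E. apply (mem_emp z). rewrite <- E. apply mem_sep; [dsolve|auto].
  - apply mem_sep in Hm; [|dsolve]. destruct Hm as (MA & MB & NE). apply NE.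
    rewrite A3, B3 by assumption. f_equal. apply res_ext. intros y Y.
    apply mem_sep in Y; [|dsolve]. destruct Y as [YZ YQ]. apply NNPP. intros NE'.
    apply (MIN y); [|exact YQ]. apply mem_sep; [dsolve|]. split; [apply (A2 m y); auto|].
    split; [apply (B2 m y); auto|exact NE'].
Qed.

(** Attempts agree where both are defined, so their common values form a definable operation [val].
    A minimal point reached by no attempt could be added to the union of all attempts. *)
Lemma wf_recursion : exists h, is_fun_on h Z /\ forall z, z ∈ Z -> ap h z = F z (res h (preds z)).
Proof.
  set (val := fun z => the (fun v => exists A h, att A h /\ z ∈ A /\ v = ap h z)).
  assert (TV : T1 val) by (unfold T1, val; apply T_the; 
    repeat (apply D_ex || apply D_and || apply D_att); dsolve).
  assert (VE : forall A h z, att A h -> z ∈ A -> val z = ap h z).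
  { intros A h z H ZA. apply the_eq; [eauto|]. intros v (B & g & G & ZB & ->).
    apply (att_agree B g A h); assumption. }
  set (cov := sep Z (fun z => exists A h, att A h /\ z ∈ A)).
  assert (DC : D1 (fun z => exists A h, att A h /\ z ∈ A)) by
    (unfold D1; repeat (apply D_ex || apply D_and || apply D_att); dsolve).
  assert (MC : forall z, z ∈ cov <-> exists A h, att A h /\ z ∈ A).
  { intros z. unfold cov. rewrite mem_sep by exact DC. split; [tauto|].
    intros (A & h & H & ZA). split; [apply H, ZA|eauto]. }
  assert (EQ : forall z, z ∈ cov -> val z = F z (res (lam cov val) (preds z)) /\
    forall y, y ∈ preds z -> y ∈ cov).
  { intros z HZ. apply MC in HZ. destruct HZ as (A & h & H & ZA).
    assert (SUB : forall y, y ∈ preds z -> y ∈ A).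
    { intros y Y. apply mem_sep in Y; [|dsolve]. apply (proj1 (proj2 H) z y); tauto. }
    split.
    - rewrite (VE A h z H ZA). rewrite (proj2 (proj2 H)) by exact ZA. f_equal.
      apply res_ext. intros y Y. apply SUB in Y. rewrite ap_lam; [symmetry; apply (VE A h y H Y)|exact TV|].
      apply MC. eauto.
    - intros y Y. apply MC. exists A, h. auto. }
  assert (ALL : forall z, z ∈ Z -> z ∈ cov).
  { intros z HZ. apply NNPP. intros C.
    destruct (wf (sep Z (fun z => z ∉ cov))) as (m & Hm & MIN).
    - intros y Y. apply mem_sep in Y; [|dsolve]. apply Y.
    - intros E. apply (mem_emp z). rewrite <- E. apply mem_sep; [dsolve|auto].
    - apply mem_sep in Hm; [|dsolve]. destruct Hm as [HmZ NM]. apply NM.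
      assert (PC : forall y, y ∈ preds m -> y ∈ cov).
      { intros y Y. apply mem_sep in Y; [|dsolve]. apply NNPP. intros NY.
        apply (MIN y); [|apply Y]. apply mem_sep; [dsolve|]. tauto. }
      (* The union of all attempts, prolonged to the minimal uncovered point m by the recursion
         itself. *)
      set (G := fun z => ite (z = m) (F m (res (lam cov val) (preds m))) (val z)).
      assert (TG : T1 G) by (unfold T1, G; dsolve).
      assert (GV : forall z, z ∈ cov -> G z = val z).
      { intros x X. unfold G. apply ite_false. intros ->. exact (NM X). }
      assert (RE : forall x, (forall y, y ∈ preds x -> y ∈ cov) ->
        res (lam (cup cov (up m m)) G) (preds x) = res (lam cov val) (preds x)).
      { intros x PX. apply res_ext. intros y Y. apply PX in Y.
        rewrite !ap_lam; [apply GV, Y|exact TV|exact Y|exact TG|apply mem_cup; auto]. }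
      apply MC. exists (cup cov (up m m)), (lam (cup cov (up m m)) G). split.
      + split; [|split].
        * intros x X. apply mem_cup in X. destruct X as [X|X].
          -- apply mem_sep in X; [apply X|exact DC].
          -- apply mem_up in X. destruct X as [-> | ->]; exact HmZ.
        * intros x y X Y YQ. apply mem_cup. left. apply mem_cup in X.
          destruct X as [X|X].
          -- apply (EQ x X). apply mem_sep; [dsolve|auto].
          -- apply PC. apply mem_up in X. apply mem_sep; [dsolve|].
             destruct X as [-> | ->]; auto.
        * intros x X. rewrite ap_lam by assumption. apply mem_cup in X. destruct X as [X|X].
          -- rewrite (RE x (proj2 (EQ x X))), GV by exact X. apply (EQ x X).
          -- assert (x = m) as -> by (apply mem_up in X; tauto).
             rewrite (RE m PC). unfold G. apply ite_true. reflexivity.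
      + apply mem_cup. right. apply mem_up. auto. }
  exists (lam Z val). split; [apply lam_fun_on, TV|]. intros z HZ.
  rewrite ap_lam by assumption.
  rewrite (proj1 (EQ z (ALL z HZ))). f_equal. apply res_ext. intros y Y.
  assert (YC : y ∈ cov) by (apply (EQ z (ALL z HZ)), Y).
  rewrite !ap_lam; [reflexivity|exact TV| |exact TV|exact YC].
  apply mem_sep in Y; [apply Y|dsolve].
Qed.
End Recursion.

Lemma ord_recursion a (F : M -> M -> M) : T2 F -> is_ord a ->
  exists h, is_fun_on h a /\ forall z, z ∈ a -> ap h z = F z (res h z).
Proof.
  intros TF A. destruct (wf_recursion a (fun y z => y ∈ z) F) as (h & H & E).
  - dsolve.
  - exact TF.
  - intros S _ NE. apply foundation_min, NE.
  - exists h. split; [exact H|]. intros z Z. rewrite E by exact Z. f_equal.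
    f_equal. apply ext. intros y. rewrite mem_sep by dsolve. split; [tauto|].
    intros Y. split; [exact (ord_trans y z a A Y Z)|exact Y].
Qed.

(** Given as a description, so that a sequence defined by recursion is again a definable operation
    of its data. *)
Definition nrec x (F : M -> M -> M) : M := the (fun h => is_fun_on h om /\ ap h emp = x /\
  forall n, n ∈ om -> ap h (suc n) = F n (ap h n)).

Lemma T_nrec (x : env -> M) (F : env -> M -> M -> M) : T x ->
  T (fun e => F (fun k => e (S (S k))) (e 1) (e 0)) -> T (fun e => nrec (x e) (F e)).
Proof.
  intros A B. unfold nrec. apply T_the.
  apply D_and; [dsolve|]. apply D_and; [dsolve|]. apply D_all. apply D_imp; [dsolve|].
  apply D_eq; [dsolve|].
  apply (T2_app (fun n v => v) (fun e => e 0)); [dsolve|dsolve|].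
  unfold T.
  apply (D_bind (fun e => ap (e 2) (e 1))
    (fun e y => e 0 = F (fun k => e (S (S (S k)))) (e 1) y)); [dsolve|].
  exact (D_ren _ (fun n => match n with 0 => 1 | 1 => 0 | 2 => 2 | S (S (S k)) => S (S (S (S k))) end) B).
Qed.

Lemma nrec_spec x F : T2 F -> is_fun_on (nrec x F) om /\ ap (nrec x F) emp = x /\
  forall n, n ∈ om -> ap (nrec x F) (suc n) = F n (ap (nrec x F) n).
Proof.
  intros TF. unfold nrec. apply (the_ext (fun h => is_fun_on h om /\ ap h emp = x /\
  forall n, n ∈ om -> ap h (suc n) = F n (ap h n))).
  (* [un n] is the predecessor of a successor n. *)
  - destruct (ord_recursion om (fun n g => ite (n = emp) x (F (un n) (ap g (un n))))) as (h & H & E).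
    + unfold T2. apply T_ite; [dsolve|dsolve|]. apply (T2_app F); dsolve.
    + apply om_ord.
    + exists h. split; [exact H|]. split.
      * rewrite E by apply om_emp. apply ite_true. reflexivity.
      * intros n N. rewrite E by (apply om_suc, N). rewrite ite_false by apply suc_not_emp.
        rewrite un_suc by (apply nat_ord, N). rewrite ap_res by apply suc_self. reflexivity.
  - intros h g (H1 & H2 & H3) (G1 & G2 & G3). apply (fun_on_ext h g om H1 G1).
    apply nat_ind_D; [dsolve|congruence|]. intros n N IH. rewrite H3, G3, IH by exact N. reflexivity.
Qed.

Lemma nrec_0 x F : T2 F -> ap (nrec x F) emp = x.
Proof. intros TF. apply nrec_spec, TF. Qed.
Lemma nrec_S x F n : T2 F -> n ∈ om -> ap (nrec x F) (suc n) = F n (ap (nrec x F) n).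
Proof. intros TF. apply nrec_spec, TF. Qed.
Lemma nrec_fun x F Z : T2 F -> x ∈ Z ->
  (forall n v, n ∈ om -> v ∈ Z -> F n v ∈ Z) -> is_fun (nrec x F) om Z.
Proof.
  intros TF X H. destruct (nrec_spec x F TF) as (A & B & C). split; [exact A|].
  assert (E : forall n, n ∈ om -> ap (nrec x F) n ∈ Z).
  { apply nat_ind_D.
    - dsolve.
    - rewrite B. exact X.
    - intros n N IH. rewrite C by exact N. apply H; assumption. }
  intros n y Y. apply (app_eq_on _ om) in Y; [|exact A]. destruct Y as [N ->]. auto.
Qed.
End Basic.

#[export] Hint Resolve D_is_upair D_is_opair T_up T_op T_un D_subset D_is_succ T_pow T_suc
 T_cup D_app T_rep T_sep T_ap T_lam T_ite T_res D_is_fun_on 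
 D_is_fun D_is_injection D_transitive D_is_ord D_ord_le D_is_empty
 D_is_limit D_is_omega D_countable T_nrec : dfn.

#[global] Opaque the emp sep rep up op un pow suc ap ite om nrec.

Ltac nind := match goal with |- forall n, n ∈ om -> @?P n => apply (nat_ind_D P); cbv beta; [dsolve| |] end.

(** * Games *)

Section Games.
Context {M : set_structure} {hZF : ZF_model M}.
Implicit Types a b c f g h x y z u v p m n k i j : M.
Notation env := (nat -> M).

Definition dbl n : M := ap (nrec emp (fun _ v => suc (suc v))) n.
Lemma T_dbl (n : env -> M) : T n -> T (fun e => dbl (n e)).
Proof. intros. unfold dbl. dsolve. Qed.
Hint Resolve T_dbl : dfn.

Lemma dbl_0 : dbl emp = emp.
Proof. unfold dbl. apply nrec_0. dsolve. Qed.
Lemma dbl_S n : n ∈ om -> dbl (suc n) = suc (suc (dbl n)).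
Proof. intros N. unfold dbl. rewrite nrec_S; [reflexivity|dsolve|exact N]. Qed.
Lemma dbl_om n : n ∈ om -> dbl n ∈ om.
Proof.
  revert n. nind; [rewrite dbl_0; apply om_emp|].
  intros n N IH. rewrite dbl_S by exact N. apply om_suc, om_suc, IH.
Qed.

Lemma nat_parity n : n ∈ om -> exists k, k ∈ om /\ (n = dbl k \/ n = suc (dbl k)).
Proof.
  revert n. nind.
  - exists emp. split; [apply om_emp|]. left. symmetry. apply dbl_0.
  - intros n N (k & K & [->| ->]); [exists k; auto|].
    exists (suc k). split; [apply om_suc, K|]. left. symmetry. apply dbl_S, K.
Qed.

Lemma dbl_not_odd k : k ∈ om -> forall j, j ∈ om -> dbl k <> suc (dbl j).
Proof.
  revert k. nind.
  - intros j J E. rewrite dbl_0 in E. exact (suc_not_emp _ (eq_sym E)).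
  - intros k K IH j J E. rewrite dbl_S in E by exact K. apply suc_inj in E.
    destruct (nat_cases j J) as [->|(i & I & ->)].
    + rewrite dbl_0 in E. exact (suc_not_emp _ E).
    + rewrite dbl_S in E by exact I. apply suc_inj in E. exact (IH i I E).
Qed.

Lemma dbl_mono k : k ∈ om -> forall j, j ∈ k -> dbl j ∈ dbl k.
Proof.
  revert k. nind.
  - intros j J. destruct (mem_emp j J).
  - intros k K IH j J. rewrite dbl_S by exact K. apply mem_suc in J.
    apply mem_suc. left. apply mem_suc. destruct J as [J| ->]; auto.
Qed.

Lemma dbl_lt_inv j k : j ∈ om -> k ∈ om -> dbl j ∈ dbl k -> j ∈ k.
Proof.
  intros J K H. destruct (ord_tricho j k (nat_ord j J) (nat_ord k K)) as [E|[->|E]]; [exact E| |].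
  - destruct (mem_irrefl _ H).
  - destruct (mem_asym _ _ H). apply dbl_mono; assumption.
Qed.

Lemma dbl_inj j k : j ∈ om -> k ∈ om -> dbl j = dbl k -> j = k.
Proof.
  intros J K H. destruct (ord_tricho j k (nat_ord j J) (nat_ord k K)) as [E|[->|E]]; [|reflexivity|].
  - apply dbl_mono in E; [|exact K]. rewrite H in E. destruct (mem_irrefl _ E).
  - apply dbl_mono in E; [|exact J]. rewrite H in E. destruct (mem_irrefl _ E).
Qed.

Lemma dbl_ge n : n ∈ om -> ord_le n (dbl n).
Proof.
  revert n. nind.
  - rewrite dbl_0. right. reflexivity.
  - intros n N IH. rewrite dbl_S by exact N.
    left. apply mem_suc_le, suc_le; [apply nat_ord, om_suc, dbl_om, N|].
    apply mem_suc_le, IH.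
Qed.

Definition evp n : Prop := exists k, k ∈ om /\ n = dbl k.
Definition hf n : M := the (fun k => k ∈ om /\ (n = dbl k \/ n = suc (dbl k))).
Lemma D_evp (n : env -> M) : T n -> D (fun e => evp (n e)).
Proof. intros. unfold evp. dsolve. Qed.
Lemma T_hf (n : env -> M) : T n -> T (fun e => hf (n e)).
Proof. intros. unfold hf. dsolve. Qed.
Hint Resolve D_evp T_hf : dfn.

Lemma evp_dbl k : k ∈ om -> evp (dbl k).
Proof. intros K. exists k. auto. Qed.
Lemma evp_odd k : k ∈ om -> ~ evp (suc (dbl k)).
Proof. intros K (j & J & E). exact (dbl_not_odd j J k K (eq_sym E)). Qed.
Lemma hf_dbl k : k ∈ om -> hf (dbl k) = k.
Proof.
  intros K. apply the_eq; [auto|]. intros j [J [E|E]].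
  - symmetry. apply dbl_inj; auto.
  - destruct (dbl_not_odd k K j J E).
Qed.
Lemma hf_odd k : k ∈ om -> hf (suc (dbl k)) = k.
Proof.
  intros K. apply the_eq; [auto|]. intros j [J [E|E]].
  - destruct (dbl_not_odd j J k K (eq_sym E)).
  - apply suc_inj in E. symmetry. apply dbl_inj; auto.
Qed.
Lemma hf_om n : n ∈ om -> hf n ∈ om.
Proof.
  intros N. destruct (nat_parity n N) as (k & K & [->| ->]); [rewrite hf_dbl|rewrite hf_odd]; exact K.
Qed.

Definition Bs : M := fn om om.
Definition agree k x y : Prop := forall i, i ∈ k -> ap x i = ap y i.
Lemma D_agree (k x y : env -> M) : T k -> T x -> T y -> D (fun e => agree (k e) (x e) (y e)).
Proof. intros. unfold agree. dsolve. Qed.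
Hint Resolve D_agree : dfn.

Lemma Bs_ap x n : x ∈ Bs -> n ∈ om -> ap x n ∈ om.
Proof. intros X N. apply mem_fn in X. apply (ap_mem x om om n X N). Qed.
Lemma Bs_ext x y : x ∈ Bs -> y ∈ Bs -> (forall n, n ∈ om -> ap x n = ap y n) -> x = y.
Proof. intros X Y. apply mem_fn in X. apply mem_fn in Y. apply (fun_ext x y om om om X Y). Qed.
Lemma Bs_lam (F : M -> M) : T1 F -> (forall n, n ∈ om -> F n ∈ om) -> lam om F ∈ Bs.
Proof. intros A B. apply mem_fn, lam_fun; assumption. Qed.

Lemma agree_refl k x : agree k x x. Proof. intros i _. reflexivity. Qed.
Lemma agree_sym k x y : agree k x y -> agree k y x.
Proof. intros H i I. symmetry. apply H, I. Qed.
Lemma agree_trans k x y z : agree k x y -> agree k y z -> agree k x z.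
Proof. intros H G i I. rewrite (H i I). apply G, I. Qed.
Lemma agree_sub k l x y : subset l k -> agree k x y -> agree l x y.
Proof. intros S H i I. apply H, S, I. Qed.
Lemma nat_sub m n : n ∈ om -> m ∈ n -> subset m n.
Proof. intros N H. apply ord_le_subset; [apply nat_ord, N|left; exact H]. Qed.
Lemma suc_sub n : subset n (suc n).
Proof. intros z Z. apply mem_suc. auto. Qed.

Lemma nat_max m n : m ∈ om -> n ∈ om -> exists k, k ∈ om /\ subset m k /\ subset n k.
Proof.
  intros A B. destruct (ord_tricho m n (nat_ord m A) (nat_ord n B)) as [H|[->|H]].
  - exists n. split; [exact B|]. split; [apply nat_sub; assumption|intros z Z; exact Z].
  - exists n. split; [exact B|]. split; intros z Z; exact Z.
  - exists m. split; [exact A|]. split; [intros z Z; exact Z|apply nat_sub; assumption].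
Qed.

(** Course-of-values recursion, used for plays against a strategy and for fixed points of
    contractions. *)
Lemma crec (G : M -> M -> M) : T2 G ->
  (forall n t, n ∈ om -> is_fun t n om -> G n t ∈ om) ->
  exists u, u ∈ Bs /\ forall n, n ∈ om -> ap u n = G n (res u n).
Proof.
  intros TG R. destruct (ord_recursion om G TG om_ord) as (h & H & E).
  assert (V : forall n, is_ord n -> n ∈ om -> ap h n ∈ om).
  { apply (ord_ind (fun n => n ∈ om -> ap h n ∈ om)); [dsolve|].
    intros n ON IH N. rewrite E by exact N. apply R; [exact N|].
    apply lam_fun; [dsolve|]. intros k K. apply IH; [exact K|]. exact (nat_trans k n N K). }
  exists h. split; [|exact E]. apply mem_fn. split; [exact H|].
  intros n v A. apply (app_eq_on h om) in A; [|exact H]. destruct A as [N ->].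
  apply V; [apply nat_ord|]; exact N.
Qed.

Lemma crec_unique (G : M -> M -> M) u v : u ∈ Bs -> v ∈ Bs ->
  (forall n, n ∈ om -> ap u n = G n (res u n)) ->
  (forall n, n ∈ om -> ap v n = G n (res v n)) -> u = v.
Proof.
  intros U V EU EV. apply (Bs_ext u v U V).
  assert (H : forall n, is_ord n -> n ∈ om -> ap u n = ap v n).
  { apply (ord_ind (fun n => n ∈ om -> ap u n = ap v n)); [dsolve|].
    intros n ON IH N. rewrite EU, EV by exact N. f_equal. apply res_ext.
    intros k K. apply IH; [exact K|]. exact (nat_trans k n N K). }
  intros n N. apply H; [apply nat_ord|]; exact N.
Qed.

(** Continuous, 1-Lipschitz and contracting maps for the metric in which sequences that first differ
    at n have distance 2^-n: digit n of the image may look at finitely many digits, at those up to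
    n, or at those below n. *)
Definition CF f : Prop := is_fun f Bs Bs /\ forall x n, x ∈ Bs -> n ∈ om ->
  exists k, k ∈ om /\ forall y, y ∈ Bs -> agree k x y -> ap (ap f x) n = ap (ap f y) n.
Definition LIP f : Prop := is_fun f Bs Bs /\ forall x y n, x ∈ Bs -> y ∈ Bs -> n ∈ om ->
  agree (suc n) x y -> ap (ap f x) n = ap (ap f y) n.
Definition CT f : Prop := is_fun f Bs Bs /\ forall x y n, x ∈ Bs -> y ∈ Bs -> n ∈ om ->
  agree n x y -> ap (ap f x) n = ap (ap f y) n.

Lemma D_CF (f : env -> M) : T f -> D (fun e => CF (f e)).
Proof. intros. unfold CF. dsolve. Qed.
Lemma D_CT (f : env -> M) : T f -> D (fun e => CT (f e)).
Proof. intros. unfold CT. dsolve. Qed.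
Hint Resolve D_CF D_CT : dfn.

Lemma CT_LIP f : CT f -> LIP f.
Proof.
  intros [A B]. split; [exact A|]. intros x y n X Y N H. apply B; try assumption.
  apply (agree_sub (suc n)); [apply suc_sub|exact H].
Qed.
Lemma LIP_CF f : LIP f -> CF f.
Proof.
  intros [A B]. split; [exact A|]. intros x n X N. exists (suc n).
  split; [apply om_suc, N|]. intros y Y H. apply B; assumption.
Qed.
Lemma CF_ap f x : CF f -> x ∈ Bs -> ap f x ∈ Bs.
Proof. intros [A _] X. exact (ap_mem f Bs Bs x A X). Qed.

Lemma CF_agree f x : CF f -> x ∈ Bs -> forall n, n ∈ om ->
  exists k, k ∈ om /\ forall y, y ∈ Bs -> agree k x y -> agree n (ap f x) (ap f y).
Proof.
  intros [A B] X. nind.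
  - exists emp. split; [apply om_emp|]. intros y Y _ i I. destruct (mem_emp i I).
  - intros n N (k & K & H). destruct (B x n X N) as (l & L & H').
    destruct (nat_max k l K L) as (m & HM & KM & LM). exists m. split; [exact HM|].
    intros y Y E i I. apply mem_suc in I. destruct I as [I| ->].
    + apply H; [exact Y| |exact I]. apply (agree_sub m); assumption.
    + apply H'; [exact Y|]. apply (agree_sub m); assumption.
Qed.

(* Playing against a fixed strategy sigma, which moves at the positions in E *)

Section Play.
Context (sq sigma : M) (E : M -> Prop) (DE : D1 E).
Context (Hsq : is_finite_sequences om sq) (Hs : is_fun sigma sq om).

(** At a position n outside E the opponent plays digit [hf n] of y. This serves both players, since
    [hf] sends 2k and 2k+1 to k. *)
Let G y := fun n t => ite (E n) (ap sigma t) (ap y (hf n)).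
Let U y := the (fun u => u ∈ Bs /\ forall n, n ∈ om -> ap u n = G y n (res u n)).

Lemma play_spec y : y ∈ Bs -> U y ∈ Bs /\ forall n, n ∈ om -> ap (U y) n = G y n (res (U y) n).
Proof.
  intros Y. apply (the_ext (fun u => u ∈ Bs /\ forall n, n ∈ om -> ap u n = G y n (res u n))).
  - apply crec.
    + unfold G. dsolve.
    + intros n t N HT. unfold G. destruct (classic (E n)) as [H|H].
      * rewrite ite_true by exact H. apply (ap_mem sigma sq); [exact Hs|].
        apply Hsq. eauto.
      * rewrite ite_false by exact H. apply Bs_ap; [exact Y|apply hf_om, N].
  - intros u v [U1 U2] [V1 V2]. apply (crec_unique (G y)); assumption.
Qed.

Lemma play_agree y y' m : y ∈ Bs -> y' ∈ Bs -> m ∈ om ->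
  (forall i, i ∈ m -> ~ E i -> ap y (hf i) = ap y' (hf i)) -> agree m (U y) (U y').
Proof.
  intros Y Y' HM H. destruct (play_spec y Y) as [U1 U2]. destruct (play_spec y' Y') as [V1 V2].
  assert (K : forall i, is_ord i -> i ∈ m -> ap (U y) i = ap (U y') i).
  { apply (ord_ind (fun i => i ∈ m -> ap (U y) i = ap (U y') i)); [dsolve|].
    intros i OI IH I. assert (IO : i ∈ om) by exact (nat_trans i m HM I).
    rewrite U2, V2 by exact IO. unfold G. destruct (classic (E i)) as [C|C].
    - rewrite !ite_true by exact C. f_equal. apply res_ext. intros k K. apply IH; [exact K|].
      exact (nat_sub i m HM I k K).
    - rewrite !ite_false by exact C. apply H; assumption. }
  intros i I. apply K; [|exact I]. apply nat_ord. exact (nat_trans i m HM I).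
Qed.

Lemma play_follows y n : y ∈ Bs -> n ∈ om -> E n -> follows_at sigma (U y) n.
Proof.
  intros Y N C. destruct (play_spec y Y) as [U1 U2].
  assert (F : is_fun (U y) om om) by apply mem_fn, U1.
  assert (HS : subset n om) by (intros z Z; exact (nat_trans z n N Z)).
  exists (res (U y) n), (ap (U y) n). split; [|split].
  - intros p. unfold res at 1, lam. rewrite mem_rep by dsolve. split.
    + intros (k & K & ->). split.
      * apply app_iff. apply (app_ap (U y) om om); [exact F|apply HS, K].
      * exists k, (ap (U y) k). rewrite is_opair_op. auto.
    + intros (P & k & v & K & O). apply is_opair_op in O. subst p. exists k. split; [exact K|].
      apply app_iff in P. apply (app_eq (U y) om om) in P; [|exact F]. destruct P as [_ ->]. reflexivity.
  - rewrite U2 by exact N. unfold G. rewrite ite_true by exact C.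
    apply (app_ap sigma sq om); [exact Hs|]. apply Hsq. exists n. split; [exact N|].
    apply (res_fun (U y) om); assumption.
  - apply (app_ap (U y) om om); assumption.
Qed.

Lemma play_answer y n : y ∈ Bs -> n ∈ om -> ~ E n -> ap (U y) n = ap y (hf n).
Proof.
  intros Y N C. destruct (play_spec y Y) as [U1 U2]. rewrite U2 by exact N.
  unfold G. apply ite_false, C.
Qed.

Lemma T_play (y : env -> M) : T y -> T (fun e => U (y e)).
Proof.
  intros. unfold U, G. apply T_the. apply D_and; [dsolve|]. apply D_all. apply D_imp; [dsolve|].
  apply D_eq; dsolve.
Qed.

Lemma play_exists : exists U : M -> M, T1 U /\
  (forall y, y ∈ Bs -> U y ∈ Bs) /\
  (forall y y' m, y ∈ Bs -> y' ∈ Bs -> m ∈ om ->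
    (forall i, i ∈ m -> ~ E i -> ap y (hf i) = ap y' (hf i)) -> agree m (U y) (U y')) /\
  (forall y n, y ∈ Bs -> n ∈ om -> E n -> follows_at sigma (U y) n) /\
  (forall y n, y ∈ Bs -> n ∈ om -> ~ E n -> ap (U y) n = ap y (hf n)).
Proof.
  exists U. split; [apply (T_play (fun e => e 0)), T_var|].
  split; [intros y Y; apply play_spec, Y|].
  split; [exact play_agree|]. split; [exact play_follows|exact play_answer].
Qed.
End Play.

Definition evn u : M := lam om (fun n => ap u (dbl n)).
Definition odd u : M := lam om (fun n => ap u (suc (dbl n))).
Lemma T_evn (u : env -> M) : T u -> T (fun e => evn (u e)).
Proof. intros. unfold evn. dsolve. Qed.
Lemma T_odd (u : env -> M) : T u -> T (fun e => odd (u e)).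
Proof. intros. unfold odd. dsolve. Qed.
Hint Resolve T_evn T_odd : dfn.
Lemma evn_Bs u : u ∈ Bs -> evn u ∈ Bs.
Proof. intros U. apply Bs_lam; [dsolve|]. intros n N. apply Bs_ap; [exact U|apply dbl_om, N]. Qed.
Lemma odd_Bs u : u ∈ Bs -> odd u ∈ Bs.
Proof. intros U. apply Bs_lam; [dsolve|]. intros n N. apply Bs_ap; [exact U|apply om_suc, dbl_om, N]. Qed.
Lemma ap_evn u n : n ∈ om -> ap (evn u) n = ap u (dbl n).
Proof. intros N. unfold evn. rewrite ap_lam; [reflexivity|dsolve|exact N]. Qed.
Lemma ap_odd u n : n ∈ om -> ap (odd u) n = ap u (suc (dbl n)).
Proof. intros N. unfold odd. rewrite ap_lam; [reflexivity|dsolve|exact N]. Qed.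

Context (hAD : AD M).

(* Player I builds x and II builds y: a strategy of II is a Lipschitz map, and one of I,
   who moves first, a contraction. *)
Theorem game_determined (P : M -> M -> Prop) : D2 P ->
  (exists f, LIP f /\ forall x, x ∈ Bs -> P x (ap f x)) \/
  (exists f, CT f /\ forall y, y ∈ Bs -> ~ P (ap f y) y).
Proof.
  (* The payoff set belongs to player I, who wants P to fail. *)
  intros DP. set (A := sep Bs (fun u => ~ P (evn u) (odd u))).
  assert (MA : forall u, u ∈ A <-> u ∈ Bs /\ ~ P (evn u) (odd u)).
  { intros u. unfold A. rewrite mem_sep by dsolve. reflexivity. }
  destruct (hAD om A) as (ev & sq & sigma & Hev & Hsq & Hs & W).
  { apply is_omega_om. reflexivity. }
  { intros x X. apply MA in X. apply mem_fn, X. }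
  assert (EV : forall n, n ∈ om -> (n ∈ ev <-> evp n)).
  { destruct Hev as (E1 & E2 & E3). nind.
    - split; [|intros _; apply E2; exact mem_emp]. intros _. exists emp.
      split; [apply om_emp|symmetry; apply dbl_0].
    - intros n N IH. rewrite (E3 n (suc n) N) by (apply is_succ_suc; reflexivity).
      rewrite IH. destruct (nat_parity n N) as (k & K & [->| ->]).
      + pose proof (evp_dbl k K). pose proof (evp_odd k K). tauto.
      + rewrite <- dbl_S by exact K. pose proof (evp_dbl (suc k) (om_suc k K)).
        pose proof (evp_odd k K). tauto. }
  destruct W as [W|W]; [right|left].
  (* I wins: II's moves y determine the play [U y], whose odd part is y and whose even part is I's
     answer. *)
  - destruct (play_exists sq sigma evp) as (U & TU & U1 & U2 & U3 & U4); [dsolve|exact Hsq|exact Hs|].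
    assert (UO : forall y, y ∈ Bs -> odd (U y) = y).
    { intros y Y. apply Bs_ext; [apply odd_Bs, U1, Y|exact Y|]. intros n N.
      rewrite ap_odd, U4, hf_odd by auto using om_suc, dbl_om, evp_odd. reflexivity. }
    exists (lam Bs (fun y => evn (U y))). split; [split|].
    + apply lam_fun; [dsolve|]. intros y Y. apply evn_Bs, U1, Y.
    (* At position 2n only y(0), ..., y(n-1) have been seen, which makes the answer a
       contraction. *)
    + intros x y n X Y N H. rewrite !ap_lam by (dsolve || assumption).
      rewrite !ap_evn by exact N. apply (U2 x y (suc (dbl n))); [exact X|exact Y|apply om_suc, dbl_om, N| |apply suc_self].
      intros i I C. assert (IO : i ∈ om) by (apply (nat_trans i (suc (dbl n))); [apply om_suc, dbl_om, N|exact I]).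
      apply H. destruct (nat_parity i IO) as (k & K & [->| ->]); [destruct C; apply evp_dbl, K|].
      rewrite hf_odd by exact K. apply dbl_lt_inv; [exact K|exact N|].
      apply mem_suc_le in I. destruct I as [I|I].
      * apply (nat_trans (suc (dbl k))) in I as I'; [|apply dbl_om, N].
        exact (ord_trans (dbl k) (suc (dbl k)) (dbl n) (nat_ord _ (dbl_om n N)) (suc_self _) I).
      * rewrite <- I. apply suc_self.
    + intros y Y. rewrite ap_lam by (dsolve || assumption).
      assert (H : U y ∈ A).
      { apply W; [apply mem_fn, U1, Y|]. intros n N Hn. apply U3; [exact Y|exact N|apply EV; assumption]. }
      apply MA in H. destruct H as [_ H]. rewrite UO in H by exact Y. exact H.
  - destruct (play_exists sq sigma (fun n => ~ evp n)) as (U & TU & U1 & U2 & U3 & U4); [dsolve|exact Hsq|exact Hs|].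
    assert (UO : forall y, y ∈ Bs -> evn (U y) = y).
    { intros y Y. apply Bs_ext; [apply evn_Bs, U1, Y|exact Y|]. intros n N.
      rewrite ap_evn, U4, hf_dbl by auto using om_suc, dbl_om, evp_dbl. reflexivity. }
    exists (lam Bs (fun y => odd (U y))). split; [split|].
    + apply lam_fun; [dsolve|]. intros y Y. apply odd_Bs, U1, Y.
    (* Position 2n+1 comes after x(0), ..., x(n), so the answer is Lipschitz only. *)
    + intros x y n X Y N H. rewrite !ap_lam by (dsolve || assumption).
      rewrite !ap_odd by exact N. apply (U2 x y (suc (suc (dbl n)))); [exact X|exact Y|apply om_suc, om_suc, dbl_om, N| |apply suc_self].
      intros i I C. assert (IO : i ∈ om) by (apply (nat_trans i (suc (suc (dbl n)))); [apply om_suc, om_suc, dbl_om, N|exact I]).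
      apply H. destruct (nat_parity i IO) as (k & K & [->| ->]); [|destruct C; apply evp_odd, K].
      rewrite hf_dbl by exact K. apply dbl_lt_inv; [exact K|apply om_suc, N|].
      rewrite dbl_S by exact N. exact I.
    + intros y Y. rewrite ap_lam by (dsolve || assumption).
      assert (H : U y ∉ A).
      { apply W; [apply mem_fn, U1, Y|]. intros n N Hn. apply U3; [exact Y|exact N|].
        intros C. apply Hn, EV; assumption. }
      apply NNPP. intros C. apply H, MA. split; [apply U1, Y|]. rewrite UO by exact Y. exact C.
Qed.
End Games.

#[export] Hint Resolve T_dbl D_evp T_hf D_agree D_CF D_CT T_evn T_odd : dfn.

(** * Strategy stealing *)

Section NoFlip.
Context {M : set_structure} {hZF : ZF_model M}.
Implicit Types a b c f g h x y z u v p m n k i j w S : M.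
Notation env := (nat -> M).

Definition il x y : M := lam om (fun n => ite (evp n) (ap x (hf n)) (ap y (hf n))).
Lemma T_il (x y : env -> M) : T x -> T y -> T (fun e => il (x e) (y e)).
Proof. intros. unfold il. dsolve. Qed.
Hint Resolve T_il : dfn.
Lemma il_dbl x y n : n ∈ om -> ap (il x y) (dbl n) = ap x n.
Proof.
  intros N. unfold il. rewrite ap_lam by (dsolve || apply dbl_om, N).
  rewrite ite_true by apply evp_dbl, N. rewrite hf_dbl by exact N. reflexivity.
Qed.
Lemma il_odd x y n : n ∈ om -> ap (il x y) (suc (dbl n)) = ap y n.
Proof.
  intros N. unfold il. rewrite ap_lam by (dsolve || apply om_suc, dbl_om, N).
  rewrite ite_false by apply evp_odd, N. rewrite hf_odd by exact N. reflexivity.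
Qed.
Lemma il_Bs x y : x ∈ Bs -> y ∈ Bs -> il x y ∈ Bs.
Proof.
  intros X Y. apply Bs_lam; [dsolve|]. intros n N. destruct (classic (evp n)) as [H|H].
  - rewrite ite_true by exact H. apply Bs_ap; [exact X|apply hf_om, N].
  - rewrite ite_false by exact H. apply Bs_ap; [exact Y|apply hf_om, N].
Qed.
Lemma evn_il x y : x ∈ Bs -> y ∈ Bs -> evn (il x y) = x.
Proof.
  intros X Y. apply Bs_ext; [apply evn_Bs, il_Bs; assumption|exact X|].
  intros n N. rewrite ap_evn, il_dbl by exact N. reflexivity.
Qed.
Lemma odd_il x y : x ∈ Bs -> y ∈ Bs -> odd (il x y) = y.
Proof.
  intros X Y. apply Bs_ext; [apply odd_Bs, il_Bs; assumption|exact Y|].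
  intros n N. rewrite ap_odd, il_odd by exact N. reflexivity.
Qed.

(** Banach's theorem digit by digit: digit n of the image depends only on the digits below n, which
    are already there. *)
Lemma contraction_fix (F : M -> M) : T1 F -> (forall x, x ∈ Bs -> F x ∈ Bs) ->
  (forall x y n, x ∈ Bs -> y ∈ Bs -> n ∈ om -> agree n x y -> ap (F x) n = ap (F y) n) ->
  exists x, x ∈ Bs /\ F x = x.
Proof.
  intros TF R C. set (pad := fun t => lam om (fun k => ap t k)).
  assert (TP : forall t : env -> M, T t -> T (fun e => pad (t e))) by (intros; unfold pad; dsolve).
  destruct (crec (fun n t => ap (F (pad t)) n)) as (u & U & E).
  - dsolve.
  - intros n t N HT. apply Bs_ap; [|exact N]. apply R. apply Bs_lam; [dsolve|].
    intros k K. destruct (classic (k ∈ n)) as [H|H].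
    + apply (ap_mem t n); assumption.
    + rewrite (ap_out t n); [apply om_emp|apply HT|exact H].
  - exists u. split; [exact U|]. apply Bs_ext; [apply R, U|exact U|].
    intros n N. rewrite E by exact N.
    assert (P : pad (res u n) ∈ Bs).
    { apply Bs_lam; [dsolve|]. intros k K. destruct (classic (k ∈ n)) as [H|H].
      - rewrite ap_res by exact H. apply Bs_ap; assumption.
      - rewrite (ap_out (res u n) n); [apply om_emp|apply res_fun_on|exact H]. }
    apply C; [exact U|exact P|exact N|]. intros i I.
    unfold pad. rewrite ap_lam; [|dsolve|exact (nat_trans i n N I)].
    symmetry. apply ap_res, I.
Qed.

Definition above a b : M := ite (a ∈ b) b (suc a).
Lemma T_above (x y : env -> M) : T x -> T y -> T (fun e => above (x e) (y e)).
Proof. intros. unfold above. dsolve. Qed.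
Hint Resolve T_above : dfn.
Lemma above_om a b : a ∈ om -> b ∈ om -> above a b ∈ om.
Proof.
  intros A B. unfold above. destruct (classic (a ∈ b)) as [H|H];
    [rewrite ite_true by exact H; exact B|rewrite ite_false by exact H; apply om_suc, A].
Qed.
Lemma above_gt a b : a ∈ above a b.
Proof.
  unfold above. destruct (classic (a ∈ b)) as [H|H];
    [rewrite ite_true by exact H; exact H|rewrite ite_false by exact H; apply suc_self].
Qed.
Lemma above_eq a b : a ∈ b -> above a b = b.
Proof. apply ite_true. Qed.

(** Forces increasing play without illegal moves: a move that is not above the previous effective
    move counts as the successor of that one. *)
Definition rs w : M := nrec (ap w emp) (fun n v => above v (ap w (suc n))).
Lemma T_rs (w : env -> M) : T w -> T (fun e => rs (w e)).
Proof. intros. unfold rs. dsolve. Qed.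
Hint Resolve T_rs : dfn.
Lemma rs_0 w : ap (rs w) emp = ap w emp.
Proof. unfold rs. apply nrec_0. dsolve. Qed.
Lemma rs_S w n : n ∈ om -> ap (rs w) (suc n) = above (ap (rs w) n) (ap w (suc n)).
Proof. intros N. unfold rs at 1. rewrite nrec_S; [reflexivity|dsolve|exact N]. Qed.
Lemma rs_om w n : w ∈ Bs -> n ∈ om -> ap (rs w) n ∈ om.
Proof.
  intros W. revert n. nind.
  - rewrite rs_0. apply Bs_ap; [exact W|apply om_emp].
  - intros n N IH. rewrite rs_S by exact N. apply above_om; [exact IH|]. apply Bs_ap; [exact W|apply om_suc, N].
Qed.
Lemma rs_mono w n : w ∈ Bs -> n ∈ om -> forall k, k ∈ n -> ap (rs w) k ∈ ap (rs w) n.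
Proof.
  intros W. revert n. nind.
  - intros k K. destruct (mem_emp k K).
  - intros n N IH k K. apply mem_suc in K. rewrite rs_S by exact N.
    assert (H : ap (rs w) n ∈ above (ap (rs w) n) (ap w (suc n))) by apply above_gt.
    destruct K as [K| ->]; [|exact H].
    refine (ord_trans _ _ _ (nat_ord _ _) (IH k K) H).
    apply above_om; [apply rs_om; assumption|]. apply Bs_ap; [exact W|apply om_suc, N].
Qed.
Lemma rs_ge w n : w ∈ Bs -> n ∈ om -> ord_le n (ap (rs w) n).
Proof.
  intros W. revert n. nind.
  - apply emp_le, nat_ord, rs_om; [exact W|apply om_emp].
  - intros n N IH. assert (H := rs_om w (suc n) W (om_suc n N)).
    apply suc_le; [apply nat_ord, H|].
    apply (ord_le_lt _ (ap (rs w) n)); [apply nat_ord, H|exact IH|].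
    apply rs_mono; [exact W|apply om_suc, N|apply suc_self].
Qed.

Definition ran w : M := rep om (fun n => ap (rs w) n).
Lemma T_ran (w : env -> M) : T w -> T (fun e => ran (w e)).
Proof. intros. unfold ran. dsolve. Qed.
Hint Resolve T_ran : dfn.
Lemma mem_ran w z : z ∈ ran w <-> exists n, n ∈ om /\ z = ap (rs w) n.
Proof. unfold ran. rewrite mem_rep by dsolve. reflexivity. Qed.

Definition unbounded S : Prop := subset S om /\ forall n, n ∈ om -> exists k, k ∈ S /\ n ∈ k.

Lemma ran_unbounded w : w ∈ Bs -> unbounded (ran w).
Proof.
  intros W. split.
  - intros z Z. apply mem_ran in Z. destruct Z as (n & N & ->). apply rs_om; assumption.
  - intros n N. exists (ap (rs w) (suc n)). split; [apply mem_ran; exists (suc n); auto using om_suc|].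
    apply (ord_le_lt n (ap (rs w) n)); [apply nat_ord, rs_om; auto using om_suc|apply rs_ge; assumption|].
    apply rs_mono; [exact W|apply om_suc, N|apply suc_self].
Qed.

Definition del S k : M := sep S (fun j => j <> k).
Lemma T_del (S k : env -> M) : T S -> T k -> T (fun e => del (S e) (k e)).
Proof. intros. unfold del. dsolve. Qed.
Hint Resolve T_del : dfn.
Lemma mem_del S k j : j ∈ del S k <-> j ∈ S /\ j <> k.
Proof. unfold del. apply (mem_sep (fun j => j <> k)). dsolve. Qed.

Lemma del_unbounded S k : unbounded S -> k ∈ S -> unbounded (del S k).
Proof.
  intros [A B] K. split; [intros z Z; apply mem_del in Z; apply A, Z|].
  intros n N. destruct (nat_max n (suc k) N (om_suc k (A k K))) as (m & HM & H1 & H2).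
  destruct (B m HM) as (j & J & MJ). exists j.
  assert (OJ : is_ord j) by (apply nat_ord, A, J).
  assert (KJ : k ∈ j).
  { apply (ord_trans k m j OJ); [apply H2, suc_self|exact MJ]. }
  split; [apply mem_del; split; [exact J|]|].
  - intros ->. exact (mem_irrefl _ KJ).
  - apply (ord_le_lt n m j OJ); [|exact MJ].
    apply ord_subset_le; [apply nat_ord, HM|apply nat_ord, N|exact H1].
Qed.

(** The play w' opens with the second effective move of w and then repeats w, so the two sets of
    moves differ exactly in the first one. *)
Lemma ran_shift w w' : w ∈ Bs -> w' ∈ Bs ->
  ap w' emp = above (ap w emp) (ap w (suc emp)) ->
  (forall n, n ∈ om -> ap w' (suc n) = ap w (suc (suc n))) ->
  ran w' = del (ran w) (ap (rs w) emp).
Proof.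
  intros W W' H0 HS.
  assert (E : forall n, n ∈ om -> ap (rs w') n = ap (rs w) (suc n)).
  { nind.
    - rewrite rs_0, rs_S, rs_0 by apply om_emp. exact H0.
    - intros n N IH. rewrite rs_S, IH, (rs_S w (suc n)), HS by auto using om_suc. reflexivity. }
  apply ext. intros z. rewrite mem_del, !mem_ran. split.
  - intros (n & N & ->). rewrite E by exact N. split; [exists (suc n); auto using om_suc|].
    intros C. apply (mem_irrefl (ap (rs w) emp)). rewrite <- C at 2.
    apply rs_mono; [exact W|apply om_suc, N|]. apply mem_suc_le, emp_le, nat_ord, N.
  - intros [(n & N & ->) NE]. destruct (nat_cases n N) as [->|(m & Hm & ->)]; [tauto|].
    exists m. rewrite E by exact Hm. auto.
Qed.

(** Here w' keeps the first move of w and omits the second effective one. The common first element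
    is deleted on both sides because the flip is applied to the sets in that form. *)
Lemma ran_skip w w' : w ∈ Bs -> w' ∈ Bs -> ap w' emp = ap w emp ->
  ap w' (suc emp) = above (above (ap w emp) (ap w (suc emp))) (ap w (suc (suc emp))) ->
  (forall n, n ∈ om -> ap w' (suc (suc n)) = ap w (suc (suc (suc n)))) ->
  del (ran w') (ap (rs w) emp) = del (del (ran w) (ap (rs w) emp)) (ap (rs w) (suc emp)).
Proof.
  intros W W' H0 H1 HS.
  assert (E : forall n, n ∈ om -> ap (rs w') (suc n) = ap (rs w) (suc (suc n))).
  { nind.
    - rewrite !rs_S, !rs_0, H0, H1 by auto using om_emp, om_suc. apply above_eq.
      refine (ord_trans _ _ _ (nat_ord _ _) (above_gt _ (ap w (suc emp))) (above_gt _ _)).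
      apply above_om; [apply above_om|]; apply Bs_ap; auto using om_suc, om_emp.
    - intros n N IH. rewrite rs_S, IH, (rs_S w (suc (suc n))), HS by auto using om_suc. reflexivity. }
  apply ext. intros z. rewrite !mem_del, !mem_ran. split.
  - intros [(n & N & ->) NE]. destruct (nat_cases n N) as [->|(m & Hm & ->)].
    { rewrite !rs_0 in NE. tauto. }
    rewrite E in * by exact Hm. split; [split; [|exact NE]|].
    + exists (suc (suc m)). auto using om_suc.
    + intros C. apply (mem_irrefl (ap (rs w) (suc emp))). rewrite <- C at 2.
      apply rs_mono; [exact W|auto using om_suc|].
      apply suc_in_nat; [apply om_suc, Hm|]. apply mem_suc_le, emp_le, nat_ord, Hm.
  - intros [[(n & N & ->) N0] N1]. split; [|exact N0].
    destruct (nat_cases n N) as [->|(m & Hm & ->)]; [tauto|].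
    destruct (nat_cases m Hm) as [->|(l & Hl & ->)]; [tauto|].
    exists (suc l). rewrite E by exact Hl. auto using om_suc.
Qed.

Lemma ran_min w j : w ∈ Bs -> j ∈ ran w -> j <> ap (rs w) emp -> ap (rs w) emp ∈ j.
Proof.
  intros W J NE. apply mem_ran in J. destruct J as (n & N & ->).
  destruct (nat_cases n N) as [->|(m & Hm & ->)]; [tauto|].
  apply rs_mono; [exact W|exact N|]. apply mem_suc_le, emp_le, nat_ord, Hm.
Qed.

Context (hAD : AD M).

(* Strategy stealing: both players play increasingly and the winner depends on the
   set of all moves.  A winning strategy is run on two boards whose sets of moves
   differ in one point, each board supplying the other's missing moves. *)
Theorem no_flip_set (F : M -> Prop) : D1 F ->
  ~ (forall S k, unbounded S -> k ∈ S -> (forall j, j ∈ S -> j <> k -> k ∈ j) ->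
      (F S <-> ~ F (del S k))).
Proof.
  intros DF FLIP.
  assert (FR : forall w, w ∈ Bs -> (F (ran w) <-> ~ F (del (ran w) (ap (rs w) emp)))).
  { intros w W. apply FLIP; [apply ran_unbounded, W|apply mem_ran; exists emp; auto using om_emp|].
    intros j J. apply ran_min; assumption. }
  destruct (game_determined hAD (fun x y => ~ F (ran (il x y)))) as [(f & Hf & W)|(f & Hf & W)]; [dsolve| |].
  - assert (FB : forall x, x ∈ Bs -> ap f x ∈ Bs) by (intros; apply (ap_mem f Bs Bs); [apply Hf|assumption]).
    (* II has a winning strategy f. Board one carries x against [f x], board two [tw x] against its
       answer. On board two I opens with the second effective move of board one and then copies the
       answers of f on board one. *)
    set (tw := fun x => lam om (fun n => ite (n = emp) (above (ap x emp) (ap (ap f x) emp)) (ap (ap f x) n))).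
    assert (TT : forall t : env -> M, T t -> T (fun e => tw (t e))) by (intros; unfold tw; dsolve).
    assert (TW0 : forall x, ap (tw x) emp = above (ap x emp) (ap (ap f x) emp)).
    { intros x. unfold tw. rewrite ap_lam by (dsolve || apply om_emp). apply ite_true. reflexivity. }
    assert (TWS : forall x n, n ∈ om -> ap (tw x) (suc n) = ap (ap f x) (suc n)).
    { intros x n N. unfold tw. rewrite ap_lam by (dsolve || apply om_suc, N). apply ite_false, suc_not_emp. }
    assert (TWB : forall x, x ∈ Bs -> tw x ∈ Bs).
    { intros x X. apply Bs_lam; [dsolve|]. intros n N. destruct (classic (n = emp)) as [E|E].
      - rewrite ite_true by exact E. apply above_om; apply Bs_ap; auto using om_emp.
      - rewrite ite_false by exact E. apply Bs_ap; auto. }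
    (* On board one I opens with 0 and copies the answers of board two. This is a contraction: move
       m+1 here is answer m there, which depends on the answers up to m here, hence on the moves up
       to m. *)
    destruct (contraction_fix (fun x => lam om (fun n => ite (n = emp) emp (ap (ap f (tw x)) (un n))))) as (x & X & EX).
    + dsolve.
    + intros x X. apply Bs_lam; [dsolve|]. intros n N. destruct (nat_cases n N) as [->|(m & Hm & ->)].
      * rewrite ite_true by reflexivity. apply om_emp.
      * rewrite ite_false by apply suc_not_emp. rewrite un_suc by apply nat_ord, Hm.
        apply Bs_ap; auto.
    + intros x y n X Y N A. rewrite !ap_lam by (dsolve || exact N).
      destruct (nat_cases n N) as [->|(m & Hm & ->)]; [rewrite !ite_true; reflexivity|].
      rewrite !ite_false by apply suc_not_emp. rewrite un_suc by apply nat_ord, Hm.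
      apply Hf; auto. intros i I.
      assert (IO : i ∈ om) by exact (nat_trans i _ N I).
      assert (FI : ap (ap f x) i = ap (ap f y) i).
      { apply Hf; auto. intros j J. apply A. apply (ord_lt_le j (suc i)); [apply nat_ord, N|exact J|].
        apply suc_le; [apply nat_ord, N|exact I]. }
      destruct (nat_cases i IO) as [->|(l & Hl & ->)].
      * rewrite !TW0, FI, (A emp I). reflexivity.
      * rewrite !TWS by exact Hl. exact FI.
    + set (x' := tw x).
      assert (X0 : ap x emp = emp).
      { rewrite <- EX. rewrite ap_lam by (dsolve || apply om_emp). apply ite_true. reflexivity. }
      assert (XS : forall n, n ∈ om -> ap x (suc n) = ap (ap f x') n).
      { intros n N. rewrite <- EX at 1. rewrite ap_lam by (dsolve || apply om_suc, N).
        rewrite ite_false by apply suc_not_emp. rewrite un_suc by apply nat_ord, N. reflexivity. }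
      assert (X' : x' ∈ Bs) by apply TWB, X.
      pose proof (W x X) as W1. pose proof (W x' X') as W2. cbv beta in W1, W2.
      assert (I1 : il x (ap f x) ∈ Bs) by (apply il_Bs; [exact X|apply FB, X]).
      assert (I2 : il x' (ap f x') ∈ Bs) by (apply il_Bs; [exact X'|apply FB, X']).
      (* II wins on both boards, although their sets of moves differ in the least element, where F
         flips. *)
      rewrite (ran_shift (il x (ap f x))) in W2; [apply W2, NNPP; intros C; apply W1, FR; [exact I1|exact C]|exact I1|exact I2| |].
      * assert (Z1 := il_odd x (ap f x) emp om_emp). assert (Z2 := il_dbl x (ap f x) emp om_emp).
        assert (Z3 := il_dbl x' (ap f x') emp om_emp). rewrite dbl_0 in *.
        rewrite Z1, Z2, Z3. apply TW0.
      * intros n N. destruct (nat_parity n N) as (k & K & [->| ->]).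
        -- rewrite il_odd by exact K. rewrite <- dbl_S, il_dbl by auto using om_suc. symmetry. apply XS, K.
        -- rewrite <- dbl_S, il_dbl, il_odd by auto using om_suc. apply TWS, K.
  - assert (FB : forall x, x ∈ Bs -> ap f x ∈ Bs) by (intros; apply (ap_mem f Bs Bs); [apply Hf|assumption]).
    (* I has a winning strategy f and opens both boards alike, so the boards are made to differ in
       the second effective move: II's first move on board two is the third effective move of board
       one. *)
    set (tw := fun y => lam om (fun n => ite (n = emp)
      (above (above (ap (ap f y) emp) emp) (ap (ap f y) (suc emp))) (ap (ap f y) (suc n)))).
    assert (TT : forall t : env -> M, T t -> T (fun e => tw (t e))) by (intros; unfold tw; dsolve).
    assert (TW0 : forall y, ap (tw y) emp = above (above (ap (ap f y) emp) emp) (ap (ap f y) (suc emp))).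
    { intros x. unfold tw. rewrite ap_lam by (dsolve || apply om_emp). apply ite_true. reflexivity. }
    assert (TWS : forall x n, n ∈ om -> ap (tw x) (suc n) = ap (ap f x) (suc (suc n))).
    { intros x n N. unfold tw. rewrite ap_lam by (dsolve || apply om_suc, N). apply ite_false, suc_not_emp. }
    assert (TWB : forall x, x ∈ Bs -> tw x ∈ Bs).
    { intros x X. apply Bs_lam; [dsolve|]. intros n N. destruct (classic (n = emp)) as [E|E].
      - rewrite ite_true by exact E. apply above_om; [apply above_om|]; try apply Bs_ap; auto using om_emp, om_suc.
      - rewrite ite_false by exact E. apply Bs_ap; auto using om_suc. }
    destruct (contraction_fix (fun y => lam om (fun n => ite (n = emp) emp (ap (ap f (tw y)) n)))) as (y & Y & EY).
    + dsolve.
    + intros x X. apply Bs_lam; [dsolve|]. intros n N. destruct (classic (n = emp)) as [E|E].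
      * rewrite ite_true by exact E. apply om_emp.
      * rewrite ite_false by exact E. apply Bs_ap; auto.
    + intros x y n X Y N A. rewrite !ap_lam by (dsolve || exact N).
      destruct (nat_cases n N) as [->|(m & Hm & ->)]; [rewrite !ite_true; reflexivity|].
      rewrite !ite_false by apply suc_not_emp.
      apply Hf; auto. intros i I.
      assert (IO : i ∈ om) by exact (nat_trans i _ N I).
      assert (FI : forall l, l ∈ om -> ord_le l (suc m) -> ap (ap f x) l = ap (ap f y) l).
      { intros l Hl L. apply Hf; auto. intros j J. apply A.
        apply (ord_lt_le j l); [apply nat_ord, N|exact J|exact L]. }
      assert (E1 : ord_le (suc i) (suc m)) by (apply suc_le; [apply nat_ord, N|exact I]).
      destruct (nat_cases i IO) as [->|(l & Hl & ->)].
      * rewrite !TW0, !FI; auto using om_emp, om_suc. apply emp_le, nat_ord, N.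
      * rewrite !TWS by exact Hl. apply FI; auto using om_suc.
    + set (y' := tw y).
      assert (Y0 : ap y emp = emp).
      { rewrite <- EY. rewrite ap_lam by (dsolve || apply om_emp). apply ite_true. reflexivity. }
      assert (YS : forall n, n ∈ om -> ap y (suc n) = ap (ap f y') (suc n)).
      { intros n N. rewrite <- EY at 1. rewrite ap_lam by (dsolve || apply om_suc, N).
        apply ite_false, suc_not_emp. }
      assert (Y' : y' ∈ Bs) by apply TWB, Y.
      assert (F0 : ap (ap f y') emp = ap (ap f y) emp).
      { apply Hf; auto using om_emp. intros i I. destruct (mem_emp i I). }
      assert (W1 : F (ran (il (ap f y) y))) by (apply NNPP, W, Y).
      assert (W2 : F (ran (il (ap f y') y'))) by (apply NNPP, W, Y').
      set (w := il (ap f y) y) in *. set (w' := il (ap f y') y') in *.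
      assert (HW : w ∈ Bs) by (apply il_Bs; auto). assert (HW' : w' ∈ Bs) by (apply il_Bs; auto).
      assert (R0 : ap w' emp = ap w emp).
      { assert (Z1 := il_dbl (ap f y') y' emp om_emp). assert (Z2 := il_dbl (ap f y) y emp om_emp).
        rewrite dbl_0 in *. unfold w, w'. rewrite Z1, Z2. exact F0. }
      assert (SK := ran_skip w w' HW HW' R0).
      apply FR in W1; [|exact HW]. apply FR in W2; [|exact HW'].
      rewrite rs_0, R0, <- rs_0, SK in W2.
      (* Deleting the common least element flips F on both sets. The two remainders differ in the
         least element of the larger one, and a further flip gives the contradiction. *)
      * apply W1. refine (proj2 (FLIP _ (ap (rs w) (suc emp)) _ _ _) W2).
        -- apply del_unbounded; [apply ran_unbounded, HW|]. apply mem_ran. exists emp. auto using om_emp.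
        -- apply mem_del. split; [apply mem_ran; exists (suc emp); auto using om_emp, om_suc|].
           intros C. apply (mem_irrefl (ap (rs w) emp)). rewrite <- C at 2.
           apply rs_mono; [exact HW|auto using om_emp, om_suc|apply suc_self].
        -- intros j J NE. apply mem_del in J. destruct J as [J N0]. apply mem_ran in J.
           destruct J as (n & N & ->). destruct (nat_cases n N) as [->|(m & Hm & ->)]; [tauto|].
           destruct (nat_cases m Hm) as [->|(l & Hl & ->)]; [tauto|].
           apply rs_mono; [exact HW|exact N|]. apply suc_in_nat; [exact Hm|].
           apply mem_suc_le, emp_le, nat_ord, Hl.
      * assert (Z1 := il_odd (ap f y') y' emp om_emp). assert (Z2 := il_odd (ap f y) y emp om_emp).
        assert (Z3 := il_dbl (ap f y) y (suc emp) (om_suc _ om_emp)).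
        assert (Z4 := il_dbl (ap f y) y emp om_emp).
        rewrite dbl_S in Z3 by apply om_emp. rewrite dbl_0 in *.
        unfold w, w'. rewrite Z1, Z2, Z3, Z4, Y0. apply TW0.
      * intros n N. unfold w, w'. destruct (nat_parity n N) as (k & K & [->| ->]).
        -- rewrite <- dbl_S, il_dbl, il_odd by auto using om_suc. symmetry. apply YS, K.
        -- rewrite <- !dbl_S, il_odd, il_dbl by auto using om_suc. apply TWS, K.
Qed.
End NoFlip.
#[export] Hint Resolve T_il T_above T_rs T_ran T_del : dfn.

(** * Codes and choice *)

Section Coding.
Context {M : set_structure} {hZF : ZF_model M}.
Implicit Types a b c f g h x y z u v p m n k i j w S q t Z : M.
Notation env := (nat -> M).

(* 2^a (2b+1) *)
Definition pr a b : M := ap (nrec (suc (dbl b)) (fun _ v => dbl v)) a.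
Lemma T_pr (a b : env -> M) : T a -> T b -> T (fun e => pr (a e) (b e)).
Proof. intros. unfold pr. dsolve. Qed.
Hint Resolve T_pr : dfn.
Lemma pr_0 b : pr emp b = suc (dbl b).
Proof. unfold pr. apply nrec_0. dsolve. Qed.
Lemma pr_S a b : a ∈ om -> pr (suc a) b = dbl (pr a b).
Proof. intros A. unfold pr. rewrite nrec_S; [reflexivity|dsolve|exact A]. Qed.
Lemma pr_om a b : a ∈ om -> b ∈ om -> pr a b ∈ om.
Proof.
  intros A B. revert a A. nind.
  - rewrite pr_0. apply om_suc, dbl_om, B.
  - intros a A IH. rewrite pr_S by exact A. apply dbl_om, IH.
Qed.
Lemma pr_inj a b a' b' : a ∈ om -> b ∈ om -> a' ∈ om -> b' ∈ om ->
  pr a b = pr a' b' -> a = a' /\ b = b'.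
Proof.
  intros A B A' B'. revert a A a' A'.
  assert (H : forall a, a ∈ om -> forall a', a' ∈ om -> pr a b = pr a' b' -> a = a' /\ b = b').
  { nind.
    - intros a' A' E. destruct (nat_cases a' A') as [->|(c & C & ->)].
      + rewrite !pr_0 in E. apply suc_inj in E. apply dbl_inj in E; auto.
      + rewrite pr_0, pr_S in E by exact C. symmetry in E. apply dbl_not_odd in E; [tauto|apply pr_om|]; assumption.
    - intros a A IH a' A' E. destruct (nat_cases a' A') as [->|(c & C & ->)].
      + rewrite pr_0, pr_S in E by exact A. apply dbl_not_odd in E; [tauto|apply pr_om|]; assumption.
      + rewrite !pr_S in E by assumption. apply dbl_inj in E; try apply pr_om; auto.
        destruct (IH c C E) as [-> ->]. auto. }
  intros a A a' A'. apply H; assumption.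
Qed.
Lemma pr_gt a b : a ∈ om -> b ∈ om -> b ∈ pr a b.
Proof.
  intros A B. revert a A. nind.
  - rewrite pr_0. apply mem_suc_le, dbl_ge, B.
  - intros a A IH. rewrite pr_S by exact A.
    apply (ord_lt_le b (pr a b)); [apply nat_ord, dbl_om, pr_om; assumption|exact IH|].
    apply dbl_ge, pr_om; assumption.
Qed.

Definition p1 m : M := the (fun a => exists b, a ∈ om /\ b ∈ om /\ m = pr a b).
Definition p2 m : M := the (fun b => exists a, a ∈ om /\ b ∈ om /\ m = pr a b).
Lemma T_p1 (m : env -> M) : T m -> T (fun e => p1 (m e)).
Proof. intros. unfold p1. dsolve. Qed.
Lemma T_p2 (m : env -> M) : T m -> T (fun e => p2 (m e)).
Proof. intros. unfold p2. dsolve. Qed.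
Hint Resolve T_p1 T_p2 : dfn.
Lemma p1_pr a b : a ∈ om -> b ∈ om -> p1 (pr a b) = a.
Proof.
  intros A B. apply the_eq; [eauto|]. intros a' (b' & A' & B' & E).
  apply pr_inj in E; try assumption. symmetry. apply E.
Qed.
Lemma p2_pr a b : a ∈ om -> b ∈ om -> p2 (pr a b) = b.
Proof.
  intros A B. apply the_eq; [eauto|]. intros b' (a' & A' & B' & E).
  apply pr_inj in E; try assumption. symmetry. apply E.
Qed.
Lemma p1_om m : p1 m ∈ om.
Proof.
  unfold p1. destruct (the_spec (fun a => exists b, a ∈ om /\ b ∈ om /\ m = pr a b)) as [[_ (b & A & _)]|[_ A]].
  - exact A.
  - apply is_empty_emp in A. rewrite A. apply om_emp.
Qed.
Lemma p2_om m : p2 m ∈ om.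
Proof.
  unfold p2. destruct (the_spec (fun b => exists a, a ∈ om /\ b ∈ om /\ m = pr a b)) as [[_ (b & _ & A & _)]|[_ A]].
  - exact A.
  - apply is_empty_emp in A. rewrite A. apply om_emp.
Qed.

(* cd x k codes the finite sequence x(0), ..., x(k-1) by a natural number. *)
Definition cd x k : M := ap (nrec emp (fun i v => suc (pr v (ap x i)))) k.
Lemma T_cd (x k : env -> M) : T x -> T k -> T (fun e => cd (x e) (k e)).
Proof. intros. unfold cd. dsolve. Qed.
Hint Resolve T_cd : dfn.
Lemma cd_0 x : cd x emp = emp.
Proof. unfold cd. apply nrec_0. dsolve. Qed.
Lemma cd_S x k : k ∈ om -> cd x (suc k) = suc (pr (cd x k) (ap x k)).
Proof. intros K. unfold cd. rewrite nrec_S; [reflexivity|dsolve|exact K]. Qed.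
Lemma cd_om x : x ∈ Bs -> forall k, k ∈ om -> cd x k ∈ om.
Proof.
  intros X. nind.
  - rewrite cd_0. apply om_emp.
  - intros k K IH. rewrite cd_S by exact K. apply om_suc, pr_om; [exact IH|apply Bs_ap; assumption].
Qed.
Lemma cd_inj x y : x ∈ Bs -> y ∈ Bs -> forall k, k ∈ om -> forall l, l ∈ om ->
  cd x k = cd y l -> k = l /\ agree k x y.
Proof.
  intros X Y. nind.
  - intros l L E. destruct (nat_cases l L) as [->|(m & Hm & ->)].
    + split; [reflexivity|]. intros i I. destruct (mem_emp i I).
    + rewrite cd_0, cd_S in E by exact Hm. symmetry in E. destruct (suc_not_emp _ E).
  - intros k K IH l L E. destruct (nat_cases l L) as [->|(m & Hm & ->)].
    + rewrite cd_0, cd_S in E by exact K. destruct (suc_not_emp _ E).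
    + rewrite !cd_S in E by assumption. apply suc_inj in E.
      apply pr_inj in E; try (apply cd_om; assumption); try (apply Bs_ap; assumption).
      destruct E as [E1 E2]. destruct (IH m Hm E1) as [-> A]. split; [reflexivity|].
      intros i I. apply mem_suc in I. destruct I as [I| ->]; [apply A, I|exact E2].
Qed.
Lemma cd_agree x y k : k ∈ om -> agree k x y -> cd x k = cd y k.
Proof.
  revert k. nind.
  - intros _. rewrite !cd_0. reflexivity.
  - intros k K IH A. rewrite !cd_S by exact K. rewrite IH, (A k (suc_self k)); [reflexivity|].
    apply (agree_sub (suc k)); [apply suc_sub|exact A].
Qed.

(** * Images of Baire space, from which DC over the reals can choose *)

Definition BS Z : Prop := exists q, is_surjection q Bs Z.

Lemma surj_spec q a b : is_surjection q a b <->
  is_fun q a b /\ forall y, y ∈ b -> exists x, x ∈ a /\ y = ap q x.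
Proof.
  unfold is_surjection. split; intros [F H]; (split; [exact F|]); intros y Y; destruct (H y Y) as (x & X).
  - apply (app_eq q a b) in X; [|exact F]. eauto.
  - destruct X as [X ->]. exists x. apply (app_ap q a b); assumption.
Qed.

Lemma surj_lam (F : M -> M) a b z0 : T1 F -> z0 ∈ b -> (forall z, z ∈ b -> exists x, x ∈ a /\ z = F x) ->
  exists q, is_surjection q a b.
Proof.
  intros TF Z0 H. exists (lam a (fun x => ite (F x ∈ b) (F x) z0)). apply surj_spec. split.
  - apply lam_fun; [dsolve|]. intros x X. destruct (classic (F x ∈ b)) as [C|C];
      [rewrite ite_true|rewrite ite_false]; assumption.
  - intros z Z. destruct (H z Z) as (x & X & ->). exists x. split; [exact X|].
    rewrite ap_lam by (dsolve || exact X). symmetry. apply ite_true, Z.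
Qed.

Lemma surj_comp a b c : (exists q, is_surjection q a b) -> (exists q, is_surjection q b c) ->
  exists q, is_surjection q a c.
Proof.
  intros [q Q] [r R]. apply surj_spec in Q. apply surj_spec in R. destruct Q as [Q1 Q2], R as [R1 R2].
  exists (lam a (fun x => ap r (ap q x))). apply surj_spec. split.
  - apply lam_fun; [dsolve|]. intros x X. apply (ap_mem r b c _ R1), (ap_mem q a b _ Q1), X.
  - intros z Z. destruct (R2 z Z) as (y & Y & ->). destruct (Q2 y Y) as (x & X & ->).
    exists x. split; [exact X|]. rewrite ap_lam; [reflexivity|dsolve|exact X].
Qed.

Definition zero : M := lam om (fun _ => emp).
Lemma zero_Bs : zero ∈ Bs.
Proof. apply Bs_lam; [dsolve|]. intros. apply om_emp. Qed.

Lemma BS_om : BS om.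
Proof.
  apply (surj_lam (fun x => ap x emp) Bs om emp); [dsolve|apply om_emp|].
  intros z Z. exists (lam om (fun _ => z)). split; [apply Bs_lam; [dsolve|auto]|].
  rewrite ap_lam; [reflexivity|dsolve|apply om_emp].
Qed.

Lemma BS_prod Z1 Z2 : BS Z1 -> BS Z2 -> BS (prod Z1 Z2).
Proof.
  intros [q Q] [r R]. apply surj_spec in Q. apply surj_spec in R. destruct Q as [Q1 Q2], R as [R1 R2].
  exists (lam Bs (fun x => op (ap q (evn x)) (ap r (odd x)))). apply surj_spec. split.
  - apply lam_fun; [dsolve|]. intros x X. apply op_in_prod.
    split; [apply (ap_mem q Bs), evn_Bs, X|apply (ap_mem r Bs), odd_Bs, X]; assumption.
  - intros z H. apply mem_prod in H. destruct H as (a & b & A & B & ->).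
    destruct (Q2 a A) as (x & X & ->). destruct (R2 b B) as (y & Y & ->).
    exists (il x y). split; [apply il_Bs; assumption|].
    rewrite ap_lam; [|dsolve|apply il_Bs; assumption]. rewrite evn_il, odd_il by assumption. reflexivity.
Qed.

(** Kleene's associates: c at the code of n and x|k is 0 as long as x|k leaves digit n open, and one
    more than the digit at the first k that settles it. *)
Definition val c x : M := the (fun y => y ∈ Bs /\ forall n, n ∈ om -> exists k, k ∈ om /\
  ap c (pr n (cd x k)) = suc (ap y n) /\ forall j, j ∈ k -> ap c (pr n (cd x j)) = emp).
Lemma T_val (c x : env -> M) : T c -> T x -> T (fun e => val (c e) (x e)).
Proof. intros. unfold val. dsolve. Qed.
Hint Resolve T_val : dfn.

Lemma val_unique c x y : y ∈ Bs -> (forall n, n ∈ om -> exists k, k ∈ om /\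
  ap c (pr n (cd x k)) = suc (ap y n) /\ forall j, j ∈ k -> ap c (pr n (cd x j)) = emp) ->
  val c x = y.
Proof.
  intros Y H. apply the_eq; [auto|]. intros z [Hz G]. apply Bs_ext; [exact Hz|exact Y|].
  intros n N. destruct (H n N) as (k & K & E & L). destruct (G n N) as (k' & K' & E' & L').
  destruct (ord_tricho k k' (nat_ord k K) (nat_ord k' K')) as [C|[<-|C]].
  - rewrite (L' k C) in E. symmetry in E. destruct (suc_not_emp _ E).
  - rewrite E in E'. apply suc_inj in E'. auto.
  - rewrite (L k' C) in E'. symmetry in E'. destruct (suc_not_emp _ E').
Qed.

Lemma CF_code f : CF f -> exists c, c ∈ Bs /\ forall x, x ∈ Bs -> val c x = ap f x.
Proof.
  intros HF.
  (* Q relates the code of n and a finite sequence to one more than digit n, provided all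
     continuations of the sequence share that digit. *)
  set (Q := fun m v => exists x k, x ∈ Bs /\ k ∈ om /\ p2 m = cd x k /\
    (forall y, y ∈ Bs -> agree k x y -> ap (ap f x) (p1 m) = ap (ap f y) (p1 m)) /\
    v = suc (ap (ap f x) (p1 m))).
  assert (DQ : D2 Q) by (unfold Q; dsolve).
  assert (UQ : forall m v v', Q m v -> Q m v' -> v = v').
  { intros m v v' (x & k & X & K & E & A & ->) (x' & k' & X' & K' & E' & A' & ->).
    rewrite E in E'. apply cd_inj in E'; try assumption. destruct E' as [<- H].
    f_equal. apply A; assumption. }
  assert (VQ : forall m v, Q m v -> the (Q m) = v).
  { intros m v H. apply the_eq; [exact H|]. intros z Z. apply (UQ m); assumption. }
  assert (V0 : forall m, ~ (exists v, Q m v) -> the (Q m) = emp).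
  { intros m H. destruct (the_spec (Q m)) as [[_ C]|[_ C]]; [destruct H; eauto|apply is_empty_emp, C]. }
  set (c := lam om (fun m => the (Q m))).
  assert (TC : T1 (fun m => the (Q m))) by dsolve.
  exists c. split.
  - apply Bs_lam; [exact TC|]. intros m Hm. destruct (classic (exists v, Q m v)) as [[v H]|H].
    + rewrite (VQ m v H). destruct H as (x & k & X & K & E & A & ->).
      apply om_suc, Bs_ap; [apply CF_ap; assumption|apply p1_om].
    + rewrite V0 by exact H. apply om_emp.
  - intros x X. apply val_unique; [apply CF_ap; assumption|]. intros n N.
    assert (CE : forall k, k ∈ om -> ap c (pr n (cd x k)) = the (Q (pr n (cd x k)))).
    { intros k K. unfold c. rewrite ap_lam; [reflexivity|exact TC|]. apply pr_om; [exact N|apply cd_om; assumption]. }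
    destruct (nat_least (fun k => forall y, y ∈ Bs -> agree k x y -> ap (ap f x) n = ap (ap f y) n))
      as (k & K & A & MIN); [dsolve| |].
    { destruct HF as [_ HF]. apply (HF x n X N). }
    exists k. split; [exact K|]. split.
    + rewrite CE by exact K. apply VQ. exists x, k.
      rewrite p1_pr, p2_pr by auto using cd_om. auto.
    + intros j J. assert (JO : j ∈ om) by exact (nat_trans j k K J).
      rewrite CE by exact JO. apply V0. intros (v & x' & k' & X' & K' & E & A' & _).
      rewrite p1_pr, p2_pr in * by auto using cd_om. apply cd_inj in E; try assumption.
      destruct E as [<- E]. apply (MIN j J). intros y Y Hy.
      transitivity (ap (ap f x') n).
      * symmetry. apply A'; [exact X|]. apply agree_sym, E.
      * apply A'; [exact Y|]. apply (agree_trans j x' x y); [apply agree_sym, E|exact Hy].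
Qed.

Definition idB : M := lam Bs (fun x => x).
Lemma ap_idB x : x ∈ Bs -> ap idB x = x.
Proof. intros X. unfold idB. rewrite ap_lam; [reflexivity|dsolve|exact X]. Qed.
Lemma CF_idB : CF idB.
Proof.
  split; [apply lam_fun; [dsolve|auto]|]. intros x n X N. exists (suc n).
  split; [apply om_suc, N|]. intros y Y A. rewrite !ap_idB by assumption. apply A, suc_self.
Qed.

Definition CFs : M := sep (fn Bs Bs) CF.
Lemma mem_CFs f : f ∈ CFs <-> CF f.
Proof.
  unfold CFs. rewrite mem_sep by dsolve. rewrite mem_fn. split; [tauto|]. intros H. split; [apply H|exact H].
Qed.

(** Reductions, unlike subsets of X, are coded by reals; this is what makes them accessible to
    choice. *)
Lemma BS_CFs : BS CFs.
Proof.
  apply (surj_lam (fun c => lam Bs (fun x => val c x)) Bs CFs idB); [dsolve|apply mem_CFs, CF_idB|].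
  intros f F. apply mem_CFs in F. destruct (CF_code f F) as (c & C & E). exists c. split; [exact C|].
  apply (fun_ext _ _ Bs Bs Bs).
  - apply F.
  - apply lam_fun; [dsolve|]. intros x X. rewrite E by exact X. apply CF_ap; assumption.
  - intros x X. rewrite ap_lam by (dsolve || exact X). symmetry. apply E, X.
Qed.

Definition comp f g : M := lam Bs (fun x => ap f (ap g x)).
Lemma T_comp (f g : env -> M) : T f -> T g -> T (fun e => comp (f e) (g e)).
Proof. intros. unfold comp. dsolve. Qed.
Hint Resolve T_comp : dfn.
Lemma ap_comp f g x : x ∈ Bs -> ap (comp f g) x = ap f (ap g x).
Proof. intros X. unfold comp. rewrite ap_lam; [reflexivity|dsolve|exact X]. Qed.
Lemma CF_comp f g : CF f -> CF g -> CF (comp f g).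
Proof.
  intros F G. split.
  - apply lam_fun; [dsolve|]. intros x X. apply CF_ap, CF_ap; assumption.
  - intros x n X N. assert (GX : ap g x ∈ Bs) by (apply CF_ap; assumption).
    destruct (proj2 F (ap g x) n GX N) as (k & K & H). destruct (CF_agree g x G X k K) as (l & L & H').
    exists l. split; [exact L|]. intros y Y A. rewrite !ap_comp by assumption.
    apply H; [apply CF_ap; assumption|]. apply H'; assumption.
Qed.

Context (R : ordered_field_data M) (hDC : DC_reals R) (hRB : exists q, is_surjection q (Rset R) Bs).

(** The relation is pulled back along a surjection of the reals onto Z. The first term of the
    sequence is not under control. *)
Lemma dependent_choice Z (Q : M -> M -> Prop) : D2 Q -> BS Z ->
  (forall x, x ∈ Z -> exists y, y ∈ Z /\ Q x y) ->
  exists h, h ∈ fn om Z /\ forall n, n ∈ om -> Q (ap h n) (ap h (suc n)).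
Proof.
  intros DQ HZ H. destruct (surj_comp _ _ _ hRB HZ) as (q & Hq). apply surj_spec in Hq.
  destruct Hq as [Q1 Q2].
  set (P := sep (prod (Rset R) (Rset R)) (fun p => exists x y, p = op x y /\ Q (ap q x) (ap q y))).
  assert (MP : forall x y, app P x y <-> x ∈ Rset R /\ y ∈ Rset R /\ Q (ap q x) (ap q y)).
  { intros x y. rewrite app_iff. unfold P. rewrite mem_sep by dsolve. rewrite op_in_prod. split.
    - intros [[X Y] (x' & y' & E & HQ)]. apply op_inj in E. destruct E; subst. auto.
    - intros (X & Y & HQ). split; [auto|]. eauto. }
  destruct (hDC P) as (w & f & W & F & HF).
  - intros x X. destruct (H (ap q x)) as (y & Y & HQ); [apply (ap_mem q (Rset R)); assumption|].
    destruct (Q2 y Y) as (x' & X' & ->). exists x'. split; [exact X'|]. apply MP. auto.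
  - apply is_omega_om in W. subst w. exists (lam om (fun n => ap q (ap f n))). split.
    + apply mem_fn, lam_fun; [dsolve|]. intros n N. apply (ap_mem q (Rset R) Z _ Q1), (ap_mem f om (Rset R) _ F), N.
    + intros n N. rewrite !ap_lam by (dsolve || auto using om_suc).
      apply MP. apply (HF n (suc n)); [exact N|apply is_succ_suc; reflexivity| |];
        apply (app_ap f om (Rset R)); auto using om_suc.
Qed.

(** Induction on n replaces choice here; it serves to repair the beginning of sequences obtained
    from dependent choice. *)
Lemma finite_choice Z (Q : M -> M -> Prop) : D2 Q ->
  (forall n, n ∈ om -> exists z, z ∈ Z /\ Q n z) ->
  forall n, n ∈ om -> exists h, forall m, m ∈ n -> ap h m ∈ Z /\ Q m (ap h m).
Proof.
  intros DQ H. nind.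
  - exists emp. intros m Hm. destruct (mem_emp m Hm).
  - intros n N [h IH]. destruct (H n N) as (z & Hz & HQ).
    exists (lam (suc n) (fun m => ite (m = n) z (ap h m))). intros m Hm.
    rewrite ap_lam by (dsolve || exact Hm). destruct (classic (m = n)) as [->|NE].
    + rewrite ite_true by reflexivity. auto.
    + rewrite ite_false by exact NE. apply mem_suc in Hm. apply IH. tauto.
Qed.

(** Dependent choice runs through pairs (n, z) with n increasing by one, but starts at an
    uncontrolled n0; the values up to n0 come from [finite_choice]. *)
Lemma countable_choice Z (Q : M -> M -> Prop) : D2 Q -> BS Z ->
  (forall n, n ∈ om -> exists z, z ∈ Z /\ Q n z) ->
  exists h, h ∈ fn om Z /\ forall n, n ∈ om -> Q n (ap h n).
Proof.
  intros DQ HZ H.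
  set (fst := fun s => the (fun n => exists z, s = op n z)).
  assert (TF : forall s : env -> M, T s -> T (fun e => fst (s e))) by (intros; unfold fst; dsolve).
  assert (FE : forall n z, fst (op n z) = n).
  { intros n z. apply the_eq; [eauto|]. intros n' (z' & E). apply op_inj in E. symmetry. apply E. }
  destruct (dependent_choice (prod om Z) (fun s s' => exists z, s' = op (suc (fst s)) z /\ Q (suc (fst s)) z))
    as (h & Hh & HS).
  - dsolve.
  - apply BS_prod; [apply BS_om|exact HZ].
  - intros s Hs. apply mem_prod in Hs. destruct Hs as (n & z & N & _ & ->).
    destruct (H (suc n) (om_suc n N)) as (z' & Z' & HQ). exists (op (suc n) z').
    rewrite op_in_prod, FE. split; [auto using om_suc|]. eauto.
  - apply mem_fn in Hh. set (n0 := fst (ap h emp)).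
    assert (SM : forall i, i ∈ om -> ap h i ∈ prod om Z) by (intros; apply (ap_mem h om); assumption).
    assert (N0 : n0 ∈ om).
    { assert (A := SM emp om_emp). apply mem_prod in A. destruct A as (n & z & N & _ & E).
      unfold n0. rewrite E, FE. exact N. }
    destruct (finite_choice Z Q DQ H (suc n0) (om_suc n0 N0)) as (g & G).
    assert (COV : forall m, m ∈ om -> m ∈ suc n0 \/ exists i z, i ∈ om /\ z ∈ Z /\ ap h i = op m z /\ Q m z).
    { assert (ST : forall i m z, i ∈ om -> ap h i = op m z ->
        exists z', z' ∈ Z /\ ap h (suc i) = op (suc m) z' /\ Q (suc m) z').
      { intros i m z I E. destruct (HS i I) as (z' & E' & HQ). rewrite E, FE in *.
        exists z'. split; [|auto]. assert (A := SM (suc i) (om_suc i I)). rewrite E' in A.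
        apply op_in_prod in A. apply A. }
      nind.
      - left. apply mem_suc_le, emp_le, nat_ord, N0.
      - intros m Hm [A|(i & z & I & HZ' & E & HQ)].
        + apply mem_suc in A. destruct A as [A|A].
          * left. apply suc_in_nat; assumption.
          * right. subst m. assert (A := SM emp om_emp). apply mem_prod in A.
            destruct A as (n & z & N & _ & E). assert (E' : n0 = n) by (unfold n0; rewrite E; apply FE).
            subst n. destruct (ST emp n0 z om_emp E) as (z' & A & B & C). exists (suc emp), z'.
            split; [apply om_suc, om_emp|auto].
        + right. destruct (ST i m z I E) as (z' & A & B & C). exists (suc i), z'.
          split; [apply om_suc, I|auto]. }
    set (i_of := fun m => the (fun i => i ∈ om /\ (exists z, ap h i = op m z /\ z ∈ Z /\ Q m z) /\
      forall j, j ∈ i -> ~ exists z, ap h j = op m z /\ z ∈ Z /\ Q m z)).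
    set (v := fun m => ite (m ∈ suc n0) (ap g m) (the (fun z => ap h (i_of m) = op m z))).
    assert (TV : T1 v) by (unfold v, i_of; dsolve).
    assert (VP : forall m, m ∈ om -> v m ∈ Z /\ Q m (v m)).
    { intros m Hm. unfold v. destruct (classic (m ∈ suc n0)) as [A|A].
      - rewrite ite_true by exact A. apply G, A.
      - rewrite ite_false by exact A. destruct (COV m Hm) as [C|(i & z & I & HZ' & E & HQ)]; [tauto|].
        destruct (nat_least (fun i => exists z, ap h i = op m z /\ z ∈ Z /\ Q m z)) as (l & L & P & MIN);
          [dsolve|eauto 8|].
        assert (EL : i_of m = l).
        { apply the_eq; [auto|]. intros l' (L' & P' & MIN').
          destruct (ord_tricho l' l (nat_ord l' L') (nat_ord l L)) as [C|[C|C]]; [destruct (MIN l' C P')|exact C|destruct (MIN' l C P)]. }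
        destruct P as (z' & E' & A' & B'). rewrite EL.
        assert (EZ : the (fun z => ap h l = op m z) = z').
        { apply the_eq; [exact E'|]. intros y Y. rewrite E' in Y. apply op_inj in Y. symmetry. apply Y. }
        rewrite EZ. auto. }
    exists (lam om v). split.
    + apply mem_fn, lam_fun; [exact TV|]. intros m Hm. apply VP, Hm.
    + intros m Hm. rewrite ap_lam by assumption. apply VP, Hm.
Qed.
End Coding.
#[export] Hint Resolve T_pr T_p1 T_p2 T_cd T_val T_comp : dfn.

(** * The real line *)

Section RealLine.
Context {M : set_structure} {hZF : ZF_model M}.
Implicit Types a b c f g h x y z u v p m n k i j w r s t : M.
Notation env := (nat -> M).
Context (R : ordered_field_data M) (hR : is_real_line R).
Notation RR := (Rset R).
Notation "x ≺ y" := (Rlt R x y) (at level 70).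
Notation "x ≼ y" := (Rle R x y) (at level 70).

Definition add x y : M := ap (Radd R) (op x y).
Definition mul x y : M := ap (Rmul R) (op x y).
Lemma T_add (x y : env -> M) : T x -> T y -> T (fun e => add (x e) (y e)).
Proof. intros. unfold add. dsolve. Qed.
Lemma D_Rlt (x y : env -> M) : T x -> T y -> D (fun e => Rlt R (x e) (y e)).
Proof. intros. unfold Rlt. dsolve. Qed.
Hint Resolve T_add D_Rlt : dfn.
Lemma D_Rle (x y : env -> M) : T x -> T y -> D (fun e => Rle R (x e) (y e)).
Proof. intros. unfold Rle. dsolve. Qed.
Hint Resolve D_Rle : dfn.

Lemma app2_iff f a b c x y z : is_fun2 f a b c ->
  (app2 f x y z <-> x ∈ a /\ y ∈ b /\ z = ap f (op x y)).
Proof.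
  intros (p & P & F). apply is_prod_prod in P. subst p. unfold app2. split.
  - intros (p & P & A). apply is_opair_op in P. subst p. apply (app_eq f (prod a b) c) in A; [|exact F].
    destruct A as [A ->]. apply op_in_prod in A. tauto.
  - intros (X & Y & ->). exists (op x y). split; [apply is_opair_op; reflexivity|].
    apply (app_ap f (prod a b) c (op x y) F). apply op_in_prod. auto.
Qed.

Lemma fun2_mem f a b c x y : is_fun2 f a b c -> x ∈ a -> y ∈ b -> ap f (op x y) ∈ c.
Proof.
  intros (p & P & F) X Y. apply is_prod_prod in P. subst p. apply (ap_mem f (prod a b)); [exact F|].
  apply op_in_prod. auto.
Qed.

Lemma app2_add x y z : app2 (Radd R) x y z <-> x ∈ RR /\ y ∈ RR /\ z = add x y.
Proof. apply (app2_iff _ _ _ RR). apply hR. Qed.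
Lemma app2_mul x y z : app2 (Rmul R) x y z <-> x ∈ RR /\ y ∈ RR /\ z = mul x y.
Proof. apply (app2_iff _ _ _ RR). apply hR. Qed.
Lemma add_in x y : x ∈ RR -> y ∈ RR -> add x y ∈ RR.
Proof. apply fun2_mem. apply hR. Qed.
Lemma mul_in x y : x ∈ RR -> y ∈ RR -> mul x y ∈ RR.
Proof. apply fun2_mem. apply hR. Qed.
Lemma Rzero_in : Rzero R ∈ RR. Proof. apply hR. Qed.
Lemma Rone_in : Rone R ∈ RR. Proof. apply hR. Qed.
Hint Resolve add_in mul_in Rzero_in Rone_in : core.

Lemma add_assoc x y z : x ∈ RR -> y ∈ RR -> z ∈ RR -> add (add x y) z = add x (add y z).
Proof.
  intros X Y Z. destruct hR as [(_ & _ & _ & _ & _ & A & _) _].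
  apply (A x y z (add x y) (add y z)); apply app2_add; auto.
Qed.
Lemma add_comm x y : x ∈ RR -> y ∈ RR -> add x y = add y x.
Proof.
  intros X Y. destruct hR as [(_ & _ & _ & _ & _ & _ & A & _) _].
  assert (H : app2 (Radd R) y x (add x y)) by (apply A, app2_add; auto).
  apply app2_add in H. apply H.
Qed.
Lemma add_0 x : x ∈ RR -> add x (Rzero R) = x.
Proof.
  intros X. destruct hR as [(_ & _ & _ & _ & _ & _ & _ & A & _) _].
  specialize (A x X). apply app2_add in A. symmetry. apply A.
Qed.
Definition neg x : M := the (fun y => y ∈ RR /\ add x y = Rzero R).
Lemma T_neg (x : env -> M) : T x -> T (fun e => neg (x e)).
Proof. intros. unfold neg. dsolve. Qed.
Hint Resolve T_neg : dfn.
Lemma neg_spec x : x ∈ RR -> neg x ∈ RR /\ add x (neg x) = Rzero R.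
Proof.
  intros X. destruct hR as [(_ & _ & _ & _ & _ & _ & _ & _ & A & _) _].
  destruct (A x X) as (y & Y). apply app2_add in Y. destruct Y as (_ & Y & E).
  apply (the_ext (fun y => y ∈ RR /\ add x y = Rzero R)); [exists y; auto|].
  intros u v [U1 U2] [V1 V2]. rewrite <- (add_0 u U1), <- V2, <- add_assoc, (add_comm u x), U2 by auto.
  rewrite add_comm, add_0; auto.
Qed.
Lemma neg_in x : x ∈ RR -> neg x ∈ RR. Proof. apply neg_spec. Qed.
Lemma add_neg x : x ∈ RR -> add x (neg x) = Rzero R. Proof. apply neg_spec. Qed.
Hint Resolve neg_in : core.
Lemma neg_eq x y : x ∈ RR -> y ∈ RR -> add x y = Rzero R -> neg x = y.
Proof.
  intros X Y E. rewrite <- (add_0 (neg x)), <- E, <- add_assoc, (add_comm (neg x)), add_neg by auto.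
  rewrite add_comm, add_0; auto.
Qed.
Lemma add_neg_r x y : x ∈ RR -> y ∈ RR -> add (add x y) (neg y) = x.
Proof. intros X Y. rewrite add_assoc, add_neg, add_0; auto. Qed.
Lemma add_neg_l x y : x ∈ RR -> y ∈ RR -> add (add x (neg y)) y = x.
Proof. intros X Y. rewrite add_assoc, (add_comm (neg y) y), add_neg, add_0; auto. Qed.

Lemma lt_irrefl x : ~ x ≺ x. Proof. apply hR. Qed.
Lemma lt_trans x y z : x ≺ y -> y ≺ z -> x ≺ z. Proof. apply hR. Qed.
Lemma lt_tricho x y : x ∈ RR -> y ∈ RR -> x ≺ y \/ x = y \/ y ≺ x.
Proof. apply hR. Qed.
Lemma add_lt_r x y z : x ∈ RR -> y ∈ RR -> z ∈ RR -> x ≺ y -> add x z ≺ add y z.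
Proof.
  intros X Y Z H. destruct hR as [_ [(_ & _ & _ & A & _) _]].
  apply (A x y z); [exact H|apply app2_add; auto|apply app2_add; auto].
Qed.
Lemma add_lt_l x y z : x ∈ RR -> y ∈ RR -> z ∈ RR -> x ≺ y -> add z x ≺ add z y.
Proof. intros X Y Z H. rewrite (add_comm z x), (add_comm z y) by auto. apply add_lt_r; assumption. Qed.
Lemma Rle_lt_trans x y z : x ≼ y -> y ≺ z -> x ≺ z.
Proof. intros [H| ->] L; [eapply lt_trans; eassumption|exact L]. Qed.
Lemma Rlt_le_trans x y z : x ≺ y -> y ≼ z -> x ≺ z.
Proof. intros L [H| <-]; [eapply lt_trans; eassumption|exact L]. Qed.
Lemma Rle_trans x y z : x ≼ y -> y ≼ z -> x ≼ z.
Proof. intros L [H| <-]; [left; eapply Rle_lt_trans; eassumption|exact L]. Qed.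
Lemma Rle_refl x : x ≼ x. Proof. right. reflexivity. Qed.
Lemma le_not_lt x y : x ≼ y -> ~ y ≺ x.
Proof. intros L H. apply (lt_irrefl x). eapply Rle_lt_trans; eassumption. Qed.
Lemma not_lt_le x y : x ∈ RR -> y ∈ RR -> ~ y ≺ x -> x ≼ y.
Proof. intros X Y H. destruct (lt_tricho x y X Y) as [A|[A|A]]; [left|right|]; tauto. Qed.
Lemma add_le_r x y z : x ∈ RR -> y ∈ RR -> z ∈ RR -> x ≼ y -> add x z ≼ add y z.
Proof. intros X Y Z [H| ->]; [left; apply add_lt_r; assumption|apply Rle_refl]. Qed.
Lemma add_le_l x y z : x ∈ RR -> y ∈ RR -> z ∈ RR -> x ≼ y -> add z x ≼ add z y.
Proof. intros X Y Z [H| ->]; [left; apply add_lt_l; assumption|apply Rle_refl]. Qed.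
Lemma add_lt x y z w : x ∈ RR -> y ∈ RR -> z ∈ RR -> w ∈ RR -> x ≺ y -> z ≺ w -> add x z ≺ add y w.
Proof. intros. apply (lt_trans _ (add y z)); [apply add_lt_r|apply add_lt_l]; assumption. Qed.
Lemma add_pos_gt x e : x ∈ RR -> e ∈ RR -> Rzero R ≺ e -> x ≺ add x e.
Proof. intros X E H. rewrite <- (add_0 x X) at 1. apply add_lt_l; auto. Qed.
Lemma diff_pos x y : x ∈ RR -> y ∈ RR -> x ≺ y -> Rzero R ≺ add y (neg x).
Proof. intros X Y H. rewrite <- (add_neg x X). apply add_lt_r; auto. Qed.

Lemma half_exists x : x ∈ RR -> exists h, h ∈ RR /\ add h h = x.
Proof.
  intros X. assert (N : add (Rone R) (Rone R) <> Rzero R).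
  { intros E. assert (O : Rzero R <> Rone R) by apply hR.
    destruct (lt_tricho (Rzero R) (Rone R)) as [H|[H|H]]; auto.
    - apply (lt_irrefl (Rzero R)). apply (lt_trans _ (Rone R)); [exact H|].
      rewrite <- E. apply add_pos_gt; auto.
    - apply (lt_irrefl (Rzero R)). apply (lt_trans _ (Rone R)); [|exact H].
      rewrite <- E at 1. rewrite <- (add_0 (Rone R)) at 3 by auto. apply add_lt_l; auto. }
  destruct hR as [(_ & _ & _ & _ & _ & _ & _ & _ & _ & _ & MC & M1 & MI & DI) _].
  destruct (MI (add (Rone R) (Rone R))) as (i & I); [auto|exact N|].
  assert (II : i ∈ RR) by (apply app2_mul in I; tauto). apply MC in I.
  exists (mul x i). split; [auto|].
  assert (E : app2 (Radd R) (mul i (Rone R)) (mul i (Rone R)) (Rone R)).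
  { apply (DI i (Rone R) (Rone R) (add (Rone R) (Rone R))); [apply app2_add; auto|exact I| |];
      apply app2_mul; auto. }
  assert (E1 : mul i (Rone R) = i).
  { specialize (M1 i II). apply app2_mul in M1. symmetry. apply M1. }
  rewrite E1 in E.
  assert (H : app2 (Radd R) (mul x i) (mul x i) x).
  { apply (DI x i i (Rone R)); [exact E|apply M1, X| |]; apply app2_mul; auto. }
  apply app2_add in H. symmetry. apply H.
Qed.

Definition half x : M := the (fun h => h ∈ RR /\ add h h = x).
Lemma T_half (x : env -> M) : T x -> T (fun e => half (x e)).
Proof. intros. unfold half. dsolve. Qed.
Hint Resolve T_half : dfn.
Lemma half_spec x : x ∈ RR -> half x ∈ RR /\ add (half x) (half x) = x.
Proof.
  intros X. apply (the_ext (fun h => h ∈ RR /\ add h h = x)).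
  - destruct (half_exists x X) as (h & H). exists h. exact H.
  - intros h g [H1 H2] [G1 G2]. destruct (lt_tricho h g H1 G1) as [L|[L|L]]; [|exact L|].
    + destruct (lt_irrefl x). rewrite <- H2 at 1. rewrite <- G2. apply add_lt; assumption.
    + destruct (lt_irrefl x). rewrite <- H2 at 2. rewrite <- G2. apply add_lt; assumption.
Qed.
Lemma half_in x : x ∈ RR -> half x ∈ RR. Proof. apply half_spec. Qed.
Hint Resolve half_in : core.
Lemma half_add x : x ∈ RR -> add (half x) (half x) = x. Proof. apply half_spec. Qed.
Lemma half_pos x : x ∈ RR -> Rzero R ≺ x -> Rzero R ≺ half x.
Proof.
  intros X H. apply NNPP. intros C. apply not_lt_le in C; auto.
  apply (lt_irrefl (Rzero R)). apply (Rlt_le_trans _ x); [exact H|].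
  rewrite <- (half_add x X). apply (Rle_trans _ (add (half x) (Rzero R))).
  - apply add_le_l; auto.
  - rewrite add_0; auto.
Qed.
Lemma half_lt x : x ∈ RR -> Rzero R ≺ x -> half x ≺ x.
Proof. intros X H. rewrite <- (half_add x X) at 2. apply add_pos_gt; auto. apply half_pos; assumption. Qed.

Definition lub a : M := the (fun u => u ∈ RR /\ (forall x, x ∈ a -> x ≼ u) /\
  forall v, v ∈ RR -> (forall x, x ∈ a -> x ≼ v) -> u ≼ v).
Lemma T_lub (x : env -> M) : T x -> T (fun e => lub (x e)).
Proof. intros. unfold lub. dsolve. Qed.
Hint Resolve T_lub : dfn.
Lemma le_antisym x y : x ≼ y -> y ≼ x -> x = y.
Proof. intros [H|H] L; [destruct (le_not_lt _ _ L H)|exact H]. Qed.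
Lemma lub_eq a u : u ∈ RR -> (forall x, x ∈ a -> x ≼ u) ->
  (forall v, v ∈ RR -> (forall x, x ∈ a -> x ≼ v) -> u ≼ v) -> lub a = u.
Proof.
  intros U A B. apply the_eq; [auto|]. intros v (V1 & V2 & V3). apply le_antisym; auto.
Qed.
Lemma lub_spec a : subset a RR -> (exists x, x ∈ a) -> (exists u, u ∈ RR /\ forall x, x ∈ a -> x ≼ u) ->
  lub a ∈ RR /\ (forall x, x ∈ a -> x ≼ lub a) /\
  forall v, v ∈ RR -> (forall x, x ∈ a -> x ≼ v) -> lub a ≼ v.
Proof.
  intros S [x X] B. destruct hR as (_ & _ & C).
  destruct (C a S) as (u & U & U1 & U2); [intros E; exact (E x X)|exact B|].
  rewrite (lub_eq a u U U1 U2). auto.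
Qed.

Lemma pos_exists : exists u, u ∈ RR /\ Rzero R ≺ u.
Proof.
  assert (O : Rzero R <> Rone R) by apply hR.
  destruct (lt_tricho (Rzero R) (Rone R)) as [H|[H|H]]; auto; [eauto|tauto|].
  exists (neg (Rone R)). split; [auto|]. rewrite <- (add_neg (Rone R)) by auto.
  apply (Rlt_le_trans _ (add (Rzero R) (neg (Rone R)))); [apply add_lt_r; auto|].
  rewrite add_comm, add_0 by auto. apply Rle_refl.
Qed.

(** The Archimedean property comes from completeness: let l be the supremum of the numbers below all
    terms. Since each term is twice the next, l + l is also below all terms, so l + l <= l and l <=
    0. *)
Lemma eps_exists : exists ep, is_fun ep om RR /\
  (forall n, n ∈ om -> Rzero R ≺ ap ep n) /\
  (forall n, n ∈ om -> ap ep (suc n) = half (ap ep n)) /\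
  (forall e, e ∈ RR -> Rzero R ≺ e -> exists n, n ∈ om /\ ap ep n ≺ e).
Proof.
  destruct pos_exists as (u & U & UP). set (ep := nrec u (fun _ v => half v)).
  assert (TE : T2 (fun _ v => half v)) by dsolve.
  assert (E0 : ap ep emp = u) by apply (nrec_0 _ _ TE).
  assert (ES : forall n, n ∈ om -> ap ep (suc n) = half (ap ep n)) by (intros; apply (nrec_S _ _ _ TE); assumption).
  assert (F : is_fun ep om RR) by (apply nrec_fun; [exact TE|exact U|intros; auto]).
  assert (FI : forall n, n ∈ om -> ap ep n ∈ RR) by (intros; apply (ap_mem ep om); assumption).
  assert (EP : forall n, n ∈ om -> Rzero R ≺ ap ep n).
  { nind; [rewrite E0; exact UP|]. intros n N IH. rewrite ES by exact N. apply half_pos; auto. }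
  exists ep. split; [exact F|]. split; [exact EP|]. split; [exact ES|].
  set (L := sep RR (fun x => forall n, n ∈ om -> x ≼ ap ep n)).
  assert (ML : forall x, x ∈ L <-> x ∈ RR /\ forall n, n ∈ om -> x ≼ ap ep n).
  { intros x. unfold L. rewrite mem_sep by dsolve. reflexivity. }
  destruct (lub_spec L) as (L1 & L2 & L3).
  { intros x X. apply ML in X. apply X. }
  { exists (Rzero R). apply ML. split; [auto|]. intros n N. left. auto. }
  { exists (ap ep emp). split; [apply FI, om_emp|]. intros x X. apply ML in X. apply X, om_emp. }
  set (l := lub L) in *.
  assert (LE : forall n, n ∈ om -> l ≼ ap ep n).
  { intros n N. apply L3; [auto|]. intros x X. apply ML in X. apply X, N. }
  assert (L0 : l ≼ Rzero R).
  { apply not_lt_le; auto. intros C. apply (le_not_lt (add l l) l); [|apply add_pos_gt; assumption].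
    apply L2, ML. split; [auto|]. intros n N.
    assert (NS := om_suc n N).
    rewrite <- (half_add (ap ep n)), <- ES by auto.
    apply (Rle_trans _ (add l (ap ep (suc n)))); [apply add_le_l|apply add_le_r]; auto. }
  intros e E E'. apply NNPP. intros C. apply (le_not_lt l (Rzero R) L0).
  apply (Rlt_le_trans _ e); [exact E'|]. apply L2, ML. split; [exact E|].
  intros n N. apply not_lt_le; auto. intros H. apply C. eauto.
Qed.

(* Every real is, up to sign, the supremum of the multiples of the eps_k below it. *)
Lemma BS_real : BS RR.
Proof.
  destruct eps_exists as (ep & F & EP & ES & EI).
  assert (FI : forall n, n ∈ om -> ap ep n ∈ RR) by (intros; apply (ap_mem ep om); assumption).
  set (mk := fun k m => ap (nrec (Rzero R) (fun _ v => add v (ap ep k))) m).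
  assert (TM : forall k m : env -> M, T k -> T m -> T (fun e => mk (k e) (m e))) by (intros; unfold mk; dsolve).
  assert (M0 : forall k, mk k emp = Rzero R) by (intros; apply nrec_0; dsolve).
  assert (MS : forall k m, m ∈ om -> mk k (suc m) = add (mk k m) (ap ep k)).
  { intros k m Hm. unfold mk. rewrite nrec_S; [reflexivity|dsolve|exact Hm]. }
  assert (MI : forall k, k ∈ om -> forall m, m ∈ om -> mk k m ∈ RR).
  { intros k K. nind; [rewrite M0; auto|]. intros m Hm IH. rewrite MS; auto. }
  (* If the multiples of eps_k were bounded, their supremum less eps_k would still be a bound. *)
  assert (ARCH : forall k r, k ∈ om -> r ∈ RR -> exists m, m ∈ om /\ r ≺ mk k m).
  { intros k r K HR'. apply NNPP. intros C.
    destruct (lub_spec (rep om (mk k))) as (L1 & L2 & L3).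
    - intros x X. rewrite mem_rep in X by dsolve. destruct X as (m & Hm & ->). auto.
    - exists (mk k emp). rewrite mem_rep by dsolve. exists emp. auto using om_emp.
    - exists r. split; [exact HR'|]. intros x X. rewrite mem_rep in X by dsolve.
      destruct X as (m & Hm & ->). apply not_lt_le; auto. intros H. apply C. eauto.
    - set (l := lub (rep om (mk k))) in *.
      apply (le_not_lt l (add l (neg (ap ep k)))).
      + apply L3; [auto|]. intros x X. rewrite mem_rep in X by dsolve. destruct X as (m & Hm & ->).
        rewrite <- (add_neg_r (mk k m) (ap ep k)), <- MS by auto.
        apply add_le_r; auto using om_suc. apply L2. rewrite mem_rep by dsolve. exists (suc m). auto using om_suc.
      + rewrite <- (add_neg_l l (ap ep k)) at 2 by auto. apply add_pos_gt; auto. }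
  set (V := fun c => lub (sep RR (fun x => exists m k, m ∈ om /\ k ∈ om /\ ap c (pr m k) <> emp /\ x = mk k m))).
  assert (TV : forall c : env -> M, T c -> T (fun e => V (c e))) by (intros; unfold V; dsolve).
  assert (POS : forall r, r ∈ RR -> Rzero R ≼ r -> exists c, c ∈ Bs /\ V c = r).
  (* c marks the pairs (m, k) for which m times eps_k is at most r. *)
  { intros r HR' P. set (c := lam om (fun i => ite (mk (p2 i) (p1 i) ≼ r) (suc emp) emp)).
    assert (C : c ∈ Bs).
    { apply Bs_lam; [dsolve|]. intros i I. destruct (classic (mk (p2 i) (p1 i) ≼ r)) as [H|H];
        [rewrite ite_true by exact H; apply om_suc, om_emp|rewrite ite_false by exact H; apply om_emp]. }
    assert (CE : forall m k, m ∈ om -> k ∈ om -> (ap c (pr m k) <> emp <-> mk k m ≼ r)).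
    { intros m k Hm K. unfold c. rewrite ap_lam by (dsolve || apply pr_om; assumption).
      rewrite p1_pr, p2_pr by assumption. destruct (classic (mk k m ≼ r)) as [H|H].
      - rewrite ite_true by exact H. pose proof (suc_not_emp emp). tauto.
      - rewrite ite_false by exact H. tauto. }
    exists c. split; [exact C|]. apply lub_eq; [exact HR'| |].
    - intros x X. apply mem_sep in X; [|dsolve]. destruct X as (_ & m & k & Hm & K & H & ->). apply CE; assumption.
    (* If some v < r bounded all marked multiples, take eps_k < r - v: the last multiple of eps_k
       not exceeding r is above v. *)
    - intros v HV UB. apply not_lt_le; auto. intros L.
      destruct (EI (add r (neg v))) as (k & K & HK); [auto|apply diff_pos; assumption|].
      destruct (nat_least (fun m => r ≺ mk k m)) as (m & Hm & A & MIN); [dsolve|apply ARCH; assumption|].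
      destruct (nat_cases m Hm) as [->|(m' & Hm' & ->)].
      + rewrite M0 in A. exact (le_not_lt _ _ P A).
      + assert (B : mk k m' ≼ r) by (apply not_lt_le; auto; apply MIN, suc_self).
        assert (B' : mk k m' ≼ v).
        { apply UB. apply mem_sep; [dsolve|]. split; [auto|]. exists m', k. rewrite CE by assumption. auto. }
        rewrite MS in A by exact Hm'. apply (lt_irrefl r).
        apply (lt_trans _ (add (mk k m') (ap ep k))); [exact A|].
        apply (Rle_lt_trans _ (add v (ap ep k))); [apply add_le_r; auto|].
        rewrite <- (add_neg_l r v) by auto. rewrite (add_comm v) by auto. apply add_lt_r; auto. }
  (* Digit 0 of the odd half carries the sign. *)
  apply (surj_lam (fun c => ite (ap (odd c) emp = emp) (V (evn c)) (neg (V (evn c)))) Bs RR (Rzero R)); [dsolve|auto|].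
  intros r HR'. destruct (classic (Rzero R ≼ r)) as [H|H].
  - destruct (POS r HR' H) as (c & C & <-). exists (il c zero). split; [apply il_Bs; auto using zero_Bs|].
    rewrite evn_il, odd_il by auto using zero_Bs. rewrite ite_true; [reflexivity|].
    unfold zero. rewrite ap_lam; [reflexivity|dsolve|apply om_emp].
  - assert (NR : Rzero R ≼ neg r).
    { apply not_lt_le; auto. intros C. apply H. left. rewrite <- (add_neg r) by auto.
      apply (Rlt_le_trans _ (add r (Rzero R))); [apply add_lt_l; auto|]. rewrite add_0; auto using Rle_refl. }
    destruct (POS (neg r) (neg_in r HR') NR) as (c & C & E).
    set (o := lam om (fun _ => suc emp)).
    assert (O : o ∈ Bs) by (apply Bs_lam; [dsolve|auto using om_suc, om_emp]).
    exists (il c o). split; [apply il_Bs; auto|].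
    rewrite evn_il, odd_il by auto. rewrite ite_false.
    + rewrite E. symmetry. apply neg_eq; auto. rewrite add_comm; auto. apply add_neg, HR'.
    + unfold o. rewrite ap_lam by (dsolve || apply om_emp). apply suc_not_emp.
Qed.

(* A Cantor scheme: the n-th bit of x adds d_n/2 at an interval of length d_n,
   and d_(n+1) = d_n/4. *)
Lemma real_BS : exists q, is_surjection q RR Bs.
Proof.
  destruct pos_exists as (u & HU & UP).
  set (d := nrec u (fun _ v => half (half v))).
  assert (TD : T2 (fun _ v => half (half v))) by dsolve.
  assert (D0 : ap d emp = u) by apply (nrec_0 _ _ TD).
  assert (DS : forall n, n ∈ om -> ap d (suc n) = half (half (ap d n))) by (intros; apply (nrec_S _ _ _ TD); assumption).
  assert (DI : forall n, n ∈ om -> ap d n ∈ RR).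
  { intros n N. apply (ap_mem d om); [|exact N]. apply nrec_fun; [exact TD|exact HU|auto]. }
  assert (DP : forall n, n ∈ om -> Rzero R ≺ ap d n).
  { nind; [rewrite D0; exact UP|]. intros n N IH. rewrite DS by exact N. apply half_pos, half_pos; auto. }
  (* Bit m says whether m codes a pair (i, x(i)): x enters the scheme through the characteristic
     function of its graph. *)
  set (on := fun x m => m = pr (p1 m) (ap x (p1 m))).
  set (A := fun x n => ap (nrec (Rzero R) (fun n v => ite (on x n) (add v (half (ap d n))) v)) n).
  assert (TA : forall x n : env -> M, T x -> T n -> T (fun e => A (x e) (n e))) by (intros; unfold A, on; dsolve).
  assert (TN : forall x, T2 (fun n v => ite (on x n) (add v (half (ap d n))) v)) by (intros; unfold on; dsolve).
  assert (A0 : forall x, A x emp = Rzero R) by (intros; apply nrec_0, TN).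
  assert (A1 : forall x n, n ∈ om -> on x n -> A x (suc n) = add (A x n) (half (ap d n))).
  { intros x n N H. unfold A. rewrite nrec_S by auto. apply ite_true, H. }
  assert (A2 : forall x n, n ∈ om -> ~ on x n -> A x (suc n) = A x n).
  { intros x n N H. unfold A at 1. rewrite nrec_S by auto. apply ite_false, H. }
  assert (AI : forall x n, n ∈ om -> A x n ∈ RR).
  { intros x. nind; [rewrite A0; auto|]. intros n N IH. destruct (classic (on x n)) as [H|H];
      [rewrite A1|rewrite A2]; auto. }
  assert (AM : forall x n, n ∈ om -> A x n ≼ A x (suc n)).
  { intros x n N. destruct (classic (on x n)) as [H|H]; [rewrite A1 by assumption|rewrite A2 by assumption; apply Rle_refl].
    left. apply add_pos_gt; auto. apply half_pos; auto. }
  assert (AM' : forall x n, n ∈ om -> forall m, ord_le m n -> m ∈ om -> A x m ≼ A x n).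
  { intros x. nind.
    - intros m [Hm| ->] _; [destruct (mem_emp m Hm)|apply Rle_refl].
    - intros n N IH m [Hm| ->] HO; [|apply Rle_refl]. apply (Rle_trans _ (A x n)); [|auto].
      apply IH; [apply mem_suc_le, Hm|exact HO]. }
  assert (AD1 : forall x n, n ∈ om -> add (A x (suc n)) (ap d (suc n)) ≼ add (A x n) (ap d n)).
  { intros x n N. rewrite DS by exact N.
    assert (H1 : half (half (ap d n)) ≺ half (ap d n)) by (apply half_lt; auto; apply half_pos; auto).
    destruct (classic (on x n)) as [H|H].
    - rewrite A1 by assumption. rewrite add_assoc by auto. apply add_le_l; auto. left.
      rewrite <- (half_add (ap d n)) at 3 by auto. apply add_lt_l; auto.
    - rewrite A2 by assumption. apply add_le_l; auto. left. apply (lt_trans _ (half (ap d n))); [exact H1|apply half_lt; auto]. }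
  assert (AD2 : forall x m, m ∈ om -> forall n, n ∈ om -> ord_le n m -> add (A x m) (ap d m) ≼ add (A x n) (ap d n)).
  { intros x. nind.
    - intros n N [Hn| ->]; [destruct (mem_emp n Hn)|apply Rle_refl].
    - intros m Hm IH n N [Hn| ->]; [|apply Rle_refl].
      apply (Rle_trans _ (add (A x m) (ap d m))); [auto|]. apply IH; [exact N|apply mem_suc_le, Hn]. }
  assert (AB : forall x n m, n ∈ om -> m ∈ om -> A x m ≼ add (A x n) (ap d n)).
  { intros x n m N Hm. destruct (ord_le_or_lt m n (nat_ord m Hm) (nat_ord n N)) as [L|L].
    - apply (Rle_trans _ (A x n)); [auto|]. left. apply add_pos_gt; auto.
    - apply (Rle_trans _ (add (A x m) (ap d m))); [left; apply add_pos_gt; auto|].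
      apply AD2; [exact Hm|exact N|left; exact L]. }
  set (rr := fun x => lub (rep om (A x))).
  assert (TR : forall x : env -> M, T x -> T (fun e => rr (x e))) by (intros; unfold rr; dsolve).
  assert (RS : forall x, rr x ∈ RR /\ (forall n, n ∈ om -> A x n ≼ rr x) /\
    forall v, v ∈ RR -> (forall n, n ∈ om -> A x n ≼ v) -> rr x ≼ v).
  { intros x. destruct (lub_spec (rep om (A x))) as (L1 & L2 & L3).
    - intros z Z. rewrite mem_rep in Z by dsolve. destruct Z as (m & Hm & ->). auto.
    - exists (A x emp). rewrite mem_rep by dsolve. exists emp. auto using om_emp.
    - exists (add (A x emp) (ap d emp)). split; [auto using om_emp|]. intros z Z. rewrite mem_rep in Z by dsolve.
      destruct Z as (m & Hm & ->). auto using om_emp.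
    - split; [exact L1|]. split.
      + intros n N. apply L2. rewrite mem_rep by dsolve. eauto.
      + intros v HV H. apply L3; [exact HV|]. intros z Z. rewrite mem_rep in Z by dsolve. destruct Z as (m & Hm & ->). auto. }
  assert (SAME : forall x y n, n ∈ om -> (forall m, m ∈ n -> (on x m <-> on y m)) -> A x n = A y n).
  { assert (DO : forall x n : env -> M, T x -> T n -> D (fun e => on (x e) (n e))) by (intros; unfold on; dsolve).
    intros x y. nind; [rewrite !A0; reflexivity|]. intros n N IH H.
    assert (E : A x n = A y n) by (apply IH; intros m Hm; apply H, mem_suc; auto).
    specialize (H n (suc_self n)). destruct (classic (on x n)) as [C|C].
    - rewrite !A1, E by (assumption || apply H, C). reflexivity.
    - rewrite !A2, E by (assumption || (intros Q; apply C, H, Q)). reflexivity. }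
  (* At the first differing bit n, with A the common partial sum, the real of y is at most A + d_n/4
     while that of x is at least A + d_n/2. *)
  assert (SEP : forall x y n, n ∈ om -> (forall m, m ∈ n -> (on x m <-> on y m)) -> on x n -> ~ on y n -> rr y ≺ rr x).
  { intros x y n N H X Y. destruct (RS x) as (X1 & X2 & X3), (RS y) as (Y1 & Y2 & Y3).
    assert (NS := om_suc n N).
    apply (Rle_lt_trans _ (add (A y (suc n)) (ap d (suc n)))).
    - apply Y3; auto.
    - apply (Rlt_le_trans _ (A x (suc n))); [|apply X2, NS].
      rewrite (A1 x), (A2 y), DS, (SAME x y n N H) by assumption. apply add_lt_l; auto.
      apply half_lt; auto. apply half_pos; auto. }
  assert (INJ : forall x y, x ∈ Bs -> y ∈ Bs -> rr x = rr y -> x = y).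
  { assert (DO : forall x n : env -> M, T x -> T n -> D (fun e => on (x e) (n e))) by (intros; unfold on; dsolve).
    intros x y X Y E. assert (H : forall n, n ∈ om -> (on x n <-> on y n)).
    { intros n N. apply NNPP. intros C. destruct (nat_least (fun n => ~ (on x n <-> on y n))) as (m & Hm & C' & MIN);
        [dsolve|eauto|]. assert (MIN' : forall k, k ∈ m -> (on x k <-> on y k)) by (intros k K; apply NNPP, MIN, K).
      destruct (classic (on x m)) as [P|P].
      - apply (lt_irrefl (rr x)). rewrite E at 1. apply (SEP x y m Hm MIN' P). intros Q. apply C'. split; intros _; assumption.
      - apply (lt_irrefl (rr x)). rewrite E at 2. apply (SEP y x m Hm); [|apply NNPP; intros Q; apply C'; split; intros; contradiction|exact P].
        intros k K. symmetry. exact (MIN' k K). }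
    apply Bs_ext; [exact X|exact Y|]. intros n N.
    assert (XN := Bs_ap x n X N).
    assert (P : on x (pr n (ap x n))) by (unfold on; rewrite p1_pr by assumption; reflexivity).
    apply H in P; [|apply pr_om; assumption]. unfold on in P. rewrite p1_pr in P by assumption.
    apply pr_inj in P; [apply P|assumption|assumption|assumption|apply Bs_ap; assumption]. }
  apply (surj_lam (fun r => the (fun x => x ∈ Bs /\ rr x = r)) RR Bs zero); [dsolve|apply zero_Bs|].
  intros x X. exists (rr x). split; [apply RS|]. symmetry. apply the_eq; [auto|].
  intros y [Y E]. exact (INJ y x Y X E).
Qed.
End RealLine.

#[export] Hint Resolve T_add D_Rlt D_Rle T_neg T_half T_lub : dfn.

(* X is identified with a retract of Baire space through s and pi; coded_open
   says that the sets {y | s y and s x agree below k} are a base of the topology. *)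
Record coded {M : set_structure} {hZF : ZF_model M} (X TT s pi dp : M) : Prop := Coded {
  coded_s : is_fun s X Bs;
  coded_pi : is_fun pi Bs X;
  coded_ret : forall x, x ∈ X -> ap pi (ap s x) = x;
  coded_open : forall V, V ∈ TT <-> subset V X /\ forall x, x ∈ V ->
    exists k, k ∈ om /\ forall y, y ∈ X -> agree k (ap s x) (ap s y) -> y ∈ V;
  coded_cont : forall b n, b ∈ Bs -> n ∈ om -> exists k, k ∈ om /\
    forall b', b' ∈ Bs -> agree k b b' -> agree n (ap s (ap pi b)) (ap s (ap pi b'));
  coded_closed : forall b, b ∈ Bs ->
    (forall k, k ∈ om -> exists x, x ∈ X /\ agree k b (ap s x)) -> ap s (ap pi b) = b;
  coded_dp : is_fun dp om X;
  coded_dense : forall x k, x ∈ X -> k ∈ om ->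
    exists i, i ∈ om /\ agree k (ap s x) (ap s (ap dp i))
}.

(** * Zero-dimensional Polish spaces as retracts of Baire space *)

Section PolishCoding.
Context {M : set_structure} {hZF : ZF_model M}.
Implicit Types a b c f g h x y z u v p m n k i j l w r : M.
Notation env := (nat -> M).
Context (R : ordered_field_data M) (hR : is_real_line R) (hDC : DC_reals R).
Notation RR := (Rset R).
Notation "x ≺ y" := (Rlt R x y) (at level 70).
Notation "x ≼ y" := (Rle R x y) (at level 70).
Notation add := (add R).
Context (X TT d : M) (hd : is_metric R X d) (hcomplete : complete_metric R X d)
  (hT : induces_topology R X d TT) (hsep : separable X TT) (hzero : zero_dimensional X TT)
  (x0 : M) (hx0 : x0 ∈ X).

Definition cp C : M := sep X (fun y => y ∉ C).
Lemma T_cp (C : env -> M) : T C -> T (fun e => cp (C e)).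
Proof. intros. unfold cp. dsolve. Qed.
Hint Resolve T_cp : dfn.
Lemma mem_cp C y : y ∈ cp C <-> y ∈ X /\ y ∉ C.
Proof. unfold cp. rewrite mem_sep by dsolve. reflexivity. Qed.

Definition dist x y : M := ap d (op x y).
Lemma T_dist (x y : env -> M) : T x -> T y -> T (fun e => dist (x e) (y e)).
Proof. intros. unfold dist. dsolve. Qed.
Hint Resolve T_dist : dfn.
Lemma app2_d x y r : app2 d x y r <-> x ∈ X /\ y ∈ X /\ r = dist x y.
Proof. apply (app2_iff d X X RR). apply hd. Qed.
Lemma dist_lt_iff x y r : dist_lt R d x y r <-> x ∈ X /\ y ∈ X /\ dist x y ≺ r.
Proof.
  unfold dist_lt. split.
  - intros (t & A & B). apply app2_d in A. destruct A as (A & B' & ->). auto.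
  - intros (A & B & C). exists (dist x y). rewrite app2_d. auto.
Qed.
Lemma dist_in x y : x ∈ X -> y ∈ X -> dist x y ∈ RR.
Proof. apply fun2_mem. apply hd. Qed.
Lemma dist_sym x y : x ∈ X -> y ∈ X -> dist x y = dist y x.
Proof.
  intros A B. destruct hd as (_ & _ & _ & S & _).
  assert (H : app2 d y x (dist x y)) by (apply S, app2_d; auto). apply app2_d in H. apply H.
Qed.
Lemma dist_zero x y : x ∈ X -> y ∈ X -> (dist x y = Rzero R <-> x = y).
Proof. intros A B. destruct hd as (_ & _ & S & _). apply S, app2_d. auto. Qed.
Lemma dist_nonneg x y : x ∈ X -> y ∈ X -> Rzero R ≼ dist x y.
Proof. intros A B. destruct hd as (_ & S & _). apply (S x y), app2_d. auto. Qed.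
Lemma dist_triangle x y z : x ∈ X -> y ∈ X -> z ∈ X -> dist x z ≼ add (dist x y) (dist y z).
Proof.
  intros A B C. destruct hd as (_ & _ & _ & _ & S).
  apply (S x y z (dist x y) (dist y z)); try (apply app2_d; auto).
  apply app2_add; [exact hR|]. auto using dist_in.
Qed.

Definition near x (P : M -> Prop) : Prop :=
  exists r, r ∈ RR /\ Rzero R ≺ r /\ forall y, y ∈ X -> dist x y ≺ r -> P y.

Lemma near_mono x (P Q : M -> Prop) : near x P -> (forall y, y ∈ X -> P y -> Q y) -> near x Q.
Proof. intros (r & A & B & C) H. exists r. auto. Qed.

Lemma near_and x (P Q : M -> Prop) : x ∈ X -> near x P -> near x Q -> near x (fun y => P y /\ Q y).
Proof.
  intros HX (r & A & B & C) (r' & A' & B' & C').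
  destruct (lt_tricho R hR r r' A A') as [L|[<-|L]].
  - exists r. split; [exact A|]. split; [exact B|]. intros y Y H. split; [auto|].
    apply C'; [exact Y|]. apply (lt_trans R hR _ r); assumption.
  - exists r. auto.
  - exists r'. split; [exact A'|]. split; [exact B'|]. intros y Y H. split; [|auto].
    apply C; [exact Y|]. apply (lt_trans R hR _ r'); assumption.
Qed.

Lemma open_iff U : U ∈ TT <-> subset U X /\ forall x, x ∈ U -> near x (fun y => y ∈ U).
Proof.
  rewrite (hT U). split; intros [S H]; (split; [exact S|]); intros x HX;
    destruct (H x HX) as (r & A & B & C); exists r; (split; [exact A|]); (split; [exact B|]);
    intros y Y L; apply C; try exact Y; try exact L.
  - apply dist_lt_iff. auto.
  - apply dist_lt_iff in L. apply L.
Qed.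

Lemma near_clopen C x : C ∈ TT -> cp C ∈ TT -> x ∈ X -> near x (fun y => x ∈ C <-> y ∈ C).
Proof.
  intros A B HX. destruct (classic (x ∈ C)) as [H|H].
  - apply open_iff in A. apply (near_mono x (fun y => y ∈ C)); [apply A, H|]. tauto.
  - apply open_iff in B. apply (near_mono x (fun y => y ∈ cp C)); [apply B, mem_cp; auto|].
    intros y Y H'. apply mem_cp in H'. tauto.
Qed.

Lemma dense_sequence : exists dp, is_fun dp om X /\
  forall U, U ∈ TT -> (exists y, y ∈ U) -> exists k, k ∈ om /\ ap dp k ∈ U.
Proof.
  destruct hsep as (D & DX & (w & i & W & [Fi Ii]) & H). apply is_omega_om in W. subst w.
  set (F := fun k => ite (exists x, x ∈ D /\ ap i x = k) (the (fun x => x ∈ D /\ ap i x = k)) x0).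
  assert (TF : T1 F) by (unfold F; dsolve).
  assert (FE : forall x, x ∈ D -> F (ap i x) = x).
  { intros x HX. unfold F. rewrite ite_true by eauto. apply the_eq; [auto|].
    intros z [Z1 Z2]. apply (Ii z x (ap i x)); [rewrite <- Z2|]; apply (app_ap i D om); assumption. }
  exists (lam om F). split.
  - apply lam_fun; [exact TF|]. intros k K. destruct (classic (exists x, x ∈ D /\ ap i x = k)) as [(x & A & <-)|C].
    + rewrite FE by exact A. apply DX, A.
    + unfold F. rewrite ite_false by exact C. exact hx0.
  - intros U HU [y Y]. destruct (H U HU) as (x & A & B).
    + intros E. exact (E y Y).
    + assert (K : ap i x ∈ om) by (apply (ap_mem i D); assumption).
      exists (ap i x). split; [exact K|]. rewrite ap_lam by assumption. rewrite FE by exact A. exact B.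
Qed.

Definition diam_lt C r : Prop := forall y z, y ∈ C -> z ∈ C -> dist y z ≺ r.

(** The clopen sets have to be chosen, which is possible because open sets are coded by reals
    through the basic balls they contain. For each n and each basic ball one picks a clopen set of
    diameter below eps_n containing the ball, if there is one, and the empty set otherwise. *)
Lemma clopen_covers (ep : M) (Fe : is_fun ep om RR) (Pe : forall n, n ∈ om -> Rzero R ≺ ap ep n)
  (Ie : forall r, r ∈ RR -> Rzero R ≺ r -> exists n, n ∈ om /\ ap ep n ≺ r)
  (dp : M) (Fd : is_fun dp om X)
  (dense : forall U, U ∈ TT -> (exists y, y ∈ U) -> exists k, k ∈ om /\ ap dp k ∈ U) :
  exists Cl, forall n, n ∈ om ->
    (forall m, m ∈ om -> ap Cl (pr n m) ∈ TT /\ cp (ap Cl (pr n m)) ∈ TT /\ diam_lt (ap Cl (pr n m)) (ap ep n)) /\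
    (forall x, x ∈ X -> exists m, m ∈ om /\ x ∈ ap Cl (pr n m)).
Proof.
  assert (De : forall n, n ∈ om -> ap ep n ∈ RR) by (intros; apply (ap_mem ep om); assumption).
  assert (Dd : forall n, n ∈ om -> ap dp n ∈ X) by (intros; apply (ap_mem dp om); assumption).
  set (ball := fun x r => sep X (fun y => dist x y ≺ r)).
  assert (TB : forall x r : env -> M, T x -> T r -> T (fun e => ball (x e) (r e))) by (intros; unfold ball; dsolve).
  assert (MB : forall x r y, y ∈ ball x r <-> y ∈ X /\ dist x y ≺ r).
  { intros x r y. unfold ball. rewrite mem_sep by dsolve. reflexivity. }
  assert (OB : forall x r, x ∈ X -> r ∈ RR -> ball x r ∈ TT).
  { intros x r HX Hr. apply open_iff. split; [intros y Y; apply MB in Y; apply Y|].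
    intros y Y. apply MB in Y. destruct Y as [Y L].
    assert (DI : dist x y ∈ RR) by (apply dist_in; assumption).
    exists (add r (neg R (dist x y))). split; [apply add_in, neg_in; assumption|].
    split; [apply diff_pos; assumption|]. intros z Z L'. apply MB. split; [exact Z|].
    apply (Rle_lt_trans R hR _ (add (dist x y) (dist y z))); [apply dist_triangle; assumption|].
    rewrite <- (add_neg_l R hR r (dist x y)) by assumption.
    rewrite (add_comm R hR (dist x y)) by auto using dist_in.
    apply add_lt_r; auto using dist_in, add_in, neg_in. }
  (* A centre within eps_j of x and the radius eps_j < r/2 give a basic ball that contains x and
     stays within r of it. *)
  assert (FINE : forall x r, x ∈ X -> r ∈ RR -> Rzero R ≺ r -> exists i j, i ∈ om /\ j ∈ om /\
    x ∈ ball (ap dp i) (ap ep j) /\ forall y, y ∈ ball (ap dp i) (ap ep j) -> dist x y ≺ r).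
  { intros x r HX Hr HP. destruct (Ie (half R r)) as (j & J & HJ); [apply half_in; assumption|apply half_pos; assumption|].
    assert (HH := half_in R hR r Hr).
    destruct (dense (ball x (ap ep j))) as (i & I & HI); [apply OB; auto| |].
    { exists x. apply MB. split; [exact HX|]. rewrite (proj2 (dist_zero x x HX HX) eq_refl). auto. }
    apply MB in HI. exists i, j. split; [exact I|]. split; [exact J|]. split.
    - apply MB. split; [exact HX|]. rewrite dist_sym by auto. apply HI.
    - intros y Y. apply MB in Y.
      apply (Rle_lt_trans R hR _ (add (dist x (ap dp i)) (dist (ap dp i) y))); [apply dist_triangle; [|auto|]; tauto|].
      rewrite <- (half_add R hR r Hr).
      apply (add_lt R hR); auto using dist_in; try (apply dist_in; [auto|apply Y]).
      + apply (lt_trans R hR _ (ap ep j)); [apply HI|exact HJ].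
      + apply (lt_trans R hR _ (ap ep j)); [apply Y|exact HJ]. }
  assert (ET : emp ∈ TT).
  { apply open_iff. split; intros y Y; destruct (mem_emp y Y). }
  assert (BT : BS TT).
  { apply (surj_lam (fun c => sep X (fun y => exists i j, i ∈ om /\ j ∈ om /\ ap c (pr i j) <> emp /\
      y ∈ ball (ap dp i) (ap ep j))) Bs TT emp); [dsolve|exact ET|].
    intros U HU. apply open_iff in HU. destruct HU as [US UN].
    exists (lam om (fun m => ite (subset (ball (ap dp (p1 m)) (ap ep (p2 m))) U) (suc emp) emp)). split.
    - apply Bs_lam; [dsolve|]. intros m Hm.
      destruct (classic (subset (ball (ap dp (p1 m)) (ap ep (p2 m))) U)) as [H|H];
        [rewrite ite_true by exact H; apply om_suc, om_emp|rewrite ite_false by exact H; apply om_emp].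
    - apply ext. intros y. rewrite mem_sep by dsolve. split.
      + intros Y. split; [apply US, Y|]. destruct (UN y Y) as (r & Hr & HP & H).
        destruct (FINE y r) as (i & j & I & J & A & B); [apply US, Y|exact Hr|exact HP|].
        exists i, j. split; [exact I|]. split; [exact J|]. split; [|exact A].
        rewrite ap_lam by (dsolve || apply pr_om; assumption). rewrite p1_pr, p2_pr by assumption.
        rewrite ite_true; [apply suc_not_emp|]. intros z Z. apply H; [apply MB in Z; apply Z|apply B, Z].
      + intros (Y & i & j & I & J & A & B).
        rewrite ap_lam in A by (dsolve || apply pr_om; assumption). rewrite p1_pr, p2_pr in A by assumption.
        apply NNPP. intros C. apply A, ite_false. intros S. apply C, S, B. }
  set (good := fun n m C => C ∈ TT /\ cp C ∈ TT /\ diam_lt C (ap ep n) /\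
    subset (ball (ap dp (p1 m)) (ap ep (p2 m))) C).
  assert (DG : forall n m C : env -> M, T n -> T m -> T C -> D (fun e => good (n e) (m e) (C e)))
    by (intros; unfold good, diam_lt; dsolve).
  destruct (countable_choice R hDC (real_BS R hR) TT (fun k C => (exists C', good (p1 k) (p2 k) C') -> good (p1 k) (p2 k) C))
    as (h & _ & HH); [dsolve|exact BT| |].
  { intros k K. destruct (classic (exists C', good (p1 k) (p2 k) C')) as [(C & HC)|H].
    - exists C. split; [apply HC|auto].
    - exists emp. split; [exact ET|tauto]. }
  exists (lam om (fun k => ite (good (p1 k) (p2 k) (ap h k)) (ap h k) emp)).
  intros n N. assert (E : forall m, m ∈ om -> ap (lam om (fun k => ite (good (p1 k) (p2 k) (ap h k)) (ap h k) emp)) (pr n m)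
    = ite (good n m (ap h (pr n m))) (ap h (pr n m)) emp).
  { intros m Hm. rewrite ap_lam by (dsolve || apply pr_om; assumption). rewrite p1_pr, p2_pr by assumption. reflexivity. }
  split.
  - intros m Hm. rewrite E by exact Hm. destruct (classic (good n m (ap h (pr n m)))) as [H|H].
    + rewrite ite_true by exact H. destruct H as (A & B & C & _). auto.
    + rewrite ite_false by exact H. split; [exact ET|]. split.
      * apply open_iff. split; [intros y Y; apply mem_cp in Y; apply Y|]. intros x HX.
        apply mem_cp in HX. exists (ap ep n). split; [auto|]. split; [auto|].
        intros y Y _. apply mem_cp. split; [exact Y|apply mem_emp].
      * intros y z Y. destruct (mem_emp y Y).
  - intros x HX. set (b := ball x (half R (ap ep n))).
    assert (HR := half_in R hR (ap ep n) (De n N)).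
    assert (HP := half_pos R hR (ap ep n) (De n N) (Pe n N)).
    destruct (hzero b x) as (C & CT & (_ & V & CV & VT) & XC & CB).
    { apply OB; assumption. }
    { apply MB. split; [exact HX|]. rewrite (proj2 (dist_zero x x HX HX) eq_refl). exact HP. }
    assert (VE : V = cp C) by (apply ext; intros z; rewrite (CV z), mem_cp; reflexivity). subst V.
    pose proof CT as CT'. apply open_iff in CT'. destruct CT' as [_ CN]. destruct (CN x XC) as (r & Hr & HrP & HN).
    destruct (FINE x r HX Hr HrP) as (i & j & I & J & A & B).
    exists (pr i j). split; [apply pr_om; assumption|]. rewrite E by (apply pr_om; assumption).
    assert (G : good n (pr i j) C).
    { split; [exact CT|]. split; [exact VT|]. split.
      - intros y z Y Z. apply CB, MB in Y. apply CB, MB in Z.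
        apply (Rle_lt_trans R hR _ (add (dist y x) (dist x z))); [apply dist_triangle; tauto|].
        rewrite <- (half_add R hR (ap ep n) (De n N)).
        apply (add_lt R hR); try apply dist_in; try tauto. rewrite dist_sym; tauto.
      - rewrite p1_pr, p2_pr by assumption. intros y Y. apply HN; [apply MB in Y; apply Y|apply B, Y]. }
    specialize (HH (pr n (pr i j)) (pr_om n (pr i j) N (pr_om i j I J))). cbv beta in HH.
    rewrite p1_pr, p2_pr in HH by auto using pr_om.
    assert (G' : good n (pr i j) (ap h (pr n (pr i j)))) by (apply HH; eauto).
    rewrite ite_true by exact G'. destruct G' as (_ & _ & _ & G'). apply G'.
    rewrite p1_pr, p2_pr by assumption. exact A.
Qed.

Theorem polish_coding : exists s pi dp, coded X TT s pi dp.
Proof.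
  destruct (eps_exists R hR) as (ep & Fe & Pe & _ & Ie).
  destruct dense_sequence as (dp & Fd & dense).
  destruct (clopen_covers ep Fe Pe Ie dp Fd dense) as (Cl & HCl).
  assert (De : forall n, n ∈ om -> ap ep n ∈ RR) by (intros; apply (ap_mem ep om); assumption).
  assert (Dd : forall n, n ∈ om -> ap dp n ∈ X) by (intros; apply (ap_mem dp om); assumption).
  (* Digit n of the code of x: the first member of the n-th cover that contains x. *)
  set (lst := fun n x => the (fun m => m ∈ om /\ x ∈ ap Cl (pr n m) /\ forall l, l ∈ m -> x ∉ ap Cl (pr n l))).
  assert (TL : forall n x : env -> M, T n -> T x -> T (fun e => lst (n e) (x e))) by (intros; unfold lst; dsolve).
  assert (UL : forall n x m m', m ∈ om -> m' ∈ om -> (x ∈ ap Cl (pr n m) /\ forall l, l ∈ m -> x ∉ ap Cl (pr n l)) ->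
     (x ∈ ap Cl (pr n m') /\ forall l, l ∈ m' -> x ∉ ap Cl (pr n l)) -> m = m').
  { intros n x m m' Hm Hm' [A B] [A' B'].
    destruct (ord_tricho m m' (nat_ord m Hm) (nat_ord m' Hm')) as [C|[C|C]]; [destruct (B' m C A)|exact C|destruct (B m' C A')]. }
  assert (LS : forall n x, n ∈ om -> x ∈ X -> lst n x ∈ om /\ x ∈ ap Cl (pr n (lst n x)) /\
    forall l, l ∈ lst n x -> x ∉ ap Cl (pr n l)).
  { intros n x N HX. unfold lst. apply (the_ext (fun m => m ∈ om /\ x ∈ ap Cl (pr n m) /\ forall l, l ∈ m -> x ∉ ap Cl (pr n l))).
    - apply nat_least; [dsolve|]. apply (HCl n N), HX.
    - intros m m' [A B] [A' B']. apply (UL n x); assumption. }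
  clearbody lst.
  set (s := fun x => lam om (fun n => lst n x)).
  assert (TS : forall x : env -> M, T x -> T (fun e => s (x e))) by (intros; unfold s; dsolve).
  assert (SE : forall x n, n ∈ om -> ap (s x) n = lst n x).
  { intros x n N. unfold s. rewrite ap_lam; [reflexivity|dsolve|exact N]. }
  assert (SB : forall x, x ∈ X -> s x ∈ Bs).
  { intros x HX. apply Bs_lam; [dsolve|]. intros n N. apply LS; assumption. }
  clearbody s.
  (* Membership in finitely many clopen sets is constant near x, whence each digit of the code is
     locally constant. *)
  assert (LOC1 : forall n x, n ∈ om -> x ∈ X -> forall m, m ∈ om ->
    near x (fun y => forall l, l ∈ m -> (x ∈ ap Cl (pr n l) <-> y ∈ ap Cl (pr n l)))).
  { assert (DN : forall (x : M) (P : env -> M -> Prop), D (fun e => P (fun q : nat => e (S q)) (e 0)) -> D (fun e => near x (P e))).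
    { intros x P HP. unfold near. apply D_ex. apply D_and; [dsolve|]. apply D_and; [dsolve|].
      apply D_all. apply D_imp; [dsolve|]. apply D_imp; [dsolve|].
      exact (D_ren _ (fun q : nat => match q with O => O | S q' => S (S q') end) HP). }
    intros n x N HX. match goal with |- forall m, m ∈ om -> @?P m => apply (nat_ind_D P) end; cbv beta.
    - apply (DN x (fun e y => forall l, l ∈ e 0 -> (x ∈ ap Cl (pr n l) <-> y ∈ ap Cl (pr n l)))). dsolve.
    - destruct (pos_exists R hR) as (u & U & UP). exists u. split; [exact U|]. split; [exact UP|].
      intros y _ _ l L. destruct (mem_emp l L).
    - intros m Hm IH. destruct (proj1 (HCl n N) m Hm) as (A & B & _).
      apply (near_mono x _ _ (near_and x _ _ HX IH (near_clopen _ x A B HX))).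
      intros y Y [H1 H2] l L. apply mem_suc in L. destruct L as [L| ->]; [exact (H1 l L)|exact H2]. }
  assert (LOC2 : forall n x, n ∈ om -> x ∈ X -> near x (fun y => ap (s x) n = ap (s y) n)).
  { intros n x N HX. destruct (LS n x N HX) as (A & B & C).
    apply (near_mono x _ _ (LOC1 n x N HX (suc (lst n x)) (om_suc _ A))).
    intros y Y H. rewrite !SE by exact N. destruct (LS n y N Y) as (A' & B' & C').
    apply (UL n y); [exact A|exact A'| |exact (conj B' C')]. split; [apply H; [apply suc_self|exact B]|].
    intros l L HL. apply (C l L). apply H; [apply mem_suc; auto|exact HL]. }
  assert (LOC : forall x, x ∈ X -> forall k, k ∈ om -> near x (fun y => agree k (s x) (s y))).
  { intros x HX. match goal with |- forall m, m ∈ om -> @?P m => apply (nat_ind_D P) end; cbv beta.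
    - unfold near. dsolve.
    - destruct (pos_exists R hR) as (u & U & UP). exists u. split; [exact U|]. split; [exact UP|].
      intros y _ _ l L. destruct (mem_emp l L).
    - intros k K IH. apply (near_mono x _ _ (near_and x _ _ HX IH (LOC2 k x K HX))).
      intros y Y [H1 H2] l L. apply mem_suc in L. destruct L as [L| ->]; auto. }
  assert (SMALL : forall x y n, n ∈ om -> x ∈ X -> y ∈ X -> ap (s x) n = ap (s y) n -> dist x y ≺ ap ep n).
  { intros x y n N HX Y E. rewrite !SE in E by exact N.
    destruct (LS n x N HX) as (A & B & _). destruct (LS n y N Y) as (A' & B' & _). rewrite <- E in B'.
    destruct (proj1 (HCl n N) _ A) as (_ & _ & DL). apply DL; assumption. }
  assert (INJ : forall x y, x ∈ X -> y ∈ X -> s x = s y -> x = y).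
  { intros x y HX Y E. apply dist_zero; [exact HX|exact Y|]. apply (le_antisym R hR); [|apply dist_nonneg; assumption].
    apply (not_lt_le R hR); [apply dist_in; assumption|apply Rzero_in, hR|]. intros L.
    destruct (Ie (dist x y)) as (n & N & H); [apply dist_in; assumption|exact L|].
    apply (lt_irrefl R hR (dist x y)). apply (lt_trans R hR _ (ap ep n)); [|exact H]. apply SMALL; try assumption.
    rewrite E. reflexivity. }
  assert (D1' : forall x k, x ∈ X -> k ∈ om -> sep X (fun y => agree k (s x) (s y)) ∈ TT).
  { intros x k HX K. apply open_iff. split; [intros y Y; apply mem_sep in Y; [apply Y|dsolve]|].
    intros y Y. apply mem_sep in Y; [|dsolve]. destruct Y as [Y E].
    apply (near_mono y _ _ (LOC y Y k K)). intros z Z H. apply mem_sep; [dsolve|].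
    split; [exact Z|]. apply (agree_trans k _ (s y)); assumption. }
  assert (D2' : forall U x, U ∈ TT -> x ∈ U -> exists k, k ∈ om /\ forall y, y ∈ X -> agree k (s x) (s y) -> y ∈ U).
  { intros U x HU HX. apply open_iff in HU. destruct HU as [US UN]. destruct (UN x HX) as (r & Hr & HP & H).
    destruct (Ie r Hr HP) as (n & N & L). exists (suc n). split; [apply om_suc, N|]. intros y Y A.
    apply H; [exact Y|]. apply (lt_trans R hR _ (ap ep n)); [|exact L].
    apply SMALL; auto. apply A, suc_self. }
  assert (DENSE : forall x k, x ∈ X -> k ∈ om -> exists i, i ∈ om /\ agree k (s x) (s (ap dp i))).
  { intros x k HX K. destruct (dense _ (D1' x k HX K)) as (i & I & H).
    - exists x. apply mem_sep; [dsolve|]. split; [exact HX|apply agree_refl].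
    - apply mem_sep in H; [|dsolve]. exists i. tauto. }
  (* [Kb b k]: the segment b|k lies in the tree of codes. By density it is enough to look at the
     points of [dp]. *)
  set (Kb := fun b k => exists i, i ∈ om /\ agree k b (s (ap dp i))).
  assert (KD : forall b k l, Kb b k -> subset l k -> Kb b l).
  { intros b k l (i & I & A) SU. exists i. split; [exact I|]. apply (agree_sub k); assumption. }
  (* If all segments of b are realized, the realizing dense points form a Cauchy sequence, since
     digit n confines them to a set of diameter below eps_n. As s is continuous, the limit has code
     b. *)
  assert (CLOSED : forall b, b ∈ Bs -> (forall k, k ∈ om -> Kb b k) -> exists x, x ∈ X /\ s x = b).
  { intros b Hb HK.
    set (ix := fun k => the (fun i => i ∈ om /\ agree k b (s (ap dp i)) /\ forall j, j ∈ i -> ~ agree k b (s (ap dp j)))).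
    assert (IX : forall k, k ∈ om -> ix k ∈ om /\ agree k b (s (ap dp (ix k)))).
    { intros k K. assert (Q : ix k ∈ om /\ agree k b (s (ap dp (ix k))) /\ forall j, j ∈ ix k -> ~ agree k b (s (ap dp j))).
      { apply (the_ext (fun i => i ∈ om /\ agree k b (s (ap dp i)) /\ forall j, j ∈ i -> ~ agree k b (s (ap dp j)))).
        - apply nat_least; [dsolve|]. apply HK, K.
        - intros i i' (I & A & B) (I' & A' & B').
          destruct (ord_tricho i i' (nat_ord i I) (nat_ord i' I')) as [C|[C|C]]; [destruct (B' i C A)|exact C|destruct (B i' C A')]. }
      tauto. }
    set (sq := lam om (fun k => ap dp (ix k))).
    assert (TI : T1 (fun k => ap dp (ix k))) by (unfold ix; dsolve).
    assert (SQ : forall k, k ∈ om -> ap sq k = ap dp (ix k)) by (intros; unfold sq; rewrite ap_lam by assumption; reflexivity).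
    assert (FS : is_fun sq om X) by (apply lam_fun; [exact TI|]; intros k K; apply Dd, IX, K).
    assert (DIG : forall k n, k ∈ om -> n ∈ k -> ap (s (ap sq k)) n = ap b n).
    { intros k n K N. rewrite SQ by exact K. symmetry. apply IX; assumption. }
    assert (SX : forall k, k ∈ om -> ap sq k ∈ X) by (intros; apply (ap_mem sq om); assumption).
    destruct (hcomplete om sq) as (l & LX & LC).
    - apply is_omega_om. reflexivity.
    - exact FS.
    - intros r Hr HP. destruct (Ie r Hr HP) as (n & N & L). exists n. split; [exact N|].
      intros k k' x y NK NK' A A'. apply (app_eq sq om X) in A; [|exact FS]. apply (app_eq sq om X) in A'; [|exact FS].
      destruct A as [K ->], A' as [K' ->]. apply dist_lt_iff. split; [auto|]. split; [auto|].
      apply (lt_trans R hR _ (ap ep n)); [|exact L]. apply SMALL; auto. rewrite !DIG; auto.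
    - exists l. split; [exact LX|]. apply Bs_ext; [apply SB, LX|exact Hb|]. intros n N.
      destruct (LOC2 n l N LX) as (r & Hr & HP & H). destruct (LC r Hr HP) as (N0 & HN0 & H').
      destruct (nat_max (suc n) (suc N0)) as (k & K & K1 & K2); [apply om_suc, N|apply om_suc, HN0|].
      rewrite <- (DIG k n K (K1 n (suc_self n))). apply H; [apply SX, K|].
      assert (A : dist_lt R d (ap sq k) l r).
      { apply (H' k); [apply K2, suc_self|]. apply (app_ap sq om X); assumption. }
      apply dist_lt_iff in A. rewrite dist_sym by tauto. apply A. }
  (* The graph of [pi]. A sequence b that is not a code leaves the tree of codes after a last level
     k, and is sent to the first dense point whose code agrees with b below k. *)
  set (Q := fun b x => x ∈ X /\ (s x = b \/ (~ (exists x', x' ∈ X /\ s x' = b)) /\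
    exists k i, k ∈ om /\ ~ Kb b (suc k) /\ i ∈ om /\ x = ap dp i /\ agree k b (s (ap dp i)) /\
      forall j, j ∈ i -> ~ agree k b (s (ap dp j)))).
  assert (DQ : D2 Q) by (unfold Q, Kb; dsolve).
  assert (QU : forall b x y, Q b x -> Q b y -> x = y).
  { intros b x y [HX HQ] [Y HQ']. destruct HQ as [E|[NE (k & i & K & NK & I & -> & A & MIN)]].
    - destruct HQ' as [E'|[NE _]]; [|destruct NE; eauto]. apply INJ; congruence.
    - destruct HQ' as [E'|[_ (k' & i' & K' & NK' & I' & -> & A' & MIN')]]; [destruct NE; eauto|].
      assert (EK : k = k').
      { destruct (ord_tricho k k' (nat_ord k K) (nat_ord k' K')) as [C|[C|C]]; [|exact C|].
        - destruct NK. apply (KD b k'); [exists i'; auto|]. apply ord_le_subset; [apply nat_ord, K'|].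
          apply suc_le; [apply nat_ord, K'|exact C].
        - destruct NK'. apply (KD b k); [exists i; auto|]. apply ord_le_subset; [apply nat_ord, K|].
          apply suc_le; [apply nat_ord, K|exact C]. }
      subst k'. destruct (ord_tricho i i' (nat_ord i I) (nat_ord i' I')) as [C|[->|C]];
        [destruct (MIN' i C A)|reflexivity|destruct (MIN i' C A')]. }
  assert (QE : forall b, b ∈ Bs -> exists x, Q b x).
  { intros b Hb. destruct (classic (exists x, x ∈ X /\ s x = b)) as [(x & HX & E)|NE].
    - exists x. split; auto.
    - assert (NK : exists k, k ∈ om /\ ~ Kb b k).
      { apply NNPP. intros C. apply NE, CLOSED; [exact Hb|]. intros k K. apply NNPP. intros C'. apply C. eauto. }
      destruct (nat_least (fun k => ~ Kb b k)) as (k' & K' & NK' & MINK); [unfold Kb; dsolve|exact NK|].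
      destruct (nat_cases k' K') as [->|(k & K & ->)].
      { destruct NK'. exists emp. split; [apply om_emp|]. intros i I. destruct (mem_emp i I). }
      assert (KK : Kb b k) by (apply NNPP, MINK, suc_self).
      destruct (nat_least (fun i => agree k b (s (ap dp i)))) as (i & I & A & MIN); [dsolve|exact KK|].
      exists (ap dp i). split; [auto|]. right. split; [exact NE|]. exists k, i. auto 10. }
  set (pi := lam Bs (fun b => the (Q b))).
  assert (TP : T1 (fun b => the (Q b))) by dsolve.
  assert (PQ : forall b, b ∈ Bs -> Q b (ap pi b)).
  { intros b Hb. unfold pi. rewrite ap_lam by assumption. apply (the_ext (Q b)); [apply QE, Hb|].
    intros y z. apply QU. }
  assert (PE : forall b x, b ∈ Bs -> Q b x -> ap pi b = x).
  { intros b x Hb H. apply (QU b); [apply PQ, Hb|exact H]. }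
  assert (PX : forall b, b ∈ Bs -> ap pi b ∈ X) by (intros b Hb; apply (PQ b Hb)).
  (* As long as b stays in the tree of codes, the code of [pi b] agrees with it. *)
  assert (PA : forall b k, b ∈ Bs -> k ∈ om -> Kb b k -> agree k b (s (ap pi b))).
  { intros b k Hb K HK. destruct (PQ b Hb) as [HX [E|[_ (k' & i & K' & NK & I & E & A & _)]]].
    - rewrite E. apply agree_refl.
    - rewrite E. apply (agree_sub k'); [|exact A].
      destruct (ord_le_or_lt k k' (nat_ord k K) (nat_ord k' K')) as [L|L].
      + apply ord_le_subset; [apply nat_ord, K'|exact L].
      + destruct NK. apply (KD b k); [exact HK|]. apply ord_le_subset; [apply nat_ord, K|].
        apply suc_le; [apply nat_ord, K|exact L]. }
  assert (TS1 : T1 s) by dsolve.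
  assert (SA : forall x, x ∈ X -> ap (lam X s) x = s x) by (intros; rewrite ap_lam by assumption; reflexivity).
  (* Continuity of [pi]: at a code it follows from the preceding agreement, and elsewhere [pi] is
     locally constant. *)
  assert (PC : forall U b, U ∈ TT -> b ∈ Bs -> ap pi b ∈ U -> exists k, k ∈ om /\
     forall b', b' ∈ Bs -> agree k b b' -> ap pi b' ∈ U).
  { intros U b HU Hb HX. destruct (classic (exists x, x ∈ X /\ s x = b)) as [(x & XX & E)|NE].
    - assert (E' : ap pi b = x) by (apply PE; [exact Hb|split; auto]). rewrite E' in HX.
      destruct (D2' U x HU HX) as (k & K & H). exists k. split; [exact K|]. intros b' Hb' A.
      apply H; [auto|]. rewrite E. apply (agree_trans k _ b'); [exact A|]. apply PA; [exact Hb'|exact K|].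
      destruct (DENSE x k XX K) as (i & I & A'). exists i. split; [exact I|].
      apply (agree_trans k _ b); [apply agree_sym, A|]. rewrite <- E. exact A'.
    - destruct (PQ b Hb) as [_ [E|[_ (k & i & K & NK & I & E & A & MIN)]]]; [destruct NE; eauto|].
      exists (suc k). split; [apply om_suc, K|]. intros b' Hb' AG.
      assert (AG' : agree k b b') by (apply (agree_sub (suc k)); [apply suc_sub|exact AG]).
      assert (E' : ap pi b' = ap dp i); [|rewrite E', <- E; exact HX].
      assert (NK' : ~ Kb b' (suc k)).
      { intros (j & J & A'). apply NK. exists j. split; [exact J|]. apply (agree_trans _ _ b'); assumption. }
      apply PE; [exact Hb'|]. split; [auto|]. right. split.
      + intros (x & XX & <-). apply NK', DENSE; [exact XX|apply om_suc, K].
      + exists k, i. split; [exact K|]. split; [exact NK'|]. split; [exact I|]. split; [reflexivity|]. split.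
        * apply (agree_trans _ _ b); [apply agree_sym, AG'|exact A].
        * intros j J A'. apply (MIN j J). apply (agree_trans _ _ b'); assumption. }
  exists (lam X s), pi, dp. split.
  - apply lam_fun; assumption.
  - apply lam_fun; [exact TP|]. intros b Hb. specialize (PX b Hb). unfold pi in PX. rewrite ap_lam in PX; assumption.
  - intros x HX. rewrite SA by exact HX. apply PE; [auto|split; auto].
  - intros V. split.
    + intros HV. assert (VX : subset V X) by (apply open_iff in HV; apply HV). split; [exact VX|].
      intros x HX. destruct (D2' V x HV HX) as (k & K & H). exists k. split; [exact K|].
      intros y Y A. rewrite !SA in A by auto. auto.
    + intros [VX H]. apply open_iff. split; [exact VX|]. intros x HX. destruct (H x HX) as (k & K & HK).
      pose proof (D1' x k (VX x HX) K) as O. apply open_iff in O.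
      apply (near_mono x (fun y => y ∈ sep X (fun y => agree k (s x) (s y)))).
      * apply O. apply mem_sep; [dsolve|]. split; [auto|apply agree_refl].
      * intros y Y A. apply mem_sep in A; [|dsolve]. apply HK; [exact Y|]. rewrite !SA by auto. apply A.
  - intros b n Hb N. assert (PB := PX b Hb).
    destruct (PC (sep X (fun y => agree n (s (ap pi b)) (s y))) b) as (k & K & H); [apply D1'; assumption|exact Hb| |].
    + apply mem_sep; [dsolve|]. split; [exact PB|apply agree_refl].
    + exists k. split; [exact K|]. intros b' Hb' A. specialize (H b' Hb' A).
      apply mem_sep in H; [|dsolve]. rewrite !SA by auto. apply H.
  - intros b Hb H. rewrite SA by auto. apply Bs_ext; [auto|exact Hb|]. intros n N.
    symmetry. apply (PA b (suc n)); [exact Hb|apply om_suc, N| |apply suc_self].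
    destruct (H (suc n) (om_suc n N)) as (x & HX & A). rewrite SA in A by exact HX.
    destruct (DENSE x (suc n) HX (om_suc n N)) as (i & I & A'). exists i. split; [exact I|].
    apply (agree_trans _ _ (s x)); assumption.
  - exact Fd.
  - intros x k HX K. destruct (DENSE x k HX K) as (i & I & A). exists i.
    split; [exact I|]. rewrite !SA by auto. exact A.
Qed.
End PolishCoding.
#[export] Hint Resolve T_cp : dfn.

(** * Martin-Monk arguments *)

Section FlipArguments.
Context {M : set_structure} {hZF : ZF_model M}.
Implicit Types a b c f g h x y z u v p m n k i j l w S : M.
Notation env := (nat -> M).
Context (hAD : AD M).

(* Martin-Monk: a set S of natural numbers selects at each n one of the two
   contractions, and the resulting inverse system has a unique solution x; removing
   one element from S changes whether x(0) lies in a(0). *)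
Section MartinMonk.
Context (a f0 f1 : M).
Context (C0 : forall n, n ∈ om -> CT (ap f0 n)) (C1 : forall n, n ∈ om -> CT (ap f1 n)).
Context (R0 : forall n x, n ∈ om -> x ∈ Bs -> (x ∈ ap a (suc n) <-> ap (ap f0 n) x ∈ ap a n)).
Context (R1 : forall n x, n ∈ om -> x ∈ Bs -> (x ∈ ap a (suc n) <-> ap (ap f1 n) x ∉ ap a n)).

Let fS S n := ite (n ∈ S) (ap f1 n) (ap f0 n).
Let T_fS (S n : env -> M) : T S -> T n -> T (fun e => fS (S e) (n e)).
Proof. intros. unfold fS. dsolve. Qed.
Let CS S n : n ∈ om -> CT (fS S n).
Proof.
  intros N. unfold fS. destruct (classic (n ∈ S)) as [H|H];
    [rewrite ite_true by exact H; auto|rewrite ite_false by exact H; auto].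
Qed.
Let CTB f x : CT f -> x ∈ Bs -> ap f x ∈ Bs.
Proof. intros [F _] X. apply (ap_mem f Bs Bs); assumption. Qed.
Let CTS f x y n : CT f -> x ∈ Bs -> y ∈ Bs -> n ∈ om -> agree n x y -> agree (suc n) (ap f x) (ap f y).
Proof.
  intros F X Y N A i I. apply mem_suc in I.
  assert (IO : i ∈ om) by (destruct I as [I| ->]; [exact (nat_trans i n N I)|exact N]).
  apply F; try assumption. apply (agree_sub n); [|exact A].
  destruct I as [I| ->]; [apply nat_sub; assumption|intros z Z; exact Z].
Qed.

Let Sys S x := is_fun x om Bs /\ forall n, n ∈ om -> ap x n = ap (fS S n) (ap x (suc n)).

(** Starting from zeros, each round of applying the contractions fixes one more digit of every x(n),
    and the diagonal of the rounds is a solution. *)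
Lemma system_exists S : exists x, Sys S x.
Proof.
  set (st := fun m => ap (nrec (lam om (fun _ => zero))
    (fun _ v => lam om (fun n => ap (fS S n) (ap v (suc n))))) m).
  assert (TN : T2 (fun _ v => lam om (fun n => ap (fS S n) (ap v (suc n))))) by dsolve.
  assert (TS : forall m : env -> M, T m -> T (fun e => st (m e))) by (intros; unfold st; dsolve).
  assert (S0 : forall n, n ∈ om -> ap (st emp) n = zero).
  { intros n N. unfold st. rewrite nrec_0 by exact TN. rewrite ap_lam; [reflexivity|dsolve|exact N]. }
  assert (SS : forall m n, m ∈ om -> n ∈ om -> ap (st (suc m)) n = ap (fS S n) (ap (st m) (suc n))).
  { intros m n Hm N. unfold st. rewrite nrec_S by assumption. rewrite ap_lam; [reflexivity|dsolve|exact N]. }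
  clearbody st.
  assert (SB : forall m, m ∈ om -> forall n, n ∈ om -> ap (st m) n ∈ Bs).
  { nind; [intros n N; rewrite S0 by exact N; apply zero_Bs|].
    intros m Hm IH n N. rewrite SS by assumption. apply CTB; [apply CS, N|]. apply IH, om_suc, N. }
  assert (AG : forall m, m ∈ om -> forall l n, l ∈ om -> n ∈ om -> ord_le m l -> agree m (ap (st m) n) (ap (st l) n)).
  { nind; [intros l n _ _ _ i I; destruct (mem_emp i I)|].
    intros m Hm IH l n L N LE. destruct (nat_cases l L) as [->|(l' & L' & ->)].
    - destruct LE as [LE|LE]; [destruct (mem_emp _ LE)|destruct (suc_not_emp _ LE)].
    - rewrite !SS by assumption. assert (NS := om_suc n N).
      apply CTS; auto. apply IH; auto. apply mem_suc_le.
      destruct LE as [LE|LE]; [|apply suc_inj in LE; subst; apply suc_self].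
      apply (ord_trans m (suc m)); [apply nat_ord, L|apply suc_self|exact LE]. }
  exists (lam om (fun n => lam om (fun i => ap (ap (st (suc i)) n) i))).
  set (x := lam om (fun n => lam om (fun i => ap (ap (st (suc i)) n) i))).
  assert (XE : forall n i, n ∈ om -> i ∈ om -> ap (ap x n) i = ap (ap (st (suc i)) n) i).
  { intros n i N I. unfold x. rewrite ap_lam by (dsolve || exact N). rewrite ap_lam; [reflexivity|dsolve|exact I]. }
  assert (XF : is_fun x om Bs).
  { apply lam_fun; [dsolve|]. intros n N. apply Bs_lam; [dsolve|]. intros i I. apply Bs_ap; [|exact I].
    apply SB; [apply om_suc, I|exact N]. }
  split; [exact XF|]. assert (XB : forall n, n ∈ om -> ap x n ∈ Bs) by (intros; apply (ap_mem x om); assumption).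
  intros n N. assert (NS := om_suc n N). apply Bs_ext; [auto|apply CTB; auto|].
  intros i I. rewrite XE, SS by assumption. apply CS; auto.
  intros j J. assert (JO : j ∈ om) by exact (nat_trans j i I J). rewrite XE by assumption.
  symmetry. apply (AG (suc j) (om_suc j JO) i); [exact I|exact NS| |apply suc_self].
  apply suc_le; [apply nat_ord, I|exact J].
Qed.

(** x(n) is computed from x(n+1), so only the maps from k on enter the values from k on; being
    contractions, they force one digit after the other. *)
Lemma system_unique S S' x y k : k ∈ om -> Sys S x -> Sys S' y ->
  (forall n, n ∈ om -> ord_le k n -> fS S n = fS S' n) ->
  forall n, n ∈ om -> ord_le k n -> ap x n = ap y n.
Proof.
  intros K [X1 X2] [Y1 Y2] E.
  assert (XB : forall n, n ∈ om -> ap x n ∈ Bs) by (intros; apply (ap_mem x om); assumption).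
  assert (YB : forall n, n ∈ om -> ap y n ∈ Bs) by (intros; apply (ap_mem y om); assumption).
  assert (H : forall m, m ∈ om -> forall n, n ∈ om -> ord_le k n -> agree m (ap x n) (ap y n)).
  { nind; [intros n _ _ i I; destruct (mem_emp i I)|].
    intros m Hm IH n N L. assert (NS := om_suc n N). rewrite (X2 n N), (Y2 n N), <- (E n N L).
    apply CTS; auto. apply IH; [exact NS|].
    left. apply mem_suc_le, L. }
  intros n N L. apply Bs_ext; auto. intros i I. apply (H (suc i) (om_suc i I) n N L). apply suc_self.
Qed.

Theorem martin_monk : False.
Proof.
  apply (no_flip_set hAD (fun S => exists x, Sys S x /\ ap x emp ∈ ap a emp)); [unfold Sys; dsolve|].
  intros S k HS K _.
  assert (KO : k ∈ om) by (apply HS, K).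
  destruct (system_exists S) as [x HX]. destruct (system_exists (del S k)) as [y HY].
  assert (EX : forall S x y, Sys S x -> Sys S y -> ap x emp = ap y emp).
  { intros S' x' y' A B. apply (system_unique S' S' x' y' emp om_emp A B); auto using om_emp. right. reflexivity. }
  assert (L : (exists x, Sys S x /\ ap x emp ∈ ap a emp) <-> ap x emp ∈ ap a emp).
  { split; [intros (x' & A & B); rewrite (EX S x x'); assumption|eauto]. }
  assert (L' : (exists x, Sys (del S k) x /\ ap x emp ∈ ap a emp) <-> ap y emp ∈ ap a emp).
  { split; [intros (x' & A & B); rewrite (EX (del S k) y x'); assumption|eauto]. }
  rewrite L, L'. clear L L' EX.
  assert (FE : forall n, n <> k -> fS S n = fS (del S k) n).
  { intros n NE. unfold fS. destruct (classic (n ∈ S)) as [C|C].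
    - rewrite !ite_true; [reflexivity|apply mem_del; auto|exact C].
    - rewrite !ite_false; [reflexivity|rewrite mem_del; tauto|exact C]. }
  assert (TAIL : ap x (suc k) = ap y (suc k)).
  { apply (system_unique S (del S k) x y (suc k)); [apply om_suc, KO|exact HX|exact HY| |apply om_suc, KO|right; reflexivity].
    intros n N L. apply FE. intros ->. apply (ord_le_not_lt _ _ (nat_ord k KO) L), suc_self. }
  destruct HX as [X1 X2], HY as [Y1 Y2].
  assert (XB : forall n, n ∈ om -> ap x n ∈ Bs) by (intros; apply (ap_mem x om); assumption).
  assert (YB : forall n, n ∈ om -> ap y n ∈ Bs) by (intros; apply (ap_mem y om); assumption).
  (* P says that the two solutions lie on different sides of a(n). It holds at k, where the tails
     coincide and the maps differ. Below k the maps agree, so P descends from n+1 to n, and its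
     least instance is 0. *)
  set (P := fun n => ap x n ∈ ap a n <-> ap y n ∉ ap a n).
  assert (PK : P k).
  { unfold P. rewrite (X2 k KO), (Y2 k KO), <- TAIL. unfold fS.
    rewrite ite_true by exact K. rewrite ite_false by (rewrite mem_del; tauto).
    assert (B := XB (suc k) (om_suc k KO)).
    pose proof (R0 k _ KO B). pose proof (R1 k _ KO B). tauto. }
  destruct (nat_least P) as (n & N & PN & MIN); [unfold P; dsolve|exists k; auto|].
  assert (LK : ord_le n k).
  { destruct (ord_le_or_lt n k (nat_ord n N) (nat_ord k KO)) as [H|H]; [exact H|destruct (MIN k H PK)]. }
  destruct (nat_cases n N) as [->|(m & Hm & ->)]; [exact PN|].
  destruct (MIN m (suc_self m)). unfold P in *.
  assert (NE : m <> k).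
  { intros ->. apply (ord_le_not_lt _ _ (nat_ord k KO) LK), suc_self. }
  rewrite (X2 m Hm), (Y2 m Hm), <- (FE m NE).
  assert (BX := XB (suc m) (om_suc m Hm)). assert (BY := YB (suc m) (om_suc m Hm)).
  unfold fS. destruct (classic (m ∈ S)) as [C|C].
  - rewrite ite_true by exact C. pose proof (R1 m _ Hm BX). pose proof (R1 m _ Hm BY). tauto.
  - rewrite ite_false by exact C. pose proof (R0 m _ Hm BX). pose proof (R0 m _ Hm BY). tauto.
Qed.
End MartinMonk.

(* Functions f(k) into the ball of radius 2^-k around p which all flip A: the
   indices are thinned out (kap below) so that infinite compositions converge. *)
Section LocalFlip.
Context (A p f : M) (hp : p ∈ Bs).
Context (Cf : forall k, k ∈ om -> CF (ap f k)).
Context (Nf : forall k x, k ∈ om -> x ∈ Bs -> agree k p (ap (ap f k) x)).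
Context (Ff : forall k x, k ∈ om -> x ∈ Bs -> (x ∈ A <-> ap (ap f k) x ∉ A)).

(** The least modulus of continuity at p, for n digits, common to all maps in Phi. *)
Let kap n Phi := the (fun k => k ∈ om /\ (forall phi y, phi ∈ Phi -> y ∈ Bs -> agree k p y -> agree n (ap phi p) (ap phi y)) /\
  forall j, j ∈ k -> ~ forall phi y, phi ∈ Phi -> y ∈ Bs -> agree j p y -> agree n (ap phi p) (ap phi y)).
Let T_kap (n Phi : env -> M) : T n -> T Phi -> T (fun e => kap (n e) (Phi e)).
Proof. intros. unfold kap. dsolve. Qed.
(** All compositions of maps g(i), i < n, in increasing order of indices. There are finitely many,
    so they are equicontinuous and g(n) can be adapted to all of them at once. *)
Let Phi n := ap (nrec (up idB idB) (fun n P => cup P (rep P (fun phi => comp phi (ap f (kap n P)))))) n.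
Let T_Phi (n : env -> M) : T n -> T (fun e => Phi (n e)).
Proof. intros. unfold Phi. dsolve. Qed.
Let g n := ap f (kap n (Phi n)).
Let T_g (n : env -> M) : T n -> T (fun e => g (n e)).
Proof. intros. unfold g. dsolve. Qed.

Let EQ P := (forall phi, phi ∈ P -> CF phi) /\ forall x n, x ∈ Bs -> n ∈ om ->
  exists k, k ∈ om /\ forall phi y, phi ∈ P -> y ∈ Bs -> agree k x y -> agree n (ap phi x) (ap phi y).

Lemma kap_spec n P : n ∈ om -> EQ P -> kap n P ∈ om /\
  forall phi y, phi ∈ P -> y ∈ Bs -> agree (kap n P) p y -> agree n (ap phi p) (ap phi y).
Proof.
  intros N [_ H]. assert (Q : kap n P ∈ om /\ (forall phi y, phi ∈ P -> y ∈ Bs -> agree (kap n P) p y -> agree n (ap phi p) (ap phi y)) /\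
    forall j, j ∈ kap n P -> ~ forall phi y, phi ∈ P -> y ∈ Bs -> agree j p y -> agree n (ap phi p) (ap phi y)).
  { unfold kap. apply (the_ext (fun k => k ∈ om /\ (forall phi y, phi ∈ P -> y ∈ Bs -> agree k p y -> agree n (ap phi p) (ap phi y)) /\
      forall j, j ∈ k -> ~ forall phi y, phi ∈ P -> y ∈ Bs -> agree j p y -> agree n (ap phi p) (ap phi y))).
    - apply nat_least; [dsolve|]. apply H; assumption.
    - intros k k' (K & B & C) (K' & B' & C').
      destruct (ord_tricho k k' (nat_ord k K) (nat_ord k' K')) as [L|[L|L]]; [destruct (C' k L B)|exact L|destruct (C k' L B')]. }
  tauto.
Qed.

Lemma Phi_0 : Phi emp = up idB idB.
Proof. unfold Phi. apply nrec_0. dsolve. Qed.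
Lemma mem_Phi_S n phi : n ∈ om -> phi ∈ Phi (suc n) <-> phi ∈ Phi n \/ exists psi, psi ∈ Phi n /\ phi = comp psi (g n).
Proof.
  intros N. unfold Phi at 1. rewrite nrec_S by (dsolve || exact N). fold (Phi n).
  rewrite mem_cup, mem_rep by dsolve. reflexivity.
Qed.

Lemma Phi_EQ n : n ∈ om -> EQ (Phi n).
Proof.
  revert n. match goal with |- forall n, n ∈ om -> @?P n => apply (nat_ind_D P) end; cbv beta.
  - unfold EQ. dsolve.
  - rewrite Phi_0. split.
    + intros phi H. apply mem_up in H. assert (phi = idB) as -> by tauto. apply CF_idB.
    + intros x n X N. exists n. split; [exact N|]. intros phi y H Y HA. apply mem_up in H.
      assert (phi = idB) as -> by tauto. rewrite !ap_idB by assumption. exact HA.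
  - intros n N [IH1 IH2]. destruct (kap_spec n (Phi n) N (conj IH1 IH2)) as [K _].
    assert (G : CF (g n)) by (apply Cf, K). split.
    + intros phi H. apply mem_Phi_S in H; [|exact N]. destruct H as [H|(psi & H & ->)]; [auto|].
      apply CF_comp; auto.
    + intros x m X Hm. destruct (IH2 x m X Hm) as (k1 & K1 & E1).
      destruct (IH2 (ap (g n) x) m (CF_ap _ _ G X) Hm) as (k2 & K2 & E2).
      destruct (CF_agree (g n) x G X k2 K2) as (k3 & K3 & E3).
      destruct (nat_max k1 k3 K1 K3) as (k & HK & S1 & S3). exists k. split; [exact HK|].
      intros phi y H Y HA. apply mem_Phi_S in H; [|exact N]. destruct H as [H|(psi & H & ->)].
      * apply E1; [exact H|exact Y|]. apply (agree_sub k); assumption.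
      * rewrite !ap_comp by assumption. apply E2; [exact H|apply CF_ap; assumption|].
        apply E3; [exact Y|]. apply (agree_sub k); assumption.
Qed.

Lemma kap_om n : n ∈ om -> kap n (Phi n) ∈ om.
Proof. intros N. apply kap_spec; [exact N|apply Phi_EQ, N]. Qed.
Lemma g_CF n : n ∈ om -> CF (g n).
Proof. intros N. apply Cf, kap_om, N. Qed.
Lemma g_flip n x : n ∈ om -> x ∈ Bs -> (x ∈ A <-> ap (g n) x ∉ A).
Proof. intros N. apply Ff, kap_om, N. Qed.

(** The composition of the g(i) for i in S below n, with the smallest index outermost. *)
Let ph S n := ap (nrec idB (fun n phi => ite (n ∈ S) (comp phi (g n)) phi)) n.
Let T_ph (S n : env -> M) : T S -> T n -> T (fun e => ph (S e) (n e)).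
Proof. intros. unfold ph. dsolve. Qed.
Lemma ph_0 S : ph S emp = idB.
Proof. apply nrec_0. dsolve. Qed.
Lemma ph_in S n : n ∈ om -> n ∈ S -> ph S (suc n) = comp (ph S n) (g n).
Proof. intros N H. unfold ph at 1. rewrite nrec_S by (dsolve || exact N). apply ite_true, H. Qed.
Lemma ph_out S n : n ∈ om -> n ∉ S -> ph S (suc n) = ph S n.
Proof. intros N H. unfold ph at 1. rewrite nrec_S by (dsolve || exact N). apply ite_false, H. Qed.
Lemma ph_Phi S n : n ∈ om -> ph S n ∈ Phi n.
Proof.
  revert n. nind.
  - rewrite ph_0, Phi_0. apply mem_up. auto.
  - intros n N IH. apply mem_Phi_S; [exact N|]. destruct (classic (n ∈ S)) as [H|H].
    + rewrite ph_in by assumption. eauto.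
    + rewrite ph_out by assumption. auto.
Qed.
Lemma ph_CF S n : n ∈ om -> CF (ph S n).
Proof. intros N. apply (Phi_EQ n N), ph_Phi, N. Qed.

(** Beyond an n in S every argument first passes through g(n), whose values are close to p. *)
Lemma ph_factor S n m : n ∈ om -> n ∈ S -> m ∈ om -> n ∈ m -> forall z, z ∈ Bs ->
  exists y, y ∈ Bs /\ agree (kap n (Phi n)) p y /\ ap (ph S m) z = ap (ph S n) y.
Proof.
  intros N NS. revert m.
  match goal with |- forall m, m ∈ om -> @?P m => apply (nat_ind_D P) end; cbv beta.
  - dsolve.
  - intros H. destruct (mem_emp n H).
  - intros m Hm IH NM z Z. apply mem_suc in NM. destruct NM as [NM|E].
    + destruct (classic (m ∈ S)) as [H|H].
      * rewrite ph_in by assumption. rewrite ap_comp by exact Z. apply IH; [exact NM|].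
        apply CF_ap; [apply g_CF, Hm|exact Z].
      * rewrite ph_out by assumption. apply IH; assumption.
    + subst m. rewrite ph_in by assumption. rewrite ap_comp by exact Z.
      exists (ap (g n) z). split; [apply CF_ap; [apply g_CF, N|exact Z]|]. split; [|reflexivity].
      apply Nf; [apply kap_om, N|exact Z].
Qed.

(** Through the choice of [kap], the first n digits depend neither on m nor on z, so that infinite
    compositions converge to a single point. *)
Lemma ph_agree S n m z : n ∈ om -> n ∈ S -> m ∈ om -> n ∈ m -> z ∈ Bs ->
  agree n (ap (ph S n) p) (ap (ph S m) z).
Proof.
  intros N NS Hm NM Z. destruct (ph_factor S n m N NS Hm NM z Z) as (y & Y & AG & ->).
  apply (kap_spec n (Phi n) N (Phi_EQ n N)); [apply ph_Phi, N|exact Y|exact AG].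
Qed.

Let Lim S x := x ∈ Bs /\ forall n m z, n ∈ S -> m ∈ om -> n ∈ m -> z ∈ Bs -> agree n x (ap (ph S m) z).

Lemma Lim_exists S : unbounded S -> exists x, Lim S x.
Proof.
  intros [SO SU]. set (Q := fun i v => exists n, n ∈ S /\ i ∈ n /\ v = ap (ap (ph S n) p) i).
  assert (DQ : D2 Q) by (unfold Q; dsolve).
  assert (QU : forall i n n', n ∈ S -> n' ∈ S -> i ∈ n -> i ∈ n' -> ap (ap (ph S n) p) i = ap (ap (ph S n') p) i).
  { assert (H : forall i n n', n ∈ S -> n' ∈ S -> i ∈ n -> n ∈ n' -> ap (ap (ph S n) p) i = ap (ap (ph S n') p) i).
    { intros i n n' N N' I L. apply (ph_agree S n n' p); auto. }
    intros i n n' N N' I I'. destruct (ord_tricho n n' (nat_ord n (SO n N)) (nat_ord n' (SO n' N'))) as [L|[->|L]].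
    - apply H; assumption.
    - reflexivity.
    - symmetry. apply H; assumption. }
  assert (QE : forall i n, n ∈ S -> i ∈ n -> the (Q i) = ap (ap (ph S n) p) i).
  { intros i n N I. apply the_eq; [exists n; auto|]. intros v (n' & N' & I' & ->). apply QU; assumption. }
  exists (lam om (fun i => the (Q i))). split.
  - apply Bs_lam; [dsolve|]. intros i I. destruct (SU i I) as (n & N & L). rewrite (QE i n N L).
    apply Bs_ap; [apply CF_ap; [apply ph_CF, SO, N|exact hp]|exact I].
  - intros n m z N Hm L Z i I. assert (IO : i ∈ om) by (apply (nat_trans i n); [apply SO, N|exact I]).
    rewrite ap_lam by (dsolve || exact IO). rewrite (QE i n N I). apply (ph_agree S n m z); auto.
Qed.

Lemma Lim_unique S x y : unbounded S -> Lim S x -> Lim S y -> x = y.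
Proof.
  intros [SO SU] [X1 X2] [Y1 Y2]. apply Bs_ext; [exact X1|exact Y1|]. intros i I.
  destruct (SU i I) as (n & N & L).
  assert (NO := SO n N).
  rewrite (X2 n (suc n) p N (om_suc n NO) (suc_self n) hp i L).
  symmetry. apply (Y2 n (suc n) p N (om_suc n NO) (suc_self n) hp i L).
Qed.

Theorem local_flip : False.
Proof.
  apply (no_flip_set hAD (fun S => exists x, Lim S x /\ x ∈ A)); [unfold Lim; dsolve|].
  intros S k HS K MIN. assert (HS' := del_unbounded S k HS K).
  destruct (Lim_exists S HS) as [x LX]. destruct (Lim_exists (del S k) HS') as [y LY].
  assert (L : (exists x, Lim S x /\ x ∈ A) <-> x ∈ A).
  { split; [intros (x' & B & C); rewrite (Lim_unique S x x'); assumption|eauto]. }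
  assert (L' : (exists x, Lim (del S k) x /\ x ∈ A) <-> y ∈ A).
  { split; [intros (x' & B & C); rewrite (Lim_unique (del S k) y x'); assumption|eauto]. }
  rewrite L, L'. clear L L'.
  destruct HS as [SO SU]. assert (KO := SO k K). destruct LX as [X1 X2], LY as [Y1 Y2].
  (* k is the least element of S, so nothing is composed before k. *)
  assert (LOW : forall n, n ∈ om -> ord_le n k -> ph S n = idB /\ ph (del S k) n = idB).
  { nind; [rewrite !ph_0; auto|]. intros n N IH LE.
    assert (NK : n ∈ k) by (apply (ord_lt_le n (suc n)); [apply nat_ord, KO|apply suc_self|exact LE]).
    assert (NS : n ∉ S).
    { intros C. assert (NE : n <> k) by (intros ->; exact (mem_irrefl _ NK)).
      exact (mem_asym _ _ NK (MIN n C NE)). }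
    rewrite !ph_out; [apply IH; left; exact NK|exact N|rewrite mem_del; tauto|exact N|exact NS]. }
  (* Beyond k, the composition for S is the one for S without k, followed by g(k). *)
  assert (HI : forall n, n ∈ om -> k ∈ n -> forall z, z ∈ Bs -> ap (ph S n) z = ap (g k) (ap (ph (del S k) n) z)).
  { nind; [intros H; destruct (mem_emp k H)|]. intros n N IH H z Z. apply mem_suc in H. destruct H as [H|E].
    - assert (NE : n <> k) by (intros ->; exact (mem_irrefl _ H)). destruct (classic (n ∈ S)) as [C|C].
      + rewrite !ph_in; [|exact N|apply mem_del; auto|exact N|exact C].
        rewrite !ap_comp by exact Z. apply IH; [exact H|]. apply CF_ap; [apply g_CF, N|exact Z].
      + rewrite !ph_out; [|exact N|rewrite mem_del; tauto|exact N|exact C]. apply IH; assumption.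
    - subst n. rewrite ph_in, (ph_out (del S k)); [|exact N|rewrite mem_del; tauto|exact N|exact K].
      destruct (LOW k N) as [-> ->]; [right; reflexivity|].
      rewrite ap_comp, !ap_idB; auto. apply CF_ap; [apply g_CF, N|exact Z]. }
  (* By continuity the same relation holds between the limits, and g(k) flips A. *)
  assert (E : x = ap (g k) y); [|rewrite E; pose proof (g_flip k y KO Y1); tauto].
  assert (GK := g_CF k KO).
  apply Bs_ext; [exact X1|apply CF_ap; assumption|]. intros i I.
  destruct (CF_agree (g k) y GK Y1 (suc i) (om_suc i I)) as (l & HL & HC).
  destruct (nat_max l (suc i) HL (om_suc i I)) as (m & Hm & M1 & M2).
  destruct (nat_max m (suc k) Hm (om_suc k KO)) as (m' & Hm' & M3 & M4).
  destruct (proj2 HS' m' Hm') as (n & N & MN). assert (NO : n ∈ om) by apply (proj1 HS' n N).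
  assert (MNS : subset m' n) by (apply nat_sub; assumption).
  assert (NS : n ∈ S) by (apply mem_del in N; apply N).
  assert (IN : i ∈ n) by apply MNS, M3, M2, suc_self.
  rewrite (X2 n (suc n) p NS (om_suc n NO) (suc_self n) hp i IN).
  rewrite HI; [|apply om_suc, NO|apply mem_suc; left; apply MNS, M4, suc_self|exact hp].
  symmetry. apply HC; [apply CF_ap; [apply ph_CF, om_suc, NO|exact hp]| |apply suc_self].
  apply (agree_sub n); [intros q Hq; apply MNS, M3, M1, Hq|].
  apply Y2; [exact N|apply om_suc, NO|apply suc_self|exact hp].
Qed.
End LocalFlip.
End FlipArguments.

(** * The Wadge order *)

Section WadgeTheory.
Context {M : set_structure} {hZF : ZF_model M}.
Implicit Types a b c f g h x y z u v p m n k i j l w A B C E K : M.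
Notation env := (nat -> M).
Context (R : ordered_field_data M) (hDC : DC_reals R) (hRB : exists q, is_surjection q (Rset R) Bs) (hAD : AD M).
Context (X TT s pi dp : M) (hX : coded X TT s pi dp).
Notation cp := (cp X).

Lemma s_in x : x ∈ X -> ap s x ∈ Bs.
Proof. apply (ap_mem s X). apply hX. Qed.
Lemma pi_in b : b ∈ Bs -> ap pi b ∈ X.
Proof. apply (ap_mem pi Bs). apply hX. Qed.
Lemma pi_s x : x ∈ X -> ap pi (ap s x) = x.
Proof. apply hX. Qed.
Hint Resolve s_in pi_in CF_ap : core.

Lemma cp_sub A : subset (cp A) X.
Proof. intros x H. apply mem_cp in H. apply H. Qed.
Lemma cp_cp A : subset A X -> cp (cp A) = A.
Proof.
  intros S. apply ext. intros x. rewrite !mem_cp. split.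
  - intros [H N]. apply NNPP. intros C. apply N. auto.
  - intros H. split; [auto|]. tauto.
Qed.

(** Wadge reducibility of X carried over to Baire space; the values of f may be any sequences, as
    they are read through [pi]. *)
Definition le A C : Prop := exists f, CF f /\ forall x, x ∈ X -> (x ∈ A <-> ap pi (ap f (ap s x)) ∈ C).
Lemma D_le (A C : env -> M) : T A -> T C -> D (fun e => le (A e) (C e)).
Proof. intros. unfold le. dsolve. Qed.
Hint Resolve D_le : dfn.

(** The projection of Baire space onto the codes, inserted between two reductions because the second
    one expects a code. *)
Definition sp : M := lam Bs (fun b => ap s (ap pi b)).
Lemma ap_sp b : b ∈ Bs -> ap sp b = ap s (ap pi b).
Proof. intros H. unfold sp. rewrite ap_lam; [reflexivity|dsolve|exact H]. Qed.
Lemma CF_sp : CF sp.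
Proof.
  split; [apply lam_fun; [dsolve|auto]|]. intros b n Hb N.
  destruct (coded_cont _ _ _ _ _ hX b (suc n) Hb (om_suc n N)) as (k & Hk & H).
  exists k. split; [exact Hk|]. intros b' Hb' A. rewrite !ap_sp by assumption.
  apply (H b' Hb' A), suc_self.
Qed.

Lemma le_refl A : le A A.
Proof.
  exists idB. split; [apply CF_idB|]. intros x Hx. rewrite ap_idB, pi_s by auto. reflexivity.
Qed.
Lemma le_trans A C E : le A C -> le C E -> le A E.
Proof.
  intros (f & F & HF) (g & G & HG). exists (comp g (comp sp f)).
  split; [apply CF_comp; [exact G|apply CF_comp; [apply CF_sp|exact F]]|].
  intros x Hx. rewrite !ap_comp, ap_sp by auto. rewrite HF by exact Hx. apply HG. auto.
Qed.
Lemma le_cp A C : le A C -> le (cp A) (cp C).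
Proof.
  intros (f & F & HF). exists f. split; [exact F|]. intros x Hx. rewrite !mem_cp, HF by exact Hx.
  assert (ap pi (ap f (ap s x)) ∈ X) by auto. tauto.
Qed.
Lemma le_cp_l A C : subset A X -> le (cp A) C -> le A (cp C).
Proof. intros S H. apply le_cp in H. rewrite cp_cp in H by exact S. exact H. Qed.
Lemma le_cp_r A C : subset C X -> le A (cp C) -> le (cp A) C.
Proof. intros S H. apply le_cp in H. rewrite cp_cp in H by exact S. exact H. Qed.

Lemma le_of_red f A C : CF f -> (forall b, b ∈ Bs -> (ap pi b ∈ A <-> ap pi (ap f b) ∈ C)) -> le A C.
Proof.
  intros F H. exists f. split; [exact F|]. intros x Hx. rewrite <- H, pi_s by auto. reflexivity.
Qed.

(** The Wadge game on X: both players play arbitrary sequences, and A and C are tested on the points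
    they stand for. *)
Lemma wadge_game A C :
  (exists f, LIP f /\ forall b, b ∈ Bs -> (ap pi b ∈ A <-> ap pi (ap f b) ∈ C)) \/
  (exists f, CT f /\ forall b, b ∈ Bs -> (ap pi b ∈ C <-> ap pi (ap f b) ∉ A)).
Proof.
  destruct (game_determined hAD (fun x y => ap pi x ∈ A <-> ap pi y ∈ C)) as [(f & F & H)|(f & F & H)]; [dsolve|left|right].
  - exists f. auto.
  - exists f. split; [exact F|]. intros b Hb. specialize (H b Hb).
    destruct (classic (ap pi b ∈ C)), (classic (ap pi (ap f b) ∈ A)); tauto.
Qed.

Lemma wadge A C : le A C \/ le C (cp A).
Proof.
  destruct (wadge_game A C) as [(f & F & H)|(f & F & H)]; [left|right].
  - apply (le_of_red f); [apply LIP_CF, F|exact H].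
  - apply (le_of_red f); [apply LIP_CF, CT_LIP, F|]. intros b Hb. rewrite H, mem_cp by exact Hb.
    assert (ap pi (ap f b) ∈ X); [|tauto]. apply pi_in, CF_ap; [apply LIP_CF, CT_LIP, F|exact Hb].
Qed.

Lemma wadge_not A C : subset A X -> ~ le A C -> le (cp C) A.
Proof.
  intros S H. destruct (wadge A C) as [L|L]; [tauto|]. apply le_cp in L. rewrite cp_cp in L by exact S. exact L.
Qed.

Definition lt A C : Prop := le A C /\ ~ le C A.
Lemma D_lt (A C : env -> M) : T A -> T C -> D (fun e => lt (A e) (C e)).
Proof. intros. unfold lt. dsolve. Qed.
Hint Resolve D_lt : dfn.
Definition sd A : Prop := le A (cp A).

Lemma lt_le_cp A C : subset A X -> subset C X -> lt A C -> le A (cp C).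
Proof.
  intros SA SC [H N]. apply (wadge_not C A SC) in N. apply le_cp_l; assumption.
Qed.

(** If A < C, then II can reduce neither C nor its complement to A; the winning strategies of I in
    these two games are the required contractions. *)
Lemma lt_contractions A C : subset A X -> subset C X -> lt A C ->
  (exists f, CT f /\ forall b, b ∈ Bs -> (ap pi b ∈ A <-> ap pi (ap f b) ∈ C)) /\
  (exists f, CT f /\ forall b, b ∈ Bs -> (ap pi b ∈ A <-> ap pi (ap f b) ∉ C)).
Proof.
  intros SA SC L. split.
  - destruct (wadge_game (cp C) A) as [(f & F & H)|(f & F & H)].
    + assert (Q : le (cp C) A) by (apply (le_of_red f); [apply LIP_CF, F|exact H]).
      destruct (proj2 L). apply (le_trans C (cp A)); [apply le_cp_l; assumption|].
      apply (le_trans _ (cp C)); [apply le_cp, L|exact Q].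
    + exists f. split; [exact F|]. intros b Hb. rewrite H, mem_cp by exact Hb.
      assert (ap pi (ap f b) ∈ X); [|split; [intros Q; apply NNPP|]; tauto].
      apply pi_in, CF_ap; [apply LIP_CF, CT_LIP, F|exact Hb].
  - destruct (wadge_game C A) as [(f & F & H)|(f & F & H)].
    + destruct (proj2 L). apply (le_of_red f); [apply LIP_CF, F|exact H].
    + exists f. auto.
Qed.

(** A continuous map of X is lifted to Baire space by projecting with [pi] and coding the value with
    [s]; conversely a map of Baire space descends by coding the argument and projecting the
    value. *)
Lemma wadge_le_iff A C : subset A X -> (wadge_le X TT A C <-> le A C).
Proof.
  intros SA. unfold wadge_le, continuous, is_preimage. split.
  - intros (f & [F HC] & HP). exists (lam Bs (fun b => ap s (ap f (ap pi b)))).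
    assert (FX : forall x, x ∈ X -> ap f x ∈ X) by (intros; apply (ap_mem f X); assumption).
    split; [split|].
    + apply lam_fun; [dsolve|]. auto.
    + intros b n Hb N. set (y := ap f (ap pi b)).
      assert (Y : y ∈ X) by (unfold y; auto).
      destruct (HC (sep X (fun z => agree (suc n) (ap s y) (ap s z)))) as (V & HV & VT).
      { apply hX. split; [intros z Z; apply mem_sep in Z; [apply Z|dsolve]|].
        intros z Z. apply mem_sep in Z; [|dsolve]. exists (suc n). split; [apply om_suc, N|].
        intros w Hw A'. apply mem_sep; [dsolve|]. split; [exact Hw|]. apply (agree_trans _ _ (ap s z)); [apply Z|exact A']. }
      assert (PV : ap pi b ∈ V).
      { apply HV. split; [auto|]. exists y. split; [apply (app_ap f X X); auto|].
        apply mem_sep; [dsolve|]. split; [exact Y|apply agree_refl]. }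
      apply hX in VT. destruct VT as [VX VT]. destruct (VT _ PV) as (k & K & H).
      destruct (coded_cont _ _ _ _ _ hX b k Hb K) as (l & L & H').
      exists l. split; [exact L|]. intros b' Hb' AG. rewrite !ap_lam by (dsolve || assumption).
      specialize (H (ap pi b') (pi_in b' Hb') (H' b' Hb' AG)). apply HV in H. destruct H as [_ (y' & Hy' & Q)].
      apply (app_eq f X X) in Hy'; [|exact F]. destruct Hy' as [_ ->].
      apply mem_sep in Q; [|dsolve]. apply Q, suc_self.
    + intros x Hx. rewrite ap_lam by (dsolve || auto). rewrite pi_s, pi_s by auto. rewrite HP. split.
      * intros [_ (y & Y & YC)]. apply (app_eq f X X) in Y; [|exact F]. destruct Y as [_ ->]. exact YC.
      * intros H. split; [exact Hx|]. exists (ap f x). split; [apply (app_ap f X X); assumption|exact H].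
  - intros (f & F & HF). set (g := lam X (fun x => ap pi (ap f (ap s x)))).
    assert (G : is_fun g X X) by (apply lam_fun; [dsolve|auto]).
    assert (GE : forall x, x ∈ X -> ap g x = ap pi (ap f (ap s x))) by (intros; unfold g; rewrite ap_lam; [reflexivity|dsolve|assumption]).
    assert (PRE : forall x U, (x ∈ X /\ exists y, app g x y /\ y ∈ U) <-> x ∈ X /\ ap pi (ap f (ap s x)) ∈ U).
    { intros x U. split.
      - intros [Hx (y & Y & YC)]. split; [exact Hx|]. apply (app_eq g X X) in Y; [|exact G].
        destruct Y as [_ ->]. rewrite <- GE by exact Hx. exact YC.
      - intros [Hx H]. split; [exact Hx|]. exists (ap g x). split; [apply (app_ap g X X); assumption|].
        rewrite GE by exact Hx. exact H. }
    exists g. split; [split; [exact G|]|].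
    + intros U HU. exists (sep X (fun x => ap pi (ap f (ap s x)) ∈ U)). split.
      * intros x. rewrite PRE. apply (mem_sep (fun x => ap pi (ap f (ap s x)) ∈ U)). dsolve.
      * apply hX. split; [intros x Hx; apply mem_sep in Hx; [apply Hx|dsolve]|].
        intros x Hx. apply mem_sep in Hx; [|dsolve]. destruct Hx as [Hx HUx].
        apply hX in HU. destruct HU as [_ HU]. destruct (HU _ HUx) as (k & K & H).
        assert (SB : ap f (ap s x) ∈ Bs) by auto.
        destruct (coded_cont _ _ _ _ _ hX _ k SB K) as (l & L & H1).
        destruct (CF_agree f (ap s x) F (s_in x Hx) l L) as (j & J & H2).
        exists j. split; [exact J|]. intros y Y AG. apply mem_sep; [dsolve|]. split; [exact Y|].
        apply H; [auto|]. apply H1; auto.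
    + intros x. rewrite PRE. split.
      * intros H. assert (x ∈ X) by auto. split; [assumption|]. apply HF; assumption.
      * intros [Hx H]. apply HF; assumption.
Qed.

Lemma wadge_lt_iff A C : subset A X -> subset C X -> (wadge_lt X TT A C <-> lt A C).
Proof. intros SA SC. unfold wadge_lt, lt. rewrite !wadge_le_iff by assumption. reflexivity. Qed.

Lemma selfdual_iff A : subset A X -> (selfdual X TT A <-> sd A).
Proof.
  intros SA. unfold selfdual, sd. split.
  - intros (C & HC & L). assert (C = cp A) as -> by (apply ext; intros z; rewrite (HC z), mem_cp; reflexivity).
    apply wadge_le_iff; assumption.
  - intros L. exists (cp A). split; [intros z; apply mem_cp|apply wadge_le_iff; assumption].
Qed.

(** A descending sequence is chosen through reductions of its terms to one fixed member A0, and the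
    contractions between successive terms are what [martin_monk] refutes. *)
Theorem wadge_wf Sf : (forall A, A ∈ Sf -> subset A X) -> Sf <> emp ->
  exists A, A ∈ Sf /\ forall C, C ∈ Sf -> ~ lt C A.
Proof.
  intros SX NE. apply NNPP. intros NM. destruct (not_empty Sf NE) as (A0 & HA0).
  set (pull := fun f => sep X (fun x => ap pi (ap f (ap s x)) ∈ A0)).
  assert (TP : forall f : env -> M, T f -> T (fun e => pull (f e))) by (intros; unfold pull; dsolve).
  assert (MP : forall f x, x ∈ pull f <-> x ∈ X /\ ap pi (ap f (ap s x)) ∈ A0).
  { intros f x. unfold pull. rewrite mem_sep by dsolve. reflexivity. }
  clearbody pull.
  assert (PL : forall A, subset A X -> le A A0 -> exists f, f ∈ CFs /\ pull f = A).
  { intros A SA (f & F & HF). exists f. split; [apply mem_CFs, F|]. apply ext. intros x. rewrite MP. split.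
    - intros [Hx H]. apply HF; assumption.
    - intros H. split; [auto|]. apply HF; auto. }
  assert (LP : forall f, f ∈ CFs -> le (pull f) A0).
  { intros f F. exists f. split; [apply mem_CFs, F|]. intros x Hx. rewrite MP. tauto. }
  destruct (PL A0 (SX A0 HA0) (le_refl A0)) as (f0 & F0 & E0).
  destruct (dependent_choice R hDC hRB CFs (fun f g => pull g ∈ Sf /\ (pull f ∈ Sf -> lt (pull g) (pull f))))
    as (h & Hh & HS); [dsolve|apply BS_CFs| |].
  { intros f F. destruct (classic (pull f ∈ Sf)) as [H|H].
    - destruct (classic (exists C, C ∈ Sf /\ lt C (pull f))) as [(C & HC & L)|N]; [|destruct NM; exists (pull f); split; [exact H|intros C HC L; apply N; eauto]].
      destruct (PL C (SX C HC)) as (g & G & <-); [apply (le_trans _ (pull f)); [apply L|apply LP, F]|].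
      exists g. auto.
    - exists f0. rewrite E0. tauto. }
  apply mem_fn in Hh.
  (* Shifted by one, because the first term supplied by dependent choice may fall outside [Sf]. *)
  set (A := fun n => pull (ap h (suc n))).
  assert (TA : forall n : env -> M, T n -> T (fun e => A (n e))) by (intros; unfold A; dsolve).
  assert (AS : forall n, n ∈ om -> A n ∈ Sf) by (intros n N; apply (HS n N)).
  assert (AL : forall n, n ∈ om -> lt (A (suc n)) (A n)).
  { intros n N. apply (HS (suc n)); [apply om_suc, N|]. apply AS, N. }
  clearbody A.
  assert (CON : forall n, n ∈ om ->
    (exists f, f ∈ CFs /\ CT f /\ forall b, b ∈ Bs -> (ap pi b ∈ A (suc n) <-> ap pi (ap f b) ∈ A n)) /\
    (exists f, f ∈ CFs /\ CT f /\ forall b, b ∈ Bs -> (ap pi b ∈ A (suc n) <-> ap pi (ap f b) ∉ A n))).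
  { intros n N. destruct (lt_contractions (A (suc n)) (A n)) as [(f & F & HF) (g & G & HG)];
      [apply SX, AS, om_suc, N|apply SX, AS, N|apply AL, N|].
    split; [exists f|exists g]; (split; [apply mem_CFs, LIP_CF, CT_LIP; assumption|auto]). }
  destruct (countable_choice R hDC hRB CFs (fun n f => CT f /\ forall b, b ∈ Bs -> (ap pi b ∈ A (suc n) <-> ap pi (ap f b) ∈ A n)))
    as (h0 & _ & H0); [dsolve|apply BS_CFs|intros n N; apply CON, N|].
  destruct (countable_choice R hDC hRB CFs (fun n f => CT f /\ forall b, b ∈ Bs -> (ap pi b ∈ A (suc n) <-> ap pi (ap f b) ∉ A n)))
    as (h1 & _ & H1); [dsolve|apply BS_CFs|intros n N; apply CON, N|].
  set (As := lam om (fun n => sep Bs (fun b => ap pi b ∈ A n))).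
  assert (ME : forall n b, n ∈ om -> b ∈ Bs -> (b ∈ ap As n <-> ap pi b ∈ A n)).
  { intros n b N Hb. unfold As. rewrite ap_lam by (dsolve || exact N). rewrite mem_sep by dsolve. tauto. }
  apply (martin_monk hAD As h0 h1).
  - intros n N. apply H0, N.
  - intros n N. apply H1, N.
  - intros n b N Hb. destruct (H0 n N) as [C0 R0].
    rewrite !ME; auto using om_suc. apply CF_ap; [apply LIP_CF, CT_LIP, C0|exact Hb].
  - intros n b N Hb. destruct (H1 n N) as [C1 R1].
    rewrite !ME; auto using om_suc. apply CF_ap; [apply LIP_CF, CT_LIP, C1|exact Hb].
Qed.

(** * Localization by retractions onto basic neighbourhoods *)

Definition rt x k : M := lam Bs (fun b => ite (agree k (ap s x) b) b (ap s x)).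
Lemma T_rt (x k : env -> M) : T x -> T k -> T (fun e => rt (x e) (k e)).
Proof. intros. unfold rt. dsolve. Qed.
Hint Resolve T_rt : dfn.
Lemma rt_in x k b : b ∈ Bs -> agree k (ap s x) b -> ap (rt x k) b = b.
Proof. intros Hb A. unfold rt. rewrite ap_lam by (dsolve || exact Hb). apply ite_true, A. Qed.
Lemma rt_out x k b : b ∈ Bs -> ~ agree k (ap s x) b -> ap (rt x k) b = ap s x.
Proof. intros Hb A. unfold rt. rewrite ap_lam by (dsolve || exact Hb). apply ite_false, A. Qed.
Lemma rt_agree x k b : b ∈ Bs -> agree k (ap s x) (ap (rt x k) b).
Proof.
  intros Hb. destruct (classic (agree k (ap s x) b)) as [H|H].
  - rewrite rt_in by assumption. exact H.
  - rewrite rt_out by assumption. apply agree_refl.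
Qed.
Lemma CF_rt x k : x ∈ X -> k ∈ om -> CF (rt x k).
Proof.
  intros Hx K. split.
  - apply lam_fun; [dsolve|]. intros b Hb. destruct (classic (agree k (ap s x) b)) as [H|H];
      [rewrite ite_true by exact H; exact Hb|rewrite ite_false by exact H; auto].
  - intros b n Hb N. destruct (nat_max k (suc n) K (om_suc n N)) as (m & Hm & KM & NM).
    exists m. split; [exact Hm|]. intros b' Hb' A.
    assert (A' : agree k b b') by (apply (agree_sub m); assumption).
    destruct (classic (agree k (ap s x) b)) as [H|H].
    + rewrite !rt_in; [apply A, NM, suc_self|exact Hb'|apply (agree_trans _ _ b); assumption|exact Hb|exact H].
    + rewrite !rt_out; [reflexivity|exact Hb'| |exact Hb|exact H].
      intros H'. apply H. apply (agree_trans _ _ b'); [exact H'|apply agree_sym, A'].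
Qed.
Lemma rt_s x k y : x ∈ X -> y ∈ X -> ap s (ap pi (ap (rt x k) (ap s y))) = ap (rt x k) (ap s y).
Proof.
  intros Hx Hy. destruct (classic (agree k (ap s x) (ap s y))) as [H|H].
  - rewrite rt_in by auto. rewrite pi_s; auto.
  - rewrite rt_out by auto. rewrite pi_s; auto.
Qed.

(* The preimage of A under the retraction of X to the basic clopen set given by x and k *)
Definition loc A x k : M := sep X (fun y => ap pi (ap (rt x k) (ap s y)) ∈ A).
Lemma T_loc (A x k : env -> M) : T A -> T x -> T k -> T (fun e => loc (A e) (x e) (k e)).
Proof. intros. unfold loc. dsolve. Qed.
Hint Resolve T_loc : dfn.
Lemma mem_loc A x k y : y ∈ loc A x k <-> y ∈ X /\ ap pi (ap (rt x k) (ap s y)) ∈ A.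
Proof. unfold loc. rewrite mem_sep by dsolve. reflexivity. Qed.
Lemma mem_loc_in A x k y : y ∈ X -> agree k (ap s x) (ap s y) -> (y ∈ loc A x k <-> y ∈ A).
Proof. intros Hy H. rewrite mem_loc, rt_in, pi_s; auto. tauto. Qed.
Lemma loc_sub A x k : subset (loc A x k) X.
Proof. intros y H. apply mem_loc in H. apply H. Qed.
Lemma loc_cp A x k : x ∈ X -> k ∈ om -> loc (cp A) x k = cp (loc A x k).
Proof.
  intros Hx K. apply ext. intros y. rewrite mem_loc, !mem_cp, mem_loc. split; [tauto|].
  intros [Hy H]. split; [exact Hy|]. split; [|tauto]. apply pi_in, CF_ap; [apply CF_rt|]; auto.
Qed.
Lemma loc_le A x k : x ∈ X -> k ∈ om -> le (loc A x k) A.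
Proof.
  intros Hx K. exists (rt x k). split; [apply CF_rt; assumption|]. intros y Hy. rewrite mem_loc. tauto.
Qed.

(** This lemma and the next three justify treating [loc A x k] as the restriction of A to the
    neighbourhood: reductions of it amount to reductions of A there, and reductions to it may be
    taken with values there. *)
Lemma loc_le_on f A C x k : x ∈ X -> k ∈ om -> CF f ->
  (forall y, y ∈ X -> agree k (ap s x) (ap s y) -> (y ∈ A <-> ap pi (ap f (ap s y)) ∈ C)) -> le (loc A x k) C.
Proof.
  intros Hx K F H. exists (comp f (rt x k)). assert (RC := CF_rt x k Hx K).
  split; [apply CF_comp; assumption|]. intros y Hy.
  rewrite mem_loc, ap_comp by auto. assert (B : ap (rt x k) (ap s y) ∈ Bs) by auto.
  rewrite H; [rewrite rt_s by assumption; tauto|auto|]. rewrite rt_s by assumption. apply rt_agree. auto.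
Qed.
Lemma le_loc_on A C x k : x ∈ X -> k ∈ om -> le (loc A x k) C -> exists f, CF f /\
  forall y, y ∈ X -> agree k (ap s x) (ap s y) -> (y ∈ A <-> ap pi (ap f (ap s y)) ∈ C).
Proof.
  intros Hx K (f & F & H). exists f. split; [exact F|]. intros y Hy A'.
  rewrite <- H, mem_loc_in by assumption. reflexivity.
Qed.
Lemma le_loc_into E A x k : x ∈ X -> k ∈ om -> le E (loc A x k) -> exists f, CF f /\
  forall y, y ∈ X -> agree k (ap s x) (ap s (ap pi (ap f (ap s y)))) /\ (y ∈ E <-> ap pi (ap f (ap s y)) ∈ A).
Proof.
  intros Hx K (f & F & H). assert (RC := CF_rt x k Hx K). exists (comp (rt x k) (comp sp f)).
  split; [apply CF_comp; [exact RC|apply CF_comp; [apply CF_sp|exact F]]|].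
  intros y Hy. rewrite !ap_comp, ap_sp by auto. rewrite rt_s by auto. split; [apply rt_agree; auto|].
  rewrite H by exact Hy. rewrite mem_loc. assert (ap pi (ap f (ap s y)) ∈ X) by auto. tauto.
Qed.
Lemma le_loc_of f E A x k : x ∈ X -> k ∈ om -> CF f -> (forall y, y ∈ X ->
  agree k (ap s x) (ap s (ap pi (ap f (ap s y)))) /\ (y ∈ E <-> ap pi (ap f (ap s y)) ∈ A)) -> le E (loc A x k).
Proof.
  intros Hx K F H. exists f. split; [exact F|]. intros y Hy. destruct (H y Hy) as [H1 H2].
  rewrite H2, mem_loc_in; auto. reflexivity.
Qed.
Lemma loc_mono A x x' k k' : x ∈ X -> x' ∈ X -> k ∈ om -> k' ∈ om -> subset k k' ->
  agree k (ap s x) (ap s x') -> le (loc A x' k') (loc A x k).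
Proof.
  intros Hx Hx' K K' S AG. apply (le_loc_of (rt x' k')); [exact Hx|exact K|apply CF_rt; assumption|].
  intros y Hy. rewrite rt_s by assumption. split; [|rewrite mem_loc; tauto].
  apply (agree_trans _ _ (ap s x')); [exact AG|]. apply (agree_sub k'); [exact S|]. apply rt_agree. auto.
Qed.
Lemma loc_agree A x x' k : x ∈ X -> x' ∈ X -> k ∈ om -> agree k (ap s x) (ap s x') ->
  le (loc A x' k) (loc A x k).
Proof. intros. apply loc_mono; auto. intros z Z. exact Z. Qed.

(** X is partitioned by the largest neighbourhoods on which A reduces to C. They are named by codes
    of finite sequences, so countable choice picks one reduction for each code. *)
Theorem gluing A C : (forall y, y ∈ X -> exists k, k ∈ om /\ le (loc A y k) C) -> le A C.
Proof.
  intros H.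
  destruct (countable_choice R hDC hRB CFs (fun m f => forall y k, y ∈ X -> k ∈ om -> cd (ap s y) k = m -> le (loc A y k) C ->
    forall z, z ∈ X -> agree k (ap s y) (ap s z) -> (z ∈ A <-> ap pi (ap f (ap s z)) ∈ C))) as (h & Hh & HC).
  - dsolve.
  - apply BS_CFs.
  - intros m Hm. destruct (classic (exists y k, y ∈ X /\ k ∈ om /\ cd (ap s y) k = m /\ le (loc A y k) C)) as [(y & k & Hy & K & E & L)|N].
    + destruct (le_loc_on A C y k Hy K L) as (f & F & HF). exists f. split; [apply mem_CFs, F|].
      intros y' k' Hy' K' E' _ z Hz AG. rewrite <- E' in E. apply cd_inj in E; auto. destruct E as [<- AG'].
      apply HF; [exact Hz|]. apply (agree_trans _ _ (ap s y')); assumption.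
    + exists idB. split; [apply mem_CFs, CF_idB|]. intros y k Hy K E L. destruct N. exists y, k. auto.
  - apply mem_fn in Hh.
    (* The level of the piece around z. It is constant on that piece, so the pasted map is
       continuous. *)
    set (kk := fun z => the (fun k => k ∈ om /\ le (loc A z k) C /\ forall j, j ∈ k -> ~ le (loc A z j) C)).
    assert (KU : forall z k k', k ∈ om -> k' ∈ om -> (le (loc A z k) C /\ forall j, j ∈ k -> ~ le (loc A z j) C) ->
      (le (loc A z k') C /\ forall j, j ∈ k' -> ~ le (loc A z j) C) -> k = k').
    { intros z k k' K K' [B1 B2] [B1' B2'].
      destruct (ord_tricho k k' (nat_ord k K) (nat_ord k' K')) as [L|[L|L]]; [destruct (B2' k L B1)|exact L|destruct (B2 k' L B1')]. }
    assert (KS : forall z, z ∈ X -> kk z ∈ om /\ le (loc A z (kk z)) C /\ forall j, j ∈ kk z -> ~ le (loc A z j) C).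
    { intros z Hz. unfold kk. apply (the_ext (fun k => k ∈ om /\ le (loc A z k) C /\ forall j, j ∈ k -> ~ le (loc A z j) C)).
      - apply nat_least; [dsolve|]. apply H, Hz.
      - intros k k' (K & B) (K' & B'). apply (KU z); assumption. }
    assert (TK : forall z : env -> M, T z -> T (fun e => kk (z e))) by (intros; unfold kk; dsolve).
    clearbody kk.
    assert (KA : forall z z', z ∈ X -> z' ∈ X -> agree (kk z) (ap s z) (ap s z') -> kk z' = kk z).
    { intros z z' Hz Hz' AG. destruct (KS z Hz) as (K & L & MIN). destruct (KS z' Hz') as (K' & L' & MIN').
      apply (KU z'); [exact K'|exact K|auto|]. split.
      - apply (le_trans _ (loc A z (kk z))); [apply loc_agree; auto|exact L].
      - intros j J HL. apply (MIN j J). assert (JO : j ∈ om) by exact (nat_trans j _ K J).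
        apply (le_trans _ (loc A z' j)); [|exact HL]. apply loc_agree; auto. apply agree_sym.
        apply (agree_sub (kk z)); [apply nat_sub; assumption|exact AG]. }
    set (F := lam Bs (fun b => ap (ap h (cd (ap s (ap pi b)) (kk (ap pi b)))) (ap s (ap pi b)))).
    assert (HF : forall m, m ∈ om -> CF (ap h m)).
    { intros m Hm. apply mem_CFs, (ap_mem h om); assumption. }
    assert (CO : forall z, z ∈ X -> cd (ap s z) (kk z) ∈ om) by (intros z Hz; apply cd_om; [auto|apply KS, Hz]).
    assert (FE : forall b, b ∈ Bs -> ap F b = ap (ap h (cd (ap s (ap pi b)) (kk (ap pi b)))) (ap s (ap pi b))).
    { intros b Hb. unfold F. rewrite ap_lam; [reflexivity|dsolve|exact Hb]. }
    exists F. split; [split|].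
    + apply lam_fun; [dsolve|]. intros b Hb. apply CF_ap; auto.
    + intros b n Hb N. set (z := ap pi b). assert (Hz : z ∈ X) by (unfold z; auto).
      destruct (KS z Hz) as (K & _).
      destruct (proj2 (HF _ (CO z Hz)) (ap s z) n (s_in z Hz) N) as (l & L & HL).
      destruct (nat_max (kk z) l K L) as (m & Hm & KM & LM).
      destruct (coded_cont _ _ _ _ _ hX b m Hb Hm) as (j & J & HJ).
      exists j. split; [exact J|]. intros b' Hb' AG. specialize (HJ b' Hb' AG). fold z in HJ.
      rewrite !FE by assumption. fold z.
      assert (AK : agree (kk z) (ap s z) (ap s (ap pi b'))) by (apply (agree_sub m); assumption).
      rewrite (KA z (ap pi b')) by auto. rewrite <- (cd_agree (ap s z) (ap s (ap pi b')) (kk z) K AK).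
      apply HL; [auto|]. apply (agree_sub m); assumption.
    + intros x Hx. destruct (KS x Hx) as (K & L & _). rewrite FE, pi_s by auto.
      apply (HC (cd (ap s x) (kk x)) (CO x Hx) x (kk x)); auto. apply agree_refl.
Qed.

(** If A reduced to itself inside every neighbourhood of p, then composing with a reduction of A to
    its complement would give maps that flip A and take values arbitrarily near p, which
    [local_flip] excludes. *)
Theorem selfdual_locally_lower A p : subset A X -> sd A -> p ∈ X -> exists k, k ∈ om /\ ~ le A (loc A p k).
Proof.
  intros SA (f & F & HF) Hp. apply NNPP. intros NO.
  assert (H : forall k, k ∈ om -> le A (loc A p k)) by (intros k K; apply NNPP; intros C; apply NO; eauto).
  destruct (countable_choice R hDC hRB CFs (fun k g => forall b, b ∈ Bs -> agree k (ap s p) (ap g b) /\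
    (ap pi b ∈ A <-> ap pi (ap g b) ∉ A))) as (h & Hh & HS); [dsolve|apply BS_CFs| |].
  - intros k K. destruct (le_loc_into A A p k Hp K (H k K)) as (g & G & HG).
    assert (Q : CF (comp sp (comp g (comp sp (comp f sp))))) by (pose proof CF_sp; apply CF_comp; [assumption|apply CF_comp; [assumption|apply CF_comp; [assumption|apply CF_comp; assumption]]]).
    exists (comp sp (comp g (comp sp (comp f sp)))). split; [apply mem_CFs, Q|]. intros b Hb.
    rewrite !ap_comp by auto using CF_sp. rewrite !ap_sp by auto 10 using CF_sp.
    set (y := ap pi (ap f (ap s (ap pi b)))). assert (Hy : y ∈ X) by (unfold y; auto 10).
    destruct (HG y Hy) as [G1 G2]. split; [exact G1|]. rewrite pi_s by auto.
    rewrite <- G2. rewrite (HF (ap pi b) (pi_in b Hb)). fold y. rewrite mem_cp. tauto.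
  - apply mem_fn in Hh. set (As := sep Bs (fun b => ap pi b ∈ A)).
    assert (MA : forall b, b ∈ Bs -> (b ∈ As <-> ap pi b ∈ A)).
    { intros b Hb. unfold As. rewrite mem_sep by dsolve. tauto. }
    assert (HC : forall k, k ∈ om -> CF (ap h k)) by (intros k K; apply mem_CFs, (ap_mem h om); assumption).
    apply (local_flip hAD As (ap s p) h); [auto|exact HC| |].
    + intros k x K Hx. apply HS; assumption.
    + intros k x K Hx. rewrite !MA by auto. apply HS; assumption.
Qed.

(** Without such a point, Wadge's lemma would reduce E to its complement near every point, and the
    reductions would glue. *)
Lemma nonselfdual_point E : subset E X -> ~ sd E -> exists p, p ∈ X /\ forall k, k ∈ om -> le E (loc E p k).
Proof.
  intros SE N. apply NNPP. intros NO. apply N. apply gluing. intros y Hy. apply NNPP. intros C.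
  apply NO. exists y. split; [exact Hy|]. intros k K. destruct (wadge E (loc E y k)) as [L|L]; [exact L|].
  destruct C. eauto.
Qed.

(* Otherwise E reduces to the complement of A, and the image y of p under the reduction
   violates both alternatives. *)
Lemma le_of_local E A p : subset A X -> subset E X -> p ∈ X -> (forall k, k ∈ om -> le E (loc E p k)) ->
  (forall y, y ∈ X -> (exists k, k ∈ om /\ ~ le E (cp (loc A y k))) \/ (y ∈ A <-> p ∈ E)) -> le A E.
Proof.
  intros SA SE Hp HE H. apply NNPP. intros N. destruct (wadge A E) as [L|(f & F & HF)]; [exact (N L)|].
  set (y := ap pi (ap f (ap s p))). assert (Hy : y ∈ X) by (unfold y; auto).
  destruct (H y Hy) as [(k & K & NL)|Q].
  - apply NL. assert (CFF : CF (comp sp f)) by (apply CF_comp; [apply CF_sp|exact F]).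
    destruct (CF_agree (comp sp f) (ap s p) CFF (s_in p Hp) k K) as (j & J & HJ).
    (* Near p the values of f are near y. As E is as complicated near p as it is globally, it
       reduces to the complement of A near y. *)
    apply (le_trans _ (loc E p j)); [apply HE, J|]. rewrite <- loc_cp by assumption.
    assert (RC := CF_rt p j Hp J).
    apply (le_loc_of (comp f (rt p j))); [exact Hy|exact K|apply CF_comp; assumption|].
    intros z Hz. rewrite ap_comp by auto. set (w := ap pi (ap (rt p j) (ap s z))).
    assert (Hw : w ∈ X) by (unfold w; auto). assert (SW : ap s w = ap (rt p j) (ap s z)) by (apply rt_s; assumption).
    rewrite <- SW. split.
    + specialize (HJ (ap s w) (s_in w Hw)). rewrite !ap_comp, !ap_sp in HJ by auto. apply HJ.
      rewrite SW. apply rt_agree. auto.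
    + rewrite mem_loc. fold w. rewrite <- HF by exact Hw. tauto.
  - specialize (HF p Hp). fold y in HF. rewrite mem_cp in HF. tauto.
Qed.
End WadgeTheory.
#[export] Hint Resolve D_le D_lt T_rt T_loc : dfn.

(** * Non-selfdual sets inside a perfect set *)

Section Decoding.
Context {M : set_structure} {hZF : ZF_model M}.
Implicit Types a b c f g h x y z u v p q m n k i j l w : M.
Notation env := (nat -> M).

(* A sequence z with infinitely many nonzero terms, at the positions p_0 < p_1 < ...,
   codes the sequence p1 p_0, p1 p_1, ...; every natural number is p1 p for
   arbitrarily large p, so that zeros act as passes. *)
Definition cnt z p : M := ap (nrec emp (fun i v => ite (ap z i = emp) v (suc v))) p.
Lemma T_cnt (z p : env -> M) : T z -> T p -> T (fun e => cnt (z e) (p e)).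
Proof. intros. unfold cnt. dsolve. Qed.
Hint Resolve T_cnt : dfn.
Definition one z p n : Prop := p ∈ om /\ ap z p <> emp /\ cnt z p = n.
Lemma D_one (z p n : env -> M) : T z -> T p -> T n -> D (fun e => one (z e) (p e) (n e)).
Proof. intros. unfold one. dsolve. Qed.
Hint Resolve D_one : dfn.
Definition infz z : Prop := forall n, n ∈ om -> exists p, one z p n.
Lemma D_infz (z : env -> M) : T z -> D (fun e => infz (z e)).
Proof. intros. unfold infz. dsolve. Qed.
Hint Resolve D_infz : dfn.
Definition dec z : M := lam om (fun n => the (fun v => exists p, one z p n /\ v = p1 p)).
Lemma T_dec (z : env -> M) : T z -> T (fun e => dec (z e)).
Proof. intros. unfold dec. dsolve. Qed.
Hint Resolve T_dec : dfn.

Lemma cnt_0 z : cnt z emp = emp.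
Proof. unfold cnt. apply nrec_0. dsolve. Qed.
Lemma cnt_S0 z p : p ∈ om -> ap z p = emp -> cnt z (suc p) = cnt z p.
Proof. intros P H. unfold cnt. rewrite nrec_S by (dsolve || exact P). apply ite_true, H. Qed.
Lemma cnt_S1 z p : p ∈ om -> ap z p <> emp -> cnt z (suc p) = suc (cnt z p).
Proof. intros P H. unfold cnt. rewrite nrec_S by (dsolve || exact P). apply ite_false, H. Qed.
Lemma cnt_om z p : p ∈ om -> cnt z p ∈ om.
Proof.
  revert p. nind; [rewrite cnt_0; apply om_emp|]. intros p P IH. destruct (classic (ap z p = emp)) as [H|H].
  - rewrite cnt_S0 by assumption. exact IH.
  - rewrite cnt_S1 by assumption. apply om_suc, IH.
Qed.
Lemma cnt_le z p : p ∈ om -> ord_le (cnt z p) p.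
Proof.
  revert p. nind; [rewrite cnt_0; right; reflexivity|]. intros p P IH. assert (C := cnt_om z p P).
  destruct (classic (ap z p = emp)) as [H|H].
  - rewrite cnt_S0 by assumption. left. apply mem_suc_le, IH.
  - rewrite cnt_S1 by assumption. apply suc_le; [apply nat_ord, om_suc, P|]. apply mem_suc_le, IH.
Qed.
Lemma cnt_agree z z' p : p ∈ om -> agree p z z' -> cnt z p = cnt z' p.
Proof.
  revert p. nind; [intros _; rewrite !cnt_0; reflexivity|]. intros p P IH A.
  assert (E := A p (suc_self p)).
  assert (IH' : cnt z p = cnt z' p) by (apply IH, (agree_sub (suc p)); [apply suc_sub|exact A]).
  destruct (classic (ap z p = emp)) as [H|H].
  - rewrite !cnt_S0; [exact IH'|exact P|congruence|exact P|exact H].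
  - rewrite !cnt_S1; [congruence|exact P|congruence|exact P|exact H].
Qed.
Lemma cnt_mono z q : q ∈ om -> forall p, p ∈ q -> ord_le (cnt z p) (cnt z q).
Proof.
  revert q. nind; [intros p H; destruct (mem_emp p H)|]. intros q Q IH p H.
  assert (L : ord_le (cnt z p) (cnt z q)) by (apply mem_suc in H; destruct H as [H| ->]; [auto|right; reflexivity]).
  destruct (classic (ap z q = emp)) as [E|E].
  - rewrite cnt_S0 by assumption. exact L.
  - rewrite cnt_S1 by assumption. left. apply mem_suc_le, L.
Qed.
Lemma one_lt z p n q : one z p n -> q ∈ om -> p ∈ q -> n ∈ cnt z q.
Proof.
  intros (P & NE & <-) Q H. assert (C := cnt_om z q Q).
  assert (E := cnt_S1 z p P NE).
  destruct (suc_le p q (nat_ord q Q) H) as [L|L].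
  - apply (ord_lt_le (cnt z p) (cnt z (suc p))); [apply nat_ord, C|rewrite E; apply suc_self|].
    apply cnt_mono; assumption.
  - rewrite <- L, E. apply suc_self.
Qed.
Lemma one_unique z p q n : one z p n -> one z q n -> p = q.
Proof.
  intros HP HQ. pose proof HP as (P & _ & EP). pose proof HQ as (Q & _ & EQ).
  destruct (ord_tricho p q (nat_ord p P) (nat_ord q Q)) as [H|[H|H]]; [|exact H|].
  - pose proof (one_lt z p n q HP Q H) as A. rewrite EQ in A. destruct (mem_irrefl _ A).
  - pose proof (one_lt z q n p HQ P H) as A. rewrite EP in A. destruct (mem_irrefl _ A).
Qed.
Lemma dec_eq z p n : n ∈ om -> one z p n -> ap (dec z) n = p1 p.
Proof.
  intros N H. unfold dec. rewrite ap_lam by (dsolve || exact N). apply the_eq; [eauto|].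
  intros v (q & HQ & ->). f_equal. apply (one_unique z q p n); assumption.
Qed.
Lemma dec_Bs z : dec z ∈ Bs.
Proof.
  apply Bs_lam; [dsolve|]. intros n N.
  destruct (the_spec (fun v => exists p, one z p n /\ v = p1 p)) as [[_ (p & _ & ->)]|[_ A]].
  - apply p1_om.
  - apply is_empty_emp in A. rewrite A. apply om_emp.
Qed.
Lemma one_agree z z' p n : agree (suc p) z z' -> one z p n -> one z' p n.
Proof.
  intros A (P & NE & E). split; [exact P|]. split; [rewrite <- (A p (suc_self p)); exact NE|].
  rewrite <- E. symmetry. apply cnt_agree; [exact P|]. apply (agree_sub (suc p)); [apply suc_sub|exact A].
Qed.
Lemma CF_dec f : CF f -> (forall x, x ∈ Bs -> infz (ap f x)) -> CF (lam Bs (fun x => dec (ap f x))).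
Proof.
  intros F HI. split; [apply lam_fun; [dsolve|]; intros; apply dec_Bs|]. intros x n X N.
  destruct (HI x X n N) as (p & HP). destruct (CF_agree f x F X (suc p)) as (k & K & H); [apply om_suc, HP|].
  exists k. split; [exact K|]. intros y Y A. rewrite !ap_lam by (dsolve || assumption).
  rewrite (dec_eq _ p n N HP). symmetry. apply dec_eq; [exact N|]. apply (one_agree (ap f x)); auto.
Qed.

Definition bin z : Prop := z ∈ Bs /\ forall n, n ∈ om -> ap z n = emp \/ ap z n = suc emp.
Lemma D_bin (z : env -> M) : T z -> D (fun e => bin (z e)).
Proof. intros. unfold bin. dsolve. Qed.
Hint Resolve D_bin : dfn.

(** Produces a binary play whose decoding obeys a rule depending on the play itself: term p is 1
    exactly when [p1 p] is the value wanted next. This is a fixed point of a contraction, since the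
    count of ones before p is at most p. *)
Lemma dec_fix (G : M -> M -> M) : T2 G -> (forall z n, z ∈ Bs -> n ∈ om -> G z n ∈ om) ->
  (forall z z' n, z ∈ Bs -> z' ∈ Bs -> n ∈ om -> agree n z z' -> G z n = G z' n) ->
  exists z, bin z /\ infz z /\ forall n, n ∈ om -> ap (dec z) n = G z n.
Proof.
  intros TG GO GC.
  destruct (contraction_fix (fun z => lam om (fun p => ite (p1 p = G z (cnt z p)) (suc emp) emp))) as (z & Z & EZ).
  - dsolve.
  - intros z Z. apply Bs_lam; [dsolve|]. intros p P. destruct (classic (p1 p = G z (cnt z p))) as [H|H];
      [rewrite ite_true by exact H; apply om_suc, om_emp|rewrite ite_false by exact H; apply om_emp].
  - intros z z' p Z Z' P A. rewrite !ap_lam by (dsolve || exact P).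
    rewrite <- (cnt_agree z z' p P A). rewrite (GC z z' (cnt z p)); [reflexivity|exact Z|exact Z'|apply cnt_om, P|].
    apply (agree_sub p); [|exact A]. apply ord_le_subset; [apply nat_ord, P|apply cnt_le, P].
  - assert (ZE : forall p, p ∈ om -> ap z p = ite (p1 p = G z (cnt z p)) (suc emp) emp).
    { intros p P. rewrite <- EZ at 1. rewrite ap_lam; [reflexivity|dsolve|exact P]. }
    assert (ON : forall p, p ∈ om -> ap z p <> emp <-> p1 p = G z (cnt z p)).
    { intros p P. rewrite ZE by exact P. destruct (classic (p1 p = G z (cnt z p))) as [H|H].
      - rewrite ite_true by exact H. pose proof (suc_not_emp emp). tauto.
      - rewrite ite_false by exact H. tauto. }
    (* If no further 1 came after p, the count would stay n, and the position that codes the wanted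
       value and lies beyond p would receive a 1. *)
    assert (NXT : forall p, p ∈ om -> exists q, one z q (cnt z p)).
    { intros p P. apply NNPP. intros NO. set (n := cnt z p) in *. assert (N : n ∈ om) by apply cnt_om, P.
      assert (C : forall q, q ∈ om -> ord_le p q -> cnt z q = n).
      { nind.
        - intros [L|L]; [destruct (mem_emp p L)|rewrite <- L; reflexivity].
        - intros q Q IH [L|L]; [|rewrite <- L; reflexivity]. apply mem_suc_le in L. specialize (IH L).
          destruct (classic (ap z q = emp)) as [E|E]; [rewrite cnt_S0; assumption|].
          destruct NO. exists q. split; auto. }
      assert (GN := GO z n Z N). assert (Q := pr_om (G z n) p GN P).
      assert (CQ : cnt z (pr (G z n) p) = n) by (apply C; [exact Q|left; apply pr_gt; assumption]).
      apply NO. exists (pr (G z n) p). split; [exact Q|]. split; [|exact CQ]. apply ON; [exact Q|].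
      rewrite CQ. apply p1_pr; assumption. }
    assert (INF : infz z).
    { assert (H : forall n, n ∈ om -> exists p, p ∈ om /\ cnt z p = n).
      { nind; [exists emp; split; [apply om_emp|apply cnt_0]|]. intros n N (p & P & <-).
        destruct (NXT p P) as (q & Q & NE & E). exists (suc q). split; [apply om_suc, Q|].
        rewrite cnt_S1, E by assumption. reflexivity. }
      intros n N. destruct (H n N) as (p & P & <-). apply NXT, P. }
    exists z. split; [split; [exact Z|]|split; [exact INF|]].
    + intros p P. rewrite ZE by exact P. destruct (classic (p1 p = G z (cnt z p))) as [H|H];
        [rewrite ite_true by exact H|rewrite ite_false by exact H]; auto.
    + intros n N. destruct (INF n N) as (p & HP). rewrite (dec_eq z p n N HP).
      destruct HP as (P & NE & E). apply ON in NE; [|exact P]. rewrite NE, E. reflexivity.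
Qed.
End Decoding.
#[export] Hint Resolve T_cnt D_one D_infz T_dec D_bin : dfn.

(** * Cantor schemes in a set without isolated points *)

Section CantorScheme.
Context {M : set_structure} {hZF : ZF_model M}.
Implicit Types a b c f g h x y z u v p q m n k i j l w K E : M.
Notation env := (nat -> M).
Context (X TT s pi dp : M) (hX : coded X TT s pi dp).
Context (K : M) (hK : subset K X).
Context (perfect : forall y k, y ∈ K -> k ∈ om -> exists y', y' ∈ K /\ y' <> y /\ agree k (ap s y) (ap s y')).
Context (x0 k0 : M) (hx0 : x0 ∈ K) (hk0 : k0 ∈ om).
Let sK y : y ∈ K -> ap s y ∈ Bs.
Proof. intros Y. apply (s_in X TT s pi dp hX), hK, Y. Qed.

Definition Knode m := exists y k, y ∈ K /\ k ∈ om /\ m = cd (ap s y) k.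
(** j codes two incompatible extensions of the node m of equal length; taking the least such j
    builds the scheme without choice. *)
Definition Spl m j := exists y y' k l, y ∈ K /\ y' ∈ K /\ k ∈ om /\ l ∈ om /\ cd (ap s y) k = m /\
  agree k (ap s y) (ap s y') /\ k ∈ l /\ p1 j = cd (ap s y) l /\ p2 j = cd (ap s y') l /\ ~ agree l (ap s y) (ap s y').
Definition spl m := the (fun j => j ∈ om /\ Spl m j /\ forall i, i ∈ j -> ~ Spl m i).
Definition child m v := ite (v = emp) (p1 (spl m)) (p2 (spl m)).
Definition Thru b m := exists k, k ∈ om /\ cd b k = m.
Lemma T_spl (m : env -> M) : T m -> T (fun e => spl (m e)).
Proof. intros. unfold spl, Spl. dsolve. Qed.
Hint Resolve T_spl : dfn.
Lemma T_child (m v : env -> M) : T m -> T v -> T (fun e => child (m e) (v e)).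
Proof. intros. unfold child. dsolve. Qed.
Lemma D_Knode (m : env -> M) : T m -> D (fun e => Knode (m e)).
Proof. intros. unfold Knode. dsolve. Qed.
Lemma D_Thru (b m : env -> M) : T b -> T m -> D (fun e => Thru (b e) (m e)).
Proof. intros. unfold Thru. dsolve. Qed.

Hint Resolve T_child D_Knode D_Thru : dfn.

Lemma spl_spec m : Knode m -> Spl m (spl m).
Proof.
  intros (y & k & Y & Hk & ->).
  assert (Q : spl (cd (ap s y) k) ∈ om /\ Spl (cd (ap s y) k) (spl (cd (ap s y) k)) /\
    forall i, i ∈ spl (cd (ap s y) k) -> ~ Spl (cd (ap s y) k) i).
  { apply (the_ext (fun j => j ∈ om /\ Spl (cd (ap s y) k) j /\ forall i, i ∈ j -> ~ Spl (cd (ap s y) k) i)).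
    - apply nat_least; [unfold Spl; dsolve|]. destruct (perfect y k Y Hk) as (y' & Y' & NE & A).
      assert (DI : exists i, i ∈ om /\ ap (ap s y) i <> ap (ap s y') i).
      { apply NNPP. intros C. apply NE. rewrite <- (pi_s X TT s pi dp hX y') by auto.
        rewrite <- (pi_s X TT s pi dp hX y) by auto. f_equal. apply Bs_ext; auto.
        intros i I. apply NNPP. intros H. apply C. exists i. auto. }
      (* The common length l exceeds both k and a place where the two codes differ. *)
      destruct DI as (i & I & NI). destruct (nat_max (suc k) (suc i)) as (l & L & L1 & L2); auto using om_suc.
      exists (pr (cd (ap s y) l) (cd (ap s y') l)). split; [apply pr_om; apply cd_om; auto|].
      exists y, y', k, l. rewrite p1_pr, p2_pr by (apply cd_om; auto).
      do 5 (split; [auto|]). split; [exact A|]. split; [apply L1, suc_self|].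
      split; [reflexivity|]. split; [reflexivity|]. intros H. apply NI, H, L2, suc_self.
    - intros j j' (J & A & B) (J' & A' & B').
      destruct (ord_tricho j j' (nat_ord j J) (nat_ord j' J')) as [L|[L|L]]; [destruct (B' j L A)|exact L|destruct (B j' L A')]. }
  apply Q.
Qed.

Opaque spl.
Lemma child_Knode m v : Knode m -> Knode (child m v).
Proof.
  intros H. destruct (spl_spec m H) as (y & y' & k & l & Y & Y' & Hk & L & _ & _ & _ & E1 & E2 & _).
  unfold child. destruct (classic (v = emp)) as [C|C].
  - rewrite ite_true by exact C. exists y, l. auto.
  - rewrite ite_false by exact C. exists y', l. auto.
Qed.

Lemma child_ext m v y k y' l : y ∈ K -> k ∈ om -> m = cd (ap s y) k -> y' ∈ K -> l ∈ om ->
  child m v = cd (ap s y') l -> k ∈ l /\ agree k (ap s y) (ap s y').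
Proof.
  intros Y Hk EM Y' L EC.
  destruct (spl_spec m) as (w & w' & k1 & l1 & W & W' & K1 & L1 & E & A & KL & E1 & E2 & _).
  { exists y, k. auto. }
  rewrite EM in E. apply cd_inj in E; auto. destruct E as [-> AW].
  unfold child in EC. destruct (classic (v = emp)) as [C|C].
  - rewrite ite_true, E1 in EC by exact C. apply cd_inj in EC; auto. destruct EC as [<- B].
    split; [exact KL|]. apply (agree_trans _ _ (ap s w)); [apply agree_sym, AW|].
    apply (agree_sub l1); [apply nat_sub; assumption|exact B].
  - rewrite ite_false, E2 in EC by exact C. apply cd_inj in EC; auto. destruct EC as [<- B].
    split; [exact KL|]. apply (agree_trans _ _ (ap s w)); [apply agree_sym, AW|].
    apply (agree_trans _ _ (ap s w')); [exact A|].
    apply (agree_sub l1); [apply nat_sub; assumption|exact B].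
Qed.

Lemma split_incompatible m b : Knode m -> b ∈ Bs -> Thru b (p1 (spl m)) -> Thru b (p2 (spl m)) -> False.
Proof.
  intros H Hb (k1 & K1 & E1) (k2 & K2 & E2).
  destruct (spl_spec m H) as (y & y' & k & l & Y & Y' & Hk & L & _ & _ & _ & F1 & F2 & NA).
  rewrite F1 in E1. rewrite F2 in E2. apply cd_inj in E1; auto. apply cd_inj in E2; auto.
  destruct E1 as [-> A1], E2 as [-> A2]. apply NA.
  apply (agree_trans _ _ b); [apply agree_sym, A1|exact A2].
Qed.

Definition pth z n := ap (nrec (cd (ap s x0) k0) (fun n m => child m (ap z n))) n.
Lemma T_pth (z n : env -> M) : T z -> T n -> T (fun e => pth (z e) (n e)).
Proof. intros. unfold pth. dsolve. Qed.
Hint Resolve T_pth : dfn.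
Lemma pth_0 z : pth z emp = cd (ap s x0) k0.
Proof. unfold pth. apply nrec_0. dsolve. Qed.
Lemma pth_S z n : n ∈ om -> pth z (suc n) = child (pth z n) (ap z n).
Proof. intros N. unfold pth at 1. rewrite nrec_S by (dsolve || exact N). reflexivity. Qed.
Opaque pth.
Lemma pth_Knode z n : n ∈ om -> Knode (pth z n).
Proof.
  revert n. nind; [rewrite pth_0; exists x0, k0; auto|]. intros n N IH.
  rewrite pth_S by exact N. apply child_Knode, IH.
Qed.
Lemma pth_ext z n y k : n ∈ om -> y ∈ K -> k ∈ om -> pth z n = cd (ap s y) k ->
  forall j, j ∈ om -> n ∈ j -> forall y' k', y' ∈ K -> k' ∈ om -> pth z j = cd (ap s y') k' ->
  k ∈ k' /\ agree k (ap s y) (ap s y').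
Proof.
  intros N Y Hk E. match goal with |- forall j, j ∈ om -> @?P j => apply (nat_ind_D P) end; cbv beta.
  - dsolve.
  - intros H. destruct (mem_emp n H).
  - intros j J IH NJ y' k' Y' K' E'. rewrite pth_S in E' by exact J. apply mem_suc in NJ.
    destruct NJ as [NJ| ->].
    + destruct (pth_Knode z j J) as (w & l & W & L & F). destruct (IH NJ w l W L F) as [A B].
      destruct (child_ext _ _ w l y' k' W L F Y' K' E') as [A' B'].
      split; [exact (ord_trans k l k' (nat_ord k' K') A A')|].
      apply (agree_trans _ _ (ap s w)); [exact B|]. apply (agree_sub l); [apply nat_sub; assumption|exact B'].
    + apply (child_ext _ _ y k y' k' Y Hk E Y' K' E').
Qed.
(** Guarantees that digit i of the branch can be read off node i+1. *)
Lemma pth_length z n : n ∈ om -> forall y k, y ∈ K -> k ∈ om -> pth z n = cd (ap s y) k -> ord_le n k.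
Proof.
  revert n. nind; [intros y k _ Hk _; apply emp_le, nat_ord, Hk|]. intros n N IH y k Y Hk E.
  destruct (pth_Knode z n N) as (w & l & W & L & F).
  destruct (pth_ext z n w l N W L F (suc n) (om_suc n N) (suc_self n) y k Y Hk E) as [A _].
  apply suc_le; [apply nat_ord, Hk|]. apply (ord_le_lt n l); [apply nat_ord, Hk|apply (IH w l W L F)|exact A].
Qed.

Definition I z := lam om (fun i => the (fun v => exists y k, y ∈ K /\ k ∈ om /\ pth z (suc i) = cd (ap s y) k /\ v = ap (ap s y) i)).
Lemma T_I (z : env -> M) : T z -> T (fun e => I (z e)).
Proof. intros. unfold I. dsolve. Qed.

Hint Resolve T_I : dfn.
Lemma I_digit z i y k : i ∈ om -> y ∈ K -> k ∈ om -> pth z (suc i) = cd (ap s y) k -> ap (I z) i = ap (ap s y) i.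
Proof.
  intros Hi Y Hk E. unfold I. rewrite ap_lam by (dsolve || exact Hi). apply the_eq; [exists y, k; auto|].
  intros v (y' & k' & Y' & K' & E' & ->). rewrite E in E'. apply cd_inj in E'; auto. destruct E' as [_ A].
  symmetry. apply A. apply (ord_lt_le i (suc i)); [apply nat_ord, Hk|apply suc_self|].
  apply (pth_length z (suc i) (om_suc i Hi) y k Y Hk E).
Qed.
Lemma I_Bs z : I z ∈ Bs.
Proof.
  apply mem_fn. split; [apply lam_fun_on; dsolve|]. intros i v H. apply (app_eq_on _ om) in H; [|apply lam_fun_on; dsolve].
  destruct H as [Hi ->]. destruct (pth_Knode z (suc i) (om_suc i Hi)) as (y & k & Y & Hk & E).
  fold (I z). rewrite (I_digit z i y k) by assumption. apply Bs_ap; auto.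
Qed.
Lemma I_agree z n y k : n ∈ om -> y ∈ K -> k ∈ om -> pth z n = cd (ap s y) k -> agree k (I z) (ap s y).
Proof.
  intros N Y Hk E i Hi. assert (IO : i ∈ om) by exact (nat_trans i k Hk Hi).
  assert (SI := om_suc i IO).
  destruct (pth_Knode z (suc i) SI) as (w & l & W & L & F). rewrite (I_digit z i w l) by assumption.
  assert (IL : i ∈ l).
  { apply (ord_lt_le i (suc i)); [apply nat_ord, L|apply suc_self|]. apply (pth_length z (suc i) SI w l W L F). }
  destruct (ord_tricho n (suc i) (nat_ord n N) (nat_ord _ SI)) as [H|[H|H]].
  - symmetry. apply (pth_ext z n y k N Y Hk E (suc i) SI H w l W L F), Hi.
  - rewrite <- H, E in F. apply cd_inj in F; auto. symmetry. apply F, Hi.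
  - apply (pth_ext z (suc i) w l SI W L F n N H y k Y Hk E), IL.
Qed.
Lemma I_thru z n : n ∈ om -> Thru (I z) (pth z n).
Proof.
  intros N. destruct (pth_Knode z n N) as (y & k & Y & Hk & E). exists k. split; [exact Hk|].
  rewrite E. apply cd_agree; [exact Hk|]. apply (I_agree z n); assumption.
Qed.
Lemma pth_agree z z' n : n ∈ om -> agree n z z' -> pth z n = pth z' n.
Proof.
  revert n. nind; [intros _; rewrite !pth_0; reflexivity|]. intros n N IH A.
  rewrite !pth_S, IH, (A n (suc_self n)); auto. apply (agree_sub (suc n)); [apply suc_sub|exact A].
Qed.

(** Follows b through the scheme, turning to the second child if b passes through it and to the
    first otherwise. This default makes the decoding [r] total, and each turn depends on finitely
    many digits of b. *)
Definition rp b n := ap (nrec (cd (ap s x0) k0) (fun _ m => ite (Thru b (p2 (spl m))) (p2 (spl m)) (p1 (spl m)))) n.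
Lemma T_rp (b n : env -> M) : T b -> T n -> T (fun e => rp (b e) (n e)).
Proof. intros. unfold rp. dsolve. Qed.
Hint Resolve T_rp : dfn.
Lemma rp_0 b : rp b emp = cd (ap s x0) k0.
Proof. unfold rp. apply nrec_0. dsolve. Qed.
Lemma rp_S b n : n ∈ om -> rp b (suc n) = ite (Thru b (p2 (spl (rp b n)))) (p2 (spl (rp b n))) (p1 (spl (rp b n))).
Proof. intros N. unfold rp at 1. rewrite nrec_S by (dsolve || exact N). reflexivity. Qed.
Opaque rp.
Lemma rp_child b n : n ∈ om -> exists v, rp b (suc n) = child (rp b n) v /\
  (Thru b (p2 (spl (rp b n))) -> v = suc emp) /\ (~ Thru b (p2 (spl (rp b n))) -> v = emp).
Proof.
  intros N. rewrite rp_S by exact N. destruct (classic (Thru b (p2 (spl (rp b n))))) as [H|H].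
  - exists (suc emp). rewrite ite_true by exact H. unfold child. rewrite ite_false by apply suc_not_emp. tauto.
  - exists emp. rewrite ite_false by exact H. unfold child. rewrite ite_true by reflexivity. tauto.
Qed.
Lemma rp_Knode b n : n ∈ om -> Knode (rp b n).
Proof.
  revert n. nind; [rewrite rp_0; exists x0, k0; auto|]. intros n N IH.
  destruct (rp_child b n N) as (v & -> & _). apply child_Knode, IH.
Qed.
Lemma spl2_Knode m : Knode m -> Knode (p2 (spl m)).
Proof.
  intros H. assert (Q := child_Knode m (suc emp) H). unfold child in Q.
  rewrite ite_false in Q by apply suc_not_emp. exact Q.
Qed.
Lemma Thru_local b m : b ∈ Bs -> Knode m -> exists k, k ∈ om /\ forall b', b' ∈ Bs -> agree k b b' -> (Thru b m <-> Thru b' m).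
Proof.
  intros Hb (y & k & Y & Hk & ->). exists k. split; [exact Hk|].
  assert (TE : forall b, b ∈ Bs -> (Thru b (cd (ap s y) k) <-> agree k b (ap s y))).
  { intros c Hc. split.
    - intros (k' & K' & E). apply cd_inj in E; auto. destruct E as [-> A]. exact A.
    - intros A. exists k. split; [exact Hk|]. apply cd_agree; assumption. }
  intros b' Hb' A. rewrite !TE by assumption. split; intros Q.
  - apply (agree_trans _ _ b); [apply agree_sym, A|exact Q].
  - apply (agree_trans _ _ b'); assumption.
Qed.
Lemma rp_local b n : b ∈ Bs -> n ∈ om -> exists k, k ∈ om /\ forall b', b' ∈ Bs -> agree k b b' -> rp b n = rp b' n.
Proof.
  intros Hb. revert n. nind.
  - exists emp. split; [apply om_emp|]. intros. rewrite !rp_0. reflexivity.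
  - intros n N (k & Hk & H). destruct (Thru_local b (p2 (spl (rp b n))) Hb) as (l & L & H').
    { apply spl2_Knode, rp_Knode, N. }
    destruct (nat_max k l Hk L) as (j & J & KJ & LJ). exists j. split; [exact J|]. intros b' Hb' A.
    rewrite !rp_S by exact N. rewrite <- (H b' Hb') by (apply (agree_sub j); assumption).
    assert (Q : Thru b (p2 (spl (rp b n))) <-> Thru b' (p2 (spl (rp b n)))) by (apply H'; [exact Hb'|apply (agree_sub j); assumption]).
    destruct (classic (Thru b (p2 (spl (rp b n))))) as [C|C].
    + transitivity (p2 (spl (rp b n))); [exact (ite_true _ _ _ C)|symmetry; exact (ite_true _ _ _ (proj1 Q C))].
    + transitivity (p1 (spl (rp b n))); [exact (ite_false _ _ _ C)|symmetry; exact (ite_false _ _ _ (fun C0 => C (proj2 Q C0)))].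
Qed.

Definition r b := lam om (fun n => ite (Thru b (p2 (spl (rp b n)))) (suc emp) emp).
Lemma T_r (b : env -> M) : T b -> T (fun e => r (b e)).
Proof. intros. unfold r. dsolve. Qed.
Hint Resolve T_r : dfn.
Lemma r_digit b n : n ∈ om -> ap (r b) n = ite (Thru b (p2 (spl (rp b n)))) (suc emp) emp.
Proof. intros N. unfold r. rewrite ap_lam; [reflexivity|dsolve|exact N]. Qed.
Lemma r_bin b : bin (r b).
Proof.
  assert (H : forall n, n ∈ om -> ap (r b) n = emp \/ ap (r b) n = suc emp).
  { intros n N. rewrite r_digit by exact N. destruct (classic (Thru b (p2 (spl (rp b n))))) as [H|H];
      [rewrite ite_true by exact H|rewrite ite_false by exact H]; auto. }
  split; [|exact H]. apply Bs_lam; [dsolve|]. intros n N. specialize (H n N). rewrite r_digit in H by exact N.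
  destruct H as [-> | ->]; auto using om_emp, om_suc.
Qed.
(** The branch of z passes through the child prescribed by z and, the two children being
    incompatible, not through the other one. *)
Lemma r_I z : bin z -> r (I z) = z.
Proof.
  intros [Z HZ].
  assert (P : forall n, n ∈ om -> rp (I z) n = pth z n -> (Thru (I z) (p2 (spl (pth z n))) <-> ap z n = suc emp)).
  { intros n N _. assert (TN := I_thru z (suc n) (om_suc n N)). rewrite pth_S in TN by exact N. unfold child in TN.
    destruct (HZ n N) as [E|E].
    - rewrite ite_true in TN by exact E. rewrite E. split.
      + intros Q. destruct (split_incompatible (pth z n) (I z) (pth_Knode z n N) (I_Bs z) TN Q).
      + intros Q. destruct (suc_not_emp emp (eq_sym Q)).
    - rewrite ite_false in TN by (rewrite E; apply suc_not_emp). split; intros _; assumption. }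
  assert (RP : forall n, n ∈ om -> rp (I z) n = pth z n).
  { nind; [rewrite rp_0, pth_0; reflexivity|]. intros n N IH. specialize (P n N IH).
    rewrite (rp_S (I z) n N), (pth_S z n N). rewrite IH. unfold child. destruct (HZ n N) as [E|E].
    - rewrite ite_false by (rewrite P, E; intros Q; exact (suc_not_emp emp (eq_sym Q))).
      symmetry. apply ite_true, E.
    - rewrite ite_true by (apply P, E). symmetry. apply ite_false. rewrite E. apply suc_not_emp. }
  apply Bs_ext; [apply r_bin|exact Z|]. intros n N. rewrite r_digit, RP by exact N.
  specialize (P n N (RP n N)). destruct (HZ n N) as [E|E].
  - rewrite ite_false; [symmetry; exact E|]. rewrite P, E. intros Q; exact (suc_not_emp emp (eq_sym Q)).
  - rewrite ite_true by (apply P, E). symmetry. exact E.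
Qed.

(** Each branch of the scheme is a code, because its segments are segments of codes and the codes
    form a closed set. *)
Theorem cantor_retract : exists I r, CF I /\ CF r /\ (forall b, b ∈ Bs -> bin (ap r b)) /\
  forall z, bin z -> agree k0 (ap s x0) (ap I z) /\ ap s (ap pi (ap I z)) = ap I z /\ ap r (ap I z) = z.
Proof.
  exists (lam Bs I), (lam Bs r).
  assert (TI : T1 I) by (apply (T_I (fun e => e 0)), T_var).
  assert (Tr : T1 r) by (apply (T_r (fun e => e 0)), T_var).
  split; [|split; [|split]].
  - apply LIP_CF. split; [apply lam_fun; [exact TI|intros; apply I_Bs]|].
    intros z z' n Z Z' N A. rewrite !ap_lam by assumption. assert (NS := om_suc n N).
    destruct (pth_Knode z (suc n) NS) as (y & k & Y & Hk & E). rewrite (I_digit z n y k) by assumption.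
    symmetry. apply (I_digit z' n y k); try assumption. rewrite <- E. symmetry. apply pth_agree; assumption.
  - split; [apply lam_fun; [exact Tr|intros; apply r_bin]|]. intros b n Hb N.
    destruct (rp_local b (suc n) Hb (om_suc n N)) as (k & Hk & H).
    destruct (rp_local b n Hb N) as (j & J & H').
    destruct (Thru_local b (p2 (spl (rp b n))) Hb) as (l & L & HL); [apply spl2_Knode, rp_Knode, N|].
    destruct (nat_max j l J L) as (m & Hm & JM & LM). exists m. split; [exact Hm|]. intros b' Hb' A.
    rewrite !ap_lam, !r_digit by assumption. rewrite <- (H' b' Hb') by (apply (agree_sub m); assumption).
    assert (Q := HL b' Hb' (agree_sub m l b b' LM A)).
    destruct (classic (Thru b (p2 (spl (rp b n))))) as [C|C].
    + transitivity (suc emp); [exact (ite_true _ _ _ C)|symmetry; exact (ite_true _ _ _ (proj1 Q C))].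
    + transitivity (emp); [exact (ite_false _ _ _ C)|symmetry; exact (ite_false _ _ _ (fun C0 => C (proj2 Q C0)))].
  - intros b Hb. rewrite ap_lam by assumption. apply r_bin.
  - intros z HZ. assert (Z : z ∈ Bs) by apply HZ. rewrite !(ap_lam I) by assumption.
    rewrite ap_lam by (exact Tr || apply I_Bs). split; [|split].
    + apply agree_sym, (I_agree z emp); auto using om_emp. apply pth_0.
    + apply (coded_closed _ _ _ _ _ hX); [apply I_Bs|]. intros k Hk.
      destruct (pth_Knode z k Hk) as (y & l & Y & L & E). exists y. split; [auto|].
      apply (agree_sub l); [|apply (I_agree z k); assumption]. apply ord_le_subset; [apply nat_ord, L|].
      apply (pth_length z k Hk y l Y L E).
    + apply r_I, HZ.
Qed.

(** Embedded binary sequences are decoded to arbitrary elements of Baire space. This makes X large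
    enough for the diagonalization that computes the length of the hierarchy. *)
Lemma perfect_onto_Bs : exists q, is_surjection q X Bs.
Proof.
  destruct cantor_retract as (J & r' & CJ & Cr & BR & H).
  apply (surj_lam (fun x => dec (ap r' (ap s x))) X Bs zero); [dsolve|apply zero_Bs|].
  intros c Hc. destruct (dec_fix (fun _ n => ap c n)) as (z & HZ & IZ & E); [dsolve|intros; apply Bs_ap; assumption|reflexivity|].
  destruct (H z HZ) as (_ & H1 & H2). exists (ap pi (ap J z)).
  split; [apply (pi_in X TT s pi dp hX), CF_ap; [exact CJ|apply HZ]|].
  rewrite H1, H2. apply Bs_ext; [exact Hc|apply dec_Bs|]. intros n N. symmetry. apply E, N.
Qed.

Context (hAD : AD M).

(* I plays x, II plays z; II must play infinitely many nonzero terms and wins if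
   dec z reduces E to its complement.  So I has a winning strategy tau, and tau
   pulls E back to a subset of Cantor space to which E still reduces: otherwise II
   would defeat tau by decoding the opposite reduction. *)
Theorem nonselfdual_inside E : subset E X -> ~ sd X s pi E -> exists q, CF q /\
  le X s pi E (loc X s pi (sep X (fun y => ap pi (ap q (ap s y)) ∈ E)) x0 k0).
Proof.
  intros SE NS. destruct cantor_retract as (J & r' & CJ & Cr & BR & H).
  assert (PI : forall b, b ∈ Bs -> ap pi b ∈ X) by (intros; apply (pi_in X TT s pi dp hX); assumption).
  assert (SI : forall x, x ∈ X -> ap s x ∈ Bs) by (intros; apply (s_in X TT s pi dp hX); assumption).
  destruct (game_determined hAD (fun x z => infz z /\ (ap pi x ∈ E <-> ap pi (dec z) ∉ E))) as [(f & F & W)|(tau & Ft & W)]; [dsolve| |].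
  (* A winning strategy of II, followed by decoding, would reduce E to its complement. *)
  - destruct NS. assert (CFF := LIP_CF f F).
    assert (CD : CF (lam Bs (fun x => dec (ap f x)))) by (apply CF_dec; [exact CFF|intros x Hx; apply (W x Hx)]).
    apply (le_of_red X TT s pi dp hX (lam Bs (fun x => dec (ap f x)))); [exact CD|].
    intros b Hb. rewrite ap_lam by (dsolve || exact Hb). rewrite mem_cp. destruct (W b Hb) as [_ Q].
    assert (ap pi (dec (ap f b)) ∈ X) by apply PI, dec_Bs. tauto.
  - assert (Ct := LIP_CF _ (CT_LIP _ Ft)).
    (* In a second game II plays a binary z and tries to reduce E to its preimage under tau. *)
    destruct (game_determined hAD (fun x z => bin z /\ (ap pi x ∈ E <-> ap pi (ap tau z) ∈ E))) as [(f & F & V)|(g & Fg & V)]; [dsolve| |].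
    (* II wins: followed by the embedding of Cantor space near x0, the strategy reduces E to the
       pullback of E under r' and tau. *)
    + exists (comp tau r'). split; [apply CF_comp; assumption|].
      assert (CFF := LIP_CF f F).
      apply (le_loc_of X TT s pi dp hX (comp J f)); [auto|exact hk0|apply CF_comp; assumption|].
      intros y Y. assert (SY := SI y Y). destruct (V (ap s y) SY) as [BZ Q].
      destruct (H _ BZ) as (H1 & H2 & H3). rewrite ap_comp, H2 by exact SY. split; [exact H1|].
      rewrite mem_sep by dsolve. rewrite H2, ap_comp, H3 by (apply CF_ap; [exact CJ|apply BZ]).
      rewrite (pi_s X TT s pi dp hX) in Q by exact Y.
      assert (ap pi (ap J (ap f (ap s y))) ∈ X) by (apply PI, CF_ap; [exact CJ|apply BZ]). tauto.
    (* I wins by g: some binary z decodes to g z. As a move against tau it makes tau z and g z fall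
       on the same side of E, as a move against g on different sides. *)
    + assert (Cg := LIP_CF _ (CT_LIP _ Fg)).
      destruct (dec_fix (fun z n => ap (ap g z) n)) as (z & HZ & IZ & E').
      * dsolve.
      * intros z n Z N. apply Bs_ap; [apply CF_ap; assumption|exact N].
      * intros z z' n Z Z' N A. apply Fg; assumption.
      * assert (Z : z ∈ Bs) by apply HZ.
        assert (DE : dec z = ap g z) by (apply Bs_ext; [apply dec_Bs|apply CF_ap; assumption|exact E']).
        exfalso. specialize (W z Z). specialize (V z Z). rewrite DE in W.
        assert (W' := fun Q => W (conj IZ Q)). assert (V' := fun Q => V (conj HZ Q)). clear - W' V'.
        destruct (classic (ap pi (ap tau z) ∈ E)), (classic (ap pi (ap g z) ∈ E)); tauto.
Qed.
End CantorScheme.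

(** * Countable ordinals *)

Section Countability.
Context {M : set_structure} {hZF : ZF_model M}.
Implicit Types a b c f g h x y z u v p m n k i j l w A B C E K : M.
Notation env := (nat -> M).
Context (R : ordered_field_data M) (hDC : DC_reals R) (hRB : exists q, is_surjection q (Rset R) Bs).

Lemma injection_spec f a b : is_injection f a b <->
  is_fun f a b /\ forall x y, x ∈ a -> y ∈ a -> ap f x = ap f y -> x = y.
Proof.
  unfold is_injection. split; intros [F H]; (split; [exact F|]).
  - intros x y X Y E. apply (H x y (ap f x)); [|rewrite E]; apply (app_ap f a b); assumption.
  - intros x y z A B. apply (app_eq f a b) in A; [|exact F]. apply (app_eq f a b) in B; [|exact F].
    destruct A as [X ->], B as [Y E]. auto.
Qed.
Lemma countable_iff a : countable a <-> exists f, is_injection f a om.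
Proof.
  unfold countable. split.
  - intros (w & f & W & H). apply is_omega_om in W. subst w. eauto.
  - intros [f H]. exists om, f. split; [apply is_omega_om; reflexivity|exact H].
Qed.
Lemma countable_lam (F : M -> M) a : T1 F -> (forall x, x ∈ a -> F x ∈ om) ->
  (forall x y, x ∈ a -> y ∈ a -> F x = F y -> x = y) -> countable a.
Proof.
  intros TF HO HI. apply countable_iff. exists (lam a F). apply injection_spec.
  split; [apply lam_fun; assumption|]. intros x y X Y E. rewrite !ap_lam in E by assumption. auto.
Qed.
Lemma countable_sub a b : subset b a -> countable a -> countable b.
Proof.
  intros S H. apply countable_iff in H. destruct H as [f H]. apply injection_spec in H. destruct H as [F I].
  apply (countable_lam (ap f)); [dsolve|intros x X; apply (ap_mem f a); auto|auto].
Qed.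
Lemma countable_add a y : countable a -> countable (cup a (up y y)).
Proof.
  intros H. apply countable_iff in H. destruct H as [f H]. apply injection_spec in H. destruct H as [F I].
  assert (MA : forall x, x ∈ cup a (up y y) -> x <> y -> x ∈ a).
  { intros x X NE. apply mem_cup in X. destruct X as [X|X]; [exact X|]. apply mem_up in X. tauto. }
  apply (countable_lam (fun x => ite (x = y) emp (suc (ap f x)))); [dsolve| |].
  - intros x X. destruct (classic (x = y)) as [E|E].
    + rewrite ite_true by exact E. apply om_emp.
    + rewrite ite_false by exact E. apply om_suc, (ap_mem f a); auto.
  - intros x z HX HZ Q. destruct (classic (x = y)) as [E|E], (classic (z = y)) as [E'|E'].
    + congruence.
    + rewrite ite_true, ite_false in Q by assumption. destruct (suc_not_emp _ (eq_sym Q)).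
    + rewrite ite_false, ite_true in Q by assumption. destruct (suc_not_emp _ Q).
    + rewrite !ite_false in Q by assumption. apply suc_inj in Q. auto.
Qed.
Lemma countable_suc a : countable a -> countable (suc a).
Proof.
  intros H. assert (E : suc a = cup a (up a a)).
  { apply ext. intros z. rewrite mem_suc, mem_cup, mem_up. tauto. }
  rewrite E. apply countable_add, H.
Qed.

(* The order type of a countable ordinal is coded by a relation on omega, and the
   code determines the injection, so that choosing codes suffices. *)
Lemma countable_union (H : M -> M) : T1 H -> (forall n, n ∈ om -> is_ord (H n) /\ countable (H n)) ->
  countable (un (rep om H)).
Proof.
  intros TH HC.
  set (Q := fun n c f => is_injection f (H n) om /\ forall i j, i ∈ om -> j ∈ om ->
    (ap c (pr i j) = emp <-> exists x y, x ∈ H n /\ y ∈ H n /\ i = ap f x /\ j = ap f y /\ ord_le x y)).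
  assert (DQ : forall n c f : env -> M, T n -> T c -> T f -> D (fun e => Q (n e) (c e) (f e))) by
    (intros n c f; intros; unfold Q; assert (T (fun e => H (n e))) by dsolve; dsolve).
  assert (QU : forall n c f g, n ∈ om -> Q n c f -> Q n c g -> forall x, x ∈ H n -> ap f x = ap g x).
  { intros n c f g N [If Ef] [Ig Eg]. apply injection_spec in If. apply injection_spec in Ig.
    destruct If as [Ff If], Ig as [Fg Ig].
    assert (OH : is_ord (H n)) by apply (HC n N).
    assert (FO : forall x, x ∈ H n -> ap f x ∈ om) by (intros; apply (ap_mem f (H n)); assumption).
    assert (GO : forall x, x ∈ H n -> ap g x ∈ om) by (intros; apply (ap_mem g (H n)); assumption).
    assert (Z : forall x, is_ord x -> x ∈ H n -> ap f x = ap g x).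
    { apply (ord_ind (fun x => x ∈ H n -> ap f x = ap g x)); [dsolve|]. intros x OX IH HX.
      assert (IH' : forall z, z ∈ x -> ap f z = ap g z).
      { intros z Hz. apply IH; [exact Hz|]. exact (ord_trans z x (H n) OH Hz HX). }
      (* The coded relation is reflexive on the values of f, so f x lies in its field and is a value
         of g as well. *)
      assert (Y : exists y, y ∈ H n /\ ap f x = ap g y).
      { assert (C : ap c (pr (ap f x) (ap f x)) = emp).
        { apply Ef; auto. exists x, x. repeat split; auto. right. reflexivity. }
        apply Eg in C; auto. destruct C as (y & _ & HY & _ & E & _). eauto. }
      assert (Y' : exists y, y ∈ H n /\ ap g x = ap f y).
      { assert (C : ap c (pr (ap g x) (ap g x)) = emp).
        { apply Eg; auto. exists x, x. repeat split; auto. right. reflexivity. }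
        apply Ef in C; auto. destruct C as (y & _ & HY & _ & E & _). eauto. }
      destruct Y as (y & HY & E), Y' as (y' & HY' & E').
      assert (OY : is_ord y) by exact (ord_in (H n) y OH HY). assert (OY' : is_ord y') by exact (ord_in (H n) y' OH HY').
      (* With f x = g y and g x = f y', the induction hypothesis excludes y < x and y' < x. If x < y
         and x < y', the code places g y before g x, so that y <= x. *)
      destruct (ord_tricho x y OX OY) as [L|[->|L]]; [|exact E|].
      - destruct (ord_tricho x y' OX OY') as [L'|[<-|L']]; [|auto|].
        + assert (C : ap c (pr (ap f x) (ap f y')) = emp).
          { apply Ef; auto. exists x, y'. repeat split; auto. left. exact L'. }
          rewrite E, <- E' in C. apply Eg in C; auto. destruct C as (u & v & HU & HV & E1 & E2 & LE).
          apply Ig in E1; auto. apply Ig in E2; auto. subst u v.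
          destruct (ord_le_not_lt _ _ OX LE L).
        + rewrite (IH' y' L') in E'. apply Ig in E'; auto. subst y'. destruct (mem_irrefl _ L').
      - rewrite <- (IH' y L) in E. apply If in E; auto. subst y. destruct (mem_irrefl _ L). }
    intros x HX. apply Z; [|exact HX]. exact (ord_in (H n) x OH HX). }
  destruct (countable_choice R hDC hRB Bs (fun n c => exists f, Q n c f)) as (h & _ & HH).
  - apply D_ex. apply DQ; dsolve.
  - exists idB. apply surj_spec. split; [apply CF_idB|]. intros y Y. exists y. rewrite ap_idB; auto.
  - intros n N. destruct (HC n N) as [OH CH]. apply countable_iff in CH. destruct CH as [f If].
    set (P := fun m => exists x y, x ∈ H n /\ y ∈ H n /\ p1 m = ap f x /\ p2 m = ap f y /\ ord_le x y).
    assert (DP : D1 P) by (unfold P; dsolve).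
    exists (lam om (fun m => ite (P m) emp (suc emp))). split.
    + apply Bs_lam; [dsolve|]. intros m Hm. destruct (classic (P m)) as [C|C];
        [rewrite ite_true by exact C; apply om_emp|rewrite ite_false by exact C; apply om_suc, om_emp].
    + exists f. split; [exact If|]. intros i j I J. rewrite ap_lam by (dsolve || apply pr_om; assumption).
      assert (PE : P (pr i j) <-> exists x y, x ∈ H n /\ y ∈ H n /\ i = ap f x /\ j = ap f y /\ ord_le x y).
      { unfold P. rewrite p1_pr, p2_pr by assumption. reflexivity. }
      rewrite <- PE. destruct (classic (P (pr i j))) as [C|C].
      * rewrite ite_true by exact C. tauto.
      * rewrite ite_false by exact C. pose proof (suc_not_emp emp). tauto.
  (* The injection is determined by the chosen code and is recovered from it by description. *)
  - set (fx := fun n x => the (fun v => exists f, Q n (ap h n) f /\ v = ap f x)).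
    assert (TFX : forall n x : env -> M, T n -> T x -> T (fun e => fx (n e) (x e))).
    { intros n x Hn Hx. unfold fx. apply T_the. apply D_ex. apply D_and; [apply DQ; dsolve|dsolve]. }
    assert (FX : forall n f x, n ∈ om -> Q n (ap h n) f -> x ∈ H n -> fx n x = ap f x).
    { intros n f x N HQ HX. apply the_eq; [eauto|]. intros v (g & HG & ->). apply (QU n (ap h n)); assumption. }
    set (nn := fun x => the (fun n => n ∈ om /\ x ∈ H n /\ forall m, m ∈ n -> x ∉ H m)).
    assert (NN : forall x, x ∈ un (rep om H) -> nn x ∈ om /\ x ∈ H (nn x)).
    { intros x HX. apply mem_un in HX. destruct HX as (y & HY & HX). rewrite mem_rep in HY by exact TH.
      destruct HY as (n & N & ->).
      assert (G : nn x ∈ om /\ x ∈ H (nn x) /\ forall m, m ∈ nn x -> x ∉ H m).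
      { unfold nn. apply (the_ext (fun n => n ∈ om /\ x ∈ H n /\ forall m, m ∈ n -> x ∉ H m)).
        - apply nat_least; [dsolve|]. eauto.
        - intros k k' (K & B & C) (K' & B' & C').
          destruct (ord_tricho k k' (nat_ord k K) (nat_ord k' K')) as [L|[L|L]]; [destruct (C' k L B)|exact L|destruct (C k' L B')]. }
      tauto. }
    assert (TNN : forall x : env -> M, T x -> T (fun e => nn (x e))) by (intros; unfold nn; dsolve).
    apply (countable_lam (fun x => pr (nn x) (fx (nn x) x))); [dsolve| |].
    + intros x HX. destruct (NN x HX) as [N HX']. destruct (HH (nn x) N) as (f & HQ).
      rewrite (FX (nn x) f x N HQ HX'). apply pr_om; [exact N|]. apply (ap_mem f (H (nn x))); [apply HQ|exact HX'].
    + intros x y HX HY E. destruct (NN x HX) as [N HX']. destruct (NN y HY) as [N' HY'].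
      destruct (HH (nn x) N) as (f & HQ). destruct (HH (nn y) N') as (g & HG).
      rewrite (FX (nn x) f x N HQ HX'), (FX (nn y) g y N' HG HY') in E.
      apply pr_inj in E; auto; [|apply (ap_mem f (H (nn x))); [apply HQ|exact HX']|apply (ap_mem g (H (nn y))); [apply HG|exact HY']].
      destruct E as [EN E]. rewrite <- EN in *. rewrite <- (QU (nn x) (ap h (nn x)) f g N HQ HG y HY') in E.
      destruct HQ as [If _]. apply injection_spec in If. apply If; assumption.
Qed.

(** The limit is b + omega, a countable union of countable ordinals. *)
Lemma limit_above b : is_ord b -> countable b -> exists l, is_limit l /\ countable l /\ b ∈ l.
Proof.
  intros OB CB. set (H := fun n => ap (nrec b (fun _ v => suc v)) n).
  assert (TH : T1 H) by (unfold H; dsolve).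
  assert (H0 : H emp = b) by (apply nrec_0; dsolve).
  assert (HS : forall n, n ∈ om -> H (suc n) = suc (H n)).
  { intros n N. unfold H. rewrite nrec_S; [reflexivity|dsolve|exact N]. }
  clearbody H.
  assert (HC : forall n, n ∈ om -> is_ord (H n) /\ countable (H n)).
  { nind; [rewrite H0; auto|]. intros n N [A B]. rewrite HS by exact N. split; [apply suc_ord, A|apply countable_suc, B]. }
  assert (MU : forall z, z ∈ un (rep om H) <-> exists n, n ∈ om /\ z ∈ H n).
  { intros z. rewrite mem_un. split.
    - intros (y & Y & Z). rewrite mem_rep in Y by exact TH. destruct Y as (n & N & ->). eauto.
    - intros (n & N & Z). exists (H n). split; [rewrite mem_rep by exact TH; eauto|exact Z]. }
  exists (un (rep om H)).
  assert (BU : b ∈ un (rep om H)).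
  { apply MU. exists (suc emp). split; [apply om_suc, om_emp|]. rewrite HS, H0 by apply om_emp. apply suc_self. }
  split; [|split; [apply countable_union; assumption|exact BU]].
  split; [|split].
  - apply un_ord. intros y Y. rewrite mem_rep in Y by exact TH. destruct Y as (n & N & ->). apply HC, N.
  - intros C. exact (C b BU).
  - intros y Y. apply MU in Y. destruct Y as (n & N & Y). exists (H n). split; [|exact Y].
    apply MU. exists (suc n). split; [apply om_suc, N|]. rewrite HS by exact N. apply suc_self.
Qed.

(** An injection into omega, inverted with default 0, enumerates the whole ordinal and is therefore
    cofinal. *)
Lemma limit_cofinality a : is_limit a -> countable a -> countable_cofinality a.
Proof.
  intros (OA & NE & _) CA. apply countable_iff in CA. destruct CA as [f If]. apply injection_spec in If. destruct If as [F I].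
  assert (EA : emp ∈ a).
  { destruct (emp_le a OA) as [L|L]; [exact L|]. destruct NE. rewrite <- L. exact mem_emp. }
  set (G := fun n => ite (exists x, x ∈ a /\ ap f x = n) (the (fun x => x ∈ a /\ ap f x = n)) emp).
  assert (TG : T1 G) by (unfold G; dsolve).
  assert (GE : forall x, x ∈ a -> G (ap f x) = x).
  { intros x HX. unfold G. rewrite ite_true by eauto. apply the_eq; [auto|]. intros z [Z E]. apply I; auto. }
  exists om, (lam om G). split; [apply is_omega_om; reflexivity|]. split.
  - apply lam_fun; [exact TG|]. intros n N. destruct (classic (exists x, x ∈ a /\ ap f x = n)) as [(x & HX & <-)|C].
    + rewrite GE by exact HX. exact HX.
    + unfold G. rewrite ite_false by exact C. exact EA.
  - intros b HB. exists (ap f b), b. split; [|right; reflexivity]. apply app_lam; [exact TG|].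
    split; [apply (ap_mem f a); assumption|]. symmetry. apply GE, HB.
Qed.

(** * Basic neighbourhoods and condensation points *)

Context (X TT s pi dp : M) (hX : coded X TT s pi dp).

Definition nbh x k : M := sep X (fun y => agree k (ap s x) (ap s y)).
Lemma T_nbh (x k : env -> M) : T x -> T k -> T (fun e => nbh (x e) (k e)).
Proof. intros. unfold nbh. dsolve. Qed.
Hint Resolve T_nbh : dfn.
Lemma mem_nbh x k y : y ∈ nbh x k <-> y ∈ X /\ agree k (ap s x) (ap s y).
Proof. unfold nbh. rewrite mem_sep by dsolve. reflexivity. Qed.
Lemma nbh_open x k : k ∈ om -> nbh x k ∈ TT.
Proof.
  intros K. apply hX. split; [intros y Y; apply mem_nbh in Y; apply Y|].
  intros y Y. apply mem_nbh in Y. exists k. split; [exact K|]. intros z Z A. apply mem_nbh.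
  split; [exact Z|]. apply (agree_trans _ _ (ap s y)); [apply Y|exact A].
Qed.
Lemma nbh_self x k : x ∈ X -> x ∈ nbh x k.
Proof. intros H. apply mem_nbh. split; [exact H|apply agree_refl]. Qed.
Lemma nbh_eq x y k : agree k (ap s x) (ap s y) -> nbh x k = nbh y k.
Proof.
  intros A. apply ext. intros z. rewrite !mem_nbh. split; intros [Z B]; (split; [exact Z|]).
  - apply (agree_trans _ _ (ap s x)); [apply agree_sym, A|exact B].
  - apply (agree_trans _ _ (ap s y)); assumption.
Qed.
Lemma open_nbh U x : U ∈ TT -> x ∈ U -> exists k, k ∈ om /\ subset (nbh x k) U.
Proof.
  intros HU HX. apply hX in HU. destruct HU as [_ H]. destruct (H x HX) as (k & K & Q).
  exists k. split; [exact K|]. intros y Y. apply mem_nbh in Y. apply Q; apply Y.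
Qed.

(** A Lindelöf argument over the countably many codes of neighbourhoods. An enumeration of a
    countable neighbourhood is packed into one element of Baire space, whose rows are the codes of
    its points, so that it can be chosen. *)
Lemma countable_local V : subset V X -> (forall x, x ∈ V -> exists k, k ∈ om /\ countable (nbh x k)) -> countable V.
Proof.
  intros SV HV. set (row := fun c n => lam om (fun i => ap c (pr n i))).
  assert (TR : forall c n : env -> M, T c -> T n -> T (fun e => row (c e) (n e))) by (intros; unfold row; dsolve).
  assert (sB : forall x, x ∈ X -> ap s x ∈ Bs) by (intros; apply (s_in X TT s pi dp hX); assumption).
  destruct (countable_choice R hDC hRB Bs (fun m c => forall x k, x ∈ X -> k ∈ om -> cd (ap s x) k = m ->
    countable (nbh x k) -> forall y, y ∈ nbh x k -> exists n, n ∈ om /\ y = ap pi (row c n))) as (h & _ & HH).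
  - dsolve.
  - exists idB. apply surj_spec. split; [apply CF_idB|]. intros y Y. exists y. rewrite ap_idB; auto.
  - intros m Hm. destruct (classic (exists x k, x ∈ X /\ k ∈ om /\ cd (ap s x) k = m /\ countable (nbh x k))) as [(x & k & HX & K & E & C)|N].
    + apply countable_iff in C. destruct C as [f If]. apply injection_spec in If. destruct If as [F I].
      assert (DPT : D1 (fun n => exists y, y ∈ nbh x k /\ ap f y = n)) by dsolve.
      exists (lam om (fun j => ite (exists y, y ∈ nbh x k /\ ap f y = p1 j)
        (ap (ap s (the (fun y => y ∈ nbh x k /\ ap f y = p1 j))) (p2 j)) emp)). split.
      * apply Bs_lam; [dsolve|]. intros j J. destruct (classic (exists y, y ∈ nbh x k /\ ap f y = p1 j)) as [(y & Y & EY)|C].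
        -- rewrite ite_true by eauto. rewrite (the_eq _ y); [|auto|intros z [Z EZ]; apply I; congruence].
           apply Bs_ap; [apply sB; apply mem_nbh in Y; apply Y|apply p2_om].
        -- rewrite ite_false by exact C. apply om_emp.
      * intros x' k' HX' K' E' _ y Y. rewrite <- E in E'. apply cd_inj in E'; auto. destruct E' as [-> A].
        rewrite (nbh_eq x' x k A) in Y. assert (YX : y ∈ X) by (apply mem_nbh in Y; apply Y).
        assert (FY : ap f y ∈ om) by (apply (ap_mem f (nbh x k)); assumption).
        exists (ap f y). split; [exact FY|]. rewrite <- (pi_s X TT s pi dp hX y YX) at 1. f_equal.
        apply Bs_ext; [auto| |].
        -- apply Bs_lam; [dsolve|]. intros i Hi. rewrite ap_lam by (dsolve || apply pr_om; assumption).
           rewrite p1_pr, p2_pr by assumption. rewrite ite_true by eauto.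
           rewrite (the_eq _ y); [|auto|intros z [Z EZ]; apply I; auto]. apply Bs_ap; auto.
        -- intros i Hi. unfold row. rewrite ap_lam by (dsolve || exact Hi). rewrite ap_lam by (dsolve || apply pr_om; assumption).
           rewrite p1_pr, p2_pr by assumption. rewrite ite_true by eauto.
           rewrite (the_eq _ y); [reflexivity|auto|intros z [Z EZ]; apply I; auto].
    + exists zero. split; [apply zero_Bs|]. intros x k HX K E C. destruct N. exists x, k. auto.
  - clearbody row.
    set (F := fun y => the (fun j => j ∈ om /\ y = ap pi (row (ap h (p1 j)) (p2 j)) /\
      forall i, i ∈ j -> y <> ap pi (row (ap h (p1 i)) (p2 i)))).
    assert (FS : forall y, y ∈ V -> F y ∈ om /\ y = ap pi (row (ap h (p1 (F y))) (p2 (F y)))).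
    { intros y Y. assert (G : F y ∈ om /\ y = ap pi (row (ap h (p1 (F y))) (p2 (F y))) /\
        forall i, i ∈ F y -> y <> ap pi (row (ap h (p1 i)) (p2 i))).
      { unfold F. apply (the_ext (fun j => j ∈ om /\ y = ap pi (row (ap h (p1 j)) (p2 j)) /\
          forall i, i ∈ j -> y <> ap pi (row (ap h (p1 i)) (p2 i)))).
        - apply (nat_least (fun j => y = ap pi (row (ap h (p1 j)) (p2 j)))); [dsolve|].
          destruct (HV y Y) as (k & K & C). assert (YX := SV y Y).
          assert (CO : cd (ap s y) k ∈ om) by (apply cd_om; auto).
          destruct (HH _ CO y k YX K eq_refl C y (nbh_self y k YX)) as (n & N & E).
          exists (pr (cd (ap s y) k) n). rewrite p1_pr, p2_pr by assumption. split; [apply pr_om; assumption|exact E].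
        - intros j j' (J & B & C) (J' & B' & C').
          destruct (ord_tricho j j' (nat_ord j J) (nat_ord j' J')) as [L|[L|L]]; [destruct (C' j L B)|exact L|destruct (C j' L B')]. }
      tauto. }
    apply (countable_lam F); [unfold F; dsolve|intros y Y; apply FS, Y|].
    intros x y HX HY E. rewrite (proj2 (FS x HX)), (proj2 (FS y HY)), E. reflexivity.
Qed.

(** Cantor-Bendixson: P consists of the points all of whose neighbourhoods are uncountable. If y
    were isolated in P, some neighbourhood of y would be locally countable apart from y, hence
    countable. *)
Lemma perfect_subset_exists : ~ countable X -> exists P, subset P X /\ (exists x, x ∈ P) /\
  forall y k, y ∈ P -> k ∈ om -> exists y', y' ∈ P /\ y' <> y /\ agree k (ap s y) (ap s y').
Proof.
  intros NC. set (P := sep X (fun x => forall k, k ∈ om -> ~ countable (nbh x k))).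
  assert (MP : forall x, x ∈ P <-> x ∈ X /\ forall k, k ∈ om -> ~ countable (nbh x k)).
  { intros x. unfold P. rewrite mem_sep by dsolve. reflexivity. }
  assert (NP : forall x, x ∈ X -> x ∉ P -> exists k, k ∈ om /\ countable (nbh x k)).
  { intros x HX N. apply NNPP. intros C. apply N, MP. split; [exact HX|]. intros k K H. apply C. eauto. }
  exists P. split; [intros x HX; apply MP in HX; apply HX|]. split.
  - apply NNPP. intros C. apply NC. apply countable_local; [intros z Z; exact Z|].
    intros x HX. apply NP; [exact HX|]. intros Q. apply C. eauto.
  - intros y k Y K. apply NNPP. intros C. apply MP in Y. destruct Y as [Y YC]. apply (YC k K).
    apply (countable_sub (cup (sep (nbh y k) (fun z => z <> y)) (up y y))).
    + intros z Z. apply mem_cup. destruct (classic (z = y)) as [E|E].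
      * right. apply mem_up. auto.
      * left. apply mem_sep; [dsolve|]. auto.
    + apply countable_add. apply countable_local.
      * intros z Z. apply mem_sep in Z; [|dsolve]. destruct Z as [Z _]. apply mem_nbh in Z. apply Z.
      * intros z Z. apply mem_sep in Z; [|dsolve]. destruct Z as [Z NE]. apply mem_nbh in Z.
        apply NP; [apply Z|]. intros Q. apply C. exists z. split; [exact Q|]. split; [exact NE|apply Z].
Qed.
End Countability.
#[export] Hint Resolve T_nbh : dfn.

(** * Wadge ranks *)

Section Ranks.
Context {M : set_structure} {hZF : ZF_model M}.
Implicit Types a b c f g h x y z u v p m n k i j l w A B C E K : M.
Notation env := (nat -> M).
Context (R : ordered_field_data M) (hR : is_real_line R) (hDC : DC_reals R) (hAD : AD M).
Context (X TT s pi dp : M) (hX : coded X TT s pi dp).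
Notation cp := (cp X).
Notation le := (le X s pi).
Notation lt := (lt X s pi).
Notation sd := (sd X s pi).
Notation loc := (loc X s pi).
Notation nbh := (nbh X s).

Let hRB := real_BS R hR.

Lemma lt_le_trans A C E : lt A C -> le C E -> lt A E.
Proof.
  intros [H N] L. split; [apply (le_trans X TT s pi dp hX A C E); assumption|].
  intros Q. apply N. apply (le_trans X TT s pi dp hX C E A); assumption.
Qed.

(** The union serves as supremum, and the summand 1 makes ranks start at 1. *)
Let rank_step A g := un (cup (up (suc emp) (suc emp)) (rep (sep (pow X) (fun C => lt C A)) (fun C => suc (ap g C)))).

Lemma rank_exists : exists r, is_fun_on r (pow X) /\ forall A, subset A X -> ap r A = rank_step A r.
Proof.
  destruct (wf_recursion (pow X) (fun C A => lt C A) rank_step) as (h & H & E).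
  - dsolve.
  - unfold rank_step. dsolve.
  - intros S HS NE. apply (wadge_wf R hDC hRB hAD X TT s pi dp hX); [|exact NE].
    intros A HA. apply mem_pow, HS, HA.
  - exists h. split; [exact H|]. intros A HA. rewrite E by (apply mem_pow, HA).
    unfold rank_step. f_equal. f_equal. apply ext. intros z. rewrite !mem_rep by dsolve.
    split; intros (C & HC & ->); exists C; (split; [exact HC|]);
      rewrite ap_res; [reflexivity|exact HC|reflexivity|exact HC].
Qed.

Context (rkf : M) (rk_fun : is_fun_on rkf (pow X)) (rk_eq : forall A, subset A X -> ap rkf A = rank_step A rkf).
Notation rk := (ap rkf).

Lemma mem_rk_raw A b : subset A X -> (b ∈ rk A <-> b = emp \/ exists C, subset C X /\ lt C A /\ b ∈ suc (rk C)).
Proof.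
  intros SA. rewrite rk_eq by exact SA. unfold rank_step. rewrite mem_un. split.
  - intros (y & Y & H). apply mem_cup in Y. destruct Y as [Y|Y].
    + apply mem_up in Y. assert (y = suc emp) as -> by tauto. apply mem_suc in H.
      destruct H as [H|H]; [destruct (mem_emp _ H)|auto].
    + rewrite mem_rep in Y by dsolve. destruct Y as (C & HC & ->). apply mem_sep in HC; [|dsolve].
      rewrite mem_pow in HC. right. exists C. tauto.
  - intros [->|(C & SC & L & H)].
    + exists (suc emp). split; [apply mem_cup; left; apply mem_up; auto|apply suc_self].
    + exists (suc (rk C)). split; [|exact H]. apply mem_cup. right. rewrite mem_rep by dsolve.
      exists C. split; [|reflexivity]. apply mem_sep; [dsolve|]. rewrite mem_pow. auto.
Qed.

Lemma wadge_ind (P : M -> Prop) : D1 P ->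
  (forall A, subset A X -> (forall C, subset C X -> lt C A -> P C) -> P A) -> forall A, subset A X -> P A.
Proof.
  intros DP IH A SA. apply NNPP. intros N.
  destruct (wadge_wf R hDC hRB hAD X TT s pi dp hX (sep (pow X) (fun A => ~ P A))) as (C & HC & MIN).
  - intros C HC. apply mem_sep in HC; [|dsolve]. apply mem_pow, HC.
  - intros E. apply (mem_emp A). rewrite <- E. apply mem_sep; [dsolve|]. rewrite mem_pow. auto.
  - apply mem_sep in HC; [|dsolve]. rewrite mem_pow in HC. destruct HC as [SC NC]. apply NC.
    apply IH; [exact SC|]. intros E SE L. apply NNPP. intros NE. apply (MIN E); [|exact L].
    apply mem_sep; [dsolve|]. rewrite mem_pow. auto.
Qed.

Lemma rk_ord A : subset A X -> is_ord (rk A).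
Proof.
  revert A. apply (wadge_ind (fun A => is_ord (rk A))); [dsolve|]. intros A SA IH.
  rewrite rk_eq by exact SA. apply un_ord. intros y Y. apply mem_cup in Y. destruct Y as [Y|Y].
  - apply mem_up in Y. assert (y = suc emp) as -> by tauto. apply suc_ord, emp_ord.
  - rewrite mem_rep in Y by dsolve. destruct Y as (C & HC & ->). apply mem_sep in HC; [|dsolve].
    rewrite mem_pow in HC. apply suc_ord, IH; apply HC.
Qed.

Lemma mem_rk A b : subset A X -> (b ∈ rk A <-> b = emp \/ exists C, subset C X /\ lt C A /\ ord_le b (rk C)).
Proof.
  intros SA. rewrite mem_rk_raw by exact SA. split; (intros [H|(C & SC & L & H)]; [auto|right; exists C]);
    (split; [exact SC|]); (split; [exact L|]); apply mem_suc_le; exact H.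
Qed.

Lemma rk_pos A : subset A X -> emp ∈ rk A.
Proof. intros SA. apply mem_rk; auto. Qed.
Lemma rk_lt A C : subset A X -> subset C X -> lt A C -> rk A ∈ rk C.
Proof. intros SA SC L. apply mem_rk; [exact SC|]. right. exists A. split; [exact SA|]. split; [exact L|right; reflexivity]. Qed.

Lemma rk_le A C : subset A X -> subset C X -> le A C -> ord_le (rk A) (rk C).
Proof.
  intros SA SC L. apply ord_subset_le; [apply rk_ord, SC|apply rk_ord, SA|]. intros b Hb.
  apply mem_rk in Hb; [|exact SA]. apply mem_rk; [exact SC|]. destruct Hb as [->|(E & SE & LE & H)]; [auto|].
  right. exists E. split; [exact SE|]. split; [apply (lt_le_trans E A C LE L)|exact H].
Qed.

(** A and its complement have the same strict predecessors, because B < A implies B <= A^c. *)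
Lemma rk_cp A : subset A X -> rk (cp A) = rk A.
Proof.
  assert (H : forall A, subset A X -> subset (rk A) (rk (cp A))).
  { intros B SB b Hb. apply mem_rk in Hb; [|exact SB]. apply mem_rk; [apply (cp_sub X)|].
    destruct Hb as [->|(E & SE & LE & Q)]; [auto|]. right. exists E. split; [exact SE|]. split; [|exact Q].
    assert (L := lt_le_cp hAD X TT s pi dp hX E B SE SB LE). split; [exact L|]. intros L'.
    apply (proj2 LE). apply (le_trans X TT s pi dp hX B (cp B)); [|exact L'].
    apply (le_cp_l X TT s pi dp hX); [exact SB|]. apply (le_trans X TT s pi dp hX _ E); [exact L'|apply LE]. }
  intros SA. apply ext. intros b. split; intros Hb.
  - apply H in Hb; [|apply (cp_sub X)]. rewrite cp_cp in Hb by exact SA. exact Hb.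
  - apply (H A SA), Hb.
Qed.

(** Wadge's lemma gives A <= C or C <= A^c, and the latter would bound the rank of C by that of
    A. *)
Lemma lt_of_rk A C : subset A X -> subset C X -> rk A ∈ rk C -> lt A C.
Proof.
  intros SA SC H. assert (OC := rk_ord C SC).
  assert (N : forall E, subset E X -> rk E = rk A -> ~ le C E).
  { intros E SE EE L. apply rk_le in L; [|exact SC|exact SE]. rewrite EE in L.
    exact (ord_le_not_lt _ _ (rk_ord A SA) L H). }
  split; [|apply N; auto]. destruct (wadge hAD X TT s pi dp hX A C) as [L|L]; [exact L|].
  destruct (N (cp A) (cp_sub X A) (rk_cp A SA) L).
Qed.
Lemma le_of_rk A E : subset A X -> subset E X -> rk A ∈ rk E -> le A E /\ le A (cp E).
Proof.
  intros SA SE H. assert (L := lt_of_rk A E SA SE H). split; [apply L|].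
  apply (lt_le_cp hAD X TT s pi dp hX); assumption.
Qed.
(** If both failed, Wadge's lemma would give C < A and the ranks would differ. *)
Lemma le_of_rk_eq A C : subset A X -> subset C X -> rk A = rk C -> le A C \/ le A (cp C).
Proof.
  intros SA SC E. destruct (classic (le A C)) as [L|L]; [auto|right].
  apply NNPP. intros N. apply (mem_irrefl (rk C)). rewrite <- E at 2. apply rk_lt; [exact SC|exact SA|].
  split.
  - apply (wadge_not hAD X TT s pi dp hX A (cp C) SA) in N. rewrite cp_cp in N by exact SC. exact N.
  - exact L.
Qed.
(** If b were skipped, every set of rank at least b would have a strict predecessor of rank at least
    b, against well-foundedness. *)
Lemma rk_initial A b : subset A X -> b ∈ rk A -> b <> emp -> exists C, subset C X /\ rk C = b.
Proof.
  intros SA Hb NE. assert (OB : is_ord b) by (apply (ord_in (rk A)); [apply rk_ord, SA|exact Hb]).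
  apply NNPP. intros NO.
  assert (H : forall A, subset A X -> ~ ord_le b (rk A)).
  { apply (wadge_ind (fun A => ~ ord_le b (rk A))); [dsolve|]. intros C SC IH [L|L].
    - apply mem_rk in L; [|exact SC]. destruct L as [L|(E & SE & LE & Q)]; [exact (NE L)|].
      exact (IH E SE LE Q).
    - apply NO. exists C. auto. }
  apply (H A SA). left. exact Hb.
Qed.

Lemma loc_lt_of_sd A y : subset A X -> sd A -> y ∈ X -> exists k, k ∈ om /\ rk (loc A y k) ∈ rk A.
Proof.
  intros SA H Y. destruct (selfdual_locally_lower R hDC hRB hAD X TT s pi dp hX A y SA H Y) as (k & K & N).
  exists k. split; [exact K|]. apply rk_lt; [apply (loc_sub X)|exact SA|]. split; [|exact N].
  apply (loc_le X TT s pi dp hX); assumption.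
Qed.

(* Two consecutive ranks are not both selfdual: a selfdual set is locally of lower
   rank, so one of the next rank would glue to a reduction to the previous one. *)
Lemma nonselfdual_between A b : subset A X -> b <> emp -> suc b ∈ rk A ->
  exists E, subset E X /\ ~ sd E /\ ord_le b (rk E) /\ rk E ∈ rk A.
Proof.
  intros SA NE H. assert (OA := rk_ord A SA). pose proof (le_trans X TT s pi dp hX) as TR.
  assert (HB : b ∈ rk A) by (apply (ord_trans b (suc b)); [exact OA|apply suc_self|exact H]).
  destruct (rk_initial A b SA HB NE) as (C & SC & EC).
  destruct (classic (sd C)) as [SDC|N]; [|exists C; rewrite EC; repeat split; auto; right; reflexivity].
  destruct (rk_initial A (suc b) SA H (suc_not_emp b)) as (E & SE & EE).
  exists E. split; [exact SE|]. rewrite EE. split; [|split; [left; apply suc_self|exact H]].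
  intros SDE. apply (mem_irrefl b).
  assert (L : le E C).
  { apply (gluing R hDC hRB X TT s pi dp hX). intros y Y.
    destruct (loc_lt_of_sd E y SE SDE Y) as (k & K & Q). exists k. split; [exact K|].
    rewrite EE in Q. apply mem_suc in Q. assert (SL := loc_sub X s pi E y k).
    destruct Q as [Q|Q].
    - apply le_of_rk; [exact SL|exact SC|rewrite EC; exact Q].
    - destruct (le_of_rk_eq (loc E y k) C SL SC) as [L|L]; [congruence|exact L|].
      apply (TR _ (cp C)); [exact L|]. apply (le_cp_r X TT s pi dp hX); assumption. }
  apply rk_le in L; [|exact SE|exact SC]. rewrite EE, EC in L.
  apply (ord_lt_le b (suc b)); [|apply suc_self|exact L]. rewrite <- EC. apply rk_ord, SC.
Qed.

(** * Agreement with the rank, the length and SD of the statement *)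

Lemma is_sup_unique (P : M -> Prop) a b : is_sup P a -> is_sup P b -> a = b.
Proof.
  intros (A1 & A2 & A3) (B1 & B2 & B3). apply ord_le_antisym; auto.
Qed.
Lemma is_one_iff a : is_one a <-> a = suc emp.
Proof.
  unfold is_one. split.
  - intros (z & Z & H). apply is_empty_emp in Z. subst z. apply is_succ_suc, H.
  - intros ->. exists emp. split; [exact mem_emp|apply is_succ_suc; reflexivity].
Qed.

Lemma rk_sup A : subset A X -> is_sup (fun b => b = suc emp \/ exists C, subset C X /\ lt C A /\ b = suc (rk C)) (rk A).
Proof.
  intros SA. split; [apply rk_ord, SA|]. split.
  - intros b [->|(C & SC & L & ->)].
    + apply suc_le; [apply rk_ord, SA|apply rk_pos, SA].
    + apply suc_le; [apply rk_ord, SA|apply rk_lt; assumption].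
  - intros c OC H. apply ord_subset_le; [exact OC|apply rk_ord, SA|]. intros b Hb.
    apply mem_rk_raw in Hb; [|exact SA]. destruct Hb as [->|(C & SC & L & Q)].
    + apply (ord_lt_le emp (suc emp)); [exact OC|apply suc_self|auto].
    + apply (ord_lt_le b (suc (rk C))); [exact OC|exact Q|]. apply H. right. eauto.
Qed.

Lemma sup_ext (P Q : M -> Prop) a : (forall b, P b <-> Q b) -> is_sup P a -> is_sup Q a.
Proof.
  intros E (A1 & A2 & A3). split; [exact A1|]. split.
  - intros b Hb. apply A2, E, Hb.
  - intros c OC H. apply A3; [exact OC|]. intros b Hb. apply H, E, Hb.
Qed.

(** Two rank functions satisfy the same recursion, so they agree by induction along the Wadge
    order. *)
Lemma rank_function_iff r : is_rank_function X TT r <-> r = rkf.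
Proof.
  assert (BR : forall A r, subset A X -> is_fun_on r (pow X) ->
    forall b, (is_one b \/ exists C g, subset C X /\ wadge_lt X TT C A /\ app r C g /\ is_succ b g) <->
      (b = suc emp \/ exists C, subset C X /\ lt C A /\ b = suc (ap r C))).
  { intros A r' SA Fr b. rewrite is_one_iff. split; (intros [H|H]; [auto|right]).
    - destruct H as (C & g & SC & L & HA & HS). exists C. split; [exact SC|].
      apply (wadge_lt_iff X TT s pi dp hX) in L; [|exact SC|exact SA]. split; [exact L|].
      apply (app_eq_on r' (pow X)) in HA; [|exact Fr]. destruct HA as [_ ->]. apply is_succ_suc, HS.
    - destruct H as (C & SC & L & ->). exists C, (ap r' C). split; [exact SC|].
      split; [apply (wadge_lt_iff X TT s pi dp hX); assumption|]. split; [|apply is_succ_suc; reflexivity].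
      apply (app_ap_on r' (pow X)); [exact Fr|apply mem_pow, SC]. }
  split.
  - intros [(p & HP & Fr) H]. apply is_power_pow in HP. subst p. apply (fun_on_ext r rkf (pow X) Fr rk_fun).
    assert (Q : forall A, subset A X -> ap r A = ap rkf A); [|intros A HA; apply Q, mem_pow, HA].
    apply (wadge_ind (fun A => ap r A = rk A)); [dsolve|]. intros A SA IH.
    assert (HS : app r A (ap r A)) by (apply (app_ap_on r (pow X)); [exact Fr|apply mem_pow, SA]).
    apply H in HS. apply (is_sup_unique (fun b => b = suc emp \/ exists C, subset C X /\ lt C A /\ b = suc (rk C))); [|apply rk_sup, SA].
    eapply sup_ext; [|exact HS]. intros b. rewrite (BR A r SA Fr b).
    split; (intros [Q|(C & SC & L & Q)]; [auto|right; exists C; split; [exact SC|split; [exact L|]]]);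
      rewrite Q, IH; auto.
  - intros ->. split; [exists (pow X); split; [apply is_power_pow; reflexivity|exact rk_fun]|].
    intros A a HA. apply (app_eq_on rkf (pow X)) in HA; [|exact rk_fun]. destruct HA as [HA ->].
    apply mem_pow in HA. eapply sup_ext; [|apply rk_sup, HA]. intros b. symmetry. apply BR; assumption.
Qed.

Lemma has_rank_iff A a : has_rank X TT A a <-> subset A X /\ a = rk A.
Proof.
  unfold has_rank. split.
  - intros (r & HR & HA). apply rank_function_iff in HR. subst r.
    apply (app_eq_on rkf (pow X)) in HA; [|exact rk_fun]. rewrite mem_pow in HA. exact HA.
  - intros [SA ->]. exists rkf. split; [apply rank_function_iff; reflexivity|].
    apply (app_ap_on rkf (pow X)); [exact rk_fun|apply mem_pow, SA].
Qed.

Definition th : M := un (rep (pow X) (fun A => suc (rk A))).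
Lemma mem_th b : b ∈ th <-> exists A, subset A X /\ ord_le b (rk A).
Proof.
  unfold th. rewrite mem_un. split.
  - intros (y & Y & H). rewrite mem_rep in Y by dsolve. destruct Y as (A & HA & ->).
    apply mem_pow in HA. exists A. split; [exact HA|apply mem_suc_le, H].
  - intros (A & SA & H). exists (suc (rk A)). split; [|apply mem_suc_le, H].
    rewrite mem_rep by dsolve. exists A. split; [apply mem_pow, SA|reflexivity].
Qed.
Lemma th_ord : is_ord th.
Proof.
  apply un_ord. intros y Y. rewrite mem_rep in Y by dsolve. destruct Y as (A & HA & ->).
  apply suc_ord, rk_ord, mem_pow, HA.
Qed.
Lemma is_Theta_X_iff t : is_Theta_X X TT t <-> t = th.
Proof.
  assert (H : is_Theta_X X TT th).
  { split; [apply th_ord|]. split.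
    - intros b (A & a & SA & HA & HS). apply has_rank_iff in HA. destruct HA as [_ ->].
      apply is_succ_suc in HS. subst b. apply suc_le; [apply th_ord|]. apply mem_th.
      exists A. split; [exact SA|right; reflexivity].
    - intros c OC H. apply ord_subset_le; [exact OC|apply th_ord|]. intros b Hb. apply mem_th in Hb.
      destruct Hb as (A & SA & L). apply (ord_lt_le b (suc (rk A))); [exact OC|apply mem_suc_le, L|].
      apply H. exists A, (rk A). split; [exact SA|]. split; [apply has_rank_iff; auto|apply is_succ_suc; reflexivity]. }
  split; [intros Q; exact (is_sup_unique _ _ _ Q H)|intros ->; exact H].
Qed.

Lemma th_rank a : a ∈ th -> a <> emp -> exists A, subset A X /\ rk A = a.
Proof.
  intros H NE. apply mem_th in H. destruct H as (A & SA & [L|L]); [|eauto].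
  apply (rk_initial A a SA L NE).
Qed.

Lemma SD_iff a : SD X TT a <-> a <> emp /\ a ∈ th /\ forall A, subset A X -> rk A = a -> sd A.
Proof.
  unfold SD. split.
  - intros ((o & O & L) & (t & HT & Q) & H). apply is_one_iff in O. subst o. apply is_Theta_X_iff in HT. subst t.
    split; [intros ->; destruct L as [L|L]; [destruct (mem_emp _ L)|destruct (suc_not_emp _ L)]|].
    split; [exact Q|]. intros A SA E. apply (selfdual_iff X TT s pi dp hX); [exact SA|].
    apply H; [exact SA|]. apply has_rank_iff. auto.
  - intros (NE & Q & H). split; [|split].
    + exists (suc emp). split; [apply is_one_iff; reflexivity|].
      assert (OA : is_ord a) by (apply (ord_in th); [apply th_ord|exact Q]).
      apply suc_le; [exact OA|]. destruct (emp_le a OA) as [L|L]; [exact L|destruct NE; auto].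
    + exists th. split; [apply is_Theta_X_iff; reflexivity|exact Q].
    + intros A SA HA. apply has_rank_iff in HA. destruct HA as [_ ->].
      apply (selfdual_iff X TT s pi dp hX); auto.
Qed.

(** Each rank up to that of A is realized by the preimage of A under a coded reduction. The element
    0 is the rank of no set and is signalled by digit 0 of the odd half. *)
Lemma ranks_onto A : subset A X -> exists q, is_surjection q (Rset R) (suc (rk A)).
Proof.
  intros SA. apply (surj_comp _ Bs); [exact hRB|]. destruct BS_CFs as (q & HQ). apply surj_spec in HQ.
  destruct HQ as [Q1 Q2].
  set (pull := fun f => sep X (fun x => ap pi (ap f (ap s x)) ∈ A)).
  assert (TP : forall f : env -> M, T f -> T (fun e => pull (f e))) by (intros; unfold pull; dsolve).
  assert (PL : forall C f, subset C X -> (forall x, x ∈ X -> (x ∈ C <-> ap pi (ap f (ap s x)) ∈ A)) -> pull f = C).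
  { intros C f SC HF. apply ext. intros x. unfold pull. rewrite mem_sep by dsolve. split.
    - intros [Hx H]. apply HF; assumption.
    - intros H. split; [auto|]. apply HF; auto. }
  clearbody pull.
  apply (surj_lam (fun x => ite (ap (odd x) emp = emp) emp (rk (pull (ap q (evn x))))) Bs _ emp); [dsolve| |].
  - apply mem_suc. left. apply rk_pos, SA.
  - intros b Hb. destruct (classic (b = emp)) as [->|NE].
    + exists (il zero zero). split; [apply il_Bs; apply zero_Bs|].
      rewrite odd_il by apply zero_Bs. rewrite ite_true; [reflexivity|].
      unfold zero. rewrite ap_lam; [reflexivity|dsolve|apply om_emp].
    + assert (QC : exists C, subset C X /\ rk C = b /\ le C A).
      { apply mem_suc in Hb. destruct Hb as [Hb| ->].
        - destruct (rk_initial A b SA Hb NE) as (C & SC & E). exists C. split; [exact SC|]. split; [exact E|].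
          apply le_of_rk; [exact SC|exact SA|rewrite E; exact Hb].
        - exists A. split; [exact SA|]. split; [reflexivity|apply (le_refl X TT s pi dp hX)]. }
      destruct QC as (C & SC & <- & (f & F & HF)). destruct (Q2 f) as (c & Hc & ->); [apply mem_CFs, F|].
      set (o := lam om (fun _ => suc emp)).
      assert (O : o ∈ Bs) by (apply Bs_lam; [dsolve|auto using om_suc, om_emp]).
      exists (il c o). split; [apply il_Bs; assumption|]. rewrite odd_il, evn_il by assumption.
      rewrite ite_false.
      * rewrite (PL C (ap q c) SC HF). reflexivity.
      * unfold o. rewrite ap_lam by (dsolve || apply om_emp). apply suc_not_emp.
Qed.

(* Comparison by local ranks and selfduality at limits *)
Hint Resolve rk_ord rk_pos : core.

Lemma not_le_cp_of_rk L E : subset L X -> subset E X -> rk L ∈ rk E -> ~ le E (cp L).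
Proof.
  intros SL SE H Q. apply rk_le in Q; [|exact SE|apply cp_sub]. rewrite rk_cp in Q by exact SL.
  exact (ord_le_not_lt _ _ (rk_ord L SL) Q H).
Qed.

(** Only the empty set reduces to the empty set, so it has rank 1, and L is the empty set or its
    complement. *)
Lemma rk_const L : subset L X -> (forall y z, y ∈ X -> z ∈ X -> y ∈ L -> z ∈ L) -> rk L = suc emp.
Proof.
  assert (E0 : rk emp = suc emp).
  { assert (S0 : subset emp X) by (intros z Z; destruct (mem_emp _ Z)).
    apply ext. intros b. rewrite mem_rk, mem_suc by exact S0. split.
    - intros [->|(C & SC & [(f & F & H) N] & _)]; [auto|]. destruct N.
      assert (C = emp) as ->; [|apply (le_refl X TT s pi dp hX)].
      apply ext. intros z. split; intros Z; [|destruct (mem_emp _ Z)]. apply H in Z; [destruct (mem_emp _ Z)|auto].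
    - intros [Q|Q]; [destruct (mem_emp _ Q)|auto]. }
  intros SL H. destruct (classic (L = emp)) as [->|NE]; [exact E0|].
  destruct (not_empty L NE) as (y & Y). rewrite <- E0, <- (rk_cp L SL). f_equal.
  apply ext. intros z. rewrite mem_cp. split; [intros [Z N]; destruct N; exact (H y z (SL y Y) Z Y)|].
  intros Z. destruct (mem_emp _ Z).
Qed.

(** One point p serves both E and its complement. Thus a set that is locally simpler everywhere lies
    below E and E^c, while a single exceptional point can still be matched with one of the two. *)
Lemma le_of_local_rank A E : subset A X -> subset E X -> ~ sd E ->
  exists p, p ∈ X /\ ((forall y, y ∈ X -> (exists k, k ∈ om /\ rk (loc A y k) ∈ rk E) \/ (y ∈ A <-> p ∈ E)) -> le A E) /\
  ((forall y, y ∈ X -> (exists k, k ∈ om /\ rk (loc A y k) ∈ rk E) \/ (y ∈ A <-> p ∉ E)) -> le A (cp E)).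
Proof.
  intros SA SE NS. destruct (nonselfdual_point R hDC hRB hAD X TT s pi dp hX E SE NS) as (p & HP & PT).
  exists p. split; [exact HP|]. split; intros H.
  - apply (le_of_local hAD X TT s pi dp hX E A p); try assumption. intros y Y.
    destruct (H y Y) as [(k & Hk & Q)|Q]; [left|auto]. exists k. split; [exact Hk|].
    apply not_le_cp_of_rk; [apply loc_sub|exact SE|exact Q].
  - apply (le_of_local hAD X TT s pi dp hX (cp E) A p); [exact SA|apply cp_sub|exact HP| |].
    + intros k Hk. rewrite (loc_cp X TT s pi dp hX) by assumption. apply (le_cp X TT s pi dp hX), PT, Hk.
    + intros y Y. destruct (H y Y) as [(k & Hk & Q)|Q]; [left|rewrite mem_cp; tauto]. exists k. split; [exact Hk|].
      apply not_le_cp_of_rk; [apply loc_sub|apply cp_sub|rewrite rk_cp by exact SE; exact Q].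
Qed.

Lemma rk_loc_eq A x y k : x ∈ X -> y ∈ X -> k ∈ om -> agree k (ap s x) (ap s y) -> rk (loc A x k) = rk (loc A y k).
Proof.
  intros HX HY Hk G. apply ord_le_antisym; try (apply rk_ord, loc_sub); apply rk_le; try apply loc_sub; apply (loc_agree X TT s pi dp hX); try assumption.
  apply agree_sym, G.
Qed.

Lemma perfect_nbh K : is_perfect X TT K -> subset K X /\
  (forall x, x ∈ X -> x ∉ K -> exists k, k ∈ om /\ forall y, y ∈ nbh x k -> y ∉ K) /\
  (forall y k, y ∈ K -> k ∈ om -> exists y', y' ∈ K /\ y' <> y /\ agree k (ap s y) (ap s y')).
Proof.
  intros [[SK (U & CU & HU)] NI]. split; [exact SK|]. split.
  - intros x HX N. destruct (open_nbh X TT s pi dp hX U x HU) as (k & Hk & S); [apply CU; auto|].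
    exists k. split; [exact Hk|]. intros y Y. apply S, CU in Y. apply Y.
  - intros y k Y Hk. destruct (NI y (nbh y k) Y) as (z & Z & ZN & NE).
    + apply (nbh_open X TT s pi dp hX), Hk.
    + apply nbh_self, SK, Y.
    + apply mem_nbh in ZN. exists z. tauto.
Qed.

Lemma finite_rep n (G : M -> M) : n ∈ om -> T1 G -> finite (rep n G).
Proof.
  intros N TG. exists om, n, (lam n G). split; [apply is_omega_om; reflexivity|]. split; [exact N|].
  split.
  - apply lam_fun; [exact TG|]. intros x Hx. rewrite mem_rep by exact TG. eauto.
  - intros y Y. rewrite mem_rep in Y by exact TG. destruct Y as (x & Hx & ->). exists x. apply app_lam; auto.
Qed.

Lemma limit_finite_bound a (Q : M -> M -> Prop) : D2 Q -> is_limit a ->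
  forall n, n ∈ om -> (forall j, j ∈ n -> exists c, c ∈ a /\ Q j c) ->
  exists b, b ∈ a /\ forall j, j ∈ n -> exists c, ord_le c b /\ Q j c.
Proof.
  intros DQ HA. assert (OA : is_ord a) by apply HA. nind.
  - intros _. destruct HA as (_ & NE & _). apply NNPP. intros N. apply NE. intros z Z. apply N. exists z.
    split; [exact Z|]. intros j J. destruct (mem_emp _ J).
  - intros n N IH H. destruct IH as (b & HB & HQ); [intros j J; apply H, mem_suc; auto|].
    destruct (H n (suc_self n)) as (c & HC & QC).
    assert (OB := ord_in a b OA HB). assert (OC := ord_in a c OA HC).
    destruct (ord_le_or_lt b c OB OC) as [L|L].
    + exists c. split; [exact HC|]. intros j J. apply mem_suc in J. destruct J as [J| ->]; [|exists c; split; [right; reflexivity|exact QC]].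
      destruct (HQ j J) as (c' & L' & Q'). exists c'. split; [apply (ord_le_trans _ b); assumption|exact Q'].
    + exists b. split; [exact HB|]. intros j J. apply mem_suc in J. destruct J as [J| ->]; [auto|exists c; split; [left; exact L|exact QC]].
Qed.

(* A cover of K without finite subcover yields infinitely many disjoint basic clopen
   pieces meeting K.  If A were not selfdual, sets of ranks cofinal in a could be placed
   on these pieces; their union B is strictly below A but of rank at least a. *)
Theorem limit_selfdual K a A : is_perfect X TT K -> ~ compact TT K -> is_limit a -> countable_cofinality a ->
  subset A X -> rk A = a -> sd A.
Proof.
  intros PK NC HA (w & f & W & F & COF) SA EA. apply is_omega_om in W. subst w.
  destruct (perfect_nbh K PK) as (SK & KC & KP). assert (OA : is_ord a) by apply HA.
  assert (sB : forall x, x ∈ X -> ap s x ∈ Bs) by (intros; apply (s_in X TT s pi dp hX); assumption).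
  assert (pB : forall x, x ∈ Bs -> ap pi x ∈ X) by (intros; apply (pi_in X TT s pi dp hX); assumption).
  apply NNPP. intros NS. apply NC. intros C SC COV. apply NNPP. intros NF.
  (* Neighbourhoods that lie inside a member of the cover or miss K. The largest ones, singled out
     by [mn], partition X. *)
  set (good := fun x k => (exists U, U ∈ C /\ subset (nbh x k) U) \/ (forall y, y ∈ nbh x k -> y ∉ K)).
  assert (DG : forall x k : env -> M, T x -> T k -> D (fun e => good (x e) (k e))) by (intros; unfold good; dsolve).
  set (mn := fun x k => k ∈ om /\ good x k /\ forall j, j ∈ k -> ~ good x j).
  assert (DM : forall x k : env -> M, T x -> T k -> D (fun e => mn (x e) (k e))) by (intros; unfold mn; dsolve).
  assert (GE : forall x, x ∈ X -> exists k, mn x k).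
  { intros x HX. destruct (nat_least (fun k => good x k)) as (k & Hk); [dsolve| |exists k; exact Hk].
    destruct (classic (x ∈ K)) as [H|H].
    - destruct (COV x H) as (U & HU & HXU). destruct (open_nbh X TT s pi dp hX U x (SC U HU) HXU) as (k & Hk & S).
      exists k. split; [exact Hk|]. left. eauto.
    - destruct (KC x HX H) as (k & Hk & S). exists k. split; [exact Hk|]. right. exact S. }
  assert (GA : forall x y k, agree k (ap s x) (ap s y) -> mn x k -> mn y k).
  { intros x y k AG (Hk & G & N). assert (Q : forall j, subset j k -> (good x j <-> good y j)).
    { intros j J. unfold good. rewrite (nbh_eq X s x y j); [reflexivity|]. apply (agree_sub k); assumption. }
    split; [exact Hk|]. split; [apply Q; [intros z Z; exact Z|exact G]|].
    intros j J G'. apply (N j J). apply Q; [apply nat_sub; assumption|exact G']. }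
  assert (GU : forall x k k', mn x k -> mn x k' -> k = k').
  { intros x k k' (K1 & G & N) (K2 & G' & N').
    destruct (ord_tricho k k' (nat_ord k K1) (nat_ord k' K2)) as [L|[L|L]]; [destruct (N' k L G)|exact L|destruct (N k' L G')]. }
  assert (GK : forall x k, x ∈ K -> mn x k -> exists U, U ∈ C /\ subset (nbh x k) U).
  { intros x k HX (_ & [G|G] & _); [exact G|]. destruct (G x); [apply nbh_self, SK, HX|exact HX]. }
  assert (MO : forall x k, mn x k -> k ∈ om) by (intros x k H; apply H).
  assert (CI : forall x k x' k', x ∈ K -> x' ∈ K -> mn x k -> mn x' k' -> cd (ap s x) k = cd (ap s x') k' ->
    k = k' /\ agree k (ap s x) (ap s x')).
  { intros x k x' k' HX HX' H H' E. apply cd_inj in E; eauto. }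
  clearbody mn. clear good DG.
  (* Infinitely many pieces meet K, since a bound on their codes would give a finite subcover. *)
  assert (UNB : forall n, n ∈ om -> exists x k, x ∈ K /\ mn x k /\ ord_le n (cd (ap s x) k)).
  { intros n N. apply NNPP. intros NO. apply NF.
    assert (BD : forall x k, x ∈ K -> mn x k -> cd (ap s x) k ∈ n).
    { intros x k HX H. assert (Q : cd (ap s x) k ∈ om) by (apply cd_om; eauto).
      destruct (ord_le_or_lt n _ (nat_ord n N) (nat_ord _ Q)) as [L|L]; [|exact L]. destruct NO. eauto. }
    destruct (classic (exists U, U ∈ C)) as [(U0 & HU0)|EC].
    - destruct (finite_choice C (fun m U => forall x k, x ∈ K -> mn x k -> cd (ap s x) k = m -> subset (nbh x k) U)) with (n := n) as (g & HG).
      + dsolve.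
      + intros m Hm. destruct (classic (exists x k, x ∈ K /\ mn x k /\ cd (ap s x) k = m)) as [(x & k & HX & H & E)|NX].
        * destruct (GK x k HX H) as (U & HU & S). exists U. split; [exact HU|].
          intros x' k' HX' H' E'. rewrite <- E in E'. destruct (CI x' k' x k) as [-> AG]; auto.
          rewrite (nbh_eq X s x' x k AG). exact S.
        * exists U0. split; [exact HU0|]. intros x k HX H E. destruct NX. eauto.
      + exact N.
      + exists (rep n (ap g)). assert (TG : T1 (ap g)) by dsolve. split; [|split].
        * intros U HU. rewrite mem_rep in HU by exact TG. destruct HU as (m & Hm & ->). apply HG, Hm.
        * apply finite_rep; assumption.
        * intros x HX. destruct (GE x (SK x HX)) as (k & H). assert (Q := BD x k HX H).
          exists (ap g (cd (ap s x) k)). split; [rewrite mem_rep by exact TG; eauto|].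
          destruct (HG _ Q) as [_ S]. apply (S x k HX H eq_refl). apply nbh_self, SK, HX.
    - exists (rep emp (fun x => x)). assert (TG : T1 (fun x : M => x)) by dsolve. split; [|split].
      + intros U HU. rewrite mem_rep in HU by exact TG. destruct HU as (m & Hm & _). destruct (mem_emp _ Hm).
      + apply finite_rep; [apply om_emp|exact TG].
      + intros x HX. destruct (COV x HX) as (U & HU & _). destruct EC. eauto. }
  set (Dq := fun q => sep X (fun y => ap pi (ap q (ap s y)) ∈ A)).
  assert (TDq : forall q : env -> M, T q -> T (fun e => Dq (q e))) by (intros; unfold Dq; dsolve).
  assert (MD : forall q y, y ∈ Dq q <-> y ∈ X /\ ap pi (ap q (ap s y)) ∈ A).
  { intros q y. unfold Dq. rewrite mem_sep by dsolve. reflexivity. }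
  clearbody Dq. assert (DS : forall q, subset (Dq q) X) by (intros q y Y; apply MD in Y; apply Y).
  (* For the piece with code m: a set of rank below A, named by a reduction to A, whose rank inside
     the piece is at least f(0), ..., f(m). *)
  destruct (countable_choice R hDC hRB CFs (fun m q => forall x k, x ∈ K -> mn x k -> cd (ap s x) k = m ->
    rk (Dq q) ∈ rk A /\ forall j, j ∈ suc m -> ord_le (ap f j) (rk (loc (Dq q) x k)))) as (h & _ & HH).
  - dsolve.
  - apply BS_CFs.
  - intros m Hm. destruct (classic (exists x k, x ∈ K /\ mn x k /\ cd (ap s x) k = m)) as [(x & k & HX & H & E)|NX];
      [|exists idB; split; [apply mem_CFs, CF_idB|]; intros x k HX H E; destruct NX; eauto].
    destruct (limit_finite_bound a (fun j c => c = ap f j)) with (n := suc m) as (b & HB & BD'); [dsolve|exact HA|apply om_suc, Hm| |].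
    { intros j J. exists (ap f j). split; [|reflexivity]. apply (ap_mem f om); [exact F|]. exact (nat_trans j _ (om_suc m Hm) J). }
    assert (BD : forall j, j ∈ suc m -> ord_le (ap f j) b).
    { intros j J. destruct (BD' j J) as (c & L & ->). exact L. }
    clear BD'.
    assert (OB := ord_in a b OA HB).
    (* [suc b] stands in for b because rank 0 is not attained. Being non-selfdual, E0 has a copy
       inside the piece; being of smaller rank than A, it reduces to A. *)
    destruct (nonselfdual_between A (suc b)) as (E0 & SE & NE & L1 & L2); [exact SA|apply suc_not_emp|rewrite EA; do 2 (apply limit_suc; [exact HA|]); exact HB|].
    destruct (nonselfdual_inside X TT s pi dp hX K SK KP x k HX (MO x k H) hAD E0 SE NE) as (q0 & Q0 & LQ).
    destruct (le_of_rk E0 A SE SA L2) as [(r & CR & HR) _].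
    set (q := comp r (comp (sp s pi) q0)).
    assert (CSP := CF_sp X TT s pi dp hX).
    assert (DE : Dq q = sep X (fun y => ap pi (ap q0 (ap s y)) ∈ E0)).
    { apply ext. intros y. rewrite MD, mem_sep by dsolve.
      assert (QE : y ∈ X -> (ap pi (ap q0 (ap s y)) ∈ E0 <-> ap pi (ap q (ap s y)) ∈ A)).
      { intros Y. assert (SY := sB y Y). assert (QY := CF_ap q0 _ Q0 SY). assert (SQ := CF_ap _ _ CSP QY).
        unfold q. rewrite !ap_comp by (rewrite ?ap_comp; assumption). apply HR. auto. }
      tauto. }
    exists q. split; [apply mem_CFs; unfold q; auto using CF_comp|]. clearbody q.
    assert (RD : rk (Dq q) ∈ rk A).
    { apply (ord_le_lt _ (rk E0)); [auto| |exact L2]. apply rk_le; [apply DS|exact SE|].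
      exists q0. split; [exact Q0|]. intros y Y. rewrite DE, mem_sep by dsolve. tauto. }
    intros x' k' HX' H' E'. split; [exact RD|]. rewrite <- E in E'. destruct (CI x' k' x k) as [-> AG]; auto.
    intros j J. assert (OL : is_ord (rk (loc (Dq q) x' k))) by (apply rk_ord, loc_sub).
    apply (ord_le_trans _ b); [exact OL|auto|]. rewrite (rk_loc_eq (Dq q) x' x k) in * by eauto.
    apply (ord_le_trans _ (rk E0)); [exact OL| |rewrite DE; apply rk_le; [exact SE|apply loc_sub|exact LQ]].
    apply (ord_le_trans _ (suc b)); [auto|left; apply suc_self|exact L1].
  (* B copies the chosen set on each piece meeting K and is empty on the others. *)
  - set (B := sep X (fun y => exists x k, x ∈ K /\ mn x k /\ agree k (ap s x) (ap s y) /\ y ∈ Dq (ap h (cd (ap s x) k)))).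
    assert (MB : forall y, y ∈ B <-> y ∈ X /\ exists x k, x ∈ K /\ mn x k /\ agree k (ap s x) (ap s y) /\ y ∈ Dq (ap h (cd (ap s x) k))).
    { intros y. unfold B. rewrite mem_sep by dsolve. reflexivity. }
    clearbody B. assert (SB : subset B X) by (intros y Y; apply MB in Y; apply Y).
    assert (B1 : forall x k y, x ∈ K -> mn x k -> y ∈ X -> agree k (ap s x) (ap s y) -> (y ∈ B <-> y ∈ Dq (ap h (cd (ap s x) k)))).
    { intros x k y HX H Y AG. rewrite MB. split; [|intros Q; split; [exact Y|]; exists x, k; auto].
      intros [_ (x' & k' & HX' & H' & AG' & Q)]. assert (k' = k) as -> by eauto.
      rewrite <- (cd_agree (ap s x') (ap s x) k); [exact Q|eauto|].
      apply (agree_trans _ _ (ap s y)); [exact AG'|apply agree_sym, AG]. }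
    assert (LOW : forall y, y ∈ X -> exists k, k ∈ om /\ rk (loc B y k) ∈ rk A).
    { intros y Y. destruct (GE y Y) as (k & H). assert (Hk := MO y k H). exists k. split; [exact Hk|].
      destruct (classic (exists x, x ∈ K /\ agree k (ap s x) (ap s y))) as [(x & HX & AG)|N].
      - assert (H' : mn x k) by (apply (GA y x); [apply agree_sym, AG|exact H]).
        assert (Q : cd (ap s x) k ∈ om) by (apply cd_om; auto).
        apply (ord_le_lt _ (rk (Dq (ap h (cd (ap s x) k))))); [auto| |].
        + apply rk_le; [apply loc_sub|apply DS|]. apply (loc_le_on X TT s pi dp hX idB); [exact Y|exact Hk|apply CF_idB|].
          intros z Z AZ. rewrite ap_idB, (pi_s X TT s pi dp hX) by auto. apply B1; auto.
          apply (agree_trans _ _ (ap s y)); assumption.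
        + apply (HH _ Q x k HX H' eq_refl).
      - rewrite EA, rk_const; [apply limit_suc; [exact HA|rewrite <- EA; auto]|apply loc_sub|].
        intros z z' Z _ Q. exfalso. apply mem_loc in Q. destruct Q as [_ Q]. apply MB in Q.
        destruct Q as [_ (x & k' & HX & H' & AG & _)]. rewrite (rt_s X TT s pi dp hX) in AG by assumption.
        assert (AG2 := rt_agree s y k (ap s z) (sB z Z)).
        assert (H1 : mn (ap pi (ap (rt s y k) (ap s z))) k).
        { apply (GA y); [|exact H]. rewrite (rt_s X TT s pi dp hX) by assumption. exact AG2. }
        assert (H2 : mn (ap pi (ap (rt s y k) (ap s z))) k').
        { apply (GA x); [|exact H']. rewrite (rt_s X TT s pi dp hX) by assumption. exact AG. }
        assert (k' = k) as -> by eauto. apply N. exists x. split; [exact HX|].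
        apply (agree_trans _ _ (ap (rt s y k) (ap s z))); [exact AG|apply agree_sym, AG2]. }
    (* B is everywhere locally of rank below A, hence lies below both A and A^c; A <= B would make A
       selfdual. *)
    destruct (le_of_local_rank B A SB SA NS) as (p & HP & L1 & L2).
    assert (LB : lt B A).
    { split; [auto|]. intros Q. apply NS. apply (le_trans X TT s pi dp hX _ B); auto. }
    assert (RB : rk B ∈ a) by (rewrite <- EA; apply rk_lt; assumption).
    (* Some f(n) reaches rk B + 1, and on a piece with code at least n the set B has rank at least
       f(n). *)
    destruct (COF (suc (rk B))) as (n & c & AP & L); [apply limit_suc; assumption|].
    apply (app_eq f om a) in AP; [|exact F]. destruct AP as [N ->].
    destruct (UNB n N) as (x & k & HX & H & LN). assert (Q : cd (ap s x) k ∈ om) by (apply cd_om; eauto).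
    destruct (HH _ Q x k HX H eq_refl) as [_ LL].
    assert (OB := rk_ord B SB).
    assert (L3 : ord_le (rk (loc (Dq (ap h (cd (ap s x) k))) x k)) (rk B)).
    { apply rk_le; [apply loc_sub|exact SB|].
      apply (loc_le_on X TT s pi dp hX idB); [auto|eauto|apply CF_idB|]. intros y Y AG.
      rewrite ap_idB, (pi_s X TT s pi dp hX) by auto. symmetry. apply B1; auto. }
    apply (mem_irrefl (rk B)). apply (ord_lt_le _ (suc (rk B))); [exact OB|apply suc_self|].
    apply (ord_le_trans _ (ap f n)); [exact OB|exact L|].
    apply (ord_le_trans _ (rk (loc (Dq (ap h (cd (ap s x) k))) x k))); [exact OB| |exact L3].
    apply LL, mem_suc_le. exact LN.
Qed.

(** * The length of the Wadge hierarchy *)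

Context (hXB : exists q, is_surjection q X Bs).

(* Diagonalization: x codes (f, (w, e)), and A_b is not reduced by f to A_w nor to
   its complement, for every w below b. *)
Lemma no_onto_th : ~ BS th.
Proof.
  intros HT. destruct (surj_comp _ _ _ hXB (BS_prod _ _ BS_CFs (BS_prod _ _ HT BS_om))) as (q & HQ).
  apply surj_spec in HQ. destruct HQ as [Q1 Q2].
  (* The flag e' selects the target to be defeated: A_w for 0, its complement otherwise. Defeating
     both puts A_w strictly below A_b. *)
  set (F := fun b g => sep X (fun x => ~ exists f w e', ap q x = op f (op w e') /\ w ∈ b /\
    (ap pi (ap f (ap s x)) ∈ ap g w <-> e' = emp))).
  destruct (ord_recursion (suc th) F) as (h & _ & HE); [unfold F; dsolve|apply suc_ord, th_ord|].
  assert (DI : forall b f w e' x, b ∈ suc th -> w ∈ b -> x ∈ X -> ap q x = op f (op w e') ->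
    (x ∈ ap h b <-> ~ (ap pi (ap f (ap s x)) ∈ ap h w <-> e' = emp))).
  { intros b f w e' x Hb Hw Hx E. rewrite HE by exact Hb. unfold F. rewrite mem_sep by dsolve. split.
    - intros [_ N] C. apply N. exists f, w, e'. rewrite ap_res by exact Hw. auto.
    - intros N. split; [exact Hx|]. intros (f' & w' & e'' & E' & Hw' & C). rewrite E in E'.
      apply op_inj in E'. destruct E' as [<- E']. apply op_inj in E'. destruct E' as [<- <-].
      rewrite ap_res in C by exact Hw. exact (N C). }
  assert (SH : forall b, b ∈ suc th -> subset (ap h b) X).
  { intros b Hb x Hx. rewrite HE in Hx by exact Hb. unfold F in Hx. apply mem_sep in Hx; [apply Hx|dsolve]. }
  assert (WT : forall b w, b ∈ suc th -> w ∈ b -> w ∈ th).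
  { intros b w Hb Hw. apply (ord_lt_le w b); [apply th_ord|exact Hw|apply mem_suc_le, Hb]. }
  assert (FIND : forall f w e', CF f -> w ∈ th -> e' ∈ om -> exists x, x ∈ X /\ ap q x = op f (op w e')).
  { intros f w e' Hf Hw He. destruct (Q2 (op f (op w e'))) as (x & Hx & E).
    - apply op_in_prod. split; [apply mem_CFs, Hf|]. apply op_in_prod. auto.
    - exists x. auto. }
  assert (LT : forall b w, b ∈ suc th -> w ∈ b -> lt (ap h w) (ap h b)).
  { intros b w Hb Hw. assert (Hw' := WT b w Hb Hw).
    assert (Hws : w ∈ suc th) by (apply mem_suc; auto). split.
    - apply NNPP. intros N. apply (wadge_not hAD X TT s pi dp hX _ _ (SH w Hws)) in N.
      apply (le_cp_l X TT s pi dp hX) in N; [|apply SH, Hb].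
      destruct N as (f & Hf & HF). destruct (FIND f w (suc emp) Hf Hw') as (x & Hx & E); [auto using om_suc, om_emp|].
      specialize (HF x Hx). rewrite (DI b f w (suc emp) x Hb Hw Hx E) in HF. rewrite mem_cp in HF.
      assert (ap pi (ap f (ap s x)) ∈ X).
      { apply (pi_in X TT s pi dp hX), CF_ap; [exact Hf|apply (s_in X TT s pi dp hX), Hx]. }
      pose proof (suc_not_emp emp). tauto.
    - intros (f & Hf & HF). destruct (FIND f w emp Hf Hw' om_emp) as (x & Hx & E).
      specialize (HF x Hx). rewrite (DI b f w emp x Hb Hw Hx E) in HF. tauto. }
  (* Ranks along the strictly increasing sequence are at least the indices, so its last term has
     rank at least [th], above all ranks. *)
  assert (RK : forall b, is_ord b -> b ∈ suc th -> ord_le b (rk (ap h b))).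
  { apply (ord_ind (fun b => b ∈ suc th -> ord_le b (rk (ap h b)))); [dsolve|]. intros b OB IH Hb.
    apply ord_subset_le; [apply rk_ord, SH, Hb|exact OB|]. intros w Hw.
    assert (Hws : w ∈ suc th) by (apply mem_suc; left; exact (WT b w Hb Hw)).
    apply (ord_le_lt w (rk (ap h w))); [apply rk_ord, SH, Hb|auto|].
    apply rk_lt; [apply SH, Hws|apply SH, Hb|apply LT; assumption]. }
  assert (HTH : th ∈ suc th) by apply suc_self.
  apply (mem_irrefl th). apply (ord_le_lt th (rk (ap h th))); [apply th_ord|apply RK; [apply th_ord|exact HTH]|].
  apply mem_th. exists (ap h th). split; [apply SH, HTH|right; reflexivity].
Qed.

(** Otherwise [th] would be a member of a, hence an image of the reals, against the
    diagonalization. *)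
Lemma onto_le_th a : is_ord a -> (exists q, is_surjection q (Rset R) a) -> ord_le a th.
Proof.
  intros OA H. destruct (ord_le_or_lt a th OA th_ord) as [L|L]; [exact L|]. destruct no_onto_th.
  destruct (surj_comp _ _ _ (BS_real R hR) H) as (q & HQ). apply surj_spec in HQ. destruct HQ as [Q1 Q2].
  apply (surj_lam (ap q) Bs th emp); [dsolve| |].
  - apply mem_th. exists emp. assert (SE : subset emp X) by (intros z Z; destruct (mem_emp z Z)).
    split; [exact SE|left; apply rk_pos, SE].
  - intros b Hb. apply Q2. exact (ord_trans b th a OA Hb L).
Qed.

Theorem Theta_th : is_Theta R th.
Proof.
  split; [apply th_ord|]. split.
  - intros a [OA H]. apply onto_le_th; assumption.
  - intros c OC H. apply ord_subset_le; [exact OC|apply th_ord|]. intros b Hb. apply mem_th in Hb.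
    destruct Hb as (A & SA & L). apply (ord_lt_le b (suc (rk A))); [exact OC|apply mem_suc_le, L|].
    apply H. split; [apply suc_ord, rk_ord, SA|apply ranks_onto, SA].
Qed.

(** The successor of a is still an image of omega, which puts a strictly below the length. *)
Lemma countable_in_th a : is_ord a -> countable a -> a ∈ th.
Proof.
  intros OA (w & f & W & [Ff If]). apply is_omega_om in W. subst w.
  apply (ord_lt_le a (suc a)); [apply th_ord|apply suc_self|]. apply onto_le_th; [apply suc_ord, OA|].
  apply (surj_comp _ Bs _ hRB). apply (surj_comp _ om _ BS_om).
  (* 0 is sent to a itself and f x + 1 to x. *)
  set (F := fun n => ite (n = emp) a (the (fun x => x ∈ a /\ suc (ap f x) = n))).
  apply (surj_lam F om (suc a) a); [unfold F; dsolve|apply suc_self|].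
  intros x Hx. apply mem_suc in Hx. destruct Hx as [Hx| ->].
  - exists (suc (ap f x)). split; [apply om_suc, (ap_mem f a); assumption|].
    unfold F. rewrite ite_false by apply suc_not_emp. symmetry. apply the_eq; [auto|].
    intros z [Z E]. apply suc_inj in E. apply (If z x (ap f x)); [rewrite <- E|]; apply (app_ap f a om); assumption.
  - exists emp. split; [apply om_emp|]. symmetry. apply ite_true. reflexivity.
Qed.

(** Every countable ordinal is below [th], so separation from [th] collects all of them. *)
Lemma omega1_exists : is_omega1 (sep th countable).
Proof.
  assert (MO : forall b, b ∈ sep th countable <-> b ∈ th /\ countable b) by (intros; apply mem_sep; dsolve).
  assert (TO := th_ord).
  assert (OO : is_ord (sep th countable)).
  { split.
    - intros b HB z Z. apply MO in HB. destruct HB as [HB CB]. apply MO. split; [exact (ord_trans z b _ TO Z HB)|].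
      apply (countable_sub b); [|exact CB]. exact (proj1 (ord_in _ b TO HB) z Z).
    - intros b HB. apply MO in HB. exact (proj1 (ord_in _ b TO (proj1 HB))). }
  split; [exact OO|]. split; [|intros b HB; apply MO, HB].
  intros CO. apply (mem_irrefl (sep th countable)). apply MO. split; [apply countable_in_th; assumption|exact CO].
Qed.

(** * The perfect kernel and its compactness *)

Definition kernel := sep X (fun x => forall k, k ∈ om -> exists P, is_perfect X TT P /\ exists y, y ∈ P /\ y ∈ nbh x k).
Lemma mem_kernel x : x ∈ kernel <-> x ∈ X /\ forall k, k ∈ om -> exists P, is_perfect X TT P /\ exists y, y ∈ P /\ y ∈ nbh x k.
Proof. apply mem_sep. unfold is_perfect, is_closed, is_compl. dsolve. Qed.

(** The kernel is the closure of the union of all perfect sets. None of its points x is isolated: a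
    perfect set meeting a neighbourhood of x has a point other than x there. *)
Lemma kernel_perfect : is_perfect_kernel X TT kernel.
Proof.
  assert (SUB : forall P, is_perfect X TT P -> subset P kernel).
  { intros P HP x HX. assert (XX : x ∈ X) by (apply HP, HX). apply mem_kernel. split; [exact XX|]. intros k Hk.
    exists P. split; [exact HP|]. exists x. split; [exact HX|apply nbh_self, XX]. }
  split; [|exact SUB]. split; [split|].
  - intros x HX. apply mem_kernel in HX. apply HX.
  - exists (cp kernel). split; [intros z; apply mem_cp|]. apply hX. split; [apply cp_sub|].
    intros x HX. apply mem_cp in HX. destruct HX as [HX N]. apply NNPP. intros NO. apply N, mem_kernel.
    split; [exact HX|]. intros k Hk. apply NNPP. intros NP. apply NO. exists k. split; [exact Hk|].
    intros y Y AG. apply mem_cp. split; [exact Y|]. intros Q. apply mem_kernel in Q. apply NP.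
    rewrite (nbh_eq X s x y k AG). apply Q, Hk.
  - intros x U HX HU HXU. destruct (open_nbh X TT s pi dp hX U x HU HXU) as (k & Hk & S).
    apply mem_kernel in HX. destruct HX as [HX H]. destruct (H k Hk) as (P & HP & y & YP & Y).
    destruct (classic (y = x)) as [->|NE]; [|exists y; split; [apply (SUB P HP), YP|auto]].
    destruct HP as [CP NI]. destruct (NI x (nbh x k) YP) as (z & Z & ZN & NE); [apply (nbh_open X TT s pi dp hX), Hk|exact Y|].
    exists z. split; [apply (SUB P (conj CP NI)), Z|auto].
Qed.

(* The points with a neighbourhood on which all ranks are bounded by a fixed countable
   ordinal form an open set V with perfect complement.  By regularity of omega_1 a
   countable ga bounds all ranks on V, and compactness gives such a bound on the
   kernel for a selfdual set of limit rank l above ga, a contradiction. *)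
Theorem kernel_not_compact : (forall l A, is_limit l -> countable l -> subset A X -> rk A = l -> sd A) -> ~ compact TT kernel.
Proof.
  intros SDL CK. assert (TO := th_ord).
  (* The bound is uniform over all subsets of X, so that it belongs to the neighbourhood alone. *)
  set (bd := fun x k b => b ∈ th /\ countable b /\ forall A, subset A X -> rk (loc A x k) ∈ b).
  assert (DB : forall x k b : env -> M, T x -> T k -> T b -> D (fun e => bd (x e) (k e) (b e))) by (intros; unfold bd; dsolve).
  assert (BT : forall x y k b, x ∈ X -> y ∈ X -> k ∈ om -> agree k (ap s x) (ap s y) -> bd x k b -> bd y k b).
  { intros x y k b HX HY Hk AG (B1 & B2 & B3). split; [exact B1|]. split; [exact B2|]. intros A SA.
    rewrite <- (rk_loc_eq A x y k) by assumption. auto. }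
  (* The least bound near a dense point, obtained without choice as the intersection of all bounds;
     it is empty if there are none. *)
  set (H := fun j => sep th (fun b => (exists c, bd (ap dp (p1 j)) (p2 j) c) /\ forall c, bd (ap dp (p1 j)) (p2 j) c -> b ∈ c)).
  assert (TH : T1 H) by (unfold H; dsolve).
  assert (MH : forall j b, b ∈ H j <-> b ∈ th /\ (exists c, bd (ap dp (p1 j)) (p2 j) c) /\ forall c, bd (ap dp (p1 j)) (p2 j) c -> b ∈ c).
  { intros j b. unfold H. rewrite mem_sep by dsolve. reflexivity. }
  clearbody H.
  assert (HO : forall j, j ∈ om -> is_ord (H j) /\ countable (H j)).
  { intros j _. split; [split|].
    - intros b HB z Z. apply MH in HB. destruct HB as (B1 & B2 & B3). apply MH.
      split; [exact (ord_trans z b _ TO Z B1)|]. split; [exact B2|]. intros c HC.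
      apply (ord_trans z b); [apply (ord_in _ c TO), HC|exact Z|auto].
    - intros b HB. apply MH in HB. exact (proj1 (ord_in _ b TO (proj1 HB))).
    - apply NNPP. intros N. assert (Q : exists c, bd (ap dp (p1 j)) (p2 j) c).
      { apply NNPP. intros NC. apply N.
        apply (countable_lam (fun x => x)); [dsolve|intros b HB|intros b b' HB _ _]; apply MH in HB; destruct (NC (proj1 (proj2 HB))). }
      destruct Q as (c & HC). apply N, (countable_sub c); [|apply HC]. intros b HB. apply MH in HB. apply HB, HC. }
  set (ga := un (rep om H)).
  assert (OG : is_ord ga).
  { apply un_ord. intros y Y. rewrite mem_rep in Y by exact TH. destruct Y as (j & J & ->). apply HO, J. }
  assert (CG : countable ga) by (apply (countable_union R hDC hRB); assumption).
  (* Each neighbourhood is also a neighbourhood of a dense point, so the countably many bounds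
     collected in [ga] suffice. *)
  assert (GB : forall x k b A, x ∈ X -> k ∈ om -> bd x k b -> subset A X -> rk (loc A x k) ∈ ga).
  { intros x k b A HX Hk HB SA. destruct (coded_dense _ _ _ _ _ hX x k HX Hk) as (i & I & AG).
    assert (DI : ap dp i ∈ X) by (apply (ap_mem dp om); [apply hX|exact I]).
    apply mem_un. exists (H (pr i k)). split; [rewrite mem_rep by exact TH; exists (pr i k); auto using pr_om|].
    rewrite (rk_loc_eq A x (ap dp i) k) by assumption. apply MH. rewrite p1_pr, p2_pr by assumption.
    assert (HB' := BT _ _ _ _ HX DI Hk AG HB). split; [|split; [eauto|intros c HC; apply HC, SA]].
    apply (ord_trans _ b); [exact TO|apply HB', SA|apply HB']. }
  clearbody ga. clear H TH MH HO.
  destruct (limit_above R hDC hRB ga OG CG) as (l & HL & CL & GL).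
  assert (OL : is_ord l) by apply HL. assert (LT := countable_in_th l OL CL).
  destruct (th_rank l LT) as (A & SA & EA); [intros ->; destruct (mem_emp _ GL)|].
  assert (SDA := SDL l A HL CL SA EA).
  assert (S1 : forall b, is_ord b -> suc emp ∈ suc (suc b)).
  { intros b OB. apply mem_suc_le, suc_le; [apply suc_ord, OB|]. apply mem_suc_le, emp_le, OB. }
  (* Non-selfdual ranks are cofinal in l. The two successors put both b and the rank 1 of constant
     pieces strictly below rk E. *)
  assert (BW : forall b, b ∈ l -> exists E, subset E X /\ ~ sd E /\ ord_le (suc (suc b)) (rk E) /\ rk E ∈ l).
  { intros b HB. rewrite <- EA. apply nonselfdual_between; [exact SA|apply suc_not_emp|].
    rewrite EA. do 3 (apply limit_suc; [exact HL|]). exact HB. }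
  set (W := sep X (fun x => forall k, k ∈ om -> forall b, ~ bd x k b)).
  assert (MW : forall x, x ∈ W <-> x ∈ X /\ forall k, k ∈ om -> forall b, ~ bd x k b).
  { intros x. unfold W. rewrite mem_sep by dsolve. reflexivity. }
  clearbody W.
  assert (NW : forall x, x ∈ X -> x ∉ W -> exists k b, k ∈ om /\ bd x k b).
  { intros x HX N. apply NNPP. intros C. apply N, MW. split; [exact HX|]. intros k Hk b HB. apply C. eauto. }
  assert (WP : is_perfect X TT W).
  { split; [split|].
    - intros x HX. apply MW in HX. apply HX.
    - exists (cp W). split; [intros z; apply mem_cp|]. apply hX. split; [apply cp_sub|].
      intros x HX. apply mem_cp in HX. destruct HX as [HX N]. destruct (NW x HX N) as (k & b & Hk & HB).
      exists k. split; [exact Hk|]. intros y Y AG. apply mem_cp. split; [exact Y|]. intros Q. apply MW in Q.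
      apply (proj2 Q k Hk b). apply (BT x); assumption.
    (* If x were isolated in W, a set localized near x would have local ranks below rk E at all
       other points. It would reduce to E or to E^c, the side being decided at x alone, and rk E + 1
       would bound all ranks near x, contrary to x in W. *)
    - intros x U HX HU HXU. apply NNPP. intros NO. destruct (open_nbh X TT s pi dp hX U x HU HXU) as (k & Hk & S).
      apply MW in HX. destruct HX as [HX NB].
      destruct (BW ga GL) as (E & SE & NE & L1 & L2). assert (OE := rk_ord E SE).
      assert (GE : ga ∈ rk E).
      { apply (ord_lt_le ga (suc (suc ga))); [exact OE| |exact L1]. apply mem_suc_le. left. apply suc_self. }
      apply (NB k Hk (suc (rk E))).
      assert (SL : suc (rk E) ∈ l) by (apply limit_suc; assumption).
      split; [exact (ord_trans _ l _ TO SL LT)|].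
      split; [apply (countable_sub l); [exact (proj1 OL _ SL)|exact CL]|].
      intros A' SA'. apply mem_suc_le. set (B := loc A' x k). assert (SB : subset B X) by apply loc_sub.
      destruct (le_of_local_rank B E SB SE NE) as (p & HP & B1 & B2).
      assert (OTH : forall y, y ∈ X -> y <> x -> exists j, j ∈ om /\ rk (loc B y j) ∈ rk E).
      { intros y Y YX. destruct (classic (agree k (ap s x) (ap s y))) as [AG|AG].
        - destruct (NW y Y) as (j & b & J & HB).
          + intros Q. apply NO. exists y. split; [exact Q|]. split; [|exact YX]. apply S, mem_nbh. auto.
          + exists j. split; [exact J|]. apply (ord_trans _ ga); [exact OE|apply (GB y j b); assumption|exact GE].
        - exists k. split; [exact Hk|]. rewrite rk_const.
          + apply (ord_lt_le (suc emp) (suc (suc ga))); auto.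
          + apply loc_sub.
          + assert (Q : forall z, z ∈ X -> (z ∈ loc B y k <-> x ∈ A')).
            { intros z Z. assert (SZ : ap s z ∈ Bs) by (apply (s_in X TT s pi dp hX); exact Z).
              assert (RZ : ap (rt s y k) (ap s z) ∈ Bs) by (apply CF_ap; [apply (CF_rt X TT s pi dp hX); assumption|exact SZ]).
              unfold B. rewrite mem_loc, mem_loc, (rt_s X TT s pi dp hX), (rt_out s x), (pi_s X TT s pi dp hX) by (assumption ||
                (intros C; apply AG; apply (agree_trans _ _ (ap (rt s y k) (ap s z))); [exact C|apply agree_sym, rt_agree, SZ])).
              assert (ap pi (ap (rt s y k) (ap s z)) ∈ X) by (apply (pi_in X TT s pi dp hX); exact RZ). tauto. }
            intros z z' Z Z'. rewrite !Q by assumption. auto. }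
      destruct (classic (x ∈ B <-> p ∈ E)) as [C|C].
      + apply rk_le; [exact SB|exact SE|]. apply B1. intros y Y. destruct (classic (y = x)) as [->|NX]; auto.
      + rewrite <- (rk_cp E SE). apply rk_le; [exact SB|apply cp_sub|]. apply B2. intros y Y.
        destruct (classic (y = x)) as [->|NX]; [right|auto]. destruct (classic (x ∈ B)), (classic (p ∈ E)); tauto. }
  (* W is perfect, so outside the kernel all local ranks are eventually below [ga]. *)
  assert (WK : subset W kernel) by (apply kernel_perfect, WP).
  (* The cover consists of neighbourhoods on which the selfdual set A has rank below l; compactness
     leaves finitely many of these ranks, bounded by [de] below l. *)
  destruct (CK (sep TT (fun U => exists x k, x ∈ X /\ k ∈ om /\ U = nbh x k /\ rk (loc A x k) ∈ l)))
    as (F & SF & (w & n & f & Hw & N & HF) & COV).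
  { intros U HU. apply mem_sep in HU; [apply HU|dsolve]. }
  { intros x HX. apply mem_kernel in HX. destruct HX as [HX _]. destruct (loc_lt_of_sd A x SA SDA HX) as (k & Hk & Q).
    exists (nbh x k). split; [|apply nbh_self, HX]. apply mem_sep; [dsolve|]. split; [apply (nbh_open X TT s pi dp hX), Hk|].
    exists x, k. rewrite EA in Q. auto. }
  apply is_omega_om in Hw. subst w. apply surj_spec in HF. destruct HF as [Ff Sf].
  destruct (limit_finite_bound l (fun j c => exists x k, x ∈ X /\ k ∈ om /\ ap f j = nbh x k /\ c = rk (loc A x k))) with (n := n)
    as (de & DL & HD); [dsolve|exact HL|exact N| |].
  { intros j J. assert (Q : ap f j ∈ F) by (apply (ap_mem f n); assumption). apply SF in Q.
    apply mem_sep in Q; [|dsolve]. destruct Q as (_ & x & k & HX & Hk & E & Q). exists (rk (loc A x k)).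
    split; [exact Q|]. exists x, k. auto. }
  assert (OD := ord_in l de OL DL).
  assert (MX : exists m, m ∈ l /\ ord_le ga m /\ ord_le de m).
  { destruct (ord_le_or_lt ga de OG OD) as [L|L].
    - exists de. split; [exact DL|]. split; [exact L|right; reflexivity].
    - exists ga. split; [exact GL|]. split; [right; reflexivity|left; exact L]. }
  (* rk E lies strictly between m and l and exceeds the local ranks of A everywhere, so A, of rank
     l, would reduce to a set of smaller rank. *)
  destruct MX as (m & ML & GM & DM). destruct (BW m ML) as (E & SE & NE & L1 & L2).
  assert (OE := rk_ord E SE). assert (OM := ord_in l m OL ML).
  assert (ME : m ∈ rk E).
  { apply (ord_lt_le m (suc (suc m))); [exact OE| |exact L1]. apply mem_suc_le. left. apply suc_self. }
  destruct (le_of_local_rank A E SA SE NE) as (p & _ & LE & _).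
  assert (Q : le A E).
  { apply LE. intros y Y. left. destruct (classic (y ∈ kernel)) as [K|K].
    - destruct (COV y K) as (U & HU & YU). destruct (Sf U HU) as (j & J & ->).
      destruct (HD j J) as (c & LC & x & k & HX & Hk & EF & ->). rewrite EF in YU. apply mem_nbh in YU.
      exists k. split; [exact Hk|]. rewrite <- (rk_loc_eq A x y k) by tauto.
      apply (ord_le_lt _ m); [exact OE| |exact ME]. apply (ord_le_trans _ de); assumption.
    - destruct (NW y Y) as (k & b & Hk & HB); [auto|]. exists k. split; [exact Hk|].
      apply (ord_trans _ m); [exact OE| |exact ME]. apply (ord_lt_le _ ga); [exact OM|apply (GB y k b); assumption|exact GM]. }
  apply rk_le in Q; [|exact SA|exact SE]. rewrite EA in Q. exact (ord_le_not_lt _ _ OE Q L2).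
Qed.
End Ranks.

(** * Assembly of the equivalences *)

Theorem theorem4p9 (M : set_structure) (hZF : ZF M)
  (R : ordered_field_data M) (hR : is_real_line R)
  (hDC : DC_reals R) (hAD : AD M)
  (X T : M) (hPolish : is_polish R X T) (hzero : zero_dimensional X T)
  (huncountable : ~ countable X) :
  let i := exists K, is_perfect_kernel X T K /\ ~ compact T K in
  let ii := forall omega1 alpha, is_omega1 omega1 -> alpha ∈ omega1 ->
              is_limit alpha -> SD X T alpha in
  let iii := forall theta alpha, is_Theta_X X T theta -> alpha ∈ theta ->
               is_limit alpha -> countable_cofinality alpha ->
               SD X T alpha in
  (exists theta, is_Theta_X X T theta /\ is_Theta R theta) /\
  (i <-> ii) /\ (ii <-> iii).
Proof.
  assert (hM : ZF_model M) by exact hZF. intros i ii iii.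
  destruct hPolish as (hsep & d & hd & hcomplete & hT).
  assert (HN : exists x, x ∈ X).
  { apply NNPP. intros N. apply huncountable.
    apply (countable_lam (fun x => x)); [dsolve|intros x HX|intros x y HX _ _]; destruct N; eauto. }
  destruct HN as (x0 & hx0).
  destruct (polish_coding R hR hDC X T d hd hcomplete hT hsep hzero x0 hx0) as (s & pi & dp & hX).
  assert (hRB := real_BS R hR).
  (* Uncountability enters here: the perfect subset maps X onto Baire space. *)
  destruct (perfect_subset_exists R hDC hRB X T s pi dp hX huncountable) as (P & SP & (y0 & Hy0) & PP).
  assert (hXB := perfect_onto_Bs X T s pi dp hX P SP PP y0 emp Hy0 om_emp).
  destruct (rank_exists R hR hDC hAD X T s pi dp hX) as (rkf & rk_fun & rk_eq).
  assert (THX := is_Theta_X_iff R hR hDC hAD X T s pi dp hX rkf rk_fun rk_eq).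
  assert (SDI := SD_iff R hR hDC hAD X T s pi dp hX rkf rk_fun rk_eq).
  assert (CTH := countable_in_th R hR hDC hAD X T s pi dp hX rkf rk_eq hXB).
  assert (NE : forall a, is_limit a -> a <> emp).
  { intros a (_ & H & _) ->. apply H. exact mem_emp. }
  assert (I_III : i -> iii).
  { intros (K & [PK _] & NC) theta alpha HT HA LA CA. apply THX in HT. subst theta.
    apply SDI. split; [apply NE, LA|]. split; [exact HA|]. intros A SA EA.
    apply (limit_selfdual R hR hDC hAD X T s pi dp hX rkf rk_eq K alpha A PK NC LA CA SA EA). }
  assert (III_II : iii -> ii).
  { intros H omega1 alpha (O1 & _ & O3) HA LA. assert (CA := O3 alpha HA). assert (OA := ord_in _ _ O1 HA).
    apply (H (th X rkf)); [apply THX; reflexivity|apply CTH; assumption|exact LA|apply limit_cofinality; assumption]. }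
  assert (II_I : ii -> i).
  { intros H. exists (kernel X T s). split; [apply (kernel_perfect X T s pi dp hX)|].
    apply (kernel_not_compact R hR hDC hAD X T s pi dp hX rkf rk_eq hXB).
    intros l A LL CL SA EA. assert (OL : is_ord l) by apply LL.
    assert (S : SD X T l); [|apply SDI in S; apply S; assumption].
    (* The hypothesis speaks of countable limits through omega_1, which therefore has to be
       exhibited as a set of M. *)
    apply (H (sep (th X rkf) countable)); [apply (omega1_exists R hR hDC hAD X T s pi dp hX rkf rk_eq hXB)| |exact LL].
    apply mem_sep; [dsolve|]. auto. }
  split; [|tauto]. exists (th X rkf). split; [apply THX; reflexivity|].
  apply (Theta_th R hR hDC hAD X T s pi dp hX rkf rk_eq hXB).
Qed.
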